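(* Let $\Omega$ be an open bounded subset of $\mathbb{R}^N$ ($N\ge 2$) with the cone property, and let $\vec\phi=(\phi_1,\dots,\phi_N)$ be a vector of Musielak-Orlicz functions. Put $\phi_{max}=\max_i\phi_i$, $\phi_{min}=\min_i\phi_i$, and let $\phi_{min}^{\ast\ast}$ be the second complementary function of $\phi_{min}$. Assume: (1) for all $x\in\overline\Omega$, $$\int_0^1\frac{(\phi_{min}^{\ast\ast})^{-1}(x,t)}{t^{1+\frac1N}}\,dt<+\infty\quad\text{and}\quad \int_1^{+\infty}\frac{(\phi_{min}^{\ast\ast})^{-1}(x,t)}{t^{1+\frac1N}}\,dt=+\infty,$$ and let $(\phi_{min}^{\ast\ast})_\ast$ be the Sobolev conjugate of $\phi_{min}^{\ast\ast}$; (2) there exist two positive constants $\nu<\frac1N$ and $c_0$ such that for every $i=1,\dots,N$, all $t\in\mathbb{R}$ and almost every $x\in\Omega$, $$\Big|\frac{\partial(\phi_{min}^{\ast\ast})_\ast(x,t)}{\partial x_i}\Big|\le c_0\Big[(\phi_{min}^{\ast\ast})_\ast(x,t)+\big((\phi_{min}^{\ast\ast})_\ast(x,t)\big)^{1+\nu}\Big],$$ provided that the derivative on the left exists; (3) $(\phi_{min}^{\ast\ast})_\ast(\cdot,t)$ is Lipschitz continuous on $\overline\Omega$; (4) $\phi_{max}$ is locally integrable. Then there is a continuous embedding $W^1L_{\vec\phi}(\Omega)\hookrightarrow L_{(\phi_{min}^{\ast\ast})_\ast}(\Omega)$.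
   Context: Musielak-Orlicz function: $\phi:\Omega\times\mathbb{R}^+\to\mathbb{R}^+$ with $\phi(\cdot,t)$ measurable for every $t$, and $\phi(x,\cdot)$ an $N$-function, i.e. convex, nondecreasing, $\phi(x,t)=0$ iff $t=0$, $\phi(x,t)>0$ for $t>0$, $\lim_{t\to\infty}\phi(x,t)/t=\infty$ and $\lim_{t\to0}\phi(x,t)/t=0$ for a.e. $x\in\Omega$, together with $\inf_{x\in\Omega}\phi(x,1)>0$. Such functions are extended to even functions of $t\in\mathbb{R}$; where a condition is imposed for $x\in\overline\Omega$ the functions are understood to be defined for $x\in\overline\Omega$. Locally integrable: $\int_K\phi(x,c)\,dx<\infty$ for every compact $K\subset\Omega$ and every constant $c>0$. Complementary function: $\phi^\ast(x,s)=\sup_{t\ge0}\{st-\phi(x,t)\}$; $\phi^{\ast\ast}=(\phi^\ast)^\ast$ (the largest convex function $\le\phi$). Inverses are taken with respect to the second variable. Space $L_\phi(\Omega)$: measurable $u:\Omega\to\mathbb{R}$ with $\int_\Omega\phi(x,u(x)/\lambda)\,dx<\infty$ for some $\lambda>0$, with norm $\|u\|_\phi=\inf\{\lambda>0:\int_\Omega\phi(x,u(x)/\lambda)\,dx\le1\}$. Anisotropic Musielak-Orlicz-Sobolev space: $W^1L_{\vec\phi}(\Omega)=\{u\in L_{\phi_{max}}(\Omega):\partial_{x_i}u\in L_{\phi_i}(\Omega),\ i=1,\dots,N\}$ (weak derivatives), with norm $\|u\|_{W^1L_{\vec\phi}(\Omega)}=\|u\|_{\phi_{max}}+\sum_{i=1}^N\|\partial_{x_i}u\|_{\phi_i}$.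 Sobolev conjugate: $(\phi_{min}^{\ast\ast})_\ast$ is the function whose inverse in the second variable is $(\phi_{min}^{\ast\ast})_\ast^{-1}(x,s)=\int_0^s\frac{(\phi_{min}^{\ast\ast})^{-1}(x,t)}{t^{1+1/N}}\,dt$, $x\in\overline\Omega$, $s\ge0$. *)

(* Defs.v *)
From HB Require Import structures.
From mathcomp Require Import all_boot all_order all_algebra.
From mathcomp Require Import all_classical all_reals all_analysis.

Set Implicit Arguments.
Unset Strict Implicit.
Unset Printing Implicit Defensive.

Import Order.TTheory GRing.Theory Num.Theory.
Import numFieldNormedType.Exports.

Local Open Scope classical_set_scope.
Local Open Scope ring_scope.

(* Lebesgue measure on R^N: Caratheodory's construction applied to the outer
   measure given by countable coverings by boxes. A covering is a sequence of
   optional boxes, [None] standing for an unused index. *)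
Section lebesgue_measure_rV.
Context {R : realType} {N : nat}.
Local Notation V := 'rV[R]_N.

Definition box (c : option (V * V)) : set V :=
  if c is Some (a, b) then
    [set x | forall i, a ord0 i <= x ord0 i <= b ord0 i]
  else set0.

Definition box_volume (c : option (V * V)) : R :=
  if c is Some (a, b) then \prod_i Num.max 0 (b ord0 i - a ord0 i) else 0.

Local Open Scope ereal_scope.

Definition box_cover (A : set V) : set (nat -> option (V * V)) :=
  [set c | A `<=` \bigcup_k box (c k)].

Definition lebesgue_outer (A : set V) : \bar R :=
  ereal_inf [set \sum_(k <oo) (box_volume (c k))%:E | c in box_cover A].

Lemma box_volume_ge0 c : 0 <= (box_volume c)%:E.
Proof.
rewrite lee_fin; case: c => [[a b]|] //=.
by apply: prodr_ge0 => i _; rewrite le_max lexx.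
Qed.

Lemma lebesgue_outer_ge0 A : 0 <= lebesgue_outer A.
Proof.
apply: le_ereal_inf_tmp => _ [c _ <-].
by apply: nneseries_ge0 => k _ _; exact: box_volume_ge0.
Qed.

Lemma lebesgue_outer0 : lebesgue_outer set0 = 0.
Proof.
apply/eqP; rewrite eq_le lebesgue_outer_ge0 andbT.
apply: ereal_inf_lbound; exists (fun=> None); first exact: sub0set.
by apply: eseries0 => k _ _.
Qed.

Lemma le_lebesgue_outer :
  {homo lebesgue_outer : A B / A `<=` B >-> A <= B}.
Proof.
move=> A B AB; apply: ereal_inf_le_tmp => x [c Bc <-].
by exists c => //; exact: subset_trans AB Bc.
Qed.

Lemma lebesgue_outer_sigma_subadditive : sigma_subadditive lebesgue_outer.
Proof.
move=> A; have [[i ioo]|] := pselect (exists i, lebesgue_outer (A i) = +oo).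
  rewrite (eseries_pinfty _ _ ioo) ?leey// => n _.
  by rewrite -ltNye (lt_le_trans _ (lebesgue_outer_ge0 _)).
rewrite -forallNE => Aoo.
apply/lee_addgt0Pr => _/posnumP[e].
rewrite (le_trans _ (epsilon_trick _ _ _))//; last first.
  by move=> n; exact: lebesgue_outer_ge0.
pose P n c := box_cover (A n) c /\
  \sum_(k <oo) (box_volume (c k))%:E <=
  lebesgue_outer (A n) + (e%:num / (2 ^ n.+1)%:R)%:E.
have [G PG] : {G & forall n, P n (G n)}.
  apply: (@choice _ _ P) => n; rewrite /P /lebesgue_outer.
  set S := (X in ereal_inf X); move infS : (ereal_inf S) => iS.
  case: iS infS => [r Sr|Soo|Soo].
  - have en1 : (0 < e%:num / (2 ^ n.+1)%:R)%R by [].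
    have /(lb_ereal_inf_adherent en1) : ereal_inf S \is a fin_num by rewrite Sr.
    move=> [x [c Ac cx xS]].
    by exists c; split => //; rewrite cx -Sr; exact/ltW.
  - by have := Aoo n; rewrite /lebesgue_outer Soo.
  - suff : lbound S 0 by move/le_ereal_inf_tmp; rewrite Soo.
    by move=> /= _ [c _ <-]; apply: nneseries_ge0 => *; exact: box_volume_ge0.
pose v (p : nat * nat) := (box_volume (G p.1 p.2))%:E.
have v_ge0 p : 0 <= v p by exact: box_volume_ge0.
apply: (@le_trans _ _ (\esum_(p in setT) v p)).
  apply: ereal_inf_lbound => /=.
  have /card_esym/ppcard_eqP[f] := card_nat2.
  exists (fun k => G (f k).1 (f k).2).
    move=> t [i _] /((PG i).1 t)[j _ Gt].
    by exists (f^-1%FUN (i, j)) => //=; rewrite invK ?inE.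
  rewrite -[LHS]/(\sum_(k <oo) (v \o f) k).
  by rewrite (reindex_esum setT setT f)// -nneseries_esumT//.
rewrite (_ : esum _ _ = \sum_(i <oo) \sum_(j <oo) v (i, j)); last first.
  rewrite nneseries_esumT; last by move=> i; exact: nneseries_ge0.
  under [RHS]eq_esum do rewrite nneseries_esumT//.
  rewrite (esum_esum (J := fun=> setT))//.
  congr esum; apply/seteqP; split => //= -[i j] _; by split.
apply: lee_nneseries => [n _ _|n _]; first exact: nneseries_ge0.
by have [_] := PG n.
Qed.

HB.instance Definition _ := isOuterMeasure.Build R V lebesgue_outer
  lebesgue_outer0 lebesgue_outer_ge0 le_lebesgue_outer
  lebesgue_outer_sigma_subadditive.

Local Close Scope ereal_scope.
End lebesgue_measure_rV.

(* R^N with the (complete) sigma-algebra of Lebesgue measurable sets. It is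
   convertible to 'rV[R]_N but carries no topology. *)
Definition lebesgue_rV (R : realType) (N : nat) :=
  caratheodory_type (@lebesgue_outer R N).

HB.instance Definition _ (R : realType) (N : nat) :=
  Measurable.copy (lebesgue_rV R N) (caratheodory_type (@lebesgue_outer R N)).

Section leb.
Context {R : realType} {N : nat}.
Local Open Scope ereal_scope.

Definition leb : set (lebesgue_rV R N) -> \bar R := lebesgue_outer.

Let leb0 : leb set0 = 0. Proof. exact: lebesgue_outer0. Qed.

Let leb_ge0 A : 0 <= leb A. Proof. exact: lebesgue_outer_ge0. Qed.

Let leb_semi_sigma_additive : semi_sigma_additive leb.
Proof. exact: caratheodory_measure_sigma_additive. Qed.

HB.instance Definition _ := isMeasure.Build _ _ _ leb
  leb0 leb_ge0 leb_semi_sigma_additive.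

End leb.

(* Cone property, as in Adams' Sobolev Spaces: every point of [Omega] is the
   vertex of a finite cone contained in [Omega] and congruent to a fixed one.
   The closed cone below has its vertex at 0, height [rho], axis direction [v]
   and aperture [kappa]; cones of equal height and aperture are congruent. *)
Definition dotp {R : realType} {N : nat} (x y : 'rV[R]_N) : R :=
  \sum_i x ord0 i * y ord0 i.

Definition enorm {R : realType} {N : nat} (x : 'rV[R]_N) : R :=
  Num.sqrt (dotp x x).

Definition finite_cone {R : realType} {N : nat} (rho kappa : R)
    (v : 'rV[R]_N) : set 'rV[R]_N :=
  [set z | enorm z <= rho /\ enorm z * enorm v * cos (kappa / 2) <= dotp z v].

Definition cone_property {R : realType} {N : nat} (Omega : set 'rV[R]_N) :=
  exists rho kappa : R, [/\ 0 < rho, 0 < kappa, kappa <= pi &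
    forall x, Omega x -> exists v : 'rV[R]_N,
      v != 0 /\ [set x + z | z in finite_cone rho kappa v] `<=` Omega].

(* The functions of the second variable live on R^+: only their values at
   t >= 0 are ever used, which amounts to extending them evenly to R. *)
Section musielak_orlicz.
Context {R : realType}.

Record n_function (f : R -> R) : Prop := {
  n_function_convex : convex_function ([set t | 0 <= t] : set R^o) f ;
  n_function_nondecreasing : forall s t, 0 <= s -> s <= t -> f s <= f t ;
  n_function_eq0 : forall t, 0 <= t -> (f t = 0 <-> t = 0) ;
  n_function_gt0 : forall t, 0 < t -> 0 < f t ;
  n_function_pinfty : f t / t @[t --> +oo] --> +oo ;
  n_function_0 : f t / t @[t --> 0^'+] --> 0 }.

Record musielak_orlicz {N : nat} (Omega : set 'rV[R]_N)
    (phi : 'rV[R]_N -> R -> R) : Prop := {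
  musielak_orlicz_ge0 :
    forall x t, closure Omega x -> 0 <= t -> 0 <= phi x t ;
  musielak_orlicz_measurable : forall t, 0 <= t ->
    measurable_fun (Omega : set (lebesgue_rV R N)) (phi^~ t) ;
  musielak_orlicz_n_function :
    {ae @leb R N, forall x, Omega x -> n_function (phi x)} ;
  musielak_orlicz_inf1 :
    (0 < ereal_inf [set (phi x 1)%:E | x in Omega])%E }.

Local Open Scope ereal_scope.

Definition phi_max {N : nat} (phi : 'I_N -> 'rV[R]_N -> R -> R)
    (x : 'rV[R]_N) (t : R) : \bar R :=
  \big[maxe/-oo]_(i < N) (phi i x t)%:E.

Definition phi_min {N : nat} (phi : 'I_N -> 'rV[R]_N -> R -> R)
    (x : 'rV[R]_N) (t : R) : \bar R :=
  \big[mine/+oo]_(i < N) (phi i x t)%:E.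

Definition complementary {T : Type} (f : T -> R -> \bar R)
    (x : T) (s : R) : \bar R :=
  ereal_sup [set (s * t)%:E - f x t | t in [set t : R | (0 <= t)%R]].

(* Inverse of a nondecreasing function of R^+: the ordinary inverse when [g] is
   an increasing bijection of R^+, the right-continuous one otherwise. *)
Definition rinv (g : R -> \bar R) (s : R) : \bar R :=
  ereal_inf [set t%:E | t in [set t : R | (0 <= t)%R /\ s%:E < g t]].

Definition sobolev_integrand (N : nat) (g : R -> \bar R) (t : R) : \bar R :=
  rinv g t * ((t `^ (1 + N%:R^-1))^-1)%:E.

(* Finite on R^+ as soon as the integral of [sobolev_integrand N (f x)] over
   [1, +oo[ is +oo. *)
Definition sobolev_conjugate {N : nat} (f : 'rV[R]_N -> R -> \bar R)
    (x : 'rV[R]_N) : R -> \bar R :=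
  rinv (fun s => \int[lebesgue_measure]_(t in `]0%R, s])
                   sobolev_integrand N (f x) t).

Definition phi_min_ss {N : nat} (phi : 'I_N -> 'rV[R]_N -> R -> R) :=
  complementary (complementary (phi_min phi)).

End musielak_orlicz.

Section spaces.
Context {R : realType} {N : nat}.
Local Notation V := 'rV[R]_N.
Local Notation mu := (@leb R N).
Variable Omega : set V.
Implicit Types (phi : V -> R -> \bar R) (u v : V -> R).
Local Open Scope ereal_scope.

Definition locally_integrable_phi phi :=
  forall (K : set V) (c : R), compact K -> K `<=` Omega -> (0 < c)%R ->
    \int[mu]_(x in K) phi x c < +oo.

Definition modular phi (l : R) u : \bar R :=
  \int[mu]_(x in Omega) phi x `|u x / l|%R.

Definition L_space phi : set (V -> R) :=
  [set u | measurable_fun (Omega : set (lebesgue_rV R N)) u /\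
     exists l : R, (0 < l)%R /\ modular phi l u < +oo].

Definition luxemburg_norm phi u : \bar R :=
  ereal_inf [set l%:E | l in [set l : R | (0 < l)%R /\ modular phi l u <= 1]].

Definition partial (i : 'I_N) (f : V -> R) : V -> R :=
  fun x => 'D_(delta_mx ord0 i : V) f x.

Definition smooth (f : V -> R) :=
  forall (s : seq 'I_N) (x : V), differentiable (foldr partial f s) x.

Definition test_function (f : V -> R) :=
  [/\ smooth f, compact (closure [set x | f x != 0%R]) &
      closure [set x | f x != 0%R] `<=` Omega].

Definition L1_loc : set (V -> R) :=
  [set u | measurable_fun (Omega : set (lebesgue_rV R N)) u /\
     forall K : set V, compact K -> K `<=` Omega ->
       mu.-integrable K (EFin \o u)].

Definition is_weak_partial (i : 'I_N) u v :=
  [/\ L1_loc u, L1_loc v &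
      forall f, test_function f ->
        (\int[mu]_(x in Omega) (u x * partial i f x) =
         - \int[mu]_(x in Omega) (v x * f x))%R].

(* A weak derivative is unique up to equality almost everywhere on [Omega]. *)
Definition weak_partial (i : 'I_N) u : V -> R :=
  xget (fun=> 0%R) [set v | is_weak_partial i u v].

Definition W1_space (phi : 'I_N -> V -> R -> R) : set (V -> R) :=
  [set u | L_space (phi_max phi) u /\
     forall i, is_weak_partial i u (weak_partial i u) /\
       L_space (fun x t => (phi i x t)%:E) (weak_partial i u)].

Definition W1_norm (phi : 'I_N -> V -> R -> R) u : \bar R :=
  luxemburg_norm (phi_max phi) u +
  \sum_(i < N) luxemburg_norm (fun x t => (phi i x t)%:E) (weak_partial i u).

Definition continuous_embedding (X Y : set (V -> R))
    (normX normY : (V -> R) -> \bar R) :=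
  X `<=` Y /\
  exists C : R, (0 < C)%R /\ forall u, X u -> normY u <= C%:E * normX u.

End spaces.

(* Main.v *)
Require Import Defs.
From HB Require Import structures.
From mathcomp Require Import all_boot all_order all_algebra.
From mathcomp Require Import all_classical all_reals all_analysis.
From mathcomp Require Import measurable_realfun ring lra.

Set Implicit Arguments.
Unset Strict Implicit.
Unset Printing Implicit Defensive.

Import Order.TTheory GRing.Theory Num.Theory.
Import numFieldNormedType.Exports.

Local Open Scope classical_set_scope.
Local Open Scope ring_scope.

(* Write G(x, t) for the Sobolev conjugate, q = 1 - 1/N and H = G^q. The
   definition of G makes H(x, .) convex with H(x, 0) = 0, and gives the Young
   inequality b * dH/dt(x, t) <= q (G(x, t) + phi_i(x, b)); the assumption on
   the derivatives of G in x bounds those of H by P = c0 q (H + H^(1 + nu/q)).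

   By the cone property, Omega is a finite union of sets on which N independent
   segments issued from every point stay in Omega. A function with weak partial
   derivatives has a representative that is absolutely continuous on almost
   every such segment, so that the value of H(x, w(x)), for w a truncation of
   |u|, is bounded by the integral of H + P + (dH/dt) |grad w| along each
   segment. Loomis-Whitney in these N directions bounds the integral of
   G(x, w) = H(x, w)^(N/(N-1)) by C I^(1/q), I being the integral over Omega of
   H + P + (dH/dt) |grad w|.

   For w = th * min(|u| / L, k) the lower order of H and P (as q + nu < 1) and
   the Young inequality give I <= eps X + C th, X(th) being the integral of
   G(x, w), so X <= 1 implies X <= 1/2 as long as th <= th0, where th0 does not
   depend on u or k. Since X(0) = 0 and X varies slowly with th (G is convex),
   X(th0) <= 1; letting k go to infinity concludes. *)

(** * Integrals along lines and the product structure of Lebesgue measure *)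

(** The derivative bound in $x$ holds, for each fixed $t$, off a null set that depends on $t$, so it
    says nothing at the points $(x,w(x))$, and no chain rule for $H(x,w(x))$ is at hand. It is
    therefore first turned into a Lipschitz bound of $H(\cdot,t)$ on small balls: on almost every
    coordinate line the bound holds almost everywhere, and continuity carries the conclusion to all
    lines. In $t$, convexity supplies the increments, with a forward difference quotient of step [d]
    in the place of $\partial H/\partial t$. The power $q$ comes from the formula for $G^{-1}$: its
    differential is a nonincreasing function of $s$ times $d(s^q)$, whence the convexity of $G^q$.
    The final estimate has the form $X\le C(\varepsilon X+C\theta)^{1/q}$ with $1/q>1$, so $X$
    cannot be absorbed. It only keeps $X$ out of $]1/2,1]$, and the continuation in $\theta$ is what
    keeps it below. The truncation at level $k$ makes $G(x,w)$ bounded, hence $X$ finite and slowly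
    varying. *)

Section borel_rV.
Context {R : realType} {N : nat}.
Local Notation V := 'rV[R]_N.

(** Caratheodory measurable sets need not pull back under $(x,t)\mapsto x+ta$ to sets of a product
    sigma-algebra. Fubini along lines is therefore run on the Borel sets, generated so that
    measurability of a map into $\mathbb R^N$ is checked coordinate by coordinate. *)
Definition coord_sets : set (set V) :=
  [set A | exists i (B : set (measurableTypeR R)),
     measurable B /\ A = [set x : V | B (x ord0 i)]].

Local Notation BV := (g_sigma_algebraType coord_sets).

Lemma measurable_fun_rV d (T : measurableType d) (D : set T) (f : T -> BV) :
  (forall i, measurable_fun D (fun t => (f t : V) ord0 i : measurableTypeR R)) ->
  measurable_fun D f.
Proof.
move=> mf mD; apply: (@measurability _ _ _ BV D f coord_sets erefl _ mD).
by move=> _ [_ [i [B [mB ->]]] <-]; exact: (mf i mD B mB).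
Qed.

Lemma measurable_coord i : measurable_fun setT
  (fun x : BV => (x : V) ord0 i : measurableTypeR R).
Proof.
move=> _ B mB; rewrite setTI; apply: sub_sigma_algebra.
by exists i, B.
Qed.

Lemma measurable_line (a : V) : measurable_fun setT
  (fun p : BV * measurableTypeR R => (p.1 : V) + (p.2 : R) *: a : BV).
Proof.
apply: measurable_fun_rV => i; under eq_fun do rewrite !mxE.
apply: measurable_funD.
  exact: (measurableT_comp (measurable_coord i) measurable_fst).
by apply: measurable_funM => //; exact: measurable_snd.
Qed.

Lemma measurable_translate (a : V) :
  measurable_fun setT (fun x : BV => (x : V) + a : BV).
Proof.
apply: measurable_fun_rV => i; under eq_fun do rewrite !mxE.
by apply: measurable_funD => //; exact: measurable_coord.
Qed.

Local Open Scope ereal_scope.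
Definition bmeas (f : V -> \bar R) :=
  measurable_fun (setT : set BV) f.

Definition lineint (a : V) (f : V -> \bar R) (x : V) : \bar R :=
  \int[lebesgue_measure]_t f (x + (t : R) *: a)%R.

Lemma bmeas_line (a : V) f : bmeas f -> measurable_fun setT
  (fun p : BV * measurableTypeR R => f ((p.1 : V) + (p.2 : R) *: a)%R).
Proof. by move=> mf; exact: (measurableT_comp mf (measurable_line a)). Qed.

Lemma measurable_line1 (a x : V) : measurable_fun setT
  (fun t : measurableTypeR R => x + (t : R) *: a : BV)%R.
Proof.
apply: measurable_fun_rV => i; under eq_fun do rewrite !mxE.
by apply: measurable_funD => //; exact: measurable_funM.
Qed.

Lemma bmeas_line1 (a x : V) f : bmeas f -> measurable_fun setT
  (fun t : measurableTypeR R => f (x + (t : R) *: a)%R).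
Proof. by move=> mf; exact: (measurableT_comp mf (measurable_line1 a x)). Qed.

Lemma bmeas_lineint a f : bmeas f -> (forall x, 0 <= f x) ->
  bmeas (lineint a f).
Proof.
move=> mf f0.
exact: (measurable_fun_fubini_tonelli_F
  (m2 := lebesgue_measure : {measure set (measurableTypeR R) -> \bar R})
  _ (bmeas_line a mf)).
Qed.

Lemma lineint_ge0 a f : (forall x, 0 <= f x) -> forall x, 0 <= lineint a f x.
Proof. by move=> f0 x; exact: integral_ge0. Qed.

Lemma le_lineint a f g : bmeas f -> bmeas g -> (forall x, 0 <= f x) ->
  (forall x, f x <= g x) -> forall x, lineint a f x <= lineint a g x.
Proof.
move=> mf mg f0 fg x; apply: ge0_le_integral => //; exact: bmeas_line1.
Qed.

Lemma measurable_line2 (a b x : V) : measurable_fun setT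
  (fun p : measurableTypeR R * measurableTypeR R =>
     (x + (p.1 : R) *: a + (p.2 : R) *: b)%R : BV).
Proof.
apply: measurable_fun_rV => i; under eq_fun do rewrite !mxE.
apply: measurable_funD; first apply: measurable_funD => //.
  by apply: measurable_funM.
by apply: measurable_funM.
Qed.

Lemma lineintC a b f : bmeas f -> (forall x, 0 <= f x) ->
  lineint a (lineint b f) = lineint b (lineint a f).
Proof.
move=> mf f0; apply/funext => x; rewrite /lineint.
have h := fubini_tonelli
  (m1 := lebesgue_measure : {measure set (measurableTypeR R) -> \bar R})
  (m2 := lebesgue_measure : {measure set (measurableTypeR R) -> \bar R})
  (fun p : measurableTypeR R * measurableTypeR R =>
     f (x + (p.1 : R) *: a + (p.2 : R) *: b)%R)
  (measurableT_comp mf (measurable_line2 a b x)) (fun=> f0 _).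
rewrite [LHS]h; apply: eq_integral => s _; apply: eq_integral => t _.
by congr f; rewrite addrAC.
Qed.

Lemma lineint_translate a f x y :
  lineint a (fun z => f (z + y)%R) x = lineint a f (x + y)%R.
Proof. by apply: eq_integral => s _; rewrite addrAC. Qed.

(** $|c|$ times the image of Lebesgue measure under $t\mapsto ct+d$ agrees with Lebesgue measure on
    half-open intervals, so the two measures coincide. *)
Lemma integral_affine (c d : R) (f : R -> \bar R) : c != 0%R ->
  measurable_fun setT f -> (forall t, 0 <= f t) ->
  \int[lebesgue_measure]_t f t =
  `|c|%:E * \int[lebesgue_measure]_t f (c * t + d)%R.
Proof.
move=> c0 mf f0.
have mphi : measurable_fun (setT : set (measurableTypeR R))
  (fun t => (c * t + d)%R : measurableTypeR R).
  by apply: measurable_funD => //; exact: measurable_funM.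
pose phi : {mfun measurableTypeR R >-> measurableTypeR R} :=
  HB.pack (fun t : measurableTypeR R => (c * t + d)%R : measurableTypeR R)
    (isMeasurableFun.Build _ _ _ _ _ mphi).
have muE A : measurable A -> lebesgue_measure A =
    mscale (NngNum (normr_ge0 c)) (pushforward lebesgue_measure phi) A.
  move=> mA; apply: lebesgue_measure_unique => // _ [[u v]] _ <-.
  (* A negative [c] swaps the open and the closed end; both kinds of interval have the same
     measure. *)
  have set_eq : (fun t : R => c * t + d)%R @^-1` `]u, v]%classic =
      if (0 < c)%R then `]((u - d) / c)%R, ((v - d) / c)%R]%classic
      else `[((v - d) / c)%R, ((u - d) / c)%R[%classic.
    have [c_gt0|c_le0] := ltP 0%R c.
      apply/seteqP; split => t /=; rewrite !in_itv/= ltr_pdivrMr// ler_pdivlMr//;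
        move=> /andP[h1 h2]; apply/andP; split; lra.
    have c_lt0 : (c < 0)%R by rewrite lt_neqAle c0.
    apply/seteqP; split => t /=; rewrite !in_itv/= ltr_ndivlMr// ler_ndivrMr//;
      move=> /andP[h1 h2]; apply/andP; split; lra.
  change (lebesgue_measure `]u, v]%classic = `|c|%:E *
    lebesgue_measure ((fun t : R => c * t + d)%R @^-1` `]u, v]%classic)).
  rewrite set_eq.
  have [c_gt0|c_le0] := ltP 0%R c.
    rewrite !lebesgue_measure_itv/= !lte_fin gtr0_norm// ltr_pM2r ?invr_gt0//.
    rewrite ltrD2r; case: ifP => // _; last by rewrite mule0.
    by rewrite -!EFinB -EFinM; congr EFin; field.
  have c_lt0 : (c < 0)%R by rewrite lt_neqAle c0.
  rewrite !lebesgue_measure_itv/= !lte_fin ltr0_norm// ltr_nM2r ?invr_lt0//.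
  rewrite ltrD2r; case: ifP => // _; last by rewrite mule0.
  by rewrite -!EFinB -EFinM; congr EFin; field.
rewrite (eq_measure_integral (mscale (NngNum (normr_ge0 c))
    (pushforward lebesgue_measure phi))); last by move=> A mA _; exact: muE.
rewrite ge0_integral_mscale//=.
by rewrite ge0_integral_pushforward.
Qed.

Lemma lineintZ c a f : c != 0%R -> bmeas f -> (forall x, 0 <= f x) ->
  lineint (c *: a)%R f = fun x => `|c|^-1%:E * lineint a f x.
Proof.
move=> c0 mf f0; apply/funext => x; rewrite /lineint.
have h := bmeas_line1 a x mf.
rewrite (@integral_affine c 0 _ c0 h)// muleA -EFinM mulVf ?normr_eq0// mul1e.
by apply: eq_integral => t _; rewrite scalerA addr0 mulrC.
Qed.

(** After the inner integration along [b] the integrand is invariant under translations by multiples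
    of [b]. This is the column operation behind the change of variables to oblique directions. *)
Lemma lineint_shear a b (c : R) f : bmeas f -> (forall x, 0 <= f x) ->
  lineint (a + c *: b)%R (lineint b f) = lineint a (lineint b f).
Proof.
move=> mf f0; apply/funext => x; rewrite /lineint.
apply: eq_integral => s _.
rewrite -[RHS]mul1e -(normr1 R) (@integral_affine 1 (- (s * c))%R); last 3 first.
- exact: oner_neq0.
- exact: bmeas_line1.
- by [].
rewrite normr1 !mul1e; apply: eq_integral => t _; congr f.
by apply/rowP => i; rewrite !mxE; ring.
Qed.

End borel_rV.

Local Close Scope ereal_scope.

Notation BV R N := (g_sigma_algebraType (@coord_sets R N)).

Section iterint.
Context {R : realType} {N : nat}.
Local Notation V := 'rV[R]_N.
Implicit Types (a b x : V) (s : seq V) (f g : V -> \bar R).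
Local Open Scope ereal_scope.

(** For independent vectors this is integration over $x$ plus their span, with $dt_1\cdots dt_k$ as
    volume element. Arbitrary lists are allowed because the directions given by the cone property
    are oblique. *)
Definition iterint s f := foldr lineint f s.

Lemma iterint_ge0 s f : (forall x, 0 <= f x) -> forall x, 0 <= iterint s f x.
Proof. by move=> f0; elim: s => //= a s IH; exact: lineint_ge0. Qed.

Lemma bmeas_iterint s f : bmeas f -> (forall x, 0 <= f x) ->
  bmeas (iterint s f).
Proof.
move=> mf f0; elim: s => //= a s IH; apply: bmeas_lineint => //.
exact: iterint_ge0.
Qed.

Lemma le_iterint s f g : bmeas f -> bmeas g -> (forall x, 0 <= f x) ->
  (forall x, f x <= g x) -> forall x, iterint s f x <= iterint s g x.
Proof.
move=> mf mg f0 fg; have g0 x : 0 <= g x by exact: le_trans (fg x).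
elim: s => //= a s IH.
by apply: le_lineint => //; [exact: bmeas_iterint..|exact: iterint_ge0].
Qed.

Lemma iterint_lineintC s a f : bmeas f -> (forall x, 0 <= f x) ->
  iterint s (lineint a f) = lineint a (iterint s f).
Proof.
move=> mf f0; elim: s => //= b s ->.
by apply: lineintC; [exact: bmeas_iterint|exact: iterint_ge0].
Qed.

Lemma iterint_cat s1 s2 f : iterint (s1 ++ s2) f = iterint s1 (iterint s2 f).
Proof. exact: foldr_cat. Qed.

Lemma iterint_perm s1 s2 f : bmeas f -> (forall x, 0 <= f x) ->
  perm_eq s1 s2 -> iterint s1 f = iterint s2 f.
Proof.
move=> mf f0; elim: s1 s2 => [s2|a s1 IH s2 p]; first by rewrite perm_sym => /perm_nilP ->.
have as2 : a \in s2 by rewrite -(perm_mem p) mem_head.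
have [s3 [s5 e]] : exists s3 s5, s2 = s3 ++ a :: s5.
  by case/splitPr: as2 => s3 s5; exists s3, s5.
move: p; rewrite {}e => p {as2}.
have p' : perm_eq s1 (s3 ++ s5).
  by rewrite -(perm_cons a) (perm_trans p)// -cat1s perm_catCA.
rewrite iterint_cat /= (IH _ p') iterint_cat iterint_lineintC//.
  exact: bmeas_iterint.
exact: iterint_ge0.
Qed.

Lemma lineint_nneseries a (f : nat -> V -> \bar R) : (forall n, bmeas (f n)) ->
  (forall n x, 0 <= f n x) ->
  lineint a (fun x => \sum_(n <oo) f n x) =
  fun x => \sum_(n <oo) lineint a (f n) x.
Proof.
move=> mf f0; apply/funext => x; rewrite /lineint integral_nneseries//.
by move=> n; exact: bmeas_line1.
Qed.

Lemma bmeas_nneseries (f : nat -> V -> \bar R) : (forall n, bmeas (f n)) ->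
  (forall n x, 0 <= f n x) -> bmeas (fun x => \sum_(n <oo) f n x).
Proof. move=> mf f0; apply: ge0_emeasurable_sum; [by move=> k x _ _; exact: f0|by move=> k _; exact: mf]. Qed.

Lemma iterint_nneseries s (f : nat -> V -> \bar R) : (forall n, bmeas (f n)) ->
  (forall n x, 0 <= f n x) ->
  iterint s (fun x => \sum_(n <oo) f n x) =
  fun x => \sum_(n <oo) iterint s (f n) x.
Proof.
move=> mf f0; elim: s => //= a s ->.
by apply: lineint_nneseries => n; [exact: bmeas_iterint|exact: iterint_ge0].
Qed.

Lemma iterintZ s (c : R) f : bmeas f -> (forall x, 0 <= f x) -> (0 <= c)%R ->
  iterint s (fun x => c%:E * f x) = fun x => c%:E * iterint s f x.
Proof.
move=> mf f0 c0; elim: s => //= a s ->; apply/funext => x; rewrite /lineint.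
rewrite ge0_integralZl_EFin// => [*|]; first exact: iterint_ge0.
by apply: bmeas_line1; exact: bmeas_iterint.
Qed.

Lemma iterintD s f g : bmeas f -> (forall x, 0 <= f x) ->
  bmeas g -> (forall x, 0 <= g x) ->
  iterint s (fun x => f x + g x) = fun x => iterint s f x + iterint s g x.
Proof.
move=> mf f0 mg g0; elim: s => //= a s ->; apply/funext => x; rewrite /lineint.
by rewrite ge0_integralD//= => *; try (exact: iterint_ge0);
  apply: bmeas_line1; exact: bmeas_iterint.
Qed.

Lemma iterint_cvg s (f : nat -> V -> \bar R) g : (forall n, bmeas (f n)) ->
  (forall n x, 0 <= f n x) -> (forall x, nondecreasing_seq (f ^~ x)) ->
  (forall x, f n x @[n --> \oo] --> g x) ->
  forall x, iterint s (f n) x @[n --> \oo] --> iterint s g x.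
Proof.
move=> mf f0 nf fg; elim: s => [//|a s IH] x /=; rewrite /lineint.
rewrite (_ : (fun t : R => iterint s g (x + t *: a)%R) =
  fun t : R => limn (fun n => iterint s (f n) (x + t *: a)%R)); last first.
  by apply/funext => t; apply/esym/cvg_lim => //; exact: IH.
pose h n (t : measurableTypeR R) := iterint s (f n) (x + (t : R) *: a)%R.
have mh n : measurable_fun setT (h n).
  by apply: bmeas_line1; exact: bmeas_iterint.
have h0 n t : setT t -> 0 <= h n t by move=> _; exact: iterint_ge0.
have nh t : setT t -> nondecreasing_seq (h ^~ t).
  by move=> _ m n mn; apply: le_iterint => // y; exact: nf.
exact: (cvg_monotone_convergence measurableT mh h0 nh).
Qed.

Lemma iterint0 s : iterint s (fun=> 0) = fun=> 0.
Proof.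
by elim: s => //= a s ->; apply/funext => x; rewrite /lineint integral0.
Qed.

End iterint.

Local Close Scope ereal_scope.

(** * Lebesgue measure of Borel sets as an iterated integral *)

Section lebesgue_borel.
Context {R : realType} {N : nat}.
Local Notation V := 'rV[R]_N.
Implicit Types (a b x : V) (s : seq V) (f g : V -> \bar R).
Local Open Scope ereal_scope.

Definition unitv (i : 'I_N) : V := delta_mx ord0 i.
Definition stdbasis : seq V := [seq unitv i | i <- enum 'I_N].

Lemma unitvE i j : unitv i ord0 j = (j == i)%:R.
Proof. by rewrite mxE eqxx. Qed.

(** Any duplicate-free list of coordinates is allowed, those already integrated being replaced by
    their integrals: the induction needs this form. *)
Lemma iterint_prod (g : 'I_N -> R -> R) (I : 'I_N -> R) (l : seq 'I_N) x :
  (forall i, measurable_fun setT (g i)) -> (forall i t, 0 <= g i t)%R ->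
  (forall i, \int[lebesgue_measure]_t (g i t)%:E = (I i)%:E) -> uniq l ->
  iterint [seq unitv i | i <- l] (fun x => (\prod_i g i (x ord0 i))%:E) x =
  (\prod_i (if i \in l then I i else g i (x ord0 i)))%:E.
Proof.
move=> mg g0 gI; elim: l x => [x _|j l IH x /= /andP[jl ul]]; first by [].
rewrite /lineint.
pose K := (\prod_(i | i != j) (if i \in l then I i else g i (x ord0 i)))%R.
have I0 i : (0 <= I i)%R.
  by rewrite -lee_fin -gI; apply: integral_ge0 => t _; rewrite lee_fin.
have K0 : (0 <= K)%R by apply: prodr_ge0 => i _; case: ifP.
transitivity (\int[lebesgue_measure]_t (K%:E * (g j (x ord0 j + t)%R)%:E)).
  apply: eq_integral => t _; rewrite IH// -EFinM; congr EFin.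
  rewrite (bigD1 j)//= (negbTE jl) mulrC; congr (_ * _)%R.
    apply: eq_bigr => i ij; case: ifP => // _.
    by rewrite !mxE eqxx (negbTE ij) mulr0 addr0.
  by rewrite !mxE !eqxx mulr1.
have mgx : measurable_fun setT (fun t : R => (g j (x ord0 j + t)%R)%:E).
  by apply/measurable_EFinP; apply: measurableT_comp => //; exact: measurable_funD.
rewrite (ge0_integralZl_EFin lebesgue_measure measurableT _ mgx K0); last first.
  by move=> t _; rewrite lee_fin.
have mgj : measurable_fun setT (EFin \o g j) by exact/measurable_EFinP.
have := @integral_affine R 1 (x ord0 j) (EFin \o g j) (oner_neq0 _) mgj.
rewrite normr1 mul1e /= gI => H.
have -> : \int[lebesgue_measure]_t (g j (x ord0 j + t)%R)%:E = (I j)%:E.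
  rewrite H; last by move=> t; rewrite lee_fin.
  by apply: eq_integral => t _; rewrite mul1r addrC.
rewrite -EFinM; congr EFin; rewrite [RHS](bigD1 j)//= mem_head mulrC.
congr (_ * _)%R; apply: eq_bigr => i ij.
by rewrite in_cons (negbTE ij).
Qed.

Lemma box_indic a b : (\1_(box (Some (a, b))) : V -> R) =
  (fun x => \prod_i (\1_(`[a ord0 i, b ord0 i]%classic) (x ord0 i) : R))%R.
Proof.
apply/funext => x; rewrite indicE.
have [|xab] := boolP (x \in box (Some (a, b))).
  rewrite inE /= => h; rewrite big1// => i _; rewrite indicE mem_set//=.
  by rewrite in_itv /=; exact: h.
have [i hi] : exists i, ~ (a ord0 i <= x ord0 i <= b ord0 i)%R.
  apply/existsNP => h; move/negP: xab; apply; rewrite inE /=; exact: h.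
rewrite (bigD1 i)//= indicE memNset ?mul0r//= in_itv/=.
Qed.

Lemma measurable_box c : measurable (box c : set (BV R N)).
Proof.
case: c => [[a b]|]; last exact: measurable0.
rewrite (_ : box _ = \bigcap_(i in [set: 'I_N])
   (fun x : BV R N => (x : V) ord0 i) @^-1` `[a ord0 i, b ord0 i]%classic).
  apply: fin_bigcap_measurable => // i _.
  by rewrite -[X in measurable X]setTI; exact: measurable_coord.
apply/seteqP; split => x /= h i; first by move=> _ /=; rewrite in_itv/=.
by have := h i Logic.I; rewrite /= in_itv.
Qed.

Lemma iterint_box c x :
  iterint stdbasis (fun x => (\1_(box c) x : R)%:E) x = (box_volume c)%:E.
Proof.
case: c => [[a b]|] /=; last first.
  by under eq_fun do rewrite indic0; rewrite -[LHS]/(iterint _ _ x) iterint0.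
rewrite box_indic.
rewrite (@iterint_prod (fun i => \1_(`[a ord0 i, b ord0 i]%classic))
  (fun i => (Num.max 0 (b ord0 i - a ord0 i))%R)) ?enum_uniq//.
  by congr EFin; apply: eq_bigr => i _; rewrite mem_enum.
move=> i; rewrite integral_indic//= setIT lebesgue_measure_itv/= lte_fin.
rewrite /Num.max subr_gt0; case: ifP => //.
Qed.

Lemma bmeas_indic (A : set (BV R N)) : measurable A ->
  bmeas (fun x : V => (\1_A x : R)%:E).
Proof. by move=> mA; apply/measurable_EFinP; exact: measurable_indic. Qed.

(** A covering of [A] by boxes bounds the indicator of [A] by the sum of their indicators, whose
    iterated integrals are their volumes. For [A] a box this is the harder half of its measure being
    its volume. *)
Lemma iterint_le_leb (A : set (BV R N)) x : measurable A ->
  iterint stdbasis (fun x : V => (\1_A x : R)%:E) x <= lebesgue_outer (A : set V).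
Proof.
move=> mA; apply: le_ereal_inf_tmp => _ [c Ac <-].
have mb k : bmeas (fun x : V => (\1_(box (c k)) x : R)%:E).
  by apply: bmeas_indic; exact: measurable_box.
have -> : \sum_(k <oo) (box_volume (c k))%:E =
    iterint stdbasis (fun x => \sum_(k <oo) (\1_(box (c k)) x : R)%:E) x.
  rewrite iterint_nneseries//.
  by apply: eq_eseriesr => k _; rewrite iterint_box.
apply: le_iterint => //.
- exact: bmeas_indic.
- exact: bmeas_nneseries.
- move=> y; rewrite indicE; case: (boolP (y \in A)) => /= yA; last first.
    by apply: nneseries_ge0 => k _ _; rewrite lee_fin.
  move: yA; rewrite inE => /Ac [k _ yk].
  rewrite (@nneseriesD1 _ _ k)//.
  rewrite indicE mem_set// leeDl//.
  by apply: nneseries_ge0 => j _ _; rewrite lee_fin.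
Qed.

Lemma leb_box_le (c : option (V * V)) : lebesgue_outer (box c) <= (box_volume c)%:E.
Proof.
apply: ereal_inf_lbound => /=.
exists (fun k : nat => if k == 0%N then c else None).
  by move=> x cx; exists 0%N.
rewrite (@nneseriesD1 _ _ 0%N)//; last by move=> *; exact: box_volume_ge0.
by rewrite eseries0 ?adde0//= => i _ /negbTE ->.
Qed.

Lemma leb_box (c : option (V * V)) : lebesgue_outer (box c) = (box_volume c)%:E.
Proof.
apply/eqP; rewrite eq_le leb_box_le -(iterint_box c 0)/=.
by apply: iterint_le_leb; exact: measurable_box.
Qed.

End lebesgue_borel.

Local Close Scope ereal_scope.

Section lebesgue_borel.
Context {R : realType} {N : nat}.
Local Notation V := 'rV[R]_N.
Local Notation LV := (lebesgue_rV R N).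
Implicit Types (a b x : V) (s : seq V) (f g : V -> \bar R).
Local Open Scope ereal_scope.

Lemma rV_norm_leP x (r : R) : (0 <= r)%R ->
  reflect (forall i, `|x ord0 i| <= r)%R (`|x| <= r)%R.
Proof.
move=> r0; rewrite [`|x|%R]mx_normrE; apply: (iffP (bigmax_leP _ _ _ _)).
  by move=> [_ h] i; exact: (h (ord0, i)).
by move=> h; split => // -[i j] _; rewrite (ord1 i); exact: h.
Qed.

Lemma rV_coord_le x i : (`|x ord0 i| <= `|x|)%R.
Proof. by move: i; apply/rV_norm_leP. Qed.

Lemma box_volume_split a b i (c : R) :
  box_volume (Some (a, b)) =
  (box_volume (Some (a, \row_j if j == i then Num.min (b ord0 i) c else b ord0 j)) +
   box_volume (Some (\row_j if j == i then Num.max (a ord0 i) c else a ord0 j, b)))%R.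
Proof.
rewrite /= [LHS](bigD1 i)//= [X in _ = (X + _)%R](bigD1 i)//=.
rewrite [X in _ = (_ + X)%R](bigD1 i)//= !mxE !eqxx.
rewrite [in X in (_ = X + _)%R](eq_bigr (fun i => (Num.max 0 (b ord0 i - a ord0 i))%R));
  last by move=> j /negbTE ji; rewrite mxE ji.
rewrite [in X in (_ = _ + X)%R](eq_bigr (fun i => (Num.max 0 (b ord0 i - a ord0 i))%R));
  last by move=> j /negbTE ji; rewrite mxE ji.
rewrite -mulrDl; congr (_ * _)%R.
rewrite /Num.max /Num.min.
by case: (ltP (b ord0 i) c) => ?; case: (ltP (a ord0 i) c) => ?;
  do !(case: ltP => ?); lra.
Qed.

Definition lowbox i (c : R) (bs : option (V * V)) : option (V * V) :=
  if bs is Some (a, b) then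
    Some (a, \row_j if j == i then (Num.min (b ord0 i) c)%R else b ord0 j) else None.

Definition highbox i (c : R) (bs : option (V * V)) : option (V * V) :=
  if bs is Some (a, b) then
    Some (\row_j if j == i then (Num.max (a ord0 i) c)%R else a ord0 j, b) else None.

(** Cutting each box of a covering along the hyperplane yields coverings of both pieces with the
    same total volume. *)
Lemma half_space_measurable i (c : R) :
  measurable ([set x : V | (c < x ord0 i)%R] : set LV).
Proof.
apply: le_caratheodory_measurable => X.
apply: le_ereal_inf_tmp => _ [bs Xbs <-].
have -> : \sum_(k <oo) (box_volume (bs k))%:E =
    \sum_(k <oo) ((box_volume (highbox i c (bs k)))%:E +
                  (box_volume (lowbox i c (bs k)))%:E).
  apply: eq_eseriesr => k _; case: (bs k) => [[a b]|] /=.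
    by rewrite -EFinD addrC; congr EFin; exact: box_volume_split.
  by rewrite adde0.
rewrite nneseriesD; [|by move=> *; exact: box_volume_ge0|by move=> *; exact: box_volume_ge0].
apply: leeD.
  apply: ereal_inf_lbound; exists (fun k => highbox i c (bs k)) => // x [Xx cx].
  have [k _ bsk] := Xbs _ Xx; exists k => //.
  move: bsk; case: (bs k) => [[a b]|//] /= h j; rewrite mxE.
  by case: eqP => [->|_]; rewrite ?ge_max ?(ltW cx) ?andbT; exact: h.
apply: ereal_inf_lbound; exists (fun k => lowbox i c (bs k)) => // x [Xx cx].
have [k _ bsk] := Xbs _ Xx; exists k => //.
move: bsk; case: (bs k) => [[a b]|//] /= h j; rewrite mxE.
case: eqP => [->|_]; last exact: h.
have /andP[h1 h2] := h i; rewrite le_min h1 h2 /= leNgt; exact/negP.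
Qed.

Lemma measurable_idLB : measurable_fun (setT : set LV) (fun x : LV => x : BV R N).
Proof.
apply: measurable_fun_rV => i.
apply: (measurability _ (RGenOInfty.measurableE R)) => //.
move=> _ [_ [c ->] <-]; rewrite setTI.
rewrite (_ : _ @^-1` _ = [set x : V | (c < x ord0 i)%R]).
  exact: half_space_measurable.
by apply/seteqP; split => x /=; rewrite in_itv/= andbT.
Qed.

Lemma borel_leb_measurable (A : set (BV R N)) : measurable A ->
  measurable (A : set LV).
Proof.
by move=> mA; have := measurable_idLB measurableT mA; rewrite setTI.
Qed.

Lemma indicE_ge0 (A : set V) y : 0 <= (\1_A y : R)%:E.
Proof. by rewrite lee_fin. Qed.

(** The inequality for [A] and the one for its complement in the box add up to the volume of the box
    on both sides, so both are equalities. *)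
Lemma leb_iterint_bounded (A : set (BV R N)) c x : measurable A ->
  A `<=` box c ->
  lebesgue_outer (A : set V) = iterint stdbasis (fun x : V => (\1_A x : R)%:E) x.
Proof.
move=> mA Ac; apply/eqP; rewrite eq_le iterint_le_leb// andbT.
have mB : measurable (box c : set (BV R N)) by exact: measurable_box.
have mD : measurable (box c `\` A : set (BV R N)) by exact: measurableD.
have e1 : leb (box c : set LV) = leb (A : set LV) + leb (box c `\` A : set LV).
  rewrite -measureU//; [|exact: borel_leb_measurable..|by rewrite setDIK].
  by rewrite setDUK.
have e2 : (box_volume c)%:E = iterint stdbasis (fun x : V => (\1_A x : R)%:E) x +
    iterint stdbasis (fun x : V => (\1_(box c `\` A) x : R)%:E) x.
  rewrite -(iterint_box c x).
  have /= <- := congr1 (@^~ x) (iterintD stdbasis (bmeas_indic mA) (indicE_ge0 A)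
    (bmeas_indic mD) (indicE_ge0 (box c `\` A))).
  congr (iterint _ _ x); apply/funext => y; rewrite -EFinD -[X in (X + _)%R]/((\1_A : V -> R) y).
  rewrite !indicE; congr EFin.
  have [yA|yA] := boolP (y \in A).
    rewrite mem_set; last by apply: Ac; rewrite inE in yA.
    by rewrite memNset ?addr0//= => -[_]; apply; rewrite inE in yA.
  rewrite add0r; congr (_%:R); congr nat_of_bool; apply/idP/idP; rewrite !inE.
    by move=> yc; split => //; rewrite notin_setE in yA.
  by move=> [].
have h1 := iterint_le_leb x mA; have h2 := iterint_le_leb x mD.
have e3 : leb (box c : set LV) = (box_volume c)%:E by exact: leb_box.
have fin2 : iterint stdbasis (fun x : V => (\1_(box c `\` A) x : R)%:E) x \is a fin_num.
  rewrite ge0_fin_numE; last by apply: iterint_ge0 => y; rewrite lee_fin.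
  apply: (@le_lt_trans _ _ (box_volume c)%:E); last exact: ltry.
  by rewrite e2 leeDr//; apply: iterint_ge0 => y; rewrite lee_fin.
rewrite -(leeD2rE _ _ fin2) -e2 -e3 e1.
by apply: leeD2l.
Qed.

Lemma leb_iterint (A : set (BV R N)) x : measurable A ->
  lebesgue_outer (A : set V) = iterint stdbasis (fun x : V => (\1_A x : R)%:E) x.
Proof.
move=> mA; apply/eqP; rewrite eq_le iterint_le_leb// andbT.
pose Q (n : nat) : set V := box (Some (const_mx (- n%:R)%R, const_mx n%:R%R)) .
have mQ n : measurable (Q n : set (BV R N)) by exact: measurable_box.
(* Disjoint shells of the cubes: countable subadditivity reduces the claim to bounded pieces. *)
pose D := seqDU Q.
have mD n : measurable (D n : set (BV R N)).
  by apply: measurableD => //; exact: bigsetU_measurable.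
have DQ n : D n `<=` Q n by exact: subDsetl.
have UQ : \bigcup_n D n = setT.
  rewrite -seqDU_bigcup_eq -subTset => y _.
  have [n hn] : exists n : nat, (`|y| <= n%:R)%R.
    by exists (Num.bound `|y|); apply: ltW; exact: archi_boundP.
  exists n => // i; rewrite !mxE -ler_norml.
  by apply: le_trans hn; exact: rV_coord_le.
have mAD n : measurable (A `&` D n : set (BV R N)) by exact: measurableI.
apply: (@le_trans _ _ (\sum_(n <oo) lebesgue_outer (A `&` D n : set V))).
  have {1}-> : A = \bigcup_n (A `&` D n) by rewrite -setI_bigcupr UQ setIT.
  exact: outer_measure_sigma_subadditive.
rewrite (eq_eseriesr (fun n _ => leb_iterint_bounded x (mAD n)
  (subset_trans (@subIsetr _ _ _) (DQ n)))).
have /= <- := congr1 (@^~ x) (iterint_nneseries stdbasis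
  (fun n => bmeas_indic (mAD n)) (fun n => indicE_ge0 (A `&` D n))).
have tD : trivIset setT D := trivIset_seqDU Q.
apply: le_iterint.
- by apply: bmeas_nneseries => n *; [exact: bmeas_indic|exact: indicE_ge0].
- exact: bmeas_indic.
- by move=> y; apply: nneseries_ge0 => *; rewrite lee_fin.
- move=> y; have : (\bigcup_n D n) y by rewrite UQ.
  move=> [k _ Dky].
  rewrite (@nneseriesD1 _ _ k)//= eseries0 => [|n _ /= nk].
    by rewrite adde0 indicI /= lee_fin ler_piMr.
  rewrite indicE memNset//= => -[_ Dny].
  by have e : n = k := tD n k Logic.I Logic.I (ex_intro _ y (conj Dny Dky));
    rewrite e eqxx in nk.
Qed.

End lebesgue_borel.

Local Close Scope ereal_scope.

Section bleb.
Context {R : realType} {N : nat}.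
Local Notation V := 'rV[R]_N.
Local Notation LV := (lebesgue_rV R N).
Local Notation BV := (BV R N).
Implicit Types (a b x : V) (s : seq V) (f g : V -> \bar R).
Local Open Scope ereal_scope.

(** Lebesgue measure on the Borel sets, as a measure of its own: [fubini_tonelli] is applied on the
    sigma-algebra for which the line maps are measurable. *)
Definition bleb (A : set BV) : \bar R := lebesgue_outer (A : set V).

Let bleb0 : bleb set0 = 0. Proof. exact: lebesgue_outer0. Qed.
Let bleb_ge0 A : 0 <= bleb A. Proof. exact: lebesgue_outer_ge0. Qed.
Let bleb_semi_sigma_additive : semi_sigma_additive bleb.
Proof.
move=> F mF tF mUF; apply: (@measure_semi_sigma_additive _ _ _ (@leb R N)) => //.
  by move=> n; exact: borel_leb_measurable.
exact: borel_leb_measurable.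
Qed.

HB.instance Definition _ := isMeasure.Build _ _ _ bleb
  bleb0 bleb_ge0 bleb_semi_sigma_additive.

Lemma bleb_sigma_finite : sigma_finite setT bleb.
Proof.
pose Q (n : nat) : set BV := box (Some (const_mx (- n%:R)%R, const_mx n%:R%R)) .
exists Q; last first.
  by move=> n; split; [exact: measurable_box|rewrite /bleb leb_box ltry].
apply/esym; rewrite -subTset => y _.
have [n hn] : exists n : nat, (`|y| <= n%:R)%R.
  by exists (Num.bound `|y|); apply: ltW; exact: archi_boundP.
by exists n => // i; rewrite !mxE -ler_norml; exact: le_trans (rV_coord_le _ _) hn.
Qed.

HB.instance Definition _ := @Measure_isSigmaFinite.Build _ _ _ bleb
  bleb_sigma_finite.

Lemma leb_integralE (D : set BV) f : measurable D -> measurable_fun D f ->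
  (forall x, D x -> 0 <= f x) ->
  \int[@leb R N]_(x in (D : set LV)) f x = \int[bleb]_(x in D) f x.
Proof.
move=> mD mf f0; pose idLB : {mfun LV >-> BV} :=
  HB.pack (fun x : LV => x : BV) (isMeasurableFun.Build _ _ _ _ _ measurable_idLB).
have e := @ge0_integral_pushforward _ _ LV BV R idLB measurable_idLB (@leb R N) D f mD mf.
rewrite -[LHS]e; last by move=> x; rewrite inE; exact: f0.
by apply: eq_measure_integral => A mA _.
Qed.

Lemma leb_integrableE (D : set BV) f : measurable D -> measurable_fun D f ->
  (@leb R N).-integrable (D : set LV) f -> bleb.-integrable D f.
Proof.
move=> mD mf /integrableP[_ h]; apply/integrableP; split => //.
by rewrite -leb_integralE//; exact: measurableT_comp.
Qed.

Lemma leb_integralE_integrable (D : set BV) f : measurable D -> measurable_fun D f ->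
  (@leb R N).-integrable (D : set LV) f ->
  \int[@leb R N]_(x in (D : set LV)) f x = \int[bleb]_(x in D) f x.
Proof.
move=> mD mf fi; rewrite integralE [RHS]integralE.
by congr (_ - _); apply: leb_integralE => //;
  [exact: measurable_funepos|exact: measurable_funeneg].
Qed.

Lemma iterint_sum_indic (I : Type) (l : seq I) s (c : I -> R) (A : I -> set BV) x :
  (forall i, 0 <= c i)%R -> (forall i, measurable (A i)) ->
  iterint s (fun x => (\sum_(i <- l) c i * \1_(A i) x)%R%:E) x =
  \sum_(i <- l) (c i)%:E * iterint s (fun x : V => (\1_(A i) x : R)%:E) x.
Proof.
move=> c0 mA; elim: l => [|i l IH].
  rewrite big_nil (_ : (fun _ => _) = fun=> 0) ?iterint0//.
  by apply/funext => y; rewrite big_nil.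
rewrite big_cons -IH.
rewrite (_ : (fun _ => _) = fun x => (c i)%:E * (\1_(A i) x)%:E +
    (\sum_(i <- l) c i * \1_(A i) x)%R%:E); last first.
  by apply/funext => y; rewrite big_cons EFinD EFinM.
have mi := bmeas_indic (mA i).
rewrite iterintD; first by rewrite iterintZ.
- by apply: emeasurable_funM.
- by move=> y; rewrite mule_ge0// lee_fin.
- apply/measurable_EFinP; apply: measurable_sum => j.
  by apply: measurable_funM => //; exact: measurable_indic.
- by move=> y; rewrite lee_fin; apply: sumr_ge0 => j _; rewrite mulr_ge0.
Qed.

Import HBNNSimple.

Lemma integral_iterint f x : bmeas f -> (forall y, 0 <= f y) ->
  \int[bleb]_y f y = iterint stdbasis f x.
Proof.
move=> mf f0.
pose h := nnsfun_approx measurableT mf.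
have hf y : (EFin \o h^~ y) @ \oo --> f y by exact: cvg_nnsfun_approx.
have nh y : nondecreasing_seq (fun n => (h n y)%:E).
  by move=> m n mn; rewrite lee_fin; exact/lefP/nd_nnsfun_approx.
have mh n : bmeas (fun y => (h n y)%:E) by exact/measurable_EFinP.
have h0 n y : 0 <= (h n y)%:E by rewrite lee_fin.
have c1 := @iterint_cvg _ _ stdbasis _ _ mh h0 nh hf x.
have c2 := cvg_monotone_convergence measurableT mh (fun n y _ => h0 n y)
  (fun y _ => nh y) (mu := bleb).
have e n : \int[bleb]_y (h n y)%:E = iterint stdbasis (fun y => (h n y)%:E) x.
  pose l : seq R := finmap.enum_fset (fset_set (range (h n))).
  pose A (r : R) := h n @^-1` [set r].
  have mA r : measurable (A r : set BV).
    by rewrite /A -[X in measurable X]setTI; exact: (measurable_funP (h n)).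
  have c0 r : (0 <= `|r : R|)%R by exact: normr_ge0.
  (* The values of [h n] are nonnegative, but the coefficients have to be so for every real [r];
     hence the absolute values. *)
  have hE : (fun y => (h n y)%:E) =
    (fun y => (\sum_(r <- l) `|r| * \1_(A r) y)%R%:E).
    apply/funext => y; rewrite fimfunE fsbig_finite//=; congr EFin.
    apply: eq_big_seq => r; rewrite in_fset_set// inE => -[z _ <-].
    by rewrite ger0_norm.
  rewrite hE iterint_sum_indic//; under eq_integral do rewrite -sumEFin.
  rewrite ge0_integral_sum//.
  - apply: eq_bigr => r _; under eq_integral do rewrite EFinM.
    rewrite ge0_integralZl_EFin//; last exact: bmeas_indic.
    by rewrite integral_indic// setIT -leb_iterint.
  - move=> r; apply/measurable_EFinP; apply: measurable_funM => //.
have -> : \int[bleb]_y f y = \int[bleb]_y limn (fun n => (h n y)%:E).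
  by apply: eq_integral => y _; apply/esym/cvg_lim => //; exact: hf.
move: c2; under eq_fun do rewrite e.
by move=> c2; exact: (cvg_unique _ c2 c1).
Qed.

End bleb.

Local Close Scope ereal_scope.

(** * Borel versions of Lebesgue measurable sets and functions *)

Section bleb2.
Context {R : realType} {N : nat}.
Local Notation V := 'rV[R]_N.
Local Notation LV := (lebesgue_rV R N).
Local Notation BV := (BV R N).
Implicit Types (a b x : V) (s : seq V) (f g : V -> \bar R).
Local Open Scope ereal_scope.

Lemma rV_boxE x (r : R) (y : V) : (0 <= r)%R ->
  box (Some (x - const_mx r, x + const_mx r)%R) y <-> (`|y - x| <= r)%R.
Proof.
move=> r0; split => [h|/rV_norm_leP h i].
  by apply/rV_norm_leP => // i; have := h i; rewrite !mxE ler_distl.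
by have := h r0 i; rewrite !mxE ler_distl.
Qed.

(** The cubes with rational centre and radius $1/(n+1)$ act as a countable base. They serve to write
    open sets as countable unions and to localise null sets. *)
Lemma rational_box (W : set V) x : open W -> W x ->
  exists p : 'rV[rat]_N * nat,
    (forall y, (`|y - map_mx (ratr : rat -> R) p.1| <= p.2.+1%:R^-1)%R -> W y) /\
    (`|x - map_mx (ratr : rat -> R) p.1| <= p.2.+1%:R^-1)%R.
Proof.
move=> oU Ux; have := open_nbhs_nbhs (conj oU Ux); rewrite -nbhs_ballE => -[e /= e0 eU].
have [n ne] : exists n : nat, (n.+1%:R^-1 < e / 2)%R.
  exists (Num.bound (2 / e)); rewrite -[ltRHS]invrK ltf_pV2 ?posrE ?invr_gt0 ?divr_gt0//.
  rewrite invf_div (lt_trans (archi_boundP (ltW (divr_gt0 (ltr0Sn R 1) e0))))//.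
  by rewrite ltr_nat.
have n0 : (0 < n.+1%:R^-1 :> R)%R by [].
have hz i : exists r : rat, (`|x ord0 i - ratr r| < n.+1%:R^-1)%R.
  have /rat_in_itvoo[r] : (x ord0 i - n.+1%:R^-1 < x ord0 i + n.+1%:R^-1)%R
    by rewrite ltrD2l gtrN.
  rewrite in_itv/= => hr; exists r; rewrite distrC ltr_distl; exact: hr.
have [z hz'] := choice hz.
exists (\row_i z i, n) => /=.
have xp : (`|x - map_mx (ratr : rat -> R) (\row_i z i)| <= n.+1%:R^-1)%R.
  by apply/rV_norm_leP => // i; rewrite !mxE; exact: ltW.
split => // y yp; apply: eU; rewrite -ball_normE /ball_ /=.
rewrite (le_lt_trans (ler_distD (map_mx ratr (\row_i z i)) _ _))// (distrC _ y).
by apply: le_lt_trans (lerD xp yp) _; rewrite [ltRHS]splitr ltrD.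
Qed.

Lemma open_boxes (U : set V) : open U -> exists c : nat -> option (V * V),
  U = \bigcup_k box (c k).
Proof.
move=> oU.
pose q (p : 'rV[rat]_N * nat) : option (V * V) :=
  let z := map_mx (ratr : rat -> R) p.1 in
  let d := const_mx p.2.+1%:R^-1%R in Some (z - d, z + d)%R.
pose c k := if unpickle k is Some p then
  if pselect (box (q p) `<=` U) then q p else None else None.
exists c; apply/seteqP; split; last first.
  move=> x [k _]; rewrite /c; case: unpickle => //= p.
  by case: pselect => //= h; exact: h.
move=> x Ux; have [p [pU xp]] := rational_box oU Ux.
have n0 : (0 <= p.2.+1%:R^-1 :> R)%R by [].
exists (pickle p) => //; rewrite /c pickleK; case: pselect => [h|[]] /=.
  exact/rV_boxE.
by move=> y By; apply: pU; apply/(rV_boxE _ _ n0).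
Qed.

Lemma open_borel (U : set V) : open U -> measurable (U : set BV).
Proof.
move=> /open_boxes[c ->]; apply: bigcup_measurable => k _.
exact: measurable_box.
Qed.

Lemma closed_borel (U : set V) : closed U -> measurable (U : set BV).
Proof.
move=> cU; rewrite -[U]setCK; apply: measurableC; apply: open_borel.
exact: closed_openC.
Qed.

(** Intersect, over [n], the unions of coverings that are optimal up to $1/(n+1)$. *)
Lemma borel_hull (A : set V) : lebesgue_outer A < +oo ->
  exists B : set BV, [/\ measurable B, A `<=` B & bleb B = lebesgue_outer A].
Proof.
move=> Aoo; have Afin : lebesgue_outer A \is a fin_num.
  by rewrite ge0_fin_numE// lebesgue_outer_ge0.
have h n : exists c : nat -> option (V * V), box_cover A c /\
    \sum_(k <oo) (box_volume (c k))%:E < lebesgue_outer A + (n.+1%:R^-1)%:E.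
  have n0 : (0 < n.+1%:R^-1 :> R)%R by [].
  have [_ [c Ac <-] hc] := lb_ereal_inf_adherent n0 Afin.
  by exists c.
have [c hc] := choice h.
pose B : set BV := \bigcap_n \bigcup_k box (c n k).
have mU n : measurable (\bigcup_k box (c n k) : set BV).
  by apply: bigcup_measurable => k _; exact: measurable_box.
have mB : measurable B by apply: bigcapT_measurable.
exists B; split => //; first by move=> x Ax n _; exact: (hc n).1.
apply/eqP; rewrite eq_le; apply/andP; split; last first.
  by apply: le_lebesgue_outer => x Ax n _; exact: (hc n).1.
apply/lee_addgt0Pr => e e0.
pose n := Num.bound (e^-1).
have ne : (n.+1%:R^-1 <= e)%R.
  rewrite -[leRHS]invrK lef_pV2 ?posrE ?invr_gt0//.
  apply: (le_trans (ltW (archi_boundP _))); first by rewrite invr_ge0 ltW.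
  by rewrite ler_nat.
apply: (@le_trans _ _ (\sum_(k <oo) (box_volume (c n k))%:E)).
  by apply: ereal_inf_lbound; exists (c n) => // x; apply.
apply: (le_trans (ltW (hc n).2)).
by rewrite leeD2l// lee_fin.
Qed.

Lemma leb_negligible_borel (A : set V) :
  (@leb R N).-negligible (A : set LV) -> bleb.-negligible (A : set BV).
Proof.
move=> [B [mB B0 AB]].
have B0' : lebesgue_outer (B : set V) = 0 by exact: B0.
have [C [mC BC C0]] := borel_hull (eq_ind_r (fun z => z < +oo) (ltry 0) B0').
by exists C; split => //; [rewrite C0 B0'|exact: subset_trans AB BC].
Qed.

Lemma borel_leb_negligible (A : set V) :
   bleb.-negligible (A : set BV) -> (@leb R N).-negligible (A : set LV).
Proof.
by move=> [B [mB B0 AB]]; exists B; split => //; exact: borel_leb_measurable.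
Qed.

(** The Borel hull exceeds [A] by a null set, the two measures being equal and finite; a second hull
    encloses this excess in a Borel null set. *)
Lemma borel_approx (A : set V) c : measurable (A : set LV) -> A `<=` box c ->
  exists B Z : set BV, [/\ measurable B, measurable Z, bleb Z = 0 &
    (A `\` B) `|` (B `\` A) `<=` Z].
Proof.
move=> mA Ac.
have Afin : lebesgue_outer A < +oo.
  by apply: (@le_lt_trans _ _ (lebesgue_outer (box c)));
    [exact: le_lebesgue_outer|rewrite leb_box ltry].
have [B [mB AB BA]] := borel_hull Afin.
have BA0 : lebesgue_outer (B `\` A) = 0.
  have mB' : measurable (B : set LV) by exact: borel_leb_measurable.
  have mBA : measurable (B `\` A : set LV) by exact: measurableD.
  have := measureU (@leb R N) mA mBA; rewrite setDIK setDUK// => /(_ erefl) e.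
  have Af : lebesgue_outer A \is a fin_num.
    by rewrite ge0_fin_numE// lebesgue_outer_ge0.
  have e' : lebesgue_outer A = lebesgue_outer A + lebesgue_outer (B `\` A) :=
    etrans (esym BA) e.
  apply/eqP; rewrite eq_le lebesgue_outer_ge0 andbT -(@leeD2lE _ (lebesgue_outer A))//.
  by rewrite adde0 -e'.
have [Z [mZ BAZ Z0]] : exists Z : set BV, [/\ measurable Z, B `\` A `<=` Z &
    bleb Z = lebesgue_outer (B `\` A)].
  by apply: borel_hull; rewrite BA0 ltry.
exists B, Z; split => //; first by rewrite Z0 BA0.
by move=> x [[Ax]|]; [move/(_ (AB _ Ax))|exact: BAZ].
Qed.

Lemma negligible_bigcup_countable (I : countType) (F : I -> set BV) :
  (forall i, bleb.-negligible (F i)) -> bleb.-negligible (\bigcup_i F i).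
Proof.
move=> nF; pose G k := if unpickle k is Some i then F i else set0.
have nG : bleb.-negligible (\bigcup_k G k).
  apply: negligible_bigcup => k; rewrite /G; case: unpickle => //.
  exact: negligible_set0.
apply: negligibleS nG => x [i _ Fi]; exists (pickle i) => //.
by rewrite /G pickleK.
Qed.

(** Each level set $\{r<f\}$ with [r] rational is Borel up to a null set. Off the union [Z] of these
    null sets, $\{c'<f\}$ is the union of the Borel sets attached to the $r\ge c'$, so that [f], set
    to zero on [Z], becomes a Borel function. *)
Lemma borel_version (D : set V) c (f : V -> R) : measurable (D : set BV) ->
  D `<=` box c -> measurable_fun (D : set LV) f ->
  exists (g : V -> R) (Z : set BV),
    [/\ measurable_fun (setT : set BV) g, measurable Z, bleb Z = 0,
     (forall x, D x -> ~ Z x -> g x = f x) & (forall x, ~ D x -> g x = 0%R)].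
Proof.
move=> mD Dc mf.
have mA (r : rat) : measurable (D `&` [set x | (ratr r < f x)%R] : set LV).
  have -> : [set x | (ratr r < f x)%R] = f @^-1` `]ratr r, +oo[%classic.
    by apply/seteqP; split => x /=; rewrite in_itv/= andbT.
  by apply: mf => //; exact: borel_leb_measurable.
have h (r : rat) : exists BZ : set BV * set BV, [/\ measurable BZ.1,
    measurable BZ.2, bleb BZ.2 = 0 &
    ((D `&` [set x | (ratr r < f x)%R]) `\` BZ.1) `|`
     (BZ.1 `\` (D `&` [set x | (ratr r < f x)%R])) `<=` BZ.2].
  have [B [Z hBZ]] := borel_approx (mA r) (subset_trans (@subIsetl _ _ _) Dc).
  by exists (B, Z).
have [F hF] := choice h.
pose Z : set BV := \bigcup_r (F r).2.
have mZ : measurable Z.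
  by apply: bigcupT_measurable_rat => r; have [] := hF r.
have Z0 : bleb Z = 0.
  apply/negligibleP => //; apply: negligible_bigcup_countable => r.
  by apply/negligibleP; have [] := hF r.
pose DZ : set BV := D `\` Z.
have mDZ : measurable DZ by exact: measurableD.
exists (f \_ DZ), Z; split => //.
- apply/(measurable_restrictT _ mDZ) => _.
  apply: (measurability _ (RGenOInfty.measurableE R)) => //.
  move=> _ [_ [c' ->] <-].
  rewrite (_ : _ `&` _ = DZ `&` \bigcup_(r in [set r : rat | (c' <= ratr r)%R]) (F r).1).
    apply: measurableI => //.
    rewrite (_ : \bigcup_(r in _) _ = \bigcup_r (if (c' <= ratr r)%R then (F r).1 else set0)).
      by apply: bigcupT_measurable_rat => r; case: ifP => // _; have [] := hF r.
    apply/seteqP; split => x.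
      by move=> [r /= cr Fr]; exists r => //; rewrite cr.
    by move=> [r _]; case: ifPn => // cr Fr; exists r.
  apply/seteqP; split => x [[Dx Zx]] /=.
    rewrite in_itv/= andbT => /rat_in_itvoo[r]; rewrite in_itv/= => /andP[cr rf].
    split => //; exists r; first exact: ltW.
    apply: contrapT => nF; apply: Zx; exists r => //.
    by have [_ _ _] := hF r; apply; left.
  move=> [r /= cr Fr]; split => //; rewrite in_itv/= andbT.
  apply: (le_lt_trans cr); apply: contrapT => nF; apply: Zx; exists r => //.
  by have [_ _ _] := hF r; apply; right; split => // -[].
- by move=> x Dx Zx; rewrite patchE mem_set.
- by move=> x Dx; rewrite patchE memNset// => -[].
Qed.

End bleb2.

Local Close Scope ereal_scope.

(** * Null sets on lines, and oblique directions *)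

Section bleb3.
Context {R : realType} {N : nat}.
Local Notation V := 'rV[R]_N.
Local Notation BV := (BV R N).
Local Notation mu := (@bleb R N).
Implicit Types (a b x : V) (s : seq V) (f g : V -> \bar R).
Local Open Scope ereal_scope.

Lemma iterint_translate s f x y :
  iterint s (fun z => f (z + y)%R) x = iterint s f (x + y)%R.
Proof.
elim: s x => //= a s IH x; rewrite -lineint_translate.
by congr lineint; apply/funext => z; exact: IH.
Qed.

Lemma bmeas_translate f y : bmeas f -> bmeas (fun x => f (x + y)%R).
Proof. by move=> mf; exact: (measurableT_comp mf (measurable_translate y)). Qed.

Lemma integral_bleb_translate f y : bmeas f -> (forall x, 0 <= f x) ->
  \int[mu]_x f (x + y)%R = \int[mu]_x f x.
Proof.
move=> mf f0; rewrite (integral_iterint 0%R (bmeas_translate y mf))//.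
by rewrite iterint_translate -integral_iterint.
Qed.

(** For fixed [t] the translate of [Z] by $-ta$ is null, so the integral over $(x,t)$ of the
    indicator of $x+ta\in Z$ vanishes. Read in the other order, this says that almost every line
    meets [Z] in a null set. *)
Lemma ae_line (Z : set BV) a : measurable Z -> mu Z = 0 ->
  {ae mu, forall x, lebesgue_measure [set t : R | Z (x + t *: a)%R] = 0}.
Proof.
move=> mZ Z0.
have mf := bmeas_line a (bmeas_indic mZ).
have := fubini_tonelli (m1 := mu)
  (m2 := lebesgue_measure : {measure set (measurableTypeR R) -> \bar R})
  _ mf (fun=> indicE_ge0 _ _).
rewrite /= [X in _ = X -> _]integral0_eq; last first.
  move=> t _; rewrite (integral_bleb_translate (t *: a)%R (bmeas_indic mZ))//.
    by rewrite integral_indic// setIT.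
have mF := bmeas_lineint a (bmeas_indic mZ) (indicE_ge0 Z).
move=> h; have : ae_eq mu setT (lineint a (fun x => (\1_Z x)%:E)) (cst 0).
  apply/ae_eq_integral_abs => //; rewrite -[RHS]h; apply: eq_integral => x _.
  by rewrite gee0_abs// lineint_ge0// => y; exact: indicE_ge0.
apply: filterS => x /(_ Logic.I) h0.
pose A : set (measurableTypeR R) := [set t : R | Z (x + t *: a)%R].
have mA : measurable A.
  by have := measurable_line1 a x measurableT mZ; rewrite setTI.
have := integral_indic lebesgue_measure measurableT mA.
by rewrite setIT => <-; exact: h0.
Qed.

(** A Lindelof argument: countably many cubes with rational data on which [E] is negligible cover
    the part of [E] in [U]. *)
Lemma negligible_local (U E : set V) : open U ->
  (forall x, U x -> exists W : set V, [/\ open W, W x & mu.-negligible (E `&` W : set BV)]) ->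
  mu.-negligible (E `&` U : set BV).
Proof.
move=> oU h.
pose B (p : 'rV[rat]_N * nat) : set V :=
  [set y | (`|y - map_mx (ratr : rat -> R) p.1| <= p.2.+1%:R^-1)%R].
pose F p : set BV := if pselect (mu.-negligible (E `&` B p : set BV)) then E `&` B p else set0.
have nF : mu.-negligible (\bigcup_p F p).
  apply: negligible_bigcup_countable => p; rewrite /F.
  by case: pselect => //= _; exact: negligible_set0.
apply: negligibleS nF => x [Ex Ux].
have [W [oW Wx nW]] := h _ Ux.
have [p [pW xp]] := rational_box oW Wx; exists p => //; rewrite /F.
case: pselect => [h'|[]] /=; first by split.
by apply: negligibleS nW => y [Ey By]; split => //; exact: pW.
Qed.

Lemma bleb_open_gt0 (U : set V) x : open U -> U x -> 0 < mu (U : set BV).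
Proof.
move=> oU Ux; have := open_nbhs_nbhs (conj oU Ux); rewrite -nbhs_ballE => -[e /= e0 eU].
have e20 : (0 < e / 2)%R by rewrite divr_gt0.
apply: (@lt_le_trans _ _ (lebesgue_outer (box (Some (x - const_mx (e/2), x + const_mx (e/2))%R)))).
  rewrite leb_box lte_fin; apply: prodr_gt0 => i _.
  by rewrite !mxE lt_max; apply/orP; right; lra.
apply: le_lebesgue_outer => y /(rV_boxE _ _ (ltW e20)) h; apply: eU.
by rewrite -ball_normE /ball_/= distrC (le_lt_trans h)//; lra.
Qed.

Lemma bounded_box (U : set V) : bounded_set U -> exists r : R, (0 < r)%R /\
  (forall x, U x -> `|x| <= r)%R /\
  U `<=` box (Some (const_mx (- r)%R, const_mx r)).
Proof.
move=> [M [_ hM]]; pose r := (`|M| + 1)%R.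
have r0 : (0 < r)%R by rewrite ltr_wpDl.
have hr x : U x -> (`|x| <= r)%R.
  by apply: hM; rewrite (le_lt_trans (ler_norm M))// ltrDl.
exists r; split => //; split => // x /hr xr i.
by rewrite !mxE -ler_norml; exact: le_trans (rV_coord_le _ _) xr.
Qed.

Lemma bleb_bounded (U : set V) : bounded_set U -> mu (U : set BV) < +oo.
Proof.
move=> /bounded_box[r [_ [_ Ur]]].
by rewrite (le_lt_trans (le_lebesgue_outer Ur))// leb_box ltry.
Qed.

Lemma iterint_scale (l : seq 'I_N) (d : R) f : d != 0%R -> bmeas f ->
  (forall x, 0 <= f x) ->
  iterint [seq (d *: unitv i)%R | i <- l] f =
  fun x => (`|d|^-1 ^+ size l)%R%:E * iterint [seq unitv i | i <- l] f x.
Proof.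
move=> d0 mf f0; elim: l => [|i l IH] /=.
  by apply/funext => x; rewrite expr0 mul1e.
rewrite IH lineintZ//; last 2 first.
- by apply: emeasurable_funM => //; exact: bmeas_iterint.
- by move=> x; rewrite mule_ge0 ?iterint_ge0// lee_fin exprn_ge0// invr_ge0.
apply/funext => x.
have d0' : (0 <= `|d|^-1 ^+ size l)%R by rewrite exprn_ge0// invr_ge0.
have mI := bmeas_iterint [seq unitv i | i <- l] mf f0.
have I0 := iterint_ge0 [seq unitv i | i <- l] f0.
have /= -> := congr1 (@^~ x) (@iterintZ _ _ [:: unitv i] _ _ mI I0 d0').
by rewrite muleA -EFinM -exprS.
Qed.

Lemma iterint_shear (l : seq 'I_N) v (c : 'I_N -> R) f : bmeas f ->
  (forall x, 0 <= f x) ->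
  lineint (v + \sum_(i <- l) c i *: unitv i)%R (iterint [seq unitv i | i <- l] f) =
  lineint v (iterint [seq unitv i | i <- l] f).
Proof.
move=> mf f0.
suff : forall l', {subset l' <= l} ->
    lineint (v + \sum_(i <- l') c i *: unitv i)%R (iterint [seq unitv i | i <- l] f) =
    lineint v (iterint [seq unitv i | i <- l] f) by apply.
elim => [_|i l' IH sl]; first by rewrite big_nil addr0.
have il : i \in l by apply: sl; rewrite mem_head.
rewrite -IH; last by move=> k kl; apply: sl; rewrite in_cons kl orbT.
rewrite big_cons addrCA addrC.
rewrite (iterint_perm mf f0 (perm_map unitv (perm_to_rem il))) /=.
by rewrite lineint_shear//; [exact: bmeas_iterint|exact: iterint_ge0].
Qed.

Lemma iterint_add (l : seq 'I_N) (w : 'I_N -> V) p f : bmeas f ->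
  (forall x, 0 <= f x) ->
  iterint [seq (w i + 1 *: p)%R | i <- l] (lineint p f) =
  iterint [seq w i | i <- l] (lineint p f).
Proof.
move=> mf f0; elim: l => [//|i l IH]; rewrite /= IH.
have mg := bmeas_iterint [seq w i | i <- l] mf f0.
have g0 := iterint_ge0 [seq w i | i <- l] f0.
rewrite (iterint_lineintC [seq w i | i <- l] p mf f0).
exact: (lineint_shear (w i) p 1 mg g0).
Qed.

(** For $p_j\ne0$ and $d\ne0$ these [N] vectors are independent, and for small [d] they all lie near
    [p]. One point inside a cone thus gives [N] independent segments in the cone. *)
Definition skewv (p : V) (j : 'I_N) (d : R) (i : 'I_N) : V :=
  if i == j then p else (p + d *: unitv i)%R.

Definition skew_const (p : V) (j : 'I_N) (d : R) : R :=
  (`|d|^-1 ^+ size (rem j (enum 'I_N)) * `|p ord0 j|^-1)%R.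

(** [skew_const] is the inverse of the absolute determinant of the directions. Subtracting [p] from
    the others leaves $de_i$ for $i\ne j$, from which [d] scales out; shearing along these reduces
    [p] to $p_je_j$. *)
Lemma iterint_skew (p : V) (j : 'I_N) (d : R) f x : (p ord0 j != 0)%R ->
  d != 0%R -> bmeas f -> (forall x, 0 <= f x) ->
  iterint [seq skewv p j d i | i <- enum 'I_N] f x =
  (skew_const p j d)%:E * \int[mu]_x f x.
Proof.
move=> pj d0 mf f0.
pose l := rem j (enum 'I_N).
have pl : perm_eq (enum 'I_N) (j :: l) by apply: perm_to_rem; rewrite mem_enum.
have jl : j \notin l by rewrite mem_rem_uniq ?enum_uniq// inE eqxx.
rewrite (iterint_perm mf f0 (perm_map (skewv p j d) pl)).
have -> : [seq skewv p j d i | i <- j :: l] =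
    p :: [seq (d *: unitv i + 1 *: p)%R | i <- l].
  rewrite /= {1}/skewv eqxx; congr cons; apply/eq_in_map => i il.
  rewrite /skewv; case: eqP => [e|_]; first by rewrite -e il in jl.
  by rewrite scale1r addrC.
have -> : iterint (p :: [seq (d *: unitv i + 1 *: p)%R | i <- l]) f =
    lineint p (iterint [seq (d *: unitv i)%R | i <- l] f).
  rewrite -[LHS]/(lineint p (iterint [seq (d *: unitv i + 1 *: p)%R | i <- l] f)).
  rewrite -(iterint_lineintC _ p mf f0) -(iterint_lineintC _ p mf f0).
  exact: iterint_add.
rewrite iterint_scale//.
have mI := bmeas_iterint [seq unitv i | i <- l] mf f0.
have I0 := iterint_ge0 [seq unitv i | i <- l] f0.
have d0' : (0 <= `|d|^-1 ^+ size l)%R by rewrite exprn_ge0// invr_ge0.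
have /= -> := congr1 (@^~ x) (@iterintZ _ _ [:: p] _ _ mI I0 d0').
have e : p = (p ord0 j *: unitv j + \sum_(i <- l) p ord0 i *: unitv i)%R.
  by rewrite [LHS](row_sum_delta p) -big_enum /= (perm_big _ pl) big_cons.
have -> : lineint p (iterint [seq unitv i | i <- l] f) =
    lineint (p ord0 j *: unitv j)%R (iterint [seq unitv i | i <- l] f).
  rewrite {1}e; exact: iterint_shear.
rewrite lineintZ// muleA -EFinM; congr (_ * _).
rewrite (integral_iterint x mf f0) /stdbasis.
by rewrite (iterint_perm mf f0 (perm_map unitv pl)).
Qed.

End bleb3.

Local Close Scope ereal_scope.

(** * Mollified products and weak derivatives along skew boxes *)

Section smooth_real.
Context {R : realType}.
Implicit Types (f g : R -> R) (x : R).

(** The derivative of $x^{-k}e^{-1/x}$ is a combination of functions of the same family; keeping [k]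
    as a parameter closes the family under differentiation. *)
Definition flat (k : nat) x : R := if 0 < x then x^-1 ^+ k * expR (- x^-1) else 0.

Lemma flat_ge0 k x : 0 <= flat k x.
Proof.
by rewrite /flat; case: ifPn => // x0; rewrite mulr_ge0 ?expR_ge0// exprn_ge0// invr_ge0 ltW.
Qed.

Lemma flat_gt0 k x : 0 < x -> 0 < flat k x.
Proof. by move=> x0; rewrite /flat x0 mulr_gt0 ?expR_gt0// exprn_gt0// invr_gt0. Qed.

Lemma flat_le0 k x : x <= 0 -> flat k x = 0.
Proof. by rewrite /flat ltNge => ->. Qed.

(** From $e^y\ge(y/(k+1))^{k+1}$ at $y=1/x$. Used for [k.+1], with one more factor $x$, it shows
    that [flat k] is quadratically small at $0$. *)
Lemma flat_bound k x : 0 < x -> flat k x <= k.+1%:R ^+ k.+1 * x.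
Proof.
move=> x0; rewrite /flat x0 expRN -ler_pdivlMr ?invr_gt0 ?expR_gt0// invrK.
set m := k.+1%:R : R; have m0 : 0 < m by rewrite ltr0n.
have y0 : 0 < x^-1 by rewrite invr_gt0.
have h : (x^-1 / m) ^+ k.+1 <= expR (x^-1).
  have -> : expR x^-1 = expR (x^-1 / m) ^+ k.+1.
    by rewrite -expRM_natl mulrC divfK// gt_eqF.
  have ym : 0 <= x^-1 / m by rewrite divr_ge0// ltW.
  apply: lerXn2r; rewrite ?nnegrE ?expR_ge0//.
  by apply: le_trans (expR_ge1Dx (x^-1 / m)); rewrite lerDr.
have -> : x^-1 ^+ k = m ^+ k.+1 * x * (x^-1 / m) ^+ k.+1.
  have zn : m ^+ k.+1 != 0 by rewrite expf_neq0// gt_eqF.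
  have xn : x != 0 by rewrite gt_eqF.
  rewrite exprMn [m^-1 ^+ _]exprVn [x^-1 ^+ k.+1]exprS; move: (m ^+ k.+1) (x^-1 ^+ k) zn => z w zn.
  by field; rewrite zn xn.
by rewrite ler_pM2l// mulr_gt0// exprn_gt0.
Qed.

Lemma cvg_is_derive (V W : normedModType R) (f : V -> W) (x v : V) (df : W) :
  h^-1 *: (f (h *: v + x) - f x) @[h --> (0 : R)^'] --> df -> is_derive x v f df.
Proof. by move=> h; split; [exact: cvgP h|exact: cvg_lim h]. Qed.

Lemma is_derive_quadratic (f : R -> R) (C : R) : f 0 = 0 ->
  (forall h, `|f h| <= C * h ^+ 2) -> is_derive (0 : R) 1 f 0.
Proof.
move=> f0 hf; apply: cvg_is_derive; apply/cvgr0Pnorm_lt => e e0 /=.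
have C0 : 0 <= C by have := hf 1; rewrite expr1n mulr1; exact: le_trans.
near=> h; have h0 : h != 0 by near: h; exact: nbhs_dnbhs_neq.
rewrite /= addr0 f0 subr0 [h *: 1]mulr1 normrZ normfV.
rewrite mulrC ltr_pdivrMr ?normr_gt0//.
apply: (le_lt_trans (hf _)); rewrite -(real_normK (num_real h)) expr2.
rewrite mulrA ltr_pM2r ?normr_gt0//.
apply: (@le_lt_trans _ _ ((C + 1) * `|h|)); first by rewrite ler_wpM2r// lerDl.
rewrite mulrC -ltr_pdivlMr ?ltr_wpDl//.
near: h; apply: dnbhs0_lt; rewrite divr_gt0// ltr_wpDl//.
Unshelve. all: by end_near. Qed.

Lemma is_derive_flat k x :
  is_derive x 1 (flat k) (flat k.+2 x - k%:R * flat k.+1 x).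
Proof.
have [x0|x0|->] := ltgtP x 0.
- rewrite !flat_le0 ?ltW// mulr0 subr0.
  apply: (near_eq_is_derive _ (is_derive_cst 0 x 1)).
  near=> y; rewrite flat_le0//; apply: ltW; near: y; exact: lt_nbhsl.
- have xn : x != 0 by rewrite gt_eqF.
  have dV : is_derive x 1 (fun y : R => y^-1) (- x^-1 ^+ 2).
    have := @is_deriveV _ id x 1 1 xn (is_derive_id _ _).
    by move=> /is_derive_eq; apply; rewrite /GRing.scale/= mulr1 exprVn.
  have D := is_deriveM (is_deriveX k dV)
    (@is_derive1_comp _ expR (fun y => - y^-1) x _ _ (is_derive_expR _) (is_deriveN dV)).
  apply: (near_eq_is_derive _ (is_derive_eq D _)).
    near=> y; have y0 : 0 < y by near: y; exact: lt_nbhsr.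
    by rewrite /flat y0 !fctE.
  rewrite /flat x0 /=; clear D dV.
  case: k => [|k]; rewrite /GRing.scale/=.
    by rewrite !mulr0n !mul0r !expr0 mulr0 addr0 subr0 mul1r opprK mulrC.
  rewrite !fctE opprK !exprS; ring.
- rewrite !flat_le0// mulr0 subr0.
  apply: (@is_derive_quadratic _ (k.+2%:R ^+ k.+2)); first by rewrite flat_le0.
  move=> h; rewrite ger0_norm ?flat_ge0//; have [h0|h0] := leP h 0.
    by rewrite flat_le0// mulr_ge0 ?sqr_ge0// exprn_ge0.
  have e : flat k h = flat k.+1 h * h.
    rewrite /flat h0 exprS; have hn : h != 0 by rewrite gt_eqF.
    by move: (h^-1 ^+ k) (expR _) => w z; field.
  by rewrite e expr2 mulrA ler_pM2r//; exact: flat_bound.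
Unshelve. all: by end_near. Qed.

(** A class closed under differentiation by construction: one derivative for each generator gives
    derivatives of every order. *)
Inductive sm : (R -> R) -> Prop :=
| sm_flat k : sm (flat k)
| sm_cst c : sm (fun=> c)
| sm_id : sm (fun x => x)
| sm_add f g : sm f -> sm g -> sm (fun x => f x + g x)
| sm_mul f g : sm f -> sm g -> sm (fun x => f x * g x)
| sm_inv f : (forall x, f x != 0) -> sm f -> sm (fun x => (f x)^-1)
| sm_aff f c d : sm f -> sm (fun x => f (c * x + d)).

Lemma is_derive_aff (f : R -> R) c d x df : is_derive (c * x + d) 1 f df ->
  is_derive x 1 (fun x => f (c * x + d)) (c * df).
Proof.
move=> fd; have dg : is_derive x 1 (fun x => c * x + d) c.
  have := is_deriveD (is_deriveZ c (is_derive_id x (1 : R))) (is_derive_cst d x 1).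
  by move=> /is_derive_eq; apply; rewrite addr0 /GRing.scale/= mulr1.
by have := @is_derive1_comp _ f (fun x => c * x + d) x _ _ fd dg; rewrite mulrC.
Qed.

Lemma sm_derive f : sm f -> exists g, sm g /\ forall x, is_derive x 1 f (g x).
Proof.
elim=> {f}.
- move=> k; exists (fun x => flat k.+2 x + (- k%:R) * flat k.+1 x).
  split; first exact: (sm_add (sm_flat _) (sm_mul (sm_cst _) (sm_flat _))).
  by move=> x; rewrite mulNr; exact: is_derive_flat.
- by move=> c; exists (fun=> 0); split; [constructor|move=> x; exact: is_derive_cst].
- by exists (fun=> 1); split; [constructor|move=> x; exact: is_derive_id].
- move=> f g _ [f' [sf' hf]] _ [g' [sg' hg]]; exists (fun x => f' x + g' x).
  by split; [exact: sm_add|move=> x; exact: is_deriveD].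
- move=> f g sf [f' [sf' hf]] sg [g' [sg' hg]].
  exists (fun x => f x * g' x + g x * f' x).
  split; first exact: (sm_add (sm_mul sf sg') (sm_mul sg sf')).
  by move=> x; exact: is_deriveM.
- move=> f f0 sf [f' [sf' hf]].
  exists (fun x => (-1) * ((f x)^-1 * (f x)^-1) * f' x); split.
    have fi := sm_inv f0 sf.
    exact: (sm_mul (sm_mul (sm_cst _) (sm_mul fi fi)) sf').
  move=> x; have := is_deriveV (f0 x) (hf x).
  by move=> /is_derive_eq; apply; rewrite /GRing.scale/= mulN1r expr2 invfM.
- move=> f c d sf [f' [sf' hf]]; exists (fun x => c * f' (c * x + d)).
  split; first exact: (sm_mul (sm_cst _) (sm_aff c d sf')).
  by move=> x; exact: is_derive_aff.
Qed.

Lemma sm_continuous f : sm f -> continuous f.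
Proof.
move=> /sm_derive[g [_ hg]] x.
by apply: differentiable_continuous; apply/derivable1_diffP; have [] := hg x.
Qed.

Definition step x : R := flat 0 x * (flat 0 x + flat 0 ((-1) * x + 1))^-1.

Lemma step_denom_gt0 x : 0 < flat 0 x + flat 0 ((-1) * x + 1).
Proof.
have [x0|x0] := ltP 0 x.
  by rewrite ltr_pwDl ?flat_gt0// flat_ge0.
by rewrite ltr_wpDl ?flat_ge0// flat_gt0//; lra.
Qed.

Lemma step_sm : sm step.
Proof.
apply: sm_mul; first exact: sm_flat.
apply: sm_inv; first by move=> x; rewrite gt_eqF// step_denom_gt0.
by apply: sm_add; [exact: sm_flat|exact: (sm_aff _ _ (sm_flat 0))].
Qed.

Lemma step_le0 x : x <= 0 -> step x = 0.
Proof. by move=> x0; rewrite /step flat_le0// mul0r. Qed.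

Lemma step_ge1 x : 1 <= x -> step x = 1.
Proof.
move=> x1; have := step_denom_gt0 x; rewrite /step.
by rewrite (@flat_le0 0 (-1 * x + 1)) ?addr0 => [h|]; [rewrite mulfV ?gt_eqF|lra].
Qed.

Lemma step_itv x : 0 <= step x <= 1.
Proof.
have d := step_denom_gt0 x; apply/andP; split.
  by apply: mulr_ge0; rewrite ?flat_ge0// invr_ge0 ltW.
by rewrite /step ler_pdivrMr// mul1r lerDl flat_ge0.
Qed.

(* A smooth approximation of the positive part. Its derivative [ramp'] is a
   smooth step, so that no integration is needed to get a primitive. *)
Definition ramp x : R := x * step x.

Lemma ramp_le0 x : x <= 0 -> ramp x = 0.
Proof. by move=> x0; rewrite /ramp step_le0// mulr0. Qed.

Lemma ramp_ge1 x : 1 <= x -> ramp x = x.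
Proof. by move=> x0; rewrite /ramp step_ge1// mulr1. Qed.

Lemma ramp_near x : `|ramp x - Num.max x 0| <= 1.
Proof.
have [x0|x0] := leP x 0; first by rewrite ramp_le0// subrr normr0.
have [x1|x1] := leP 1 x; first by rewrite ramp_ge1// subrr normr0.
have /andP[s0 s1] := step_itv x.
rewrite ler_norml /ramp; apply/andP; split; last by nra.
by nra.
Qed.

Lemma ramp_sm : sm ramp.
Proof. by apply: sm_mul; [exact: sm_id|exact: step_sm]. Qed.

Lemma ramp_deriv : exists (d : R -> R) (M : R), [/\ sm d,
  (forall x, is_derive x 1 ramp (d x)),
  (forall x, x <= 0 -> d x = 0), (forall x, 1 < x -> d x = 1) &
  forall x, `|d x| <= M].
Proof.
have [d [sd hd]] := sm_derive ramp_sm.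
have d0 x : x <= 0 -> d x = 0.
  (* At $0$ the ramp is constant on one side only, so the product rule is used: [step 0] and the
     factor $x$ both vanish. *)
  rewrite le_eqVlt => /predU1P[->|x0].
    have [s' [_ hs']] := sm_derive step_sm.
    have [_ <-] := hd 0; have [_] := is_deriveM (is_derive_id 0 (1 : R)) (hs' 0).
    by rewrite step_le0// !scale0r addr0.
  have [_ <-] := hd x; rewrite (@near_eq_derive _ _ _ _ (cst 0)).
    exact: derive_cst.
  by near=> y; rewrite ramp_le0//; apply: ltW; near: y; exact: lt_nbhsl.
have d1 x : 1 < x -> d x = 1.
  move=> x0; have [_ <-] := hd x.
  rewrite (@near_eq_derive _ _ _ _ id); first exact: derive_id.
  by near=> y; rewrite ramp_ge1//; apply: ltW; near: y; exact: lt_nbhsr.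
have cd := sm_continuous sd.
have [M hM] : exists M, forall x, x \in `[0, 1] -> `|d x| <= M.
  have [c _ hc] := @EVT_max R (fun x => `|d x|) 0 1 ler01
    (continuous_subspaceT (fun x => continuous_comp (cd x) (@norm_continuous _ _ _))).
  by exists `|d c|.
exists d, (M + 1); split => // x.
have M0 : 0 <= M by apply: le_trans (hM 0 _); rewrite ?normr_ge0// in_itv/= lexx ler01.
have [x0|x0] := leP x 0; first by rewrite d0// normr0; lra.
have [x1|x1] := ltP 1 x; last first.
  by apply: (le_trans (hM x _)); [rewrite in_itv/= x1 ltW|lra].
rewrite d1// normr1.
lra.
Unshelve. all: by end_near. Qed.

End smooth_real.

Section test_functions.
Context {R : realType} {N : nat}.
Local Notation V := 'rV[R]_N.
Local Notation BV := (BV R N).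
Local Notation LV := (lebesgue_rV R N).

Lemma is_derive_line (f : V -> R) x v df :
  is_derive (0 : R) 1 (fun h : R => f (x + h *: v)) df -> is_derive x v f df.
Proof.
have e : (fun h : R => h^-1 *: (((fun h : R => f (x + h *: v)) \o shift (0 : R)) (h *: (1 : R)) -
   (fun h : R => f (x + h *: v)) 0)) = (fun h : R => h^-1 *: ((f \o shift x) (h *: v) - f x)).
  apply/funext => h /=; rewrite addr0 scale0r addr0 [h *: 1]mulr1.
  by rewrite [h *: v + x]addrC.
move=> [h1 h2]; split; first by rewrite /derivable -e.
by rewrite -h2 /derive e.
Qed.

Definition linf (w : 'I_N -> R) (y : V) : R := \sum_i w i * y ord0 i.

Lemma linf_line w x (t : R) v : linf w (x + t *: v) = linf w x + t * linf w v.
Proof.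
rewrite /linf mulr_sumr -big_split /=; apply: eq_bigr => i _.
by rewrite !mxE mulrDr mulrCA.
Qed.

Lemma linf_differentiable w x : differentiable (linf w) x.
Proof.
rewrite (_ : linf w = \sum_(i < N) (w i *: (fun y : V => y ord0 i))).
  apply: differentiable_sum => i; apply: differentiableZ.
  exact: differentiable_coord.
by apply/funext => y; rewrite fct_sumE.
Qed.

(** The analogue of [sm] in several variables, built from [sm] functions of linear forms.
    Directional derivatives stay in the class, whence [smooth]. *)
Inductive smV : (V -> R) -> Prop :=
| smV_lin q w : sm q -> smV (fun y => q (linf w y))
| smV_cst c : smV (fun=> c)
| smV_add f g : smV f -> smV g -> smV (fun x => f x + g x)
| smV_mul f g : smV f -> smV g -> smV (fun x => f x * g x).

Lemma smV_derive f : smV f -> (forall x, differentiable f x) /\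
  forall v, exists g, smV g /\ forall x, is_derive x v f (g x).
Proof.
elim=> {f}.
- move=> q w sq; have [q' [sq' hq]] := sm_derive sq; split.
    move=> x; apply: differentiable_comp; first exact: linf_differentiable.
    by apply/derivable1_diffP; have [] := hq (linf w x).
  move=> v; exists (fun x => q' (linf w x) * linf w v); split.
    exact: (smV_mul (smV_lin w sq') (smV_cst _)).
  move=> x; apply: is_derive_line.
  rewrite (_ : (fun _ => _) = (fun h => q (linf w v * h + linf w x))); last first.
    by apply/funext => h; rewrite linf_line addrC mulrC.
  rewrite mulrC; apply: is_derive_aff; rewrite mulr0 add0r; exact: hq.
- move=> c; split; first by move=> x; exact: differentiable_cst.
  by move=> v; exists (fun=> 0); split; [exact: smV_cst|move=> x; exact: is_derive_cst].
- move=> f g sf [df hf] sg [dg hg]; split.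
    by move=> x; exact: differentiableD.
  move=> v; have [f' [sf' hf']] := hf v; have [g' [sg' hg']] := hg v.
  exists (fun x => f' x + g' x); split; first exact: smV_add.
  by move=> x; exact: is_deriveD.
- move=> f g sf [df hf] sg [dg hg]; split.
    by move=> x; exact: differentiableM.
  move=> v; have [f' [sf' hf']] := hf v; have [g' [sg' hg']] := hg v.
  exists (fun x => f x * g' x + g x * f' x); split.
    exact: (smV_add (smV_mul sf sg') (smV_mul sg sf')).
  by move=> x; exact: is_deriveM.
Qed.

Lemma smV_partial i f : smV f -> smV (partial i f).
Proof.
move=> /smV_derive[_ /(_ (delta_mx ord0 i))[g [sg hg]]].
suff -> : partial i f = g by [].
by apply/funext => x; rewrite /partial; have [_ ->] := hg x.
Qed.

Lemma smV_smooth f : smV f -> smooth f.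
Proof.
move=> sf s x; suff : smV (foldr partial f s) by move=> /smV_derive[].
by elim: s => //= i s; exact: smV_partial.
Qed.

Lemma smV_continuous f : smV f -> continuous f.
Proof. by move=> /smV_derive[df _] x; exact: differentiable_continuous. Qed.

Lemma smV_prod (I : Type) (s : seq I) (f : I -> V -> R) :
  (forall i, smV (f i)) -> smV (fun y => \prod_(i <- s) f i y).
Proof.
move=> sf; elim: s => [|i s IH].
  by under eq_fun do rewrite big_nil; exact: smV_cst.
by under eq_fun do rewrite big_cons; exact: smV_mul.
Qed.

Lemma continuous_borel (f : V -> R) : continuous f ->
  measurable_fun (setT : set BV) f.
Proof.
move=> /continuousP cf; apply: (measurability _ (RGenOInfty.measurableE R)) => //.
move=> _ [_ [c ->] <-]; rewrite setTI; apply: open_borel; apply: cf.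
exact: interval_open.
Qed.

(** Coordinates with respect to the basis in which $e_j$ is replaced by [a]: along [a] only the
    [j]-th one moves, at unit speed. *)
Definition skc (a : V) (j i : 'I_N) (y : V) : R :=
  if i == j then y ord0 j / a ord0 j else y ord0 i - a ord0 i / a ord0 j * y ord0 j.

Lemma skc_linf (a : V) j i : exists w, skc a j i = linf w.
Proof.
exists (fun k => if i == j then (k == j)%:R / a ord0 j else
  (k == i)%:R - a ord0 i / a ord0 j * (k == j)%:R).
have dl (k : 'I_N) (y : V) : \sum_(m < N) (m == k)%:R * y ord0 m = y ord0 k :> R.
  rewrite (bigD1 k)//= eqxx mul1r big1 ?addr0// => l /negbTE ->.
  by rewrite mul0r.
apply/funext => y; rewrite /skc /linf; case: (i == j).
  rewrite -[in LHS](dl j y) mulr_suml; apply: eq_bigr => k _.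
  by rewrite mulrAC.
rewrite -[in LHS](dl j y) -[in LHS](dl i y) mulr_sumr -sumrB.
by apply: eq_bigr => k _; rewrite mulrBl mulrA.
Qed.

Lemma skc_line (a : V) j i (y : V) (t : R) : a ord0 j != 0 ->
  skc a j i (y + t *: a) = skc a j i y + (if i == j then t else 0).
Proof.
move=> aj; rewrite /skc !mxE; case: ifP => _; first by field.
by rewrite addr0; field.
Qed.

Lemma skc_inv (a : V) j i (y : V) : a ord0 j != 0 ->
  y ord0 i = (if i == j then 0 else skc a j i y) + a ord0 i * skc a j j y.
Proof. by move=> aj; rewrite /skc eqxx; case: eqP => [->|_]; field. Qed.

Definition skprod (a : V) (j : 'I_N) (q : 'I_N -> R -> R) (y : V) : R :=
  \prod_i q i (skc a j i y).

Lemma skc_continuous (a : V) j i : continuous (skc a j i).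
Proof.
have [w ->] := skc_linf a j i => x.
exact: differentiable_continuous (linf_differentiable _ _).
Qed.

Lemma skprod_smV a j q : (forall i, sm (q i)) -> smV (skprod a j q).
Proof.
move=> sq; apply: smV_prod => i; have [w ->] := skc_linf a j i.
exact: smV_lin.
Qed.

Definition skbox (a : V) (j : 'I_N) (al be : 'I_N -> R) : set V :=
  [set y | forall i, al i <= skc a j i y <= be i].

Lemma skbox_closed a j al be : closed (skbox a j al be).
Proof.
rewrite (_ : skbox _ _ _ _ = \bigcap_(i in [set: 'I_N])
  (skc a j i @^-1` `[al i, be i]%classic)).
  apply: closed_bigI => i _; apply: closed_comp; last exact: interval_closed.
  by move=> x _; exact: skc_continuous.
apply/seteqP; split => y h i; first by move=> _ /=; rewrite in_itv/=; exact: h.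
by have := h i Logic.I; rewrite /= in_itv.
Qed.

Lemma skbox_compact (a : V) j al be : a ord0 j != 0 -> compact (skbox a j al be).
Proof.
move=> aj; apply: bounded_closed_compact; last exact: skbox_closed.
pose M := \sum_i (`|al i| + `|be i|); pose M2 := \sum_i `|a ord0 i|.
have hM i : `|al i| + `|be i| <= M.
  by rewrite /M (bigD1 i)//= lerDl sumr_ge0.
have hM2 i : `|a ord0 i| <= M2.
  by rewrite /M2 (bigD1 i)//= lerDl sumr_ge0.
have M0 : 0 <= M by apply: sumr_ge0 => i _; rewrite addr_ge0.
have M20 : 0 <= M2 by apply: sumr_ge0 => i _.
have hs i y : skbox a j al be y -> `|skc a j i y| <= M.
  move=> /(_ i) /andP[h1 h2]; apply: le_trans (hM i); rewrite ler_norml.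
  have := ler_norm (be i); have := ler_norm (- al i); rewrite normrN.
  have := normr_ge0 (al i); have := normr_ge0 (be i) => ? ? ? ?.
  by apply/andP; split; lra.
exists (M + M2 * M); split; first exact: num_real.
move=> C hC y yb; apply: le_trans (ltW hC).
apply/rV_norm_leP; first by rewrite addr_ge0// mulr_ge0.
move=> i; rewrite (skc_inv i y aj) (le_trans (ler_normD _ _))// lerD//.
  by case: eqP => _; rewrite ?normr0// hs.
by rewrite normrM ler_pM// hs.
Qed.

Lemma skprod_support a j q al be : (forall i s, q i s != 0 -> al i <= s <= be i) ->
  [set x | skprod a j q x != 0] `<=` skbox a j al be.
Proof.
move=> hq x /= h i; apply: hq; apply: contra_neq h => h.
by rewrite /skprod (bigD1 i)//= h mul0r.
Qed.

Lemma skprod_test (Omega : set V) (a : V) j q al be : a ord0 j != 0 ->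
  (forall i, sm (q i)) -> (forall i s, q i s != 0 -> al i <= s <= be i) ->
  skbox a j al be `<=` Omega -> test_function Omega (skprod a j q).
Proof.
move=> aj sq hq bO.
have cb : closure [set x | skprod a j q x != 0] `<=` skbox a j al be.
  rewrite closureE => x; apply; split; first exact: skbox_closed.
  exact: skprod_support.
split; first by apply: smV_smooth; exact: skprod_smV.
  apply: subclosed_compact cb; [exact: closed_closure|exact: skbox_compact].
exact: subset_trans cb bO.
Qed.

Lemma skprod_derive (a : V) j (q : 'I_N -> R -> R) (q' : R -> R) (x : V) : a ord0 j != 0 ->
  (forall s : R, is_derive s 1 (q j) (q' s)) ->
  is_derive x a (skprod a j q) (q' (skc a j j x) * \prod_(i | i != j) q i (skc a j i x)).
Proof.
move=> aj hq; apply: is_derive_line.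
rewrite (_ : (fun _ => _) = (fun h => (\prod_(i | i != j) q i (skc a j i x)) *
    (q j (1 * h + skc a j j x)))); last first.
  apply/funext => h; rewrite /skprod (bigD1 j)//= mulrC; congr (_ * _).
    by apply: eq_bigr => i /negbTE ij; rewrite skc_line// ij addr0.
  by rewrite skc_line// eqxx mul1r addrC.
have hq' : is_derive (0 : R) 1 (fun h => q j (1 * h + skc a j j x)) (1 * q' (skc a j j x)).
  by apply: is_derive_aff; rewrite mulr0 add0r.
have := is_deriveZ (\prod_(i | i != j) q i (skc a j i x)) hq'.
by move=> /is_derive_eq; apply; rewrite mul1r mulrC.
Qed.

Lemma partial_sum (a : V) (f : V -> R) x : differentiable f x ->
  \sum_i a ord0 i * partial i f x = 'D_a f x.
Proof.
move=> df; rewrite deriveE// [in RHS](row_sum_delta a) linear_sum.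
by apply: eq_bigr => i _; rewrite linearZ /partial deriveE.
Qed.

End test_functions.

Lemma Rintegral_sum d (T : measurableType d) (R : realType)
    (mu : {measure set T -> \bar R}) (D : set T) (I : Type) (s : seq I) (F : I -> T -> R) :
  measurable D -> (forall i, mu.-integrable D (EFin \o F i)) ->
  mu.-integrable D (EFin \o (fun x => \sum_(i <- s) F i x)) /\
  (\int[mu]_(x in D) (\sum_(i <- s) F i x) = \sum_(i <- s) \int[mu]_(x in D) F i x)%R.
Proof.
move=> mD iF; elim: s => [|i s [IH1 IH2]].
  under [X in EFin \o X]eq_fun do rewrite big_nil.
  under eq_Rintegral do rewrite big_nil.
  rewrite big_nil; split; first exact: (@integrable0 _ _ _ mu D).
  by rewrite Rintegral_cst// mul0r.
under [X in EFin \o X]eq_fun do rewrite big_cons.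
under eq_Rintegral do rewrite big_cons.
rewrite big_cons RintegralD// IH2; split=> //.
rewrite (_ : EFin \o _ = (fun x => (EFin \o F i) x + (EFin \o (fun x => (\sum_(j <- s) F j x)%R)) x)%E)//.
exact: integrableD.
Qed.

Section weak_derivative.
Context {R : realType} {N : nat}.
Local Notation V := 'rV[R]_N.
Local Notation BV := (BV R N).
Local Notation LV := (lebesgue_rV R N).
Local Notation leb := (@leb R N).
Local Notation mu := (@bleb R N).
Variable Omega : set V.
Hypothesis oO : open Omega.
Hypothesis bO : bounded_set Omega.

Lemma compact_borel (K : set V) : compact K -> measurable (K : set BV).
Proof.
by move=> cK; apply: closed_borel; apply: compact_closed cK; exact: norm_hausdorff.
Qed.

Lemma borel_leb_fun (D : set BV) d (T : measurableType d) (f : V -> T) :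
  measurable D -> measurable_fun (setT : set BV) f -> measurable_fun (D : set LV) f.
Proof.
move=> mD mf; apply: (@measurable_funTS _ _ LV _ D).
exact: (measurableT_comp mf measurable_idLB).
Qed.

Lemma integrable_continuousM (K : set V) (g h : V -> R) : compact K ->
  mu.-integrable (K : set BV) (EFin \o g) -> continuous h ->
  mu.-integrable (K : set BV) (EFin \o (fun x => g x * h x)%R).
Proof.
move=> cK ig ch.
have bh : [bounded h x | x in K].
  have : compact (h @` K) by apply: continuous_compact => //; exact: continuous_subspaceT.
  move=> /compact_bounded[M [Mr hM]]; exists M; split => // m /hM hm x Kx.
  by apply: hm; exists x.
have mh : measurable_fun (K : set BV) h.
  by apply: measurable_funTS; exact: continuous_borel.
have := integrableMl (compact_borel cK) ig mh bh.
by apply: eq_integrable => //; exact: compact_borel.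
Qed.

(** Weak derivatives are tested on the Lebesgue side and lines are treated on the Borel side; this
    carries integrals of [f] against continuous functions from one to the other. *)
Lemma L1_loc_version (f : V -> R) : L1_loc Omega f ->
  exists g : V -> R, [/\ measurable_fun (setT : set BV) g,
    (forall x, ~ Omega x -> g x = 0),
    leb.-negligible ([set x | Omega x /\ g x <> f x] : set LV) &
    forall K : set V, compact K -> K `<=` Omega ->
      mu.-integrable (K : set BV) (EFin \o g) /\
      forall h : V -> R, continuous h ->
        (\int[leb]_(x in (K : set LV)) (f x * h x) =
         \int[mu]_(x in (K : set BV)) (g x * h x))%R].
Proof.
move=> [mf lf]; have [r [r0 [_ Ob]]] := bounded_box bO.
have [g [Z [mg mZ Z0 gf g0]]] := borel_version (open_borel oO) Ob mf.
exists g; split => //.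
  apply: borel_leb_negligible; exists Z; split => // x [Ox gfx].
  by apply: contrapT => Zx; apply: gfx; exact: gf.
move=> K cK KO; have mK := compact_borel cK.
have mKL := borel_leb_measurable mK.
have ae : {ae leb, forall x, (K : set LV) x -> g x = f x}.
  exists (Z : set LV); split => //; first exact: borel_leb_measurable.
  move=> x /= h; apply: contrapT => Zx; apply: h => Kx; apply: gf => //; exact: KO.
have mgK : measurable_fun (K : set LV) g by exact: borel_leb_fun.
have mfK : measurable_fun (K : set LV) f.
  by apply: measurable_funS mf => //; apply: borel_leb_measurable; exact: open_borel.
have igL : leb.-integrable (K : set LV) (EFin \o g).
  apply/integrableP; split; first exact/measurable_EFinP.
  have /integrableP[_] := lf K cK KO; congr (_ < _)%E.
  apply: ae_eq_integral => //.
  - by apply: measurableT_comp => //; exact/measurable_EFinP.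
  - by apply: measurableT_comp => //; exact/measurable_EFinP.
  - by apply: filterS ae => x h /h /= ->.
have ig : mu.-integrable (K : set BV) (EFin \o g).
  apply: leb_integrableE igL => //; apply/measurable_EFinP.
  exact: measurable_funTS.
split=> // h ch; rewrite /Rintegral.
have mh : measurable_fun (setT : set BV) h by exact: continuous_borel.
have mhK : measurable_fun (K : set LV) h by exact: borel_leb_fun.
congr fine; transitivity (\int[leb]_(x in (K : set LV)) (g x * h x)%:E)%E.
  apply: ae_eq_integral => //.
  - by apply/measurable_EFinP; exact: measurable_funM.
  - by apply/measurable_EFinP; exact: measurable_funM.
  - by apply: filterS ae => x e /e /= ->.
apply: leb_integralE_integrable => //.
  apply/measurable_EFinP; apply: measurable_funTS; exact: measurable_funM.
have bh : [bounded h x | x in K].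
  have : compact (h @` K) by apply: continuous_compact => //; exact: continuous_subspaceT.
  move=> /compact_bounded[M [Mr hM]]; exists M; split => // m /hM hm x Kx.
  by apply: hm; exists x.
by have := integrableMl mKL igL mhK bh; apply: eq_integrable.
Qed.

(** On a test function that is a product in the skew coordinates, the weak partial derivatives,
    weighted by the components of [a] and summed, become an identity for the derivative along [a],
    which differentiates the [j]-th factor only. The integrals are over the supporting box because
    [u] and the [v i] are only locally integrable. *)
Lemma skprod_weak (j0 : 'I_N) (u : V -> R) (v : 'I_N -> V -> R) :
  (forall i, is_weak_partial Omega i u (v i)) ->
  exists (u' : V -> R) (v' : 'I_N -> V -> R),
  [/\ measurable_fun (setT : set BV) u' /\ (forall x, ~ Omega x -> u' x = 0),
     leb.-negligible ([set x | Omega x /\ u' x <> u x] : set LV),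
     forall i, measurable_fun (setT : set BV) (v' i) /\ (forall x, ~ Omega x -> v' i x = 0),
     forall i, leb.-negligible ([set x | Omega x /\ v' i x <> v i x] : set LV) &
     (forall K : set V, compact K -> K `<=` Omega ->
        mu.-integrable (K : set BV) (EFin \o u') /\
        forall i, mu.-integrable (K : set BV) (EFin \o v' i)) /\
     forall (a : V) (j : 'I_N) (q : 'I_N -> R -> R) (q' : R -> R) (al be : 'I_N -> R),
       a ord0 j != 0 -> (forall i, sm (q i)) -> (forall s : R, is_derive s 1 (q j) (q' s)) ->
       (forall i s, q i s != 0 -> al i <= s <= be i) -> skbox a j al be `<=` Omega ->
       (\int[mu]_(x in (skbox a j al be : set BV))
          (u' x * (q' (skc a j j x) * \prod_(i | i != j) q i (skc a j i x))) =
        - \int[mu]_(x in (skbox a j al be : set BV))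
          ((\sum_i a ord0 i * v' i x) * \prod_i q i (skc a j i x)))%R].
Proof.
move=> wv.
have [Lu _ _] := wv j0.
have [u' [mu' u0 nu Ku]] := L1_loc_version Lu.
have /choice[v' hv] : forall i, exists g : V -> R, [/\ measurable_fun (setT : set BV) g,
    (forall x, ~ Omega x -> g x = 0),
    leb.-negligible ([set x | Omega x /\ g x <> v i x] : set LV) &
    forall K : set V, compact K -> K `<=` Omega ->
      mu.-integrable (K : set BV) (EFin \o g) /\
      forall h : V -> R, continuous h ->
        (\int[leb]_(x in (K : set LV)) (v i x * h x) =
         \int[mu]_(x in (K : set BV)) (g x * h x))%R].
  by move=> i; have [_ Lv _] := wv i; exact: L1_loc_version.
exists u', v'; split => //.
- by move=> i; have [] := hv i.
- by move=> i; have [] := hv i.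
split.
  move=> K cK KO; split; first by have [] := Ku K cK KO.
  by move=> i; have [_ _ _ /(_ K cK KO)[]] := hv i.
move=> a j q q' al be aj sq dq hq KO.
set K := skbox a j al be; have cK : compact K by exact: skbox_compact.
have mK := compact_borel cK.
have tf := skprod_test aj sq hq KO.
have sf := skprod_smV a j sq.
have f0 x : ~ K x -> skprod a j q x = 0.
  by move=> nKx; apply: contra_notP nKx => /eqP h; exact: (skprod_support hq).
have Kf (w F : V -> R) : (forall x, ~ K x -> F x = 0) ->
  (\int[leb]_(x in (Omega : set LV)) (w x * F x) = \int[leb]_(x in (K : set LV)) (w x * F x))%R.
  move=> F0; rewrite /Rintegral integral_mkcond [in RHS]integral_mkcond; congr (fine _).
  apply: eq_integral => x _; rewrite !patchE.
  case: (pselect (K x)) => Kx; first by rewrite !mem_set//; exact: KO.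
  by rewrite F0// mulr0 !if_same.
have e i : (\int[mu]_(x in (K : set BV)) (u' x * partial i (skprod a j q) x) =
            - \int[mu]_(x in (K : set BV)) (v' i x * skprod a j q x))%R.
  have [_ _ /(_ _ tf)] := wv i.
  rewrite Kf; last first.
    move=> x nKx; rewrite /partial (@near_eq_derive _ _ _ _ (cst 0)); first exact: derive_cst.
    have oK : open (~` K) by apply: closed_openC; exact: skbox_closed.
    have nK : nbhs x (~` K) by apply: open_nbhs_nbhs; split.
    by apply: filterS nK => y; exact: f0.
  rewrite Kf//; have [_ ->] := Ku K cK KO; last exact: smV_continuous (smV_partial i sf).
  by have [_ _ _ /(_ K cK KO)[_ ->//]] := hv i; exact: smV_continuous.
have D x : q' (skc a j j x) * \prod_(i | i != j) q i (skc a j i x) =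
    \sum_i a ord0 i * partial i (skprod a j q) x.
  rewrite partial_sum; last by have [] := smV_derive sf.
  by have [_ ->] := skprod_derive x aj dq.
transitivity (\int[mu]_(x in (K : set BV))
   (\sum_i a ord0 i * (u' x * partial i (skprod a j q) x)))%R.
  apply: eq_Rintegral => x _; rewrite D mulr_sumr; apply: eq_bigr => i _.
  by rewrite mulrCA.
have iu : mu.-integrable (K : set BV) (EFin \o u') by have [] := Ku K cK KO.
have ip i : mu.-integrable (K : set BV) (EFin \o (fun x => u' x * partial i (skprod a j q) x)).
  by apply: integrable_continuousM => //; exact: smV_continuous (smV_partial i sf).
have iv i : mu.-integrable (K : set BV) (EFin \o (fun x => v' i x * skprod a j q x)).
  have [_ _ _ /(_ K cK KO)[iv _]] := hv i.
  by apply: integrable_continuousM => //; exact: smV_continuous.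
have iZ (c : R) (F : V -> R) : mu.-integrable (K : set BV) (EFin \o F) ->
    mu.-integrable (K : set BV) (EFin \o (fun x => c * F x)).
  by move=> iF; have := integrableZl mK c iF; apply: eq_integrable.
have [_ ->] := Rintegral_sum (index_enum 'I_N) mK (fun i => iZ (a ord0 i) _ (ip i)).
transitivity (- \int[mu]_(x in (K : set BV))
   (\sum_i a ord0 i * (v' i x * skprod a j q x)))%R; last first.
  congr (- _); apply: eq_Rintegral => x _; rewrite mulr_suml; apply: eq_bigr => i _.
  by rewrite mulrA.
have [_ ->] := Rintegral_sum (index_enum 'I_N) mK (fun i => iZ (a ord0 i) _ (iv i)).
rewrite -sumrN; apply: eq_bigr => i _.
by rewrite !RintegralZl// e mulrN.
Qed.

End weak_derivative.

Lemma Rintegral_dominated d (T : measurableType d) (R : realType)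
    (mu : {measure set T -> \bar R}) (D : set T) (u : T -> R) (p : nat -> T -> R)
    (p0 : T -> R) (B : R) :
  measurable D -> mu.-integrable D (EFin \o u) ->
  (forall n, measurable_fun D (p n)) ->
  (forall x, D x -> p n x @[n --> \oo] --> p0 x) ->
  (forall n x, D x -> `|p n x| <= B) ->
  (\int[mu]_(x in D) (u x * p n x))%R @[n --> \oo] --> (\int[mu]_(x in D) (u x * p0 x))%R
  /\ mu.-integrable D (EFin \o (fun x => u x * p0 x)).
Proof.
move=> mD iu mp cp pB.
have mu' : measurable_fun D u by apply/measurable_EFinP; exact: measurable_int iu.
have mf n : measurable_fun D (fun x => (u x * p n x)%:E).
  by apply/measurable_EFinP; exact: measurable_funM.
have cf x : D x -> (u x * p n x)%:E @[n --> \oo] --> (u x * p0 x)%:E.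
  by move=> Dx; apply: cvg_EFin; [exact: nearW|apply: cvgMr; exact: cp].
have ig : mu.-integrable D (fun x => `|B|%:E * `|(u x)%:E|)%E.
  by apply: integrableZl => //; exact: integrable_abse.
have gf x : D x -> (`|B|%:E * `|(u x)%:E|)%E \is a fin_num by [].
have fg n x : D x -> (`|(u x * p n x)%:E| <= `|B|%:E * `|(u x)%:E|)%E.
  move=> Dx; rewrite /= -EFinM lee_fin normrM mulrC ler_wpM2r//.
  by apply: (le_trans (pB _ _ Dx)); exact: ler_norm.
have ip := @lebesgue_integral_dominated_convergence.dominated_integrable _ _ _ mu D mD _ _ _ mf cf ig fg.
split=> //; apply: fine_cvg; rewrite fineK; last exact: integrable_fin_num ip.
exact: (@dominated_cvg _ _ _ mu D mD _ _ _ mf cf gf ig fg).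
Qed.

(** * From smooth products to half-open boxes *)

Section half_open.
Context {R : realType}.
Implicit Types al be h s : R.

Definition hchi al be s : R := (al < s <= be)%R%:R.
(** The primitive of [hchi al be] that vanishes to the left of [al], written with positive parts
    because these are the limits of rescaled ramps. *)
Definition kap al be s : R := Num.max (s - al) 0 - Num.max (s - be) 0.

Lemma kap_mono al be h s : al <= be -> 0 <= h -> 0 <= kap al be s - kap al be (s - h).
Proof.
move=> ab h0; rewrite /kap /Num.max.
by do !case: ltP => ?; lra.
Qed.

Lemma kap_le al be s : al <= be -> 0 <= kap al be s <= be - al.
Proof.
move=> ab; rewrite /kap /Num.max; apply/andP.
by do !case: ltP => ?; split; lra.
Qed.

Lemma kap_integral al be h s : al <= be -> 0 <= h ->
  (\int[lebesgue_measure]_(r in `]0%R, h]) (hchi al be (s - r))%:E =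
   (kap al be s - kap al be (s - h))%:E)%E.
Proof.
(* [A] lies between the open and the closed interval with ends [lo] and [hi], which have equal
   measure; this avoids a discussion of its endpoints. *)
move=> ab h0; pose A := [set r : R | 0 < r <= h /\ al < s - r <= be].
pose lo := Num.max 0 (s - be); pose hi := Num.min h (s - al).
have Al : `]lo, hi[%classic `<=` A.
  move=> r /=; rewrite in_itv/= gt_max lt_min -andbA => /and4P[h1 h2 h3 h4].
  by split; apply/andP; split; lra.
have Au : A `<=` `[lo, hi]%classic.
  move=> r [/andP[h1 h2] /andP[h3 h4]] /=; rewrite in_itv/= ge_max le_min.
  by apply/andP; split; apply/andP; split; lra.
have mA : measurable (A : set (measurableTypeR R)).
  apply: is_interval_measurable => x y [/andP[h1 h2] /andP[h3 h4]] [/andP[h5 h6] /andP[h7 h8]].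
  by move=> z /andP[xz zy]; split; apply/andP; split; lra.
have -> : (\int[lebesgue_measure]_(r in `]0%R, h]) (hchi al be (s - r))%:E =
    lebesgue_measure (A : set (measurableTypeR R)))%E.
  transitivity (\int[lebesgue_measure]_(r in `]0%R, h]) (\1_A r)%:E)%E.
    apply: eq_integral => r; rewrite inE/= in_itv/= => rh; congr EFin.
    rewrite /hchi indicE; congr (nat_of_bool _)%:R; apply/idP/idP => [h1|].
      by apply/mem_set; split.
    by move=> /set_mem[].
  rewrite integral_indic//; congr lebesgue_measure; apply/setIidPl => r [h1 _].
  by rewrite /= in_itv.
have W : ((kap al be s - kap al be (s - h)) = if lo < hi then hi - lo else 0)%R.
  have e x y : x - h - y = x - y - h by ring.
  rewrite /kap !e /lo /hi; move: (s - al) (s - be) (lerB (lexx s) ab) => x y yx {Al Au lo hi e}.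
  have m0 (z : R) : z <= 0 -> Num.max z 0 = 0 by exact: max_r.
  have m1 (z : R) : 0 <= z -> Num.max z 0 = z by exact: max_l.
  have cmp (z t : R) : z <= t \/ t < z by case: leP; [left|right].
  rewrite [Num.max 0 y]maxC; have [y0|y0] := cmp y 0.
    rewrite (m0 y)// (m0 (y - h)); last lra.
    have [hx|hx] := cmp h x.
      rewrite (min_l hx) (m1 x) ?(m1 (x - h)); [|lra|lra].
      by case: ltP => ?; lra.
    rewrite (min_r (ltW hx)) (m0 (x - h)); last lra.
    have [x0|x0] := cmp x 0.
      by rewrite (m0 x)//; case: ltP => ?; lra.
    by rewrite (m1 x) ?(ltW x0)//; case: ltP => ?; lra.
  rewrite (m1 y) ?(ltW y0)// (m1 x); last lra.
  have [hx|hx] := cmp h x.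
    rewrite (min_l hx) (m1 (x - h)); last lra.
    have [hy|hy] := cmp h y; first by rewrite (m1 (y - h)); [case: ltP => ?; lra|lra].
    by rewrite (m0 (y - h)); [case: ltP => ?; lra|lra].
  rewrite (min_r (ltW hx)) (m0 (x - h)) ?(m0 (y - h)); [|lra|lra].
  by case: ltP => ?; lra.
apply/eqP; rewrite eq_le W; apply/andP; split.
  apply: (@le_trans _ _ (lebesgue_measure (`[lo, hi]%classic : set (measurableTypeR R)))).
    by apply: le_measure; rewrite ?inE.
  by rewrite lebesgue_measure_itv/= lte_fin; case: ifP.
apply: (@le_trans _ _ (lebesgue_measure (`]lo, hi[%classic : set (measurableTypeR R)))).
  by rewrite lebesgue_measure_itv/= lte_fin; case: ifP.
by apply: le_measure; rewrite ?inE.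
Qed.

End half_open.

Section box_limit.
Context {R : realType} {N : nat}.
Local Notation V := 'rV[R]_N.
Local Notation BV := (BV R N).
Local Notation mu := (@bleb R N).
Variables (Omega : set V) (a : V) (j : 'I_N) (u v : V -> R).
Hypothesis aj : a ord0 j != 0.
Hypothesis iu : forall K : set V, compact K -> K `<=` Omega ->
  mu.-integrable (K : set BV) (EFin \o u).
Hypothesis iv : forall K : set V, compact K -> K `<=` Omega ->
  mu.-integrable (K : set BV) (EFin \o v).
Hypothesis star : forall (q : 'I_N -> R -> R) (q' : R -> R) (al be : 'I_N -> R),
  (forall i, sm (q i)) -> (forall s : R, is_derive s 1 (q j) (q' s)) ->
  (forall i s, q i s != 0 -> al i <= s <= be i) -> skbox a j al be `<=` Omega ->
  (\int[mu]_(x in (skbox a j al be : set BV))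
     (u x * (q' (skc a j j x) * \prod_(i | i != j) q i (skc a j i x))) =
   - \int[mu]_(x in (skbox a j al be : set BV))
     (v x * \prod_i q i (skc a j i x)))%R.

Variables (al be : 'I_N -> R) (h eta : R).
Hypothesis ab : forall i, al i <= be i.
Hypothesis h0 : 0 <= h.
Hypothesis eta0 : 0 < eta.
(** Room for the translate by [h] along [a] and for the width [eta] of the mollification. *)
Let be' i := be i + (if i == j then h else 0) + eta.
Let K := skbox a j al be'.
Hypothesis KO : K `<=` Omega.

Lemma measurable_skc i : measurable_fun (setT : set BV) (skc a j i).
Proof. by apply: continuous_borel; exact: skc_continuous. Qed.

Lemma sm_measurable (q : R -> R) i : sm q ->
  measurable_fun (K : set BV) (fun x => q (skc a j i x)).
Proof.
move=> sq; apply: measurable_funTS; apply: measurableT_comp; last exact: measurable_skc.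
by apply: continuous_measurable_fun; exact: sm_continuous.
Qed.

(** The limit of [star] for mollified boxes. The [j]-th factor is a smoothed difference of [kap] and
    its translate, whose derivative is a difference of indicators: [u] enters through its increments
    by $ha$, and [v] through its integrals over the segments in between. *)
Lemma box_limit :
  let Pr x := \prod_(i | i != j) hchi (al i) (be i) (skc a j i x) in
  let p x := (hchi (al j) (be j) (skc a j j x) - hchi (al j) (be j) (skc a j j x - h)) * Pr x in
  let w x := (kap (al j) (be j) (skc a j j x) - kap (al j) (be j) (skc a j j x - h)) * Pr x in
  [/\ (\int[mu]_(x in (K : set BV)) (u x * p x) = - \int[mu]_(x in (K : set BV)) (v x * w x))%R,
    mu.-integrable (K : set BV) (EFin \o (fun x => u x * p x)) &
    mu.-integrable (K : set BV) (EFin \o (fun x => v x * w x))].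
Proof.
move=> Pr p w; have h0_ := h0; have eta0_ := eta0.
have [d [M [sd hd d0 d1 dM]]] := @ramp_deriv R.
have M1 : 1 <= M by apply: le_trans (dM 2); rewrite d1 ?normr1// ltr1n.
(* The ramps have width $1/c_n\le\eta$, so the supports stay in [K] for every [n]. *)
pose c n : R := n.+1%:R / eta.
have c0 n : 0 < c n by rewrite divr_gt0.
have ci n : (c n)^-1 <= eta.
  by rewrite invf_div ler_pdivrMr// ler_peMr ?ler1n// ltW.
pose dl (n : nat) (t s : R) : R := d (c n * s + (- (c n * t))).
pose rl (n : nat) (t s : R) : R := (c n)^-1 * ramp (c n * s + (- (c n * t))).
have cst_ (n : nat) (t s : R) : c n * s + (- (c n * t)) = c n * (s - t) by rewrite mulrBr.
have dl0 n t s : s <= t -> dl n t s = 0.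
  by move=> st; rewrite /dl cst_ d0// pmulr_rle0// subr_le0.
have dl1 n t s : t + (c n)^-1 < s -> dl n t s = 1.
  move=> st; rewrite /dl cst_ d1// -(@mulfV _ (c n)) ?gt_eqF// ltr_pM2l//; lra.
have rl0 n t s : s <= t -> rl n t s = 0.
  by move=> st; rewrite /rl cst_ ramp_le0 ?mulr0// pmulr_rle0// subr_le0.
have rl1 n t s : t + (c n)^-1 <= s -> rl n t s = s - t.
  move=> st; rewrite /rl cst_ ramp_ge1 ?mulKf ?gt_eqF//.
  rewrite -(@mulfV _ (c n)) ?gt_eqF// ler_pM2l//; lra.
have rln n t s : `|rl n t s - Num.max (s - t) 0| <= (c n)^-1.
  rewrite /rl cst_; have -> : Num.max (s - t) 0 = (c n)^-1 * Num.max (c n * (s - t)) 0.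
    rewrite -{2}(mulr0 (c n)) -maxr_pMr ?(ltW (c0 n))// mulKf// gt_eqF//.
  rewrite -mulrBr normrM ger0_norm ?invr_ge0 ?(ltW (c0 n))// -[leRHS]mulr1.
  by rewrite ler_wpM2l ?invr_ge0 ?(ltW (c0 n))// ramp_near.
have sdl n t : sm (dl n t) by exact: sm_aff.
have srl n t : sm (rl n t) by apply: sm_mul; [exact: sm_cst|apply: sm_aff; exact: ramp_sm].
have smN f : sm f -> sm (fun s : R => - f s).
  move=> sf; rewrite (_ : (fun s => - f s) = (fun s => (-1) * f s)).
    by apply: sm_mul => //; exact: sm_cst.
  by apply/funext => s; rewrite mulN1r.
pose qj (n : nat) (s : R) : R := (rl n (al j) s - rl n (be j) s) - (rl n (al j + h) s - rl n (be j + h) s).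
pose qi (n : nat) (i : 'I_N) (s : R) : R := dl n (al i) s - dl n (be i) s.
pose q (n : nat) (i : 'I_N) : R -> R := if i == j then qj n else qi n i.
pose q' (n : nat) (s : R) : R := (dl n (al j) s - dl n (be j) s) - (dl n (al j + h) s - dl n (be j + h) s).
have sq n i : sm (q n i).
  rewrite /q; case: (i == j); last by apply: sm_add => //; exact: smN.
  by apply: sm_add; [|apply: (smN (fun s => _ - _))]; apply: sm_add => //; exact: smN.
have sq' n : sm (q' n).
  by apply: sm_add; [|apply: (smN (fun s => _ - _))]; apply: sm_add => //; exact: smN.
have drl n t (s : R) : is_derive s 1 (rl n t) (dl n t s).
  have D := is_derive_aff (hd (c n * s + (- (c n * t)))).
  have := is_deriveZ (c n)^-1 D.
  by move=> /is_derive_eq; apply; rewrite /GRing.scale/= mulKf// gt_eqF.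
have dq n (s : R) : is_derive s 1 (q n j) (q' n s).
  rewrite /q eqxx; apply: is_deriveB; exact: is_deriveB.
have qs n i (s : R) : q n i s != 0 -> al i <= s <= be' i.
  move=> nz; apply/andP; split.
    rewrite leNgt; apply: contra_neqN nz => sl; have := ab j; have := ab i => abi abj.
    rewrite /q; case: eqP sl abi => [->|_] sl abi.
      by rewrite /qj !rl0; lra.
    by rewrite /qi !dl0; lra.
  rewrite leNgt; apply: contra_neqN nz; rewrite /be' /q => sl.
  have := ci n => cin; have := ab i => abi; move: sl; case: eqP abi => [->|_] abi sl.
    by rewrite /qj !rl1; lra.
  by rewrite /qi !dl1 ?subrr//; lra.
have st n := star (sq n) (dq n) (qs n) KO.
have cK : compact K by exact: skbox_compact.
have mK := compact_borel cK.
(* At $s=t$ the value is $0$ for every [n]: this is why the limit boxes are open on the left and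
   closed on the right. *)
have near_dl (t s : R) : \forall n \near \oo, dl n t s = (t < s)%R%:R.
  have [ts|st_] := ltP t s; last by near=> n; rewrite dl0.
  near=> n; apply: dl1; rewrite -ltrBrDl invf_div ltr_pdivrMr//.
  have : eta / (s - t) < n.+1%:R.
    near: n; exists (Num.bound (eta / (s - t))) => // n /= hn.
    have := archi_boundP (divr_ge0 (ltW eta0) (ltW (_ : 0 < s - t))).
    rewrite subr_gt0 => /(_ ts) /lt_le_trans; apply; rewrite ler_nat; exact: leqW.
  by rewrite ltr_pdivrMr ?subr_gt0// mulrC.
have hE (al' be'' s : R) : al' <= be'' -> (al' < s)%R%:R - (be'' < s)%R%:R = hchi al' be'' s.
  move=> ab'; rewrite /hchi; case: (ltP be'' s) => bs; rewrite ?andbF ?andbT ?subr0//.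
  by rewrite (le_lt_trans ab' bs) subrr.
have near_qi i s : \forall n \near \oo, qi n i s = hchi (al i) (be i) s.
  near=> n; rewrite /qi -hE//; congr (_ - _); near: n; exact: near_dl.
have near_q' s : \forall n \near \oo, q' n s = hchi (al j) (be j) s - hchi (al j) (be j) (s - h).
  near=> n; rewrite /q' -!hE// !(ltrBrDr _ _ h).
  by congr (_ - _ - (_ - _)); near: n; exact: near_dl.
have cqj s : qj n s @[n --> \oo] --> kap (al j) (be j) s - kap (al j) (be j) (s - h).
  have cr t : rl n t s @[n --> \oo] --> Num.max (s - t) 0.
    apply/cvgrPdist_le => e e0; near=> n; rewrite distrC; apply: (le_trans (rln n t s)).
    rewrite invf_div ler_pdivrMr// -ler_pdivrMl//.
    near: n; exists (Num.bound (e^-1 * eta)) => // n /= hn.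
    have := archi_boundP (mulr_ge0 (_ : 0 <= e^-1) (ltW eta0)).
    rewrite invr_ge0 => /(_ (ltW e0)) /ltW /le_trans; apply.
    by rewrite ler_nat; exact: leqW.
  rewrite /kap; have e t : s - h - t = s - (t + h) by ring.
  by rewrite !e; apply: cvgB; apply: cvgB; exact: cr.
pose Pn n x := \prod_(i | i != j) q n i (skc a j i x).
have near_P x : \forall n \near \oo, Pn n x = Pr x.
  have : \forall n \near \oo, forall i, qi n i (skc a j i x) = hchi (al i) (be i) (skc a j i x).
    by apply: filter_forall => i; exact: near_qi.
  apply: filterS => n hn; rewrite /Pn /Pr; apply: eq_bigr => i /negbTE ij.
  by rewrite /q ij hn.
have bq n i s : `|qi n i s| <= M + M.
  by apply: (le_trans (ler_normB _ _)); rewrite lerD// dM.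
have bP n x : `|Pn n x| <= (M + M) ^+ N.
  rewrite /Pn normr_prod; apply: (@le_trans _ _ (\prod_(i < N | i != j) (M + M))).
    apply: ler_prod => i /negbTE ij; rewrite normr_ge0 /q ij /=; exact: bq.
  rewrite prodr_const -[leRHS]/( _ ^+ N); apply: ler_weXn2l; first lra.
  by rewrite (leq_trans (max_card _))// card_ord.
have bq' n s : `|q' n s| <= M + M + (M + M).
  apply: (le_trans (ler_normB _ _)); apply: lerD;
  by apply: (le_trans (ler_normB _ _)); rewrite lerD// dM.
have bqj n s : `|qj n s| <= 4 * eta + (be j - al j).
  have k1 := kap_le s (ab j); have k2 := kap_le (s - h) (ab j).
  have r1 := rln n (al j) s; have r2 := rln n (be j) s.
  have r3 := rln n (al j + h) s; have r4 := rln n (be j + h) s.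
  have cn := ci n; move: k1 k2; rewrite /kap.
  have e t : s - h - t = s - (t + h) by ring.
  rewrite !e /qj; move: r1 r2 r3 r4; rewrite !ler_norml.
  move: (Num.max _ _) (Num.max _ _) (Num.max _ _) (Num.max _ _) => m1 m2 m3 m4.
  move: (rl _ _ _) (rl _ _ _) (rl _ _ _) (rl _ _ _) => x1 x2 x3 x4.
  move=> /andP[? ?] /andP[? ?] /andP[? ?] /andP[? ?] /andP[? ?] /andP[? ?].
  by apply/andP; split; lra.
have mP n : measurable_fun (K : set BV) (Pn n).
  rewrite /Pn; elim: (index_enum _) => [|i l IH].
    by under eq_fun do rewrite big_nil; exact: measurable_cst.
  under eq_fun do rewrite big_cons; case: (i != j) => //.
  by apply: measurable_funM => //; exact: sm_measurable.
have m1 n : measurable_fun (K : set BV) (fun x => q' n (skc a j j x) * Pn n x).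
  by apply: measurable_funM => //; exact: sm_measurable.
have sqj n : sm (qj n) by have := sq n j; rewrite /q eqxx.
have m2 n : measurable_fun (K : set BV) (fun x => qj n (skc a j j x) * Pn n x).
  by apply: measurable_funM => //; exact: sm_measurable.
have cv1 x : K x -> (q' n (skc a j j x) * Pn n x) @[n --> \oo] --> p x.
  move=> _; apply: cvg_near_cst; near=> n; rewrite /p; congr (_ * _).
    by near: n; exact: near_q'.
  by near: n; exact: near_P.
have cv2 x : K x -> (qj n (skc a j j x) * Pn n x) @[n --> \oo] --> w x.
  by move=> _; apply: cvgM; [exact: cqj|apply: cvg_near_cst; exact: near_P].
have b1 n x : K x -> `|q' n (skc a j j x) * Pn n x| <= (M + M + (M + M)) * (M + M) ^+ N.
  by move=> _; rewrite normrM ler_pM.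
have b2 n x : K x -> `|qj n (skc a j j x) * Pn n x| <= (4 * eta + (be j - al j)) * (M + M) ^+ N.
  by move=> _; rewrite normrM ler_pM.
have [c1 i1] := Rintegral_dominated mK (iu cK KO) m1 cv1 b1.
have [c2 i2] := Rintegral_dominated mK (iv cK KO) m2 cv2 b2.
split=> //.
have E n : (\int[mu]_(x in (K : set BV)) (u x * (q' n (skc a j j x) * Pn n x)) =
  - \int[mu]_(x in (K : set BV)) (v x * (qj n (skc a j j x) * Pn n x)))%R.
  rewrite st; congr (- _); apply: eq_Rintegral => x _; congr (_ * _).
  by rewrite (bigD1 j)//= {1}/q eqxx.
have c3 : (\int[mu]_(x in (K : set BV)) (u x * (q' n (skc a j j x) * Pn n x)))%R @[n --> \oo]
    --> - (\int[mu]_(x in (K : set BV)) (v x * w x))%R.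
  by under eq_fun do rewrite E; exact: cvgN c2.
by rewrite -(cvg_lim _ c1)//; exact: cvg_lim.
Unshelve. all: by end_near. Qed.

End box_limit.

(** * Absolute continuity on almost every line *)

Section skew_half_open.
Context {R : realType} {N : nat}.
Local Notation V := 'rV[R]_N.
Local Notation BV := (BV R N).
Local Notation mu := (@bleb R N).
Local Notation lam := (lebesgue_measure : {measure set (measurableTypeR R) -> \bar R}).
Local Open Scope ereal_scope.
Variables (a : V) (j : 'I_N).
Hypothesis aj : (a ord0 j != 0)%R.

(** Half-open boxes are stable under intersection, as the uniqueness theorem for measures requires,
    and they are what the smooth products converge to. *)
Definition hbox (al be : 'I_N -> R) : set V :=
  [set x | forall i, (al i < skc a j i x <= be i)%R].

Lemma hbox_prod al be x :
  (\prod_i hchi (al i) (be i) (skc a j i x) = (\1_(hbox al be) x : R))%R.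
Proof.
rewrite indicE; case: (pselect (hbox al be x)) => h.
  rewrite mem_set// big1// => i _; rewrite /hchi; have := h i.
  by move=> ->.
rewrite memNset//; have [i hi] : exists i, ~~ (al i < skc a j i x <= be i)%R.
  by apply: contrapT => hn; apply: h => i; apply: contrapT => /negP hi; apply: hn; exists i.
by rewrite (bigD1 i)//= /hchi (negbTE hi) mul0r.
Qed.

Lemma hbox_prodj al be h x :
  (hchi (al j) (be j) (skc a j j x - h) * \prod_(i | i != j) hchi (al i) (be i) (skc a j i x) =
   (\1_(hbox al be) (x + h *: (- a)) : R))%R.
Proof.
rewrite -hbox_prod [RHS](bigD1 j)//= scalerN -scaleNr skc_line// eqxx; congr (_ * _)%R.
by apply: eq_bigr => i /negbTE ij; rewrite skc_line// ij addr0.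
Qed.

Lemma hboxI al be al' be' : hbox al be `&` hbox al' be' =
  hbox (fun i => Num.max (al i) (al' i)) (fun i => Num.min (be i) (be' i)).
Proof.
apply/seteqP; split => x.
  move=> [h1 h2] i; have /andP[? ?] := h1 i; have /andP[? ?] := h2 i.
  by rewrite gt_max le_min; apply/andP; split; apply/andP.
move=> h; split=> i; have := h i; rewrite gt_max le_min => /andP[/andP[? ?] /andP[? ?]];
  by apply/andP.
Qed.

Lemma measurable_hbox al be : measurable (hbox al be : set BV).
Proof.
rewrite (_ : hbox al be = \bigcap_(i in [set: 'I_N]) (skc a j i @^-1` `]al i, be i]%classic)).
  apply: fin_bigcap_measurable => [|i _]; first exact: finite_finset.
  by rewrite -[X in measurable X]setTI; exact: measurable_skc.
apply/seteqP; split => x h i; first by move=> _; rewrite /= in_itv/=; exact: h.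
by have := h i Logic.I; rewrite /= in_itv.
Qed.

Lemma measurable_hbox_generated :
  @measurable _ BV = <<s [set A | exists al be, A = hbox al be] >>.
Proof.
set G := [set A | _]; apply/seteqP; split; last first.
  apply: smallest_sub; first exact: smallest_sigma_algebra.
  by move=> _ [al [be ->]]; exact: measurable_hbox.
apply: smallest_sub; first exact: smallest_sigma_algebra.
pose T' := g_sigma_algebraType G.
have mG A : G A -> measurable (A : set T') by exact: sub_sigma_algebra.
have ms i : measurable_fun (setT : set T') (skc a j i).
  apply: (measurability _ (RGenOInfty.measurableE R)) => //.
  move=> _ [_ [c ->] <-]; rewrite setTI.
  rewrite (_ : _ @^-1` _ = \bigcup_n hbox (fun k => if k == i then c else (- n%:R)%R) (fun=> n%:R)).
    by apply: bigcup_measurable => n _; apply: mG; do 2 eexists.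
  apply/seteqP; split => x /=; rewrite in_itv/= andbT; last first.
    by move=> [n _ /(_ i)]; rewrite eqxx => /andP[].
  move=> cx; pose m := (\sum_k (Num.bound `|skc a j k x|%R))%N.
  have hm k : (`|skc a j k x| < m.+1%:R)%R.
    apply: (@lt_le_trans _ _ (Num.bound `|skc a j k x|%R)%:R).
      exact: archi_boundP.
    by rewrite ler_nat /m (bigD1 k)//= -addnS leq_addr.
  exists m.+1 => // k; have := hm k; rewrite ltr_norml => /andP[h1 h2].
  by rewrite (ltW h2) andbT; case: eqP => [->|].
move=> _ [i [B [mB ->]]].
have mi : measurable_fun (setT : set T') (fun x : V => x ord0 i).
  rewrite (_ : (fun _ => _) = (fun x => (if i == j then 0 else skc a j i x) + a ord0 i * skc a j j x)%R).
    apply: measurable_funD; first by case: (i == j).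
    exact: measurable_funM.
  by apply/funext => x; exact: skc_inv.
by have := mi measurableT B mB; rewrite setTI.
Qed.

(** Cut off to the large box, the two functions are densities of finite measures that agree on all
    half-open boxes, hence on all Borel sets. *)
Lemma hbox_ae_eq (P1 P2 : V -> \bar R) al0 be0 : bmeas P1 -> bmeas P2 ->
  (forall x, 0 <= P1 x) -> (forall x, 0 <= P2 x) ->
  \int[mu]_(x in (hbox al0 be0 : set BV)) P1 x < +oo ->
  (forall al be, (forall i, al i <= be i)%R -> hbox al be `<=` hbox al0 be0 ->
     (forall i, al0 i <= al i /\ be i <= be0 i)%R ->
    \int[mu]_(x in (hbox al be : set BV)) P1 x = \int[mu]_(x in (hbox al be : set BV)) P2 x) ->
  {ae mu, forall x, hbox al0 be0 x -> P1 x = P2 x}.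
Proof.
move=> m1 m2 p1 p2 fin eqb; set Q0 := hbox al0 be0.
have mQ0 : measurable (Q0 : set BV) by exact: measurable_hbox.
pose f1 := P1 \_ Q0; pose f2 := P2 \_ Q0.
have mf1 : bmeas f1.
  by apply/(measurable_restrictT (D := (Q0 : set BV)) _ mQ0); exact: measurable_funTS.
have mf2 : bmeas f2.
  by apply/(measurable_restrictT (D := (Q0 : set BV)) _ mQ0); exact: measurable_funTS.
have f10 x : 0 <= f1 x by rewrite /f1 patchE; case: ifP.
have f20 x : 0 <= f2 x by rewrite /f2 patchE; case: ifP.
have int0 (f : V -> \bar R) : \int[mu]_(x in (set0 : set BV)) f x = 0 by exact: integral_set0.
have ge0 (f : V -> \bar R) (h : forall x, 0 <= f x) (A : set BV) :
  0 <= \int[mu]_(x in A) f x by exact: integral_ge0.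
pose n1 := isMeasure.Build _ BV R (fun A => \int[mu]_(x in A) f1 x) (int0 f1) (ge0 f1 f10)
  (semi_sigma_additive_nng_induced (mu := (mu : {measure set BV -> \bar R})) mf1 f10).
pose n2 := isMeasure.Build _ BV R (fun A => \int[mu]_(x in A) f2 x) (int0 f2) (ge0 f2 f20)
  (semi_sigma_additive_nng_induced (mu := (mu : {measure set BV -> \bar R})) mf2 f20).
pose M1 : {measure set BV -> \bar R} := HB.pack (fun A : set BV => \int[mu]_(x in A) f1 x) n1.
pose M2 : {measure set BV -> \bar R} := HB.pack (fun A : set BV => \int[mu]_(x in A) f2 x) n2.
have key al be : \int[mu]_(x in (hbox al be : set BV)) f1 x = \int[mu]_(x in (hbox al be : set BV)) f2 x.
  rewrite -!integral_mkcondr /Q0 hboxI.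
  set al' := (fun i => _); set be' := (fun i => _).
  have [h|h] := pselect (forall i, al' i <= be' i)%R.
    apply: eqb => //; first by rewrite /al' /be' -hboxI => x [].
    by move=> i; rewrite /al' /be' le_max lexx orbT ge_min lexx orbT.
  rewrite (_ : hbox al' be' = set0) ?integral_set0//.
  apply/seteqP; split => // x hx; apply: h => i; have /andP[h1 h2] := hx i.
  exact: le_trans (ltW h1) h2.
have eqM A : measurable A -> M1 A = M2 A.
  apply: (@measure_unique _ R BV [set A | exists al be, A = hbox al be]
    (fun n => hbox (fun=> - n%:R)%R (fun=> n%:R)%R) _ _ _ _ M1 M2).
  - exact: measurable_hbox_generated.
  - by move=> _ _ [al [be ->]] [al' [be' ->]]; rewrite hboxI; do 2 eexists.
  - by move=> n; do 2 eexists.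
  - apply/seteqP; split => // x _.
    pose m := (\sum_k (Num.bound `|skc a j k x|%R))%N.
    have hm k : (`|skc a j k x| < m.+1%:R)%R.
      apply: (@lt_le_trans _ _ (Num.bound `|skc a j k x|%R)%:R); first exact: archi_boundP.
      by rewrite ler_nat /m (bigD1 k)//= -addnS leq_addr.
    exists m.+1 => // k; have := hm k; rewrite ltr_norml => /andP[h1 h2].
    by rewrite (ltW h2) h1.
  - by move=> _ [al [be ->]]; exact: key.
  - move=> n; apply: le_lt_trans fin; rewrite /M1/=.
    rewrite [leRHS]integral_mkcond; apply: ge0_subset_integral => //.
    exact: measurable_hbox.
have if1 : mu.-integrable (setT : set BV) f1.
  apply/integrableP; split=> //; under eq_integral do rewrite gee0_abs//.
  by rewrite -integral_mkcond.
have := @integral_ae_eq _ BV R mu setT measurableT f2 f1 if1 mf2 (fun E _ mE => eqM E mE).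
apply: filterS => x /(_ Logic.I); rewrite /f1 /f2 !patchE => h Qx.
by move: h; rewrite mem_set.
Qed.

Definition lineseg (h : R) (f : V -> \bar R) (x : V) : \bar R :=
  \int[lam]_(r in `]0%R, h]) f (x + (r : R) *: a)%R.

Let mseg h : measurable (`]0%R, h]%classic : set (measurableTypeR R)). Proof. by []. Qed.

Lemma linesegE h f x : lineseg h f x =
  \int[lam]_r ((\1_(`]0%R, h]%classic) (r : R))%:E * f (x + (r : R) *: a)%R).
Proof.
rewrite /lineseg integral_mkcond; apply: eq_integral => r _.
by rewrite patchE indicE; case: (r \in _); rewrite ?mul1e ?mul0e.
Qed.

Lemma measurable_seg_indic h : measurable_fun (setT : set (measurableTypeR R))
  (fun r : R => (\1_(`]0%R, h]%classic : set R) r)%:E : \bar R).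
Proof. by apply/measurable_EFinP; exact: measurable_indic. Qed.

Lemma bmeas_lineseg h f : bmeas f -> (forall x, 0 <= f x) -> bmeas (lineseg h f).
Proof.
move=> mf f0; rewrite /bmeas (_ : lineseg h f = fun x => \int[lam]_r
  ((\1_(`]0%R, h]%classic) (r : R))%:E * f (x + (r : R) *: a)%R)); last first.
  by apply/funext => x; exact: linesegE.
apply: (@measurable_fun_fubini_tonelli_F _ _ BV (measurableTypeR R) R lam
  (fun p => (\1_(`]0%R, h]%classic) (p.2 : R))%:E * f (p.1 + (p.2 : R) *: a)%R)) => //.
  apply: emeasurable_funM; last exact: bmeas_line.
  exact: (measurableT_comp (measurable_seg_indic h) measurable_snd).
by move=> p; rewrite mule_ge0// lee_fin.
Qed.

Lemma lineseg_ge0 h f x : (forall x, 0 <= f x) -> 0 <= lineseg h f x.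
Proof. by move=> f0; exact: integral_ge0. Qed.

Lemma integral_hbox (f : V -> \bar R) al be : (forall x, 0 <= f x) ->
  \int[mu]_(x in (hbox al be : set BV)) f x = \int[mu]_x (f x * (\1_(hbox al be) x)%:E).
Proof.
move=> f0; rewrite integral_mkcond; apply: eq_integral => x _.
by rewrite patchE indicE; case: (x \in _); rewrite ?mule1 ?mule0.
Qed.

Lemma integral_hbox_shift (f : V -> \bar R) al be h : bmeas f -> (forall x, 0 <= f x) ->
  \int[mu]_x (f x * (\1_(hbox al be) (x + h *: (- a))%R)%:E) =
  \int[mu]_(x in (hbox al be : set BV)) f (x + h *: a)%R.
Proof.
move=> mf f0; rewrite integral_hbox//.
have mi : bmeas (fun x => (\1_(hbox al be) x : R)%:E) by exact: bmeas_indic (measurable_hbox _ _).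
rewrite -(@integral_bleb_translate _ _ _ (h *: a)); last 2 first.
- by apply: emeasurable_funM => //; exact: (bmeas_translate (h *: (- a)) mi).
- by move=> x; rewrite mule_ge0// lee_fin.
apply: eq_integral => x _; congr (_ * (\1_(_) _)%:E).
by rewrite scalerN addrK.
Qed.

(** The difference of the two values of [kap] is the integral over $r\in\,]0,h]$ of the indicator
    shifted by [r]. Exchange the integrals and translate by $ra$. *)
Lemma integral_kap (f : V -> \bar R) al be h : (al j <= be j)%R -> (0 <= h)%R ->
  bmeas f -> (forall x, 0 <= f x) ->
  \int[mu]_x (f x * ((kap (al j) (be j) (skc a j j x) - kap (al j) (be j) (skc a j j x - h)) *
     \prod_(i | i != j) hchi (al i) (be i) (skc a j i x))%R%:E) =
  \int[mu]_(x in (hbox al be : set BV)) lineseg h f x.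
Proof.
move=> ab h0 mf f0.
have mi : bmeas (fun x => (\1_(hbox al be) x : R)%:E) by exact: bmeas_indic (measurable_hbox _ _).
have ms := measurable_seg_indic h.
pose F (p : BV * measurableTypeR R) := (\1_(`]0%R, h]%classic) (p.2 : R))%:E *
  (f p.1 * (\1_(hbox al be) (p.1 + (p.2 : R) *: (- a))%R)%:E).
have mF : measurable_fun setT F.
  apply: emeasurable_funM; first exact: (measurableT_comp ms measurable_snd).
  apply: emeasurable_funM; first exact: (measurableT_comp mf measurable_fst).
  exact: (bmeas_line (- a) mi).
have F0 p : 0 <= F p by rewrite /F !mule_ge0// lee_fin.
transitivity (\int[mu]_x \int[lam]_r F (x, r)).
  apply: eq_integral => x _.
  have -> : (((kap (al j) (be j) (skc a j j x) - kap (al j) (be j) (skc a j j x - h)) *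
     \prod_(i | i != j) hchi (al i) (be i) (skc a j i x))%R%:E =
     \int[lam]_r ((\1_(`]0%R, h]%classic) (r : R))%:E * (\1_(hbox al be) (x + (r : R) *: (- a))%R)%:E)).
    have A1 : (0 <= \prod_(i | i != j) hchi (al i) (be i) (skc a j i x))%R.
      by apply: prodr_ge0 => i _; rewrite /hchi ler0n.
    have A2 (r : R) : `]0%R, h]%classic r -> 0 <= (hchi (al j) (be j) (skc a j j x - r))%:E.
      by move=> _; rewrite lee_fin /hchi ler0n.
    have A3 : measurable_fun (`]0%R, h]%classic : set (measurableTypeR R))
        (fun r => (hchi (al j) (be j) (skc a j j x - r))%:E).
      apply: measurable_funTS; apply/measurable_EFinP.
      rewrite (_ : (fun _ => _) = (\1_(`]al j, be j]%classic) : R -> R) \o (fun r => skc a j j x - r)%R).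
        apply: measurableT_comp; first exact: measurable_indic.
        exact: measurable_funB.
      by apply/funext => r; rewrite /= indicE /hchi mem_setE in_itv.
    rewrite EFinM -(kap_integral (skc a j j x) ab h0) muleC -ge0_integralZl_EFin//.
    rewrite integral_mkcond; apply: eq_integral => r _.
    rewrite patchE indicE; case: (r \in _); last by rewrite mul0e.
    by rewrite mul1e -hbox_prodj -EFinM mulrC.
  have A1 : measurable_fun (setT : set (measurableTypeR R)) (fun r : R =>
      (\1_(`]0%R, h]%classic) r)%:E * (\1_(hbox al be) (x + (r : R) *: (- a))%R)%:E : \bar R).
    apply: emeasurable_funM => //; exact: (bmeas_line1 (- a) x mi).
  have A2 (r : R) : [set: R] r ->
      0 <= (\1_(`]0%R, h]%classic) r)%:E * (\1_(hbox al be) (x + (r : R) *: (- a))%R)%:E :> \bar R.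
    by move=> _; rewrite mule_ge0// lee_fin.
  rewrite -ge0_integralZl//.
  by apply: eq_integral => r _; rewrite /F/= muleCA.
rewrite (fubini_tonelli (m1 := mu) (m2 := lam) F mF F0).
rewrite integral_hbox; last by move=> x; exact: lineseg_ge0.
pose F' (p : BV * measurableTypeR R) := (\1_(`]0%R, h]%classic) (p.2 : R))%:E *
  (f (p.1 + (p.2 : R) *: a)%R * (\1_(hbox al be) p.1)%:E).
have mF' : measurable_fun setT F'.
  apply: emeasurable_funM; first exact: (measurableT_comp ms measurable_snd).
  apply: emeasurable_funM; first exact: bmeas_line.
  exact: (measurableT_comp mi measurable_fst).
have F'0 p : 0 <= F' p by rewrite /F' !mule_ge0// lee_fin.
transitivity (\int[lam]_r \int[mu]_x F' (x, r)).
  apply: eq_integral => r _; rewrite /F /F' /=.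
  have mt (y : V) : bmeas (fun x => f (x + y)%R) by exact: bmeas_translate.
  have A1 : bmeas (fun x => f x * (\1_(hbox al be) (x + (r : R) *: (- a))%R)%:E).
    by apply: emeasurable_funM => //; exact: (bmeas_translate (r *: (- a)) mi).
  have A2 : bmeas (fun x => f (x + (r : R) *: a)%R * (\1_(hbox al be) x)%:E).
    by apply: emeasurable_funM => //; exact: mt.
  have A3 x : [set: V] x -> 0 <= f x * (\1_(hbox al be) (x + (r : R) *: (- a))%R)%:E.
    by move=> _; rewrite mule_ge0// lee_fin.
  have A4 x : [set: V] x -> 0 <= f (x + (r : R) *: a)%R * (\1_(hbox al be) x)%:E.
    by move=> _; rewrite mule_ge0// lee_fin.
  have A5 : 0 <= (\1_(`]0%R, h]%classic) (r : R))%:E :> \bar R by rewrite lee_fin.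
  rewrite !ge0_integralZl//.
  by rewrite integral_hbox_shift// integral_hbox.
rewrite -(fubini_tonelli (m1 := mu) (m2 := lam) F' mF' F'0).
apply: eq_integral => x _; rewrite linesegE.
have A1 : measurable_fun (setT : set (measurableTypeR R)) (fun r : R =>
    (\1_(`]0%R, h]%classic) r)%:E * f (x + (r : R) *: a)%R).
  by apply: emeasurable_funM => //; exact: bmeas_line1.
have A2 (r : R) : [set: R] r -> 0 <= (\1_(`]0%R, h]%classic) r)%:E * f (x + (r : R) *: a)%R.
  by move=> _; rewrite mule_ge0// lee_fin.
have A3 : 0 <= (\1_(hbox al be) x)%:E :> \bar R by rewrite lee_fin.
rewrite -ge0_integralZr//.
by apply: eq_integral => r _; rewrite /F' /= muleA.
Qed.

End skew_half_open.

Local Close Scope ereal_scope.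

Section absolute_continuity.
Context {R : realType} {N : nat}.
Local Notation V := 'rV[R]_N.
Local Notation BV := (BV R N).
Local Notation mu := (@bleb R N).
Local Notation lam := (lebesgue_measure : {measure set (measurableTypeR R) -> \bar R}).
Variables (Omega : set V) (a : V) (j : 'I_N) (u v : V -> R).
Hypothesis oO : open Omega.
Hypothesis aj : a ord0 j != 0.
Hypothesis mu_ : measurable_fun (setT : set BV) u.
Hypothesis mv_ : measurable_fun (setT : set BV) v.
Hypothesis iu : forall K : set V, compact K -> K `<=` Omega ->
  mu.-integrable (K : set BV) (EFin \o u).
Hypothesis iv : forall K : set V, compact K -> K `<=` Omega ->
  mu.-integrable (K : set BV) (EFin \o v).
Hypothesis star : forall (q : 'I_N -> R -> R) (q' : R -> R) (al be : 'I_N -> R),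
  (forall i, sm (q i)) -> (forall s : R, is_derive s 1 (q j) (q' s)) ->
  (forall i s, q i s != 0 -> al i <= s <= be i) -> skbox a j al be `<=` Omega ->
  (\int[mu]_(x in (skbox a j al be : set BV))
     (u x * (q' (skc a j j x) * \prod_(i | i != j) q i (skc a j i x))) =
   - \int[mu]_(x in (skbox a j al be : set BV))
     (v x * \prod_i q i (skc a j i x)))%R.

Definition pospart (f : V -> R) (x : V) : R := Num.max (f x) 0.
Definition negpart (f : V -> R) (x : V) : R := Num.max (- f x) 0.

Lemma pospart_ge0 f x : 0 <= pospart f x. Proof. by rewrite le_max lexx orbT. Qed.
Lemma negpart_ge0 f x : 0 <= negpart f x. Proof. by rewrite le_max lexx orbT. Qed.

Lemma posneg f x : f x = pospart f x - negpart f x.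
Proof.
rewrite /pospart /negpart; have [h|h] := leP (f x) 0.
  by rewrite max_l ?oppr_ge0// sub0r opprK.
by rewrite max_r ?oppr_le0 ?(ltW h)// subr0.
Qed.

Lemma pospart_le f x : pospart f x <= `|f x|.
Proof. by rewrite ge_max ler_norm normr_ge0. Qed.
Lemma negpart_le f x : negpart f x <= `|f x|.
Proof. by rewrite ge_max -normrN ler_norm normr_ge0. Qed.

Lemma measurable_pospart f : measurable_fun (setT : set BV) f ->
  measurable_fun (setT : set BV) (pospart f).
Proof. by move=> mf; apply: measurable_maxr. Qed.
Lemma measurable_negpart f : measurable_fun (setT : set BV) f ->
  measurable_fun (setT : set BV) (negpart f).
Proof. by move=> mf; apply: measurable_maxr => //; exact: measurable_funN. Qed.

(** One side of $u(x+ha)=u(x)+\int_0^hv(x+ra)\,dr$ after all negative terms are moved across: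
    $u^+(x)+u^-(x+ha)+\int v^+=u^-(x)+u^+(x+ha)+\int v^-$. Both sides are nonnegative, so Tonelli
    applies before integrability on lines is known. *)
Definition acside (h : R) (f g k : V -> R) (x : V) : \bar R :=
  ((f x)%:E + ((g (x + h *: a))%:E + lineseg a h (EFin \o k) x))%E.

Section box.
Variables (al be : 'I_N -> R) (h eta : R).
Hypothesis ab : forall i, al i <= be i.
Hypothesis h0 : 0 <= h.
Hypothesis eta0 : 0 < eta.
Let be' i := be i + (if i == j then h else 0) + eta.
Let K := skbox a j al be'.
Hypothesis KO : K `<=` Omega.
Let Q := hbox a j al be.
Let chi x : R := \1_Q x.
Let chih x : R := \1_Q (x + h *: (- a)).
Let Pr x := \prod_(i | i != j) hchi (al i) (be i) (skc a j i x).
Let w x := (kap (al j) (be j) (skc a j j x) - kap (al j) (be j) (skc a j j x - h)) * Pr x.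

Let w0 x : 0 <= w x.
Proof.
apply: mulr_ge0; first exact: kap_mono.
by apply: prodr_ge0 => i _; rewrite /hchi ler0n.
Qed.

Let outK x : ~ K x -> [/\ chi x = 0, chih x = 0 & w x = 0].
Proof.
move=> nK; have h0' := h0; have eta0' := eta0.
have [i /negP hi] : exists i, ~ (al i <= skc a j i x <= be' i).
  by apply: contrapT => hn; apply: nK => i; apply: contrapT => hi; apply: hn; exists i.
have abi := ab i.
have [ij|ij] := eqVneq i j.
  have c1 : hchi (al j) (be j) (skc a j j x) = 0.
    rewrite -ij /hchi; case: andP => // -[h1 h2]; case/negP: hi.
    by rewrite /be' ij eqxx -ij; apply/andP; split; lra.
  have c2 : hchi (al j) (be j) (skc a j j x - h) = 0.
    rewrite -ij /hchi; case: andP => // -[h1 h2]; case/negP: hi.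
    by rewrite /be' ij eqxx -ij; apply/andP; split; lra.
  split.
  - by rewrite /chi /Q -hbox_prod (bigD1 j)//= c1 mul0r.
  - by rewrite /chih /Q -hbox_prodj// c2 mul0r.
  - rewrite /w /kap -ij; move: hi; rewrite /be' ij eqxx -ij negb_and -!ltNge.
    move=> /orP[hi|hi].
      have m0 (z : R) : z <= 0 -> Num.max z 0 = 0 by exact: max_r.
      rewrite (m0 (_ - al i)); last lra.
      rewrite (m0 (_ - be i)); last lra.
      rewrite (m0 (_ - h - al i)); last lra.
      by rewrite (m0 (_ - h - be i)); [rewrite !subrr mul0r|lra].
    have m1 (z : R) : 0 <= z -> Num.max z 0 = z by exact: max_l.
    rewrite (m1 (_ - al i)); last lra.
    rewrite (m1 (_ - be i)); last lra.
    rewrite (m1 (_ - h - al i)); last lra.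
    rewrite (m1 (_ - h - be i)); last lra.
    by rewrite [X in X * _](_ : _ = 0) ?mul0r//; ring.
have c : hchi (al i) (be i) (skc a j i x) = 0.
  rewrite /hchi; case: andP => // -[h1 h2]; case/negP: hi.
  by rewrite /be' (negbTE ij); apply/andP; split; lra.
have P0 : Pr x = 0 by rewrite /Pr (bigD1 i)//= c mul0r.
split; last by rewrite /w P0 mulr0.
  by rewrite /chi /Q -hbox_prod (bigD1 i)//= c mul0r.
by rewrite /chih /Q -hbox_prodj// -/(Pr x) P0 mulr0.
Qed.

Let mQ : measurable (Q : set BV). Proof. exact: measurable_hbox. Qed.
Let mchi : measurable_fun (setT : set BV) chi. Proof. exact: measurable_indic. Qed.
Let mchih : measurable_fun (setT : set BV) chih.
Proof. exact: (measurableT_comp mchi (measurable_translate _)). Qed.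
Let cK : compact K. Proof. exact: skbox_compact. Qed.
Let mK : measurable (K : set BV). Proof. exact: compact_borel. Qed.

Let toT (f : V -> R) : (forall x, ~ K x -> f x = 0) ->
  (\int[mu]_(x in (K : set BV)) (f x)%:E = \int[mu]_x (f x)%:E)%E.
Proof.
move=> f0; rewrite integral_mkcond; apply: eq_integral => x _; rewrite patchE.
by case: ifPn => // /negP nK; rewrite f0// => Kx; apply: nK; exact/mem_set.
Qed.

Let acbox (f g k : V -> R) : measurable_fun (setT : set BV) f ->
  measurable_fun (setT : set BV) g -> measurable_fun (setT : set BV) k ->
  (forall x, 0 <= f x) -> (forall x, 0 <= g x) -> (forall x, 0 <= k x) ->
  (\int[mu]_(x in (Q : set BV)) acside h f g k x =
   \int[mu]_(x in (K : set BV)) (f x * chi x + g x * chih x)%:E +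
   \int[mu]_(x in (K : set BV)) (k x * w x)%:E)%E.
Proof.
move=> mf mg mk f0 g0 k0.
have mf' : bmeas (EFin \o f) by exact/measurable_EFinP.
have mg' : bmeas (EFin \o g) by exact/measurable_EFinP.
have mk' : bmeas (EFin \o k) by exact/measurable_EFinP.
have k0' x : (0 <= (EFin \o k) x)%E by rewrite lee_fin.
have g0' x : (0 <= (EFin \o g) x)%E by rewrite lee_fin.
have f0' x : (0 <= (EFin \o f) x)%E by rewrite lee_fin.
have mgh : bmeas (fun x => (g (x + h *: a))%:E) by exact: (bmeas_translate (h *: a) mg').
have ml := bmeas_lineseg a h mk' k0'.
have l0 x : (0 <= lineseg a h (EFin \o k) x)%E by exact: lineseg_ge0.
have mc1 : bmeas (fun x => (f x * chi x)%:E) by apply/measurable_EFinP; exact: measurable_funM.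
have mc2 : bmeas (fun x => (g x * chih x)%:E) by apply/measurable_EFinP; exact: measurable_funM.
have chi0 x : 0 <= chi x by [].
have chih0 x : 0 <= chih x by [].
rewrite toT; last by move=> x /outK[-> -> _]; rewrite !mulr0 addr0.
rewrite toT; last by move=> x /outK[_ _ ->]; rewrite mulr0.
under [X in (_ = X + _)%E]eq_integral do rewrite EFinD.
rewrite [X in (_ = X + _)%E]ge0_integralD//; last 2 first.
- by move=> x _; rewrite lee_fin mulr_ge0.
- by move=> x _; rewrite lee_fin mulr_ge0.
under [X in (_ = X + _ + _)%E]eq_integral do rewrite EFinM.
under [X in (_ = _ + X + _)%E]eq_integral do rewrite EFinM.
under [X in (_ = _ + X)%E]eq_integral do rewrite EFinM.
rewrite (integral_kap aj (ab j) h0 mk' k0').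
rewrite (integral_hbox_shift a j al be h mg' g0').
rewrite -(integral_hbox a j al be f0') -addeA.
have A1 : measurable_fun (Q : set BV) (fun x => (f x)%:E) by exact: measurable_funTS.
have A2 : measurable_fun (Q : set BV) (fun x => (g (x + h *: a))%:E) by exact: measurable_funTS.
have A3 : measurable_fun (Q : set BV) (lineseg a h (EFin \o k)) by exact: measurable_funTS.
have A4 : measurable_fun (Q : set BV) (fun x => (g (x + h *: a))%:E + lineseg a h (EFin \o k) x)%E.
  exact: emeasurable_funD.
have A5 x : Q x -> (0 <= (g (x + h *: a))%:E + lineseg a h (EFin \o k) x)%E.
  by move=> _; rewrite adde_ge0// lee_fin.
have A6 x : Q x -> (0 <= (g (x + h *: a))%:E)%E by rewrite lee_fin.
have A7 x : Q x -> (0 <= (f x)%:E)%E by rewrite lee_fin.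
by rewrite /acside (ge0_integralD _ mQ A7 A1 A5 A4) (ge0_integralD _ mQ A6 A2 _ A3).
Qed.

Lemma ac_box :
  (\int[mu]_(x in (Q : set BV)) acside h (pospart u) (negpart u) (pospart v) x =
   \int[mu]_(x in (Q : set BV)) acside h (negpart u) (pospart u) (negpart v) x)%E /\
  (\int[mu]_(x in (Q : set BV)) acside h (pospart u) (negpart u) (pospart v) x < +oo)%E.
Proof.
have [e i1 i2] := box_limit aj iu iv star ab h0 eta0 KO.
have chi1 x : 0 <= chi x <= 1 by rewrite /chi indicE; case: (x \in _); rewrite lexx ler01.
have chih1 x : 0 <= chih x <= 1 by rewrite /chih indicE; case: (_ \in _); rewrite lexx ler01.
have mpu := measurable_pospart mu_; have mnu := measurable_negpart mu_.
have mpv := measurable_pospart mv_; have mnv := measurable_negpart mv_.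
have iS (f g : V -> R) : measurable_fun (setT : set BV) f -> measurable_fun (setT : set BV) g ->
    (forall x, 0 <= f x <= `|u x|) -> (forall x, 0 <= g x <= `|u x|) ->
    mu.-integrable (K : set BV) (EFin \o (fun x => f x * chi x + g x * chih x)).
  move=> mf mg fu gu.
  have i2u : mu.-integrable (K : set BV) (fun x => 2%:E * (EFin \o u) x)%E.
    by apply: integrableZl => //; exact: iu.
  apply: le_integrable i2u => //.
    apply/measurable_EFinP; apply: measurable_funTS.
    by apply: measurable_funD; exact: measurable_funM.
  move=> x _ /=; rewrite lee_fin normrM [`|2|]ger0_norm//.
  have /andP[f0 f1] := fu x; have /andP[g0 g1] := gu x.
  have /andP[c0 c1] := chi1 x; have /andP[d0 d1] := chih1 x.
  have nn : 0 <= f x * chi x + g x * chih x by rewrite addr_ge0// mulr_ge0.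
  rewrite (ger0_norm nn).
  have := ler_pM f0 c0 f1 c1; have := ler_pM g0 d0 g1 d1; lra.
have iW (k : V -> R) : measurable_fun (setT : set BV) k -> (forall x, 0 <= k x <= `|v x|) ->
    mu.-integrable (K : set BV) (EFin \o (fun x => k x * w x)).
  move=> mk kv; apply: le_integrable i2 => //.
    apply/measurable_EFinP; apply: measurable_funM; first exact: measurable_funTS.
    apply: measurable_funTS; apply: measurable_funM.
      by apply: measurable_funB; do ?apply: measurable_funB; apply: measurable_maxr => //;
        do ?apply: measurable_funB => //; exact: measurable_skc.
    rewrite /Pr; elim: (index_enum _) => [|i l IH].
      by under eq_fun do rewrite big_nil; exact: measurable_cst.
    under eq_fun do rewrite big_cons; case: (i != j) => //.
    apply: measurable_funM => //.
    rewrite (_ : (fun _ => _) = (\1_(`]al i, be i]%classic) : R -> R) \o (skc a j i)).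
      by apply: measurableT_comp; [exact: measurable_indic|exact: measurable_skc].
    by apply/funext => r; rewrite /= indicE /hchi mem_setE in_itv.
  move=> x _ /=; rewrite lee_fin !normrM ler_wpM2r//.
  by have /andP[k0 k1] := kv x; rewrite ger0_norm.
have pu x : 0 <= pospart u x <= `|u x| by rewrite pospart_ge0 pospart_le.
have nu x : 0 <= negpart u x <= `|u x| by rewrite negpart_ge0 negpart_le.
have pv x : 0 <= pospart v x <= `|v x| by rewrite pospart_ge0 pospart_le.
have nv x : 0 <= negpart v x <= `|v x| by rewrite negpart_ge0 negpart_le.
have S1 := iS _ _ mpu mnu pu nu; have S2 := iS _ _ mnu mpu nu pu.
have W1 := iW _ mpv pv; have W2 := iW _ mnv nv.
rewrite !acbox//; try by move=> x; rewrite ?pospart_ge0 ?negpart_ge0.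
have fS1 := integrable_fin_num mK S1; have fS2 := integrable_fin_num mK S2.
have fW1 := integrable_fin_num mK W1; have fW2 := integrable_fin_num mK W2.
split; last by rewrite -(fineK fS1) -(fineK fW1) -EFinD ltry.
rewrite -(fineK fS1) -(fineK fS2) -(fineK fW1) -(fineK fW2) -!EFinD; congr EFin.
have e1 : (\int[mu]_(x in (K : set BV)) (u x * ((hchi (al j) (be j) (skc a j j x) -
     hchi (al j) (be j) (skc a j j x - h)) * Pr x)) =
   \int[mu]_(x in (K : set BV)) (pospart u x * chi x + negpart u x * chih x) -
   \int[mu]_(x in (K : set BV)) (negpart u x * chi x + pospart u x * chih x))%R.
  rewrite -RintegralB//; apply: eq_Rintegral => x _.
  rewrite mulrBl /Pr hbox_prodj// -/(chih x).
  have -> : hchi (al j) (be j) (skc a j j x) *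
    \prod_(i | i != j) hchi (al i) (be i) (skc a j i x) = chi x.
    by rewrite /chi /Q -hbox_prod [RHS](bigD1 j).
  by rewrite {1}(posneg u x); ring.
have e2 : (\int[mu]_(x in (K : set BV)) (v x * w x) =
   \int[mu]_(x in (K : set BV)) (pospart v x * w x) -
   \int[mu]_(x in (K : set BV)) (negpart v x * w x))%R.
  rewrite -RintegralB//; apply: eq_Rintegral => x _.
  by rewrite {1}(posneg v x); ring.
move: e; rewrite -/K -/Pr; rewrite [X in X = _]e1 [X in _ = - X]e2 /Rintegral; lra.
Qed.

End box.

End absolute_continuity.

Section segments.
Context {R : realType} {N : nat}.
Local Notation V := 'rV[R]_N.
Variable Omega : set V.
Hypothesis oO : open Omega.

Definition segset (a : V) : set V :=
  [set x | forall t : R, 0 <= t <= 1 -> Omega (x + t *: a)].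

(** The segment is compact, so one radius serves all its points. *)
Lemma segset_nbhs a x : segset a x -> exists e : R, 0 < e /\
  forall t z, 0 <= t <= 1 -> `|z| < e -> Omega (x + t *: a + z).
Proof.
move=> sx.
have /compact_near_coveringP nc : compact (`[0, 1]%classic : set R) by exact: segment_compact.
have nb : nbhs (0 : V) (fun z => `[0, 1]%classic `<=` (fun t : R => Omega (x + t *: a + z))).
  apply: (nc V (nbhs (0 : V)) (fun z t => Omega (x + t *: a + z))).
  move=> t; rewrite /= in_itv/= => t01.
  have cf : (fun p : R * V => x + p.1 *: a + p.2) @ (t, 0 : V) --> x + t *: a + 0.
    apply: cvgD; last exact: cvg_snd.
    apply: cvgD; first exact: cvg_cst.
    by apply: cvgZr_tmp; exact: cvg_fst.
  have : nbhs (x + t *: a + 0) Omega.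
    by apply: open_nbhs_nbhs; split => //; rewrite addr0; exact: sx.
  by move=> /cf.
have [e /= e0 he] := (nbhs_ballP _ _).1 nb; exists e; split => // t z t01 ze.
by apply: (he z) => //=; rewrite ?in_itv//= -ball_normE/= sub0r normrN.
Qed.

Lemma segset_open a : open (segset a).
Proof.
rewrite openE => x /segset_nbhs[e [e0 he]]; apply/nbhs_ballP; exists e => // y.
rewrite -ball_normE/= => xy t t01.
by have := he t (y - x) t01; rewrite distrC xy addrAC subrKC; exact.
Qed.

Lemma segset_sub a : segset a `<=` Omega.
Proof. by move=> x /(_ 0); rewrite scale0r addr0 lexx ler01; exact. Qed.

End segments.

Section absolute_continuity.
Context {R : realType} {N : nat}.
Local Notation V := 'rV[R]_N.
Local Notation BV := (BV R N).
Local Notation mu := (@bleb R N).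
Local Notation lam := (lebesgue_measure : {measure set (measurableTypeR R) -> \bar R}).
Variables (Omega : set V) (a : V) (j : 'I_N) (u v : V -> R).
Hypothesis oO : open Omega.
Hypothesis aj : a ord0 j != 0.
Hypothesis mu_ : measurable_fun (setT : set BV) u.
Hypothesis mv_ : measurable_fun (setT : set BV) v.
Hypothesis iu : forall K : set V, compact K -> K `<=` Omega ->
  mu.-integrable (K : set BV) (EFin \o u).
Hypothesis iv : forall K : set V, compact K -> K `<=` Omega ->
  mu.-integrable (K : set BV) (EFin \o v).
Hypothesis star : forall (q : 'I_N -> R -> R) (q' : R -> R) (al be : 'I_N -> R),
  (forall i, sm (q i)) -> (forall s : R, is_derive s 1 (q j) (q' s)) ->
  (forall i s, q i s != 0 -> al i <= s <= be i) -> skbox a j al be `<=` Omega ->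
  (\int[mu]_(x in (skbox a j al be : set BV))
     (u x * (q' (skc a j j x) * \prod_(i | i != j) q i (skc a j i x))) =
   - \int[mu]_(x in (skbox a j al be : set BV))
     (v x * \prod_i q i (skc a j i x)))%R.

Let P1 h := acside a h (pospart u) (negpart u) (pospart v).
Let P2 h := acside a h (negpart u) (pospart u) (negpart v).

Lemma skcB i (x y : V) : skc a j i (x - y) = skc a j i x - skc a j i y.
Proof.
rewrite /skc !mxE; case: (i == j); first by rewrite mulrBl.
by move: (a ord0 i / a ord0 j) => c; ring.
Qed.

Lemma bmeas_acside (h : R) (f g k : V -> R) : measurable_fun (setT : set BV) f ->
  measurable_fun (setT : set BV) g -> measurable_fun (setT : set BV) k ->
  (forall x, 0 <= k x) -> bmeas (acside a h f g k).
Proof.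
move=> mf mg mk k0.
have mf' : bmeas (EFin \o f) by exact/measurable_EFinP.
have mg' : bmeas (EFin \o g) by exact/measurable_EFinP.
have mk' : bmeas (EFin \o k) by exact/measurable_EFinP.
apply: emeasurable_funD => //; apply: emeasurable_funD.
  exact: (bmeas_translate (h *: a) mg').
by apply: bmeas_lineseg => // x; rewrite lee_fin.
Qed.

Lemma acside_ge0 (h : R) (f g k : V -> R) x : (forall x, 0 <= f x) -> (forall x, 0 <= g x) ->
  (forall x, 0 <= k x) -> (0 <= acside a h f g k x)%E.
Proof.
move=> f0 g0 k0; apply: adde_ge0; first by rewrite lee_fin.
by apply: adde_ge0; rewrite ?lee_fin//; apply: lineseg_ge0 => y; rewrite lee_fin.
Qed.

Let P1_0 h x : (0 <= P1 h x)%E.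
Proof. by apply: acside_ge0 => y; rewrite ?pospart_ge0 ?negpart_ge0. Qed.
Let P2_0 h x : (0 <= P2 h x)%E.
Proof. by apply: acside_ge0 => y; rewrite ?pospart_ge0 ?negpart_ge0. Qed.
Let mP1 h : bmeas (P1 h).
Proof.
by apply: bmeas_acside => [| | |y]; rewrite ?pospart_ge0//;
  do ?[exact: measurable_pospart|exact: measurable_negpart].
Qed.
Let mP2 h : bmeas (P2 h).
Proof.
by apply: bmeas_acside => [| | |y]; rewrite ?negpart_ge0//;
  do ?[exact: measurable_pospart|exact: measurable_negpart].
Qed.

Lemma ac_local h x0 : 0 <= h <= 1 -> segset Omega a x0 ->
  exists W : set V, [/\ open W, W x0 &
    {ae mu, forall x, W x -> P1 h x = P2 h x /\ P1 h x \is a fin_num}].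
Proof.
move=> /andP[h0 h1] /(segset_nbhs oO)[e [e0 he]].
(* With $4r(1+|a|)=e$, every point of the enlarged box lies at distance at most $2r(1+|a|)<e$ from
   the segment. *)
pose r := e / (4 * (1 + `|a|)).
have a0 : 0 < 4 * (1 + `|a|) by rewrite mulr_gt0// ltr_wpDr.
have r0 : 0 < r by rewrite divr_gt0.
have re : 4 * (r * (1 + `|a|)) = e by rewrite mulrCA /r divfK// gt_eqF.
pose al i := skc a j i x0 - r; pose be i := skc a j i x0 + r.
pose be' i := be i + (if i == j then h else 0) + r.
have KO : skbox a j al be' `<=` Omega.
  move=> y yK; pose d := skc a j j y - skc a j j x0.
  (* [t] is the projection on $[0,h]$ of the relative coordinate [d] along [a], which leaves this
     interval by at most $2r$. *)
  have [t [t01 t1 t2]] : exists t, [/\ 0 <= t <= 1, - r <= d - t & d - t <= 2 * r].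
    have := yK j; rewrite /be' /be /al eqxx => /andP[k1 k2].
    have d1 : - r <= d by rewrite /d; lra.
    have d2 : d <= h + 2 * r by rewrite /d; lra.
    case: (lerP d 0) => [d0|d0]; first by exists 0; split; [rewrite lexx ler01|lra|lra].
    case: (lerP h d) => [hd|dh]; first by exists h; split; [rewrite h0|lra|lra].
    by exists d; split; [apply/andP; split|..]; lra.
  pose z := y - x0 - t *: a.
  have -> : y = x0 + t *: a + z by rewrite /z addrC -[y - x0 - _]addrA -opprD subrK.
  apply: he => //.
  have zb i : `|skc a j i z| <= 2 * r.
    rewrite /z -scaleNr skc_line// skcB ler_norml.
    have := yK i; rewrite /be' /be /al; case: eqP => [->|_] /andP[k1 k2].
      by rewrite -/d; apply/andP; split; lra.
    by apply/andP; split; lra.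
  apply: (@le_lt_trans _ _ (2 * (r * (1 + `|a|)))); last lra.
  have r20 : 0 <= 2 * r by lra.
  have B0 : 0 <= 2 * (r * (1 + `|a|)) by rewrite mulrA mulr_ge0// addr_ge0.
  apply/(rV_norm_leP _ B0).
  move=> i; rewrite (skc_inv i z aj) (le_trans (ler_normD _ _))//.
  rewrite mulrDr mulr1 mulrDr lerD//.
    by case: eqP => _; rewrite ?normr0//; exact: zb.
  by rewrite normrM mulrA mulrC ler_pM// rV_coord_le.
have ab i : al i <= be i by rewrite /al /be; lra.
have [eq0 fin0] := ac_box aj mu_ mv_ iu iv star ab h0 r0 KO.
have mQ := measurable_hbox a j al be.
have ae1 : {ae mu, forall x, hbox a j al be x -> P1 h x = P2 h x}.
  apply: (hbox_ae_eq aj (mP1 h) (mP2 h) (P1_0 h) (P2_0 h) fin0).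
  move=> al' be'' ab' _ sub; apply: (proj1 (ac_box aj mu_ mv_ iu iv star ab' h0 r0 _)).
  move=> y yK; apply: KO => i; have /andP[k1 k2] := yK i; have [s1 s2] := sub i.
  by rewrite (le_trans s1 k1) (le_trans k2)// /be' !lerD2r.
have ae2 : {ae mu, forall x, hbox a j al be x -> P1 h x \is a fin_num}.
  apply: integrable_ae => //; apply/integrableP; split; first by apply: measurable_funTS; exact: mP1.
  by under eq_integral do rewrite gee0_abs//.
exists (interior (hbox a j al be)); split.
- exact: open_interior.
- rewrite /interior /=.
  have : \forall x \near x0, forall i, `|skc a j i x0 - skc a j i x| < r.
    apply: (@filter_forall V 'I_N (fun i x => `|skc a j i x0 - skc a j i x| < r) (nbhs x0)) => i.
    by have /cvgrPdist_lt/(_ r r0) := @skc_continuous R N a j i x0.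
  apply: filterS => x hx i; have := hx i; rewrite ltr_norml /al /be => /andP[? ?].
  by apply/andP; split; lra.
- have FF := ae_filter_ringOfSetsType mu.
  by apply: filterS2 ae1 ae2 => x e1 e2 /interior_subset hx; split; [exact: e1|exact: e2].
Qed.

Lemma ac_at h : 0 <= h <= 1 ->
  {ae mu, forall x, segset Omega a x -> P1 h x = P2 h x /\ P1 h x \is a fin_num}.
Proof.
move=> h01.
pose E := [set x | ~ (P1 h x = P2 h x /\ P1 h x \is a fin_num)].
have : mu.-negligible (E `&` segset Omega a : set BV).
  apply: negligible_local; first exact: segset_open.
  move=> x sx; have [W [oW Wx aeW]] := ac_local h01 sx; exists W; split => //.
  apply: negligibleS aeW => y [Ey Wy] /= h'; exact: Ey (h' Wy).
by apply: negligibleS => x /= /not_implyP[sx Ex]; split.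
Qed.

Let chiu (p : BV * measurableTypeR R) : R :=
  \1_(segset Omega a : set BV) p.1 * \1_(`[0, 1]%classic : set R) (p.2 : R).

(** The upper limit of the segment is moved into the integrand as an indicator, which makes the
    parametric integral measurable in $(x,h)$ jointly. *)
Lemma measurable_acside_joint (f g k : V -> R) : measurable_fun (setT : set BV) f ->
  measurable_fun (setT : set BV) g -> measurable_fun (setT : set BV) k ->
  (forall x, 0 <= k x) ->
  measurable_fun setT (fun p : BV * measurableTypeR R => acside a (p.2 : R) f g k p.1).
Proof.
move=> mf mg mk k0.
have mf' : bmeas (EFin \o f) by exact/measurable_EFinP.
have mg' : bmeas (EFin \o g) by exact/measurable_EFinP.
have mk' : bmeas (EFin \o k) by exact/measurable_EFinP.
apply: emeasurable_funD; first exact: (measurableT_comp mf' measurable_fst).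
apply: emeasurable_funD; first exact: (bmeas_line a mg').
pose F (p : (BV * measurableTypeR R) * measurableTypeR R) : \bar R :=
  ((\1_(`[0, +oo[%classic : set R) ((p.1.2 : R) - (p.2 : R)) *
    \1_(`]0, +oo[%classic : set R) (p.2 : R))%:E * (k (p.1.1 + (p.2 : R) *: a))%:E)%E.
rewrite (_ : (fun _ => _) = fun q => \int[lam]_r F (q, r))%E; last first.
  apply/funext => q; rewrite linesegE; apply: eq_integral => r _; rewrite /F /=.
  congr (_%:E * _)%E; rewrite !indicE !mem_setE !in_itv/= !andbT subr_ge0.
  by case: (0 < r); case: (r <= q.2); rewrite ?mulr0 ?mulr1.
apply: (@measurable_fun_fubini_tonelli_F _ _ _ (measurableTypeR R) R lam F) => //.
  apply: emeasurable_funM; last first.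
    have mq : measurable_fun setT
        (fun p : (BV * measurableTypeR R) * measurableTypeR R => (p.1.1, p.2)).
      apply: measurable_fun_pair => //.
      exact: (measurableT_comp measurable_fst measurable_fst).
    exact: (measurableT_comp (bmeas_line a mk') mq).
  apply/measurable_EFinP; apply: measurable_funM.
    apply: measurableT_comp; first exact: measurable_indic.
    apply: measurable_funB => //.
    exact: (measurableT_comp measurable_snd measurable_fst).
  by apply: measurableT_comp; first exact: measurable_indic.
by move=> p; rewrite mule_ge0// lee_fin.
Qed.

Lemma lineseg_mono (h h' : R) (f : V -> \bar R) x : h <= h' -> bmeas f -> (forall x, 0 <= f x)%E ->
  (lineseg a h f x <= lineseg a h' f x)%E.
Proof.
move=> hh mf f0; apply: ge0_subset_integral => //.
  by apply: measurable_funTS; exact: (bmeas_line1 a x mf).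
by apply: subset_itvl; rewrite bnd_simp.
Qed.

(** For each [h] the identity holds off a null set that depends on [h]. Fubini in $(x,h)$ exchanges
    the quantifiers: for almost every [x] it holds for almost every [h], which suffices as [h] is
    integrated over later. *)
Lemma ac_lines :
  {ae mu, forall x, segset Omega a x ->
     [/\ (lineseg a 1 (EFin \o pospart v) x < +oo)%E,
      (lineseg a 1 (EFin \o negpart v) x < +oo)%E &
     {ae lam, forall h : R, 0 <= h <= 1 -> u (x + h *: a) = u x +
       (fine (lineseg a h (EFin \o pospart v) x) - fine (lineseg a h (EFin \o negpart v) x))}]}.
Proof.
have mpu := measurable_pospart mu_; have mnu := measurable_negpart mu_.
have mpv := measurable_pospart mv_; have mnv := measurable_negpart mv_.
have mJ1 := measurable_acside_joint mpu mnu mpv (pospart_ge0 v).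
have mJ2 := measurable_acside_joint mnu mpu mnv (negpart_ge0 v).
have FF := ae_filter_ringOfSetsType mu.
have mS : measurable (segset Omega a : set BV) by apply: open_borel; exact: segset_open.
pose bad (p : BV * measurableTypeR R) : \bar R :=
  ((chiu p)%:E * `|P1 (p.2 : R) p.1 - P2 (p.2 : R) p.1|)%E.
have mbad : measurable_fun setT bad.
  apply: emeasurable_funM.
    apply/measurable_EFinP; apply: measurable_funM.
      by apply: measurableT_comp; [exact: measurable_indic|exact: measurable_fst].
    by apply: measurableT_comp; [exact: measurable_indic|exact: measurable_snd].
  by apply: measurableT_comp => //; exact: emeasurable_funB.
have bad0 p : (0 <= bad p)%E by rewrite mule_ge0// lee_fin mulr_ge0.
have := fubini_tonelli (m1 := mu) (m2 := lam) bad mbad bad0.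
rewrite [X in _ = X -> _]integral0_eq; last first.
  move=> h _; have mbh : bmeas (fun x => bad (x, h)) by exact: measurableT_comp mbad _.
  transitivity (\int[mu]_x `|bad (x, h)|)%E.
    by apply: eq_integral => x _; rewrite gee0_abs.
  apply/ae_eq_integral_abs => //.
  have [h01|h01] := boolP (0 <= h <= 1); last first.
    apply: aeW => x _ /=; rewrite /bad /chiu /=.
    by rewrite [\1_(`[0, 1]%classic) h]indicE mem_setE in_itv/= (negbTE h01) mulr0 mul0e.
  apply: filterS (ac_at h01) => x hx _ /=; rewrite /bad /chiu /=.
  case: (pselect (segset Omega a x)) => sx; last by rewrite [\1_(segset _ _) x]indicE memNset// mul0r mul0e.
  by have [<- fp] := hx sx; rewrite subee// abse0 mule0.
move=> Fub; pose I x := (\int[lam]_h bad (x, h))%E.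
have mI : bmeas I by exact: (@measurable_fun_fubini_tonelli_F _ _ BV (measurableTypeR R) R lam bad).
have I0 x : (0 <= I x)%E by exact: integral_ge0.
have aeI : ae_eq mu setT I (cst 0%E).
  apply/ae_eq_integral_abs => //; rewrite -[RHS]Fub; apply: eq_integral => x _.
  by rewrite gee0_abs.
(* The identity at $h=1$, finite on both sides, bounds the integrals over all shorter segments. *)
have h11 : 0 <= (1 : R) <= 1 by rewrite ler01 lexx.
apply: filterS2 aeI (ac_at h11) => x /(_ Logic.I) Ix hx sx.
have [e1 f1] := hx sx; have f2 := f1; rewrite e1 in f2.
have l1 : (lineseg a 1 (EFin \o pospart v) x < +oo)%E.
  move: f1; rewrite ge0_fin_numE//; apply: le_lt_trans; rewrite /P1 /acside addeA.
  by rewrite leeDr// adde_ge0// lee_fin ?pospart_ge0 ?negpart_ge0.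
have l2 : (lineseg a 1 (EFin \o negpart v) x < +oo)%E.
  move: f2; rewrite ge0_fin_numE//; apply: le_lt_trans; rewrite /P2 /acside addeA.
  by rewrite leeDr// adde_ge0// lee_fin ?pospart_ge0 ?negpart_ge0.
split => //.
have mbx : measurable_fun (setT : set (measurableTypeR R)) (fun h => bad (x, h)).
  exact: measurableT_comp mbad _.
have /ae_eq_integral_abs aeh : (\int[lam]_h `|bad (x, h)| = 0)%E.
  by rewrite -[RHS]Ix; apply: eq_integral => h _; rewrite gee0_abs.
have FL := ae_filter_ringOfSetsType lam.
apply: filterS (aeh measurableT mbx) => h /(_ Logic.I) /= bh /andP[h0 h1].
have mpv' : bmeas (EFin \o pospart v) by exact/measurable_EFinP.
have mnv' : bmeas (EFin \o negpart v) by exact/measurable_EFinP.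
have pv0 y : (0 <= (EFin \o pospart v) y)%E by rewrite lee_fin pospart_ge0.
have nv0 y : (0 <= (EFin \o negpart v) y)%E by rewrite lee_fin negpart_ge0.
have fl1 : lineseg a h (EFin \o pospart v) x \is a fin_num.
  by rewrite ge0_fin_numE ?lineseg_ge0//; apply: le_lt_trans l1; exact: lineseg_mono.
have fl2 : lineseg a h (EFin \o negpart v) x \is a fin_num.
  by rewrite ge0_fin_numE ?lineseg_ge0//; apply: le_lt_trans l2; exact: lineseg_mono.
move: bh; rewrite /bad /chiu /= !indicE mem_set// mem_setE in_itv/= h0 h1 /= mulr1 mul1e.
rewrite /P1 /P2 /acside -(fineK fl1) -(fineK fl2) /=.
move=> [] /eqP; rewrite normr_eq0 => /eqP.
have := posneg u x; have := posneg u (x + h *: a); lra.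
Qed.

End absolute_continuity.

(** * One-dimensional Lebesgue differentiation *)

Section lipschitz_real.
Context {R : realType}.
Local Open Scope charge_scope.
Local Notation mu := (@lebesgue_measure R).

(* Lebesgue's differentiation theorem for a monotone Lipschitz function, through
   the Radon-Nikodym density of its Stieltjes measure. *)
Lemma lipschitz_monotone_density (F : R -> R) (L a b : R) : a <= b -> 0 < L ->
  (forall s t, s <= t -> F s <= F t) ->
  (forall s t, s <= t -> F t - F s <= L * (t - s)) ->
  exists f : R -> R, mu.-integrable setT (EFin \o f) /\
    forall s t, a <= s -> s <= t -> t <= b -> F t - F s = (\int[mu]_(x in `]s, t]) f x)%R.
Proof.
move=> ab L0 nF LF.
have cont (K : R -> R) : (forall s t, s <= t -> K s <= K t) ->
    (forall s t, s <= t -> K t - K s <= L * (t - s)) -> right_continuous K.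
  move=> nK LK; apply: right_continuousW => x.
  apply/cvgrPdist_lt => e e0.
  exists (e / L); first by rewrite /= divr_gt0.
  move=> y /= xy; have [h|h] := leP x y.
    rewrite distrC ger0_norm ?subr_ge0 ?nK//.
    rewrite (le_lt_trans (LK _ _ h))// mulrC -ltr_pdivlMr//.
    by rewrite (le_lt_trans _ xy)// distrC ler_norm.
  rewrite ger0_norm ?subr_ge0 ?nK ?(ltW h)//.
  rewrite (le_lt_trans (LK _ _ (ltW h)))// mulrC -ltr_pdivlMr//.
  by rewrite (le_lt_trans _ xy)// ler_norm.
(* This is nondecreasing too, and $F+G$ is $L$ times the identity: Lebesgue measure is $1/L$ times
   the sum of the two Stieltjes measures, whence absolute continuity. *)
pose G t := L * t - F t.
have nG s t : s <= t -> G s <= G t.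
  by move=> st; have := LF _ _ st; rewrite /G mulrBr; lra.
have LG s t : s <= t -> G t - G s <= L * (t - s).
  by move=> st; have := nF _ _ st; rewrite /G mulrBr; lra.
pose Fc : cumulative R R := HB.pack F (isCumulative.Build R _ R F (fun s t => @nF s t) (cont F nF LF)).
pose Gc : cumulative R R := HB.pack G (isCumulative.Build R _ R G (fun s t => @nG s t) (cont G nG LG)).
pose mF := lebesgue_stieltjes_measure Fc.
pose mG := lebesgue_stieltjes_measure Gc.
have itvE (K : cumulative R R) u v : u <= v ->
    lebesgue_stieltjes_measure K `]u, v]%classic = (K v - K u)%:E.
  move=> uv; rewrite /lebesgue_stieltjes_measure /measure_extension.
  rewrite measurable_mu_extE/=; last exact: is_ocitv.
  by rewrite wlength_itv_bnd.
have Li0 : 0 <= L^-1 by rewrite invr_ge0 ltW.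
have muE A : measurable A -> mu A = mscale (NngNum Li0) (measure_add mF mG) A.
  move=> mA; apply: lebesgue_measure_unique => // _ [[u v]] _ <- /=.
  have [uv|vu] := leP u v; last first.
    by rewrite set_itv_ge ?bnd_simp -?leNgt ?ltW// !measure0.
  change (mu `]u, v]%classic = (L^-1)%:E * (measure_add mF mG) `]u, v]%classic)%E.
  rewrite measure_addE.
  change (mu `]u, v]%classic = (L^-1)%:E * (lebesgue_stieltjes_measure Fc `]u, v]%classic +
     lebesgue_stieltjes_measure Gc `]u, v]%classic))%E.
  rewrite !itvE// lebesgue_measure_itv/= lte_fin.
  case: ltP => [_|vu]; last first.
    have -> : u = v by apply/eqP; rewrite eq_le uv.
    by rewrite !subrr adde0 mule0.
  rewrite -EFinD -EFinM; congr EFin; rewrite /= /G; field.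
  by rewrite gt_eqF.
have mFoo : (mF `]a, b]%classic < +oo)%E by rewrite /mF itvE// ltry.
have mab : measurable (`]a, b]%classic : set (measurableTypeR R)) by [].
(* Restricted to $]a,b]$ the Stieltjes measure is finite, as the Radon-Nikodym theorem requires. *)
pose nu := mfrestr mab mFoo.
have dom : charge_of_finite_measure nu `<< mu.
  apply/null_content_dominatesP => A mA muA0.
  rewrite /= /charge_of_finite_measure/= /mfrestr /mrestr.
  apply/eqP; rewrite eq_le measure_ge0 andbT.
  apply: (@le_trans _ _ (mF A)); first by apply: le_measure; rewrite ?inE//; exact: measurableI.
  have := muE A mA; rewrite muA0 => /esym.
  change ((L^-1)%:E * (measure_add mF mG) A = 0 -> mF A <= 0)%E.
  rewrite measure_addE => /eqP; rewrite mule_eq0 eqe invr_eq0 gt_eqF//=.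
  rewrite padde_eq0// => /andP[/eqP e _].
  exact: (eq_ind_r (fun z => (z <= 0)%E) (lexx 0%E) e).
have RNi := Radon_Nikodym_integrable dom.
pose f x := fine ('d (charge_of_finite_measure nu) '/d mu x).
have fE : EFin \o f = 'd (charge_of_finite_measure nu) '/d mu.
  by apply/funext => x /=; rewrite fineK// Radon_Nikodym_fin_num.
exists f; split; first by rewrite fE.
move=> s t as_ st tb.
have mst : measurable (`]s, t]%classic : set (measurableTypeR R)) by [].
have := Radon_Nikodym_integral dom mst.
rewrite -fE /= /charge_of_finite_measure/= /mfrestr /mrestr.
have -> : `]s, t] `&` `]a, b] = `]s, t]%classic.
  apply/setIidPl => x /=; rewrite !in_itv/= => /andP[sx xt].
  by rewrite (le_lt_trans as_ sx) (le_trans xt).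
by rewrite /mF itvE// => h; rewrite /Rintegral -h.
Qed.

Lemma integrable_cst_itv (a b M : R) : mu.-integrable `]a, b] (EFin \o cst M).
Proof.
apply/integrableP; split; first exact/measurable_EFinP.
apply: (@le_lt_trans _ _ (`|M|%:E * mu `]a, b]%classic)%E).
  by rewrite -integral_cst.
rewrite lebesgue_measure_itv/=.
by case: ifP => _; rewrite ?mule0 ?ltry// -EFinB -EFinM ltry.
Qed.

(** A mean value inequality in which the derivative is bounded only almost everywhere, and only
    where it exists. Adding $Mt$ makes the function nondecreasing, and its density is then its
    derivative almost everywhere. *)
Lemma lipschitz_ae_derive_le (p : R -> R) (a b K C : R) : a < b -> 0 <= C ->
  (forall s t, a <= s -> s <= t -> t <= b -> `|p t - p s| <= K * (t - s)) ->
  {ae mu, forall t, a < t < b -> derivable p t 1 -> `|'D_1 p t| <= C} ->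
  `|p b - p a| <= C * (b - a).
Proof.
move=> ab C0 lip aeC.
pose M := `|K| + 1; have M0 : 0 < M by rewrite ltr_wpDl.
(* Clamping to $[a,b]$ extends the function to the whole line with the same Lipschitz bound. *)
pose c t := Num.max a (Num.min b t).
have ca t : a <= c t by rewrite /c le_max lexx.
have cb t : c t <= b by rewrite /c ge_max (ltW ab) ge_min lexx.
have cmono s t : s <= t -> c s <= c t.
  move=> st; rewrite /c le_max !ge_max lexx/=; apply/orP.
  have [h|h] := leP a (Num.min b t); [right|left].
    by rewrite le_min !ge_min lexx st orbT.
  by rewrite (le_trans _ (ltW h))// le_min !ge_min lexx st orbT.
have cid t : a <= t -> t <= b -> c t = t.
  by move=> h1 h2; rewrite /c (min_idPr h2) (max_idPr h1).
have c1 s t : s <= t -> c t - c s <= t - s.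
  move=> st; rewrite /c /Num.max /Num.min.
  by case: (ltP b t) => ?; case: (ltP b s) => ?; do !(case: ltP => ?); lra.
pose F t := p (c t) + M * c t.
have lip' s t : s <= t -> `|p (c t) - p (c s)| <= M * (c t - c s).
  move=> st; apply: (le_trans (lip _ _ (ca _) (cmono _ _ st) (cb _))).
  apply: ler_wpM2r; first by rewrite subr_ge0 cmono.
  by rewrite /M; have := ler_norm K; lra.
have [f [fi fE]] : exists f : R -> R, mu.-integrable setT (EFin \o f) /\
    forall s t, a <= s -> s <= t -> t <= b -> F t - F s = (\int[mu]_(x in `]s, t]) f x)%R.
  apply: (@lipschitz_monotone_density F (2 * M) a b); [exact: ltW|by rewrite mulr_gt0| |].
    move=> s t st; have := lip' _ _ st; rewrite ler_norml /F mulrBr => /andP[h _].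
    lra.
  move=> s t st; have := lip' _ _ st; rewrite ler_norml /F => /andP[_ h].
  have := c1 _ _ st; rewrite -(ler_pM2l M0); lra.
have li : locally_integrable setT f.
  by apply: open_integrable_locally => //; exact: openT.
have fi' y : mu.-integrable [set` Interval (BRight a) (BRight y)] (EFin \o f).
  by apply: integrableS fi.
have fa := FTC1 fi' li.
have FF := ae_filter_ringOfSetsType mu.
have abae : {ae mu, forall t, a < t < b -> `|f t - M| <= C}.
  apply: filterS2 fa aeC => t h1 h2 tab; have /andP[at_ tb] := tab.
  have [d1 d2] := h1 at_.
  pose F2 x := (\int[mu]_(t in [set` Interval (BRight a) (BRight x)]) f t)%R.
  have nE : \forall y \near t, F2 y + (F a - M * y) = p y.
    near=> y; have ya : a < y by near: y; exact: lt_nbhsr.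
    have yb : y < b by near: y; exact: lt_nbhsl.
    rewrite /F2 -fE ?(ltW ya) ?(ltW yb)// /F !cid ?(ltW ya) ?(ltW yb) ?(ltW ab)//.
    by lra.
  have D2 : is_derive t 1 F2 (f t).
    by split => //; rewrite -d2 derive1E.
  have D3 : is_derive t 1 (fun y => F a - M * y) (- M).
    have := is_deriveB (is_derive_cst (F a) t 1) (is_deriveZ M (is_derive_id t (1 : R))).
    by move=> /is_derive_eq; apply; rewrite sub0r /GRing.scale/= mulr1.
  have D4 := near_eq_is_derive nE (is_deriveD D2 D3).
  have [d4 d5] := D4.
  by rewrite -d5; exact: h2.
have -> : p b - p a = (\int[mu]_(x in `]a, b]) (f x - M))%R.
  have fab : mu.-integrable `]a, b] (EFin \o f) by apply: integrableS fi.
  rewrite (RintegralB _ fab (integrable_cst_itv a b M))//.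
  rewrite -fE ?(ltW ab)// /F !cid ?(ltW ab)// Rintegral_cst//.
  have -> : fine (mu `]a, b]%classic) = b - a.
    by rewrite lebesgue_measure_itv/= lte_fin ab -EFinB.
  lra.
have mint : mu.-integrable `]a, b] (EFin \o (fun x => f x - M)).
  rewrite (_ : EFin \o _ = (fun x => (EFin \o f) x - (EFin \o cst M) x)%E)//.
  by apply: integrableB => //; first [exact: integrable_cst_itv|apply: integrableS fi].
apply: (le_trans (le_normr_Rintegral _ mint)) => //.
rewrite -lee_fin; rewrite /Rintegral fineK; last first.
  exact: integrable_fin_num (integrable_norm mint).
have mfab : measurable_fun `]a, b] (EFin \o (fun x => f x - M)).
  exact: measurable_int mint.
have C0' : (0 <= C%:E)%E by rewrite lee_fin.
have mE : (mu `]a, b]%classic = (b - a)%:E)%E.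
  by rewrite lebesgue_measure_itv/= lte_fin ab -EFinB.
rewrite EFinM -mE.
have mI : measurable (`]a, b]%classic : set (measurableTypeR R)) by [].
have nb : {ae mu, forall t, t <> b}.
  exists [set b]; split => //; first exact: lebesgue_measure_set1.
  by move=> x /= /contrapT ->.
have h : {ae mu, forall t, `]a, b]%classic t ->
    (`|(EFin \o (fun x => (f x - M)%R)) t| <= C%:E)%E}.
  apply: filterS2 abae nb => t h tb; rewrite /= in_itv/= lee_fin => /andP[at_ tb'].
  by apply: h; rewrite at_ lt_neqAle tb' andbT; apply/eqP.
exact: (@integral_le_bound _ _ _ mu _ _ _ mI mfab C0' h).
Unshelve. all: by end_near. Qed.

End lipschitz_real.

Local Close Scope charge_scope.

(** * The Sobolev conjugate in the second variable *)

Section inverse_convex.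
Context {R : realType}.
(** The abstract situation $G=I^{-1}$, $q\,dI=A\,d(s^q)$ with [A] nonincreasing, given by integrated
    inequalities. Later $A(s)$ is the inverse of the biconjugate at [s] divided by [s], and [I] is
    the integral that defines the inverse of the conjugate. *)
Variables (q : R) (A I G : R -> R).
Hypothesis q0 : 0 < q.
Hypothesis A0 : forall s, 0 < s -> 0 < A s.
Hypothesis A_ni : forall s1 s2, 0 < s1 -> s1 <= s2 -> A s2 <= A s1.
Hypothesis I_ge : forall s1 s2, 0 < s1 -> s1 <= s2 ->
  A s2 * (s2 `^ q - s1 `^ q) <= q * (I s2 - I s1).
Hypothesis I_le : forall s1 s2, 0 < s1 -> s1 <= s2 ->
  q * (I s2 - I s1) <= A s1 * (s2 `^ q - s1 `^ q).
Hypothesis I_ge0 : forall s, 0 < s -> 0 <= I s.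
Hypothesis I_small : forall e, 0 < e -> exists2 s, 0 < s & I s < e.
Hypothesis G_ge0 : forall t, 0 <= t -> 0 <= G t.
Hypothesis G_gt : forall t s, 0 <= t -> G t < s -> t < I s.
Hypothesis G_le : forall t s, 0 <= t -> 0 < s -> s < G t -> I s <= t.

Let pqK x : 0 <= x -> (x `^ q^-1) `^ q = x.
Proof. by move=> x0; rewrite -powRrM mulVf ?gt_eqF// powRr1. Qed.

Let Kpq x : 0 <= x -> (x `^ q) `^ q^-1 = x.
Proof. by move=> x0; rewrite -powRrM mulfV ?gt_eqF// powRr1. Qed.

Let pq_lt x y : 0 <= x -> x < y -> x `^ q < y `^ q.
Proof.
move=> x0 xy; apply: gt0_ltr_powR => //; rewrite nnegrE//.
exact: le_trans (ltW xy).
Qed.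

Let pq_le x y : 0 <= x -> x <= y -> x `^ q <= y `^ q.
Proof.
move=> x0 xy; apply: ge0_ler_powR => //; rewrite ?nnegrE//; first exact: ltW.
exact: le_trans xy.
Qed.

Let qi_lt x y : 0 <= x -> x < y -> x `^ q^-1 < y `^ q^-1.
Proof.
move=> x0 xy; apply: gt0_ltr_powR => //; rewrite ?nnegrE ?invr_gt0//.
exact: le_trans (ltW xy).
Qed.

Lemma I_strict s1 s2 : 0 < s1 -> s1 < s2 -> I s1 < I s2.
Proof.
move=> s10 s12; have := I_ge s10 (ltW s12).
have h1 := pq_lt (ltW s10) s12; have h2 := A0 (lt_trans s10 s12).
have : 0 < A s2 * (s2 `^ q - s1 `^ q) by rewrite mulr_gt0// subr_gt0.
by move=> h3 h4; have := lt_le_trans h3 h4; rewrite pmulr_rgt0// subr_gt0.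
Qed.

Lemma G_gt0 t : 0 < t -> 0 < G t.
Proof.
move=> t0; rewrite lt_neqAle G_ge0 ?ltW// andbT; apply/negP => /eqP G0.
have [s s0 Is] := I_small t0.
have := G_gt (ltW t0) (eq_ind _ (fun z => z < s) s0 _ G0).
by rewrite ltNge ltW.
Qed.

Lemma G0 : G 0 = 0.
Proof.
apply/eqP; rewrite eq_le G_ge0// andbT leNgt; apply/negP => Gp.
have s0 : 0 < G 0 / 2 by rewrite divr_gt0.
have s1 : G 0 / 2 / 2 < G 0 / 2 by rewrite ltr_pdivrMr// mulr2n mulrDr mulr1 ltrDl.
have s2 : G 0 / 2 < G 0 by rewrite ltr_pdivrMr// mulr2n mulrDr mulr1 ltrDl.
have s3 : 0 < G 0 / 2 / 2 by rewrite divr_gt0.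
have := I_strict s3 s1; have := G_le (lexx 0) s0 s2.
by move=> h1 h2; have := lt_le_trans h2 h1; rewrite ltNge I_ge0.
Qed.

(** [I] is continuous at positive points, so the generalised inverse is exact there: perturb $s^q$
    by [d] on either side. *)
Lemma IG t : 0 < t -> I (G t) = t.
Proof.
move=> t0; set s := G t; have s0 : 0 < s := G_gt0 t0.
have sq0 : 0 < s `^ q by exact: powR_gt0.
apply/eqP; rewrite eq_le; apply/andP; split.
  apply/ler_addgt0Pr => e e0.
  (* A lower bound for the perturbed point [s'], which keeps [A s'] below [A m]; [d] is then chosen
     so that the increment of [I] is at most [e]. *)
  pose m := (s `^ q / 2) `^ q^-1.
  have m0 : 0 < m by rewrite powR_gt0// divr_gt0.
  have K0 : 0 < A m / q by rewrite divr_gt0// A0.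
  pose d := Num.min (s `^ q / 2) (e / (A m / q)).
  have d0 : 0 < d by rewrite lt_min; apply/andP; split; rewrite divr_gt0.
  have d1 : d <= s `^ q / 2 by rewrite ge_min lexx.
  have d2 : d <= e / (A m / q) by rewrite ge_min lexx orbT.
  pose s' := (s `^ q - d) `^ q^-1.
  have sd0 : 0 < s `^ q - d by lra.
  have s'0 : 0 < s' by rewrite powR_gt0.
  have s's : s' < s by rewrite -[ltRHS]Kpq ?ltW// qi_lt ?ltW//; lra.
  have ms' : m <= s'.
    apply: ge0_ler_powR; rewrite ?invr_ge0 ?nnegrE ?(ltW q0) ?(ltW sd0)//; lra.
  have e1 : s' `^ q = s `^ q - d by rewrite /s' pqK ?ltW.
  have := I_le s'0 (ltW s's); rewrite e1.
  have -> : s `^ q - (s `^ q - d) = d by lra.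
  move=> h1; have h2 := G_le (ltW t0) s'0 s's.
  have h3 := A_ni m0 ms'.
  have h4 : A s' * d <= A m * d by rewrite ler_wpM2r// ltW.
  have h5 : A m * d <= q * e.
    by move: d2; rewrite ler_pdivlMr// mulrA ler_pdivrMr// mulrC (mulrC e).
  have : q * (I s - I s') <= q * e by exact: le_trans h1 (le_trans h4 h5).
  rewrite ler_pM2l//; lra.
apply/ler_addgt0Pr => e e0.
have K0 : 0 < A s / q by rewrite divr_gt0// A0.
pose d := e / (A s / q); have d0 : 0 < d by rewrite divr_gt0.
pose s' := (s `^ q + d) `^ q^-1.
have ss' : s < s' by rewrite -[ltLHS]Kpq ?ltW// qi_lt ?ltW// ltrDl.
have e1 : s' `^ q = s `^ q + d by rewrite /s' pqK ?addr_ge0 ?ltW.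
have := I_le s0 (ltW ss'); rewrite e1.
have -> : s `^ q + d - s `^ q = d by lra.
have h5 : A s * d = q * e.
  by rewrite /d; field; rewrite ?gt_eqF// A0.
rewrite h5 ler_pM2l//; have := G_gt (ltW t0) ss'; lra.
Qed.

Lemma G_mono t1 t2 : 0 <= t1 -> t1 <= t2 -> G t1 <= G t2.
Proof.
move=> t10; rewrite le_eqVlt => /predU1P[->//|t12].
rewrite leNgt; apply/negP => h; have t20 := le_lt_trans t10 t12.
have := G_le t10 (G_gt0 t20) h; rewrite IG//; lra.
Qed.

Lemma H_slope_le t1 t2 : 0 <= t1 -> t1 <= t2 -> 0 < t2 ->
  A (G t2) * (G t2 `^ q - G t1 `^ q) <= q * (t2 - t1).
Proof.
move=> t10 t12 t20; have := t10; rewrite le_eqVlt => /predU1P[t1E|t1p]; last first.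
  by have := I_ge (G_gt0 t1p) (G_mono t10 t12); rewrite !IG.
rewrite -t1E G0 powR0 ?gt_eqF// !subr0.
have g0 := G_gt0 t20; have a0 := A0 g0.
(* The case $t_1=0$ is a limit: start from a small [s] for which $A(G(t_2))\,s^q\le e$. *)
apply/ler_addgt0Pr => e e0.
pose d := Num.min (e / A (G t2)) (G t2 `^ q).
have d0 : 0 < d by rewrite lt_min divr_gt0//= powR_gt0.
pose s := d `^ q^-1; have s0 : 0 < s by rewrite powR_gt0.
have sG : s <= G t2.
  rewrite -[leRHS](Kpq (ltW g0)) /s ge0_ler_powR ?invr_ge0 ?nnegrE ?(ltW q0) ?(ltW d0) ?powR_ge0//.
  by rewrite ge_min lexx orbT.
have e1 : s `^ q = d by rewrite /s pqK ?ltW.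
have := I_ge s0 sG; rewrite e1 IG//.
have h1 : A (G t2) * d <= e.
  by rewrite mulrC -ler_pdivlMr// ge_min lexx.
have h2 : 0 <= q * I s by rewrite mulr_ge0 ?I_ge0 ?ltW.
rewrite !mulrBr; lra.
Qed.

Lemma H_slope_ge t1 t2 : 0 < t1 -> t1 <= t2 ->
  q * (t2 - t1) <= A (G t1) * (G t2 `^ q - G t1 `^ q).
Proof.
move=> t10 t12; have t20 := lt_le_trans t10 t12.
by have := I_le (G_gt0 t10) (G_mono (ltW t10) t12); rewrite !IG.
Qed.

(** The slopes of $G^q$ before and after $t_1$ are separated by $q/A(G(t_1))$. *)
Lemma H_convex t0 t1 t2 : 0 <= t0 -> t0 < t1 -> t1 < t2 ->
  (G t1 `^ q - G t0 `^ q) * (t2 - t1) <= (G t2 `^ q - G t1 `^ q) * (t1 - t0).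
Proof.
move=> t00 t01 t12; have t10 := le_lt_trans t00 t01.
have h1 := H_slope_le t00 (ltW t01) t10; have h2 := H_slope_ge t10 (ltW t12).
have a0 := A0 (G_gt0 t10).
set h0 := _ - _ in h1 *; set h3 := G t2 `^ q - _ in h2 *.
rewrite -(ler_pM2l a0) -(ler_pM2l q0).
apply: (@le_trans _ _ (q * (t1 - t0) * (q * (t2 - t1)))).
  rewrite !mulrA -[leLHS]mulrA mulrAC -[leLHS]mulrA [leRHS]mulrC.
  rewrite [leLHS](_ : _ = q * (t2 - t1) * (A (G t1) * h0)); last by ring.
  by rewrite [leRHS](_ : _ = q * (t2 - t1) * (q * (t1 - t0))); [
    rewrite ler_pM2l// mulr_gt0// subr_gt0|ring].
rewrite [leRHS](_ : _ = q * (t1 - t0) * (A (G t1) * h3)); last by ring.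
by rewrite ler_pM2l// mulr_gt0// subr_gt0.
Qed.

End inverse_convex.

Section power_integral.
Context {R : realType}.
Local Notation mu := (@lebesgue_measure R).

Lemma integral_powR (q s t : R) : 0 < q -> 0 < s -> s <= t ->
  (\int[mu]_(x in `]s, t]) (x `^ (q - 1))%:E = ((t `^ q - s `^ q) / q)%:E)%E.
Proof.
move=> q0 s0; rewrite le_eqVlt => /predU1P[<-|st].
  by rewrite set_itv_ge ?bnd_simp// integral_set0 subrr mul0r.
rewrite integral_itv_obnd_cbnd; last first.
  apply: measurable_funTS; apply/measurable_EFinP.
  exact: (measurableT_comp (measurable_powR _)).
have cont x r : 0 < x -> {for x, continuous (fun x : R => x `^ r)}.
  move=> x0; apply: differentiable_continuous; apply/derivable1_diffP.
  by have [] := is_derive1_powR r x0.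
have D (x : R) : 0 < x -> is_derive x 1 (fun x => x `^ q / q) (x `^ (q - 1)).
  move=> x0; have := is_deriveZ q^-1 (is_derive1_powR q x0).
  have -> : (fun x => x `^ q / q) = q^-1 *: (fun x : R => x `^ q).
    by apply/funext => y; rewrite mulrC.
  by move=> /is_derive_eq; apply; rewrite /GRing.scale/= mulrA mulVf ?gt_eqF// mul1r.
rewrite (@continuous_FTC2 _ (fun x => x `^ (q - 1)) (fun x => x `^ q / q))//.
- by rewrite -EFinB mulrBl.
- apply: continuous_in_subspaceT => x; rewrite inE/= in_itv/= => /andP[sx _].
  by apply: cont; exact: lt_le_trans sx.
- split.
  + move=> x; rewrite in_itv/= => /andP[sx _].
    by have [] := D _ (lt_trans s0 sx).
  + apply: cvg_at_right_filter; apply: cvgMl; exact: cont.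
  + apply: cvg_at_left_filter; apply: cvgMl; apply: cont; exact: lt_trans st.
- move=> x; rewrite in_itv/= => /andP[sx _].
  by rewrite derive1E; have [_ ->] := D _ (lt_trans s0 sx).
Qed.

End power_integral.

(** * The generalised inverse and the integrand of the conjugate *)

Section rinv.
Context {R : realType}.
Implicit Types (f : R -> \bar R).
Local Open Scope ereal_scope.
Local Notation mu := (@lebesgue_measure R).

Lemma rinv_ge0 f s : 0 <= rinv f s.
Proof. by apply: le_ereal_inf_tmp => _ [t [t0 _] <-]; rewrite lee_fin. Qed.

Lemma rinv_mono f s t : (s <= t)%R -> rinv f s <= rinv f t.
Proof.
move=> st; apply: ereal_inf_le_tmp => _ [u [u0 tu] <-]; exists u => //.
by split => //; rewrite (le_lt_trans _ tu)// lee_fin.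
Qed.

Lemma rinv_le f s t : (0 <= t)%R -> s%:E < f t -> rinv f s <= t%:E.
Proof. by move=> t0 st; apply: ereal_inf_lbound; exists t. Qed.

Lemma rinv_ge f s (t : \bar R) : (forall u, (0 <= u)%R -> s%:E < f u -> t <= u%:E) ->
  t <= rinv f s.
Proof. by move=> h; apply: le_ereal_inf_tmp => _ [u [u0 su] <-]; exact: h. Qed.

Lemma measurable_rinv f : measurable_fun setT (rinv f).
Proof.
apply: (measurability _ (ErealGenOInfty.measurableE R)) => //.
move=> _ [_ [c ->] <-]; rewrite setTI; apply: is_interval_measurable.
move=> x y /=; rewrite !in_itv/= !andbT => hx hy z /andP[xz zy].
by rewrite in_itv/= andbT (lt_le_trans hx)// rinv_mono.
Qed.

Variables (N : nat) (F : R -> \bar R).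
Hypothesis N2 : (2 <= N)%N.
Let q : R := (1 - N%:R^-1)%R.
Let g := sobolev_integrand N F.
Hypothesis H1_0 : \int[mu]_(t in `]0%R, 1%R]) g t < +oo.
Hypothesis H1_oo : \int[mu]_(t in `[1%R, +oo[) g t = +oo.

Let N0 : (0 < N%:R :> R)%R. Proof. by rewrite ltr0n (leq_trans _ N2). Qed.

Let q0 : (0 < q)%R.
Proof. by rewrite subr_gt0 invf_lt1// ltr1n. Qed.

Let g_ge0 t : 0 <= g t.
Proof. by rewrite /g /sobolev_integrand mule_ge0 ?rinv_ge0// lee_fin invr_ge0 powR_ge0. Qed.

Let mg : measurable_fun setT g.
Proof.
apply: emeasurable_funM; first exact: measurable_rinv.
apply/measurable_EFinP.
rewrite (_ : (fun _ => _) = (fun t : R => t `^ (- (1 + N%:R^-1)))%R).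
  exact: measurable_powR.
by apply/funext => t; rewrite powRN.
Qed.

Definition sobI (s : R) : \bar R := \int[mu]_(t in `]0%R, s]) g t.

Lemma sobI_ge0 s : 0 <= sobI s.
Proof. exact: integral_ge0. Qed.

Lemma sobI_add s t : (0 <= s)%R -> (s <= t)%R ->
  sobI t = sobI s + \int[mu]_(x in `]s, t]) g x.
Proof.
move=> s0 st; rewrite /sobI -ge0_integral_setU//=; last 2 first.
- exact: measurable_funTS.
- by rewrite disj_set2E; apply/eqP/seteqP; split => x //= -[]; rewrite !in_itv/= => /andP[_ h1] /andP[h2 _]; rewrite leNgt h2 in h1.
by rewrite -itv_bndbnd_setU// bnd_simp.
Qed.

Lemma sobI_mono s t : (0 <= s)%R -> (s <= t)%R -> sobI s <= sobI t.
Proof. by move=> s0 st; rewrite (sobI_add s0 st) leeDl// integral_ge0. Qed.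

Lemma sobI_lty_le1 s : (s <= 1)%R -> sobI s < +oo.
Proof.
move=> s1; apply: le_lt_trans H1_0; apply: ge0_subset_integral => //.
  exact: measurable_funTS.
by apply: subset_itvl; rewrite bnd_simp.
Qed.

Let cvg_int (E : nat -> set R) :
  nondecreasing_seq E -> (forall n, measurable (E n)) ->
  \int[mu]_(x in E i) g x @[i --> \oo] --> \int[mu]_(x in \bigcup_i E i) g x.
Proof.
move=> nd mE; apply: ge0_nondecreasing_set_cvg_integral => //.
by move=> i; exact: measurable_funTS.
Qed.

Lemma sobI_unbounded (M : R) : exists2 s, (0 < s)%R & M%:E < sobI s.
Proof.
apply: contrapT => hM.
have h s : (0 < s)%R -> sobI s <= M%:E.
  by move=> s0; rewrite leNgt; apply/negP => h; apply: hM; exists s.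
have : \int[mu]_(t in `[1%R, +oo[) g t <= M%:E; last by rewrite H1_oo.
have nE : (`[1%R, +oo[%classic : set R) `<=` \bigcup_n `]0%R, n.+1%:R]%classic.
  move=> x; rewrite /= in_itv/= andbT => x1.
  exists (Num.bound x) => //=; rewrite in_itv/= (lt_le_trans ltr01 x1)/=.
  rewrite (le_trans (ltW (archi_boundP _)))//; last by rewrite ler_nat.
  exact: le_trans x1.
have mI n : measurable (`]0%R, n.+1%:R]%classic : set (measurableTypeR R)) by [].
apply: (@le_trans _ _ (\int[mu]_(t in \bigcup_n `]0%R, n.+1%:R]%classic) g t)).
  apply: ge0_subset_integral => //; first exact: bigcup_measurable.
  exact: measurable_funTS.
have nd : nondecreasing_seq (fun n : nat => `]0%R, n.+1%:R]%classic : set R).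
  move=> m n mn; apply/subsetPset; apply: subset_itvl.
  by rewrite bnd_simp ler_nat.
have := cvg_int nd mI.
move=> /cvg_lim <- //.
apply: lime_le; last by apply: nearW => n; exact: h.
apply: ereal_nondecreasing_is_cvgn => m n mn.
by apply: (@sobI_mono m.+1%:R n.+1%:R) => //; rewrite ler_nat.
Qed.

(** The integrals over $]1/(n+1),1]$ increase to the finite integral over $]0,1]$; what they leave
    out is the integral near $0$. *)
Lemma sobI_small (e : R) : (0 < e)%R -> exists2 s, (0 < s)%R & sobI s < e%:E.
Proof.
move=> e0.
have nd : nondecreasing_seq (fun n : nat => `]n.+1%:R^-1%R, 1%R]%classic : set R).
  move=> m n mn; apply/subsetPset; apply: subset_itvr.
  by rewrite bnd_simp lef_pV2 ?posrE// ler_nat.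
have mI n : measurable (`]n.+1%:R^-1%R, 1%R]%classic : set (measurableTypeR R)) by [].
have UE : \bigcup_n `]n.+1%:R^-1%R, 1%R]%classic = `]0%R, 1%R]%classic :> set R.
  apply/seteqP; split => x.
    by move=> [n _] /=; rewrite !in_itv/= => /andP[h ->]; rewrite (lt_trans _ h).
  rewrite /= in_itv/= => /andP[x0 x1]; exists (Num.bound x^-1) => //=.
  rewrite in_itv/= x1 andbT invf_plt ?posrE//.
  by rewrite (lt_le_trans (archi_boundP _)) ?ler_nat// invr_ge0 ltW.
have := cvg_int nd mI.
rewrite UE -/(sobI 1) => cv.
have I1 := sobI_lty_le1 (lexx 1%R).
have I1f : sobI 1 \is a fin_num by rewrite ge0_fin_numE// sobI_ge0.
have /cvgeNP/= cvN := cv.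
have hn : exists n : nat, sobI 1 < \int[mu]_(x in `]n.+1%:R^-1%R, 1%R]) g x + e%:E.
  apply: contrapT => hn.
  have : sobI 1 + e%:E <= sobI 1; last first.
    by rewrite -(fineK I1f) -EFinD lee_fin gerDl leNgt e0.
  have h n : \int[mu]_(x in `]n.+1%:R^-1%R, 1%R]) g x + e%:E <= sobI 1.
    by rewrite leNgt; apply/negP => h; apply: hn; exists n.
  have cv' : \int[mu]_(x in `]n.+1%:R^-1%R, 1%R]) g x + e%:E @[n --> \oo] --> sobI 1 + e%:E.
    by apply: cvgeD => //; [rewrite fin_num_adde_defr|exact: cvg_cst].
  by rewrite -(cvg_lim _ cv')//; apply: lime_le; [exact: cvgP cv'|exact: nearW].
case: hn => n hn; exists n.+1%:R^-1%R => //.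
have n1 : (n.+1%:R^-1 <= 1 :> R)%R by rewrite invf_le1// ler1n.
have In : sobI n.+1%:R^-1 \is a fin_num by rewrite ge0_fin_numE ?sobI_ge0// sobI_lty_le1.
move: hn; rewrite (sobI_add _ n1)// [_ + e%:E]addeC lteD2rE//.
rewrite ge0_fin_numE ?integral_ge0//; apply: le_lt_trans I1.
by rewrite (sobI_add _ n1)// leeDr// sobI_ge0.
Qed.

Hypothesis F_star : forall (th t : R), (0 <= th)%R -> (th <= 1)%R -> (0 <= t)%R ->
  F (th * t)%R <= th%:E * F t.
Hypothesis F_ge0 : forall t, (0 <= t)%R -> 0 <= F t.
Hypothesis F_lty : forall t, (0 <= t)%R -> F t < +oo.

(** [F_star] is what convexity gives together with $F(0)=0$; for the inverse it means that
    $F^{-1}(s)/s$ is nonincreasing. *)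
Lemma rinv_star s t : (0 < s)%R -> (s <= t)%R ->
  s%:E * rinv F t <= t%:E * rinv F s.
Proof.
move=> s0 st; have t0 := lt_le_trans s0 st.
have h : (t / s)^-1%:E * rinv F t <= rinv F s.
  apply: rinv_ge => u u0 su.
  rewrite lee_pdivrMl ?divr_gt0// -EFinM; apply: rinv_le.
    by rewrite mulr_ge0// divr_ge0// ltW.
  have th0 : (0 <= s / t)%R by rewrite divr_ge0// ltW.
  have th1 : (s / t <= 1)%R by rewrite ler_pdivrMr// mul1r.
  have tu0 : (0 <= t / s * u)%R by rewrite mulr_ge0// divr_ge0// ltW.
  have := F_star th0 th1 tu0.
  have -> : (s / t * (t / s * u) = u)%R by field; rewrite !gt_eqF.
  move=> /(lt_le_trans su); rewrite -lte_pdivrMl ?divr_gt0// -EFinM.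
  by have -> : ((s / t)^-1 * s = t)%R by field; rewrite !gt_eqF.
have := lee_wpmul2l (_ : 0 <= t%:E) h; rewrite lee_fin => /(_ (ltW t0)).
by rewrite muleA -EFinM; have -> : (t * (t / s)^-1 = s)%R by field; rewrite !gt_eqF.
Qed.

(** If $b>F^{-1}(s)$, every $u\le b$ with $F(u)>s$ satisfies $s<F(u)\le(u/b)F(b)$, so $bs\le uF(b)$;
    take the infimum over [u]. *)
Lemma rinv_young (b s : R) : (0 <= b)%R -> (0 < s)%R ->
  b%:E * s%:E <= rinv F s * (s%:E + F b).
Proof.
move=> b0 s0; have [h|h] := leP b%:E (rinv F s).
  apply: lee_pmul; rewrite ?lee_fin ?(ltW s0)//.
  by rewrite leeDl// F_ge0.
have [t [t0 st tb]] : exists t : R, [/\ (0 <= t)%R, s%:E < F t & t%:E < b%:E].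
  apply: contrapT => hn; move: h; rewrite ltNge => /negP; apply.
  apply: rinv_ge => u u0 su; rewrite leNgt; apply/negP => ub.
  by apply: hn; exists u.
rewrite lte_fin in tb; have b0' := le_lt_trans t0 tb.
have key u : (0 <= u)%R -> s%:E < F u -> b%:E * s%:E <= u%:E * (s%:E + F b).
  move=> u0 su; have [ub|bu] := leP u b; last first.
    apply: lee_pmul; rewrite ?lee_fin ?(ltW s0) ?(ltW bu)//.
    by rewrite leeDl// F_ge0.
  have h1 := F_star (_ : 0 <= u / b)%R (_ : u / b <= 1)%R b0.
  have := h1 (divr_ge0 u0 b0); rewrite ler_pdivrMr// mul1r => /(_ ub).
  rewrite divfK ?gt_eqF// => /(le_trans (ltW su)) h2.
  have := lee_wpmul2l (_ : 0 <= b%:E) h2; rewrite lee_fin => /(_ b0).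
  rewrite muleA -!EFinM (mulrC b (u / b)%R) divfK ?gt_eqF// => /le_trans; apply.
  by apply: lee_wpmul2l; rewrite ?lee_fin// leeDr// lee_fin ltW.
have Fbf : F b \is a fin_num by rewrite ge0_fin_numE ?F_ge0// F_lty.
have sF : (0 < s + fine (F b))%R by rewrite ltr_pwDl// fine_ge0// F_ge0.
rewrite -(fineK Fbf) -EFinD [rinv F s * _]muleC -lee_pdivrMl//.
apply: rinv_ge => u u0 su; rewrite lee_pdivrMl//.
have := key _ u0 su; rewrite -{1}(fineK Fbf) -EFinD [u%:E * _]muleC; exact.
Qed.

(** By [rinv_star] an infinite value at [t] propagates down to some $s<1$, hence by monotonicity to
    all of $]s,1]$, against integrability near $0$. *)
Lemma rinv_lty t : (0 < t)%R -> rinv F t < +oo.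
Proof.
move=> t0; rewrite ltey; apply/eqP => rt.
pose s := Num.min t (2^-1)%R.
have s0 : (0 < s)%R by rewrite /s lt_min t0 invr_gt0 ltr0n.
have st : (s <= t)%R by rewrite ge_min lexx.
have s1 : (s < 1)%R by rewrite (@le_lt_trans _ _ (2^-1)%R) ?ge_min ?lexx ?orbT// invf_lt1// ltr1n.
have := rinv_star s0 st; rewrite rt gt0_muley// leye_eq => /eqP rs.
have rsE : rinv F s = +oo.
  by move: (rinv_ge0 F s) rs; case: (rinv F s).
have := sobI_lty_le1 (lexx 1%R); rewrite (sobI_add (ltW s0) (ltW s1)).
rewrite (_ : \int[mu]_(x in `]s, 1%R]) g x = +oo); first by rewrite addey// gt_eqF// (lt_le_trans _ (sobI_ge0 _)).
rewrite (eq_integral (cst +oo)); last first.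
  move=> x; rewrite inE/= in_itv/= => /andP[sx x1].
  have rx : rinv F x = +oo by apply/eqP; rewrite -leye_eq -rsE rinv_mono// ltW.
  rewrite /g /sobolev_integrand rx gt0_mulye// lte_fin invr_gt0 powR_gt0//.
  exact: lt_trans sx.
rewrite integral_cst//= lebesgue_measure_itv/= lte_fin s1 -EFinB gt0_mulye//.
by rewrite lte_fin subr_gt0.
Qed.

Lemma sobI_lty s : sobI s < +oo.
Proof.
have [s1|s1] := leP s 1%R; first exact: sobI_lty_le1.
rewrite (sobI_add ler01 (ltW s1)) lte_add_pinfty ?sobI_lty_le1//.
apply: (@le_lt_trans _ _ (\int[mu]_(x in `]1%R, s]) (rinv F s))).
  apply: ge0_le_integral => //.
    exact: measurable_funTS.
  move=> x; rewrite /= in_itv/= => /andP[x1 xs].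
  rewrite /g /sobolev_integrand -[leRHS]mule1; apply: lee_pmul; rewrite ?rinv_ge0//.
  - by rewrite lee_fin invr_ge0 powR_ge0.
  - exact: rinv_mono.
  - rewrite lee_fin invf_le1 ?powR_gt0 ?(lt_trans ltr01)//.
    have p0 : (0 <= 1 + N%:R^-1 :> R)%R by rewrite addr_ge0// invr_ge0.
    have := ge0_ler_powR p0 (_ : (1 : R)%R \in Num.nneg) (_ : x \in Num.nneg) (ltW x1).
    by rewrite powR1; apply; rewrite nnegrE// (le_trans _ (ltW x1)).
have rf : rinv F s \is a fin_num.
  by rewrite ge0_fin_numE ?rinv_ge0// rinv_lty// (lt_trans ltr01).
rewrite -(fineK rf) integral_cst//= lebesgue_measure_itv/= lte_fin s1 -EFinB.
by rewrite -EFinM ltry.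
Qed.

(** A zero at [t] propagates to the right and makes [sobI] bounded, against divergence at
    infinity. *)
Lemma rinv_gt0 t : (0 < t)%R -> 0 < rinv F t.
Proof.
move=> t0; rewrite lt_neqAle rinv_ge0 andbT eq_sym; apply/eqP => rt.
have It : sobI t \is a fin_num by rewrite ge0_fin_numE ?sobI_ge0// sobI_lty.
have [s s0] := sobI_unbounded (fine (sobI t)); rewrite fineK// ltNge => /negP; apply.
have [st|ts] := leP s t; first by apply: sobI_mono => //; exact: ltW.
rewrite (sobI_add (ltW t0) (ltW ts)) integral0_eq ?adde0// => x.
rewrite /= in_itv/= => /andP[tx xs].
have := rinv_star t0 (ltW tx); rewrite rt mule0 => h.
have rx : rinv F x = 0.
  apply/eqP; rewrite eq_le rinv_ge0 andbT.
  by rewrite -(lee_pmul2l (x := t%:E))// mule0.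
by rewrite /g /sobolev_integrand rx mul0e.
Qed.

Let A (s : R) : R := (fine (rinv F s) / s)%R.
Let I (s : R) : R := fine (sobI s).

Lemma rinvE s : (0 < s)%R -> rinv F s = (A s * s)%R%:E.
Proof.
move=> s0; rewrite /A divfK ?gt_eqF// fineK//.
by rewrite ge0_fin_numE ?rinv_ge0// rinv_lty.
Qed.

Lemma rinv_A_gt0 s : (0 < s)%R -> (0 < A s)%R.
Proof.
by move=> s0; have := rinv_gt0 s0; rewrite rinvE// lte_fin pmulr_lgt0.
Qed.

Lemma rinv_A_ni s1 s2 : (0 < s1)%R -> (s1 <= s2)%R -> (A s2 <= A s1)%R.
Proof.
move=> s10 s12; have s20 := lt_le_trans s10 s12.
have := rinv_star s10 s12; rewrite !rinvE// -!EFinM lee_fin.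
rewrite (_ : s1 * (A s2 * s2) = (s1 * s2) * A s2)%R; last by ring.
rewrite (_ : s2 * (A s1 * s1) = (s1 * s2) * A s1)%R; last by ring.
by rewrite ler_pM2l// mulr_gt0.
Qed.

(** One factor $x$ of the inverse is spent on $x^{-1-1/N}$: this is where the exponent $q=1-1/N$
    arises. *)
Lemma gE x : (0 < x)%R -> g x = (A x * x `^ (q - 1))%R%:E.
Proof.
move=> x0; rewrite /g /sobolev_integrand rinvE// -EFinM; congr EFin.
rewrite -mulrA -powRN; congr (_ * _)%R.
rewrite -[X in (X * _)%R]powRr1 ?(ltW x0)// -powRD; last by apply/implyP => _; rewrite gt_eqF.
by congr (_ `^ _)%R; rewrite /q; ring.
Qed.

Let IB s1 s2 : (0 < s1)%R -> (s1 <= s2)%R ->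
  (I s2 - I s1)%R%:E = \int[mu]_(x in `]s1, s2]) g x.
Proof.
move=> s10 s12.
have f1 : sobI s1 \is a fin_num by rewrite ge0_fin_numE ?sobI_ge0// sobI_lty.
have f2 : sobI s2 \is a fin_num by rewrite ge0_fin_numE ?sobI_ge0// sobI_lty.
rewrite EFinB /I !fineK// (sobI_add (ltW s10) s12) addeAC subee ?add0e//.
Qed.

Let mp (s1 s2 : R) : measurable_fun (`]s1, s2]%classic : set R) (fun x : R => (x `^ (q - 1))%R%:E).
Proof. by apply: measurable_funTS; apply/measurable_EFinP; exact: measurable_powR. Qed.

Let Dq (c D d : R) : (c * (D / q) <= d -> c * D <= q * d)%R.
Proof.
move=> /(ler_wpM2l (ltW q0)); rewrite (_ : q * (c * (D / q)) = c * D)%R//.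
by field; rewrite gt_eqF.
Qed.

Let qD (c D d : R) : (d <= c * (D / q) -> q * d <= c * D)%R.
Proof.
move=> /(ler_wpM2l (ltW q0)); rewrite (_ : q * (c * (D / q)) = c * D)%R//.
by field; rewrite gt_eqF.
Qed.

Let cE c s1 s2 : (0 <= c)%R -> c%:E * \int[mu]_(x in `]s1, s2]) (x `^ (q - 1))%R%:E =
  \int[mu]_(x in `]s1, s2]) (c * x `^ (q - 1))%R%:E.
Proof.
move=> c0; under [in RHS]eq_integral do rewrite EFinM.
rewrite ge0_integralZl_EFin//; try exact: mp.
by move=> x _; rewrite lee_fin powR_ge0.
Qed.

Let mpc c (s1 s2 : R) :
  measurable_fun (`]s1, s2]%classic : set R) (fun x : R => (c * x `^ (q - 1))%R%:E).
Proof.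
by apply: measurable_funTS; apply/measurable_EFinP; apply: measurable_funM.
Qed.

Lemma rinv_I_ge s1 s2 : (0 < s1)%R -> (s1 <= s2)%R ->
  (A s2 * (s2 `^ q - s1 `^ q) <= q * (I s2 - I s1))%R.
Proof.
move=> s10 s12; have s20 := lt_le_trans s10 s12; apply: Dq.
have cA : (0 <= A s2)%R by rewrite ltW// rinv_A_gt0.
rewrite -lee_fin IB// EFinM -(integral_powR q0 s10 s12) (cE _ _ cA).
apply: ge0_le_integral => //; try exact: mpc; try exact: (measurable_funTS mg).
- by move=> x _; rewrite lee_fin mulr_ge0 ?powR_ge0.
- move=> x; rewrite /= in_itv/= => /andP[sx xs]; have x0 := lt_trans s10 sx.
  by rewrite gE// lee_fin ler_wpM2r ?powR_ge0// rinv_A_ni.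
Qed.

Lemma rinv_I_le s1 s2 : (0 < s1)%R -> (s1 <= s2)%R ->
  (q * (I s2 - I s1) <= A s1 * (s2 `^ q - s1 `^ q))%R.
Proof.
move=> s10 s12; have s20 := lt_le_trans s10 s12; apply: qD.
have cA : (0 <= A s1)%R by rewrite ltW// rinv_A_gt0.
rewrite -lee_fin IB// EFinM -(integral_powR q0 s10 s12) (cE _ _ cA).
apply: ge0_le_integral => //; try exact: mpc; try exact: (measurable_funTS mg).
move=> x; rewrite /= in_itv/= => /andP[sx xs]; have x0 := lt_trans s10 sx.
  by rewrite gE// lee_fin ler_wpM2r ?powR_ge0// rinv_A_ni// ltW.
Qed.

End rinv.

Local Close Scope ereal_scope.

Arguments rinv : simpl never.

Section conjugate.
Context {R : realType}.
Local Open Scope ereal_scope.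
Local Notation mu := (@lebesgue_measure R).
Variables (N : nat) (F : R -> \bar R).
Hypothesis N2 : (2 <= N)%N.
Let q : R := (1 - N%:R^-1)%R.
Hypothesis H1_0 : \int[mu]_(t in `]0%R, 1%R]) sobolev_integrand N F t < +oo.
Hypothesis H1_oo : \int[mu]_(t in `[1%R, +oo[) sobolev_integrand N F t = +oo.

Definition sobG (t : R) : \bar R := rinv (sobI N F) t.

Lemma sobG_fin t : sobG t \is a fin_num.
Proof.
rewrite ge0_fin_numE ?rinv_ge0//; have [s s0 ts] := sobI_unbounded H1_oo t.
by rewrite (le_lt_trans (rinv_le (ltW s0) ts))// ltry.
Qed.

Lemma sobG_gt0 t : (0 < t)%R -> (0 < fine (sobG t))%R.
Proof.
move=> t0; have [s s0 Is] := sobI_small H1_0 t0.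
rewrite -lte_fin fineK ?sobG_fin//; apply: (@lt_le_trans _ _ s%:E) => //.
apply: rinv_ge => u u0 tu; rewrite lee_fin leNgt; apply/negP => us.
by move: (lt_trans Is tu); rewrite ltNge sobI_mono// ltW.
Qed.

Lemma sobG_mono s t : (s <= t)%R -> (fine (sobG s) <= fine (sobG t))%R.
Proof. by move=> st; rewrite -lee_fin !fineK ?sobG_fin// rinv_mono. Qed.

Lemma sobG_ge0 t : (0 <= fine (sobG t))%R.
Proof. by rewrite fine_ge0// rinv_ge0. Qed.

Hypothesis F_star : forall (th t : R), (0 <= th)%R -> (th <= 1)%R -> (0 <= t)%R ->
  F (th * t)%R <= th%:E * F t.
Hypothesis F_ge0 : forall t, (0 <= t)%R -> 0 <= F t.
Hypothesis F_lty : forall t, (0 <= t)%R -> F t < +oo.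

Let q0 : (0 < q)%R.
Proof. by rewrite subr_gt0 invf_lt1// ?ltr1n// ltr0n (leq_trans _ N2). Qed.

Let A (s : R) : R := (fine (rinv F s) / s)%R.
Let I (s : R) : R := fine (sobI N F s).
Let G (t : R) : R := fine (sobG t).

Let If s : sobI N F s \is a fin_num.
Proof. by rewrite ge0_fin_numE ?sobI_ge0//; apply: sobI_lty => //. Qed.

Let A0 s : (0 < s)%R -> (0 < A s)%R.
Proof. by move=> s0; apply: (rinv_A_gt0 H1_0). Qed.

Let A_ni s1 s2 : (0 < s1)%R -> (s1 <= s2)%R -> (A s2 <= A s1)%R.
Proof. by move=> h1 h2; apply: (rinv_A_ni H1_0). Qed.

Let I_ge s1 s2 : (0 < s1)%R -> (s1 <= s2)%R ->
  (A s2 * (s2 `^ q - s1 `^ q) <= q * (I s2 - I s1))%R.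
Proof. by move=> h1 h2; apply: rinv_I_ge. Qed.

Let I_le s1 s2 : (0 < s1)%R -> (s1 <= s2)%R ->
  (q * (I s2 - I s1) <= A s1 * (s2 `^ q - s1 `^ q))%R.
Proof. by move=> h1 h2; apply: rinv_I_le. Qed.

Let I_ge0 s : (0 < s)%R -> (0 <= I s)%R.
Proof. by move=> _; rewrite fine_ge0// sobI_ge0. Qed.

Let I_small e : (0 < e)%R -> exists2 s, (0 < s)%R & (I s < e)%R.
Proof.
move=> e0; have [s s0 Is] := sobI_small H1_0 e0; exists s => //.
by rewrite -lte_fin fineK.
Qed.

Let G_gt t s : (0 <= t)%R -> (G t < s)%R -> (t < I s)%R.
Proof.
move=> t0; rewrite -lte_fin fineK ?sobG_fin// => h.
rewrite -lte_fin fineK//.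
have [_ [u [u0 tu] <-] us] := ereal_inf_lt h.
by rewrite (lt_le_trans tu)// sobI_mono// ltW.
Qed.

Let G_le t s : (0 <= t)%R -> (0 < s)%R -> (s < G t)%R -> (I s <= t)%R.
Proof.
move=> t0 s0; rewrite -lte_fin fineK ?sobG_fin// => h.
rewrite leNgt; apply/negP; rewrite -lte_fin fineK// => h2.
by have := rinv_le (ltW s0) h2; rewrite leNgt => /negP.
Qed.

Lemma sobG0 : fine (sobG 0) = 0%R.
Proof.
exact: (@G0 _ q A I G q0 A0 I_ge I_ge0 (fun t _ => sobG_ge0 t) G_le).
Qed.

Lemma sobG_convex t0 t1 t2 : (0 <= t0)%R -> (t0 < t1)%R -> (t1 < t2)%R ->
  ((G t1 `^ q - G t0 `^ q) * (t2 - t1) <= (G t2 `^ q - G t1 `^ q) * (t1 - t0))%R.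
Proof.
exact: (@H_convex _ q A I G q0 A0 A_ni I_ge I_le I_ge0 I_small (fun t _ => sobG_ge0 t) G_gt G_le).
Qed.

(** With $g=G(t_2)$, [rinv_young] reads $b\le A(g)(g+F(b))$, and the slope of $G^q$ up to $t_2$ is
    at most $q/A(g)$; the factor $A(g)$ cancels. *)
Lemma sobG_young (b t1 t2 : R) : (0 <= b)%R -> (0 <= t1)%R -> (t1 <= t2)%R -> (0 < t2)%R ->
  (b * (G t2 `^ q - G t1 `^ q) <= q * (t2 - t1) * (G t2 + fine (F b)))%R.
Proof.
move=> b0 t10 t12 t20; have g0 := sobG_gt0 t20.
have h1 := @H_slope_le _ q A I G q0 A0 A_ni I_ge I_le I_ge0 I_small (fun t _ => sobG_ge0 t) G_gt G_le t1 t2 t10 t12 t20.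
have := rinv_young F_star F_ge0 F_lty b0 g0.
have Fbf : F b \is a fin_num by rewrite ge0_fin_numE ?F_ge0// F_lty.
have Fb0 : (0 <= fine (F b))%R by rewrite fine_ge0// F_ge0.
rewrite -{1}(fineK Fbf) (rinvE H1_0 F_star g0) -EFinD -!EFinM lee_fin -/(A (G t2)).
rewrite mulrAC ler_pM2r// => h2.
have dH : (0 <= G t2 `^ q - G t1 `^ q)%R.
  rewrite subr_ge0; apply: ge0_ler_powR; rewrite ?nnegrE ?sobG_ge0 ?(ltW q0)//.
  exact: sobG_mono.
apply: (le_trans (ler_wpM2r dH h2)).
rewrite mulrAC; apply: ler_wpM2r => //.
by rewrite addr_ge0// ltW.
Qed.

End conjugate.

(** * The second complementary function *)

Section biconjugate.
Context {R : realType}.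
Local Open Scope ereal_scope.
Variables (T : Type) (m : T -> R -> \bar R) (x : T).
Hypothesis m_ge0 : forall t, (0 <= t)%R -> 0 <= m x t.
Hypothesis m0 : m x 0%R = 0.

Let ms := complementary m.
Let F := complementary ms x.

Let ms_ge0 s : 0 <= ms x s.
Proof.
apply: ereal_sup_ubound; exists 0%R; first exact: lexx.
by rewrite m0 sube0 mulr0.
Qed.

Let ms0 : ms x 0%R = 0.
Proof.
apply/eqP; rewrite eq_le ms_ge0 andbT; apply: ge_ereal_sup => _ [t /= t0 <-].
by rewrite mul0r add0e oppe_le0 m_ge0.
Qed.

Lemma biconj_ge0 t : 0 <= F t.
Proof.
apply: ereal_sup_ubound; exists 0%R; first exact: lexx.
by rewrite ms0 sube0 mulr0.
Qed.

(** The biconjugate is a supremum of affine functions whose value at $0$ is nonpositive, as [ms] is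
    nonnegative. *)
Lemma biconj_star th t : (0 <= th)%R -> (th <= 1)%R -> F (th * t)%R <= th%:E * F t.
Proof.
move=> th0 th1; apply: ge_ereal_sup => _ [s /= s0 <-].
have h : (t * s)%:E - ms x s <= F t by apply: ereal_sup_ubound; exists s.
have th0' : 0 <= th%:E by rewrite lee_fin.
apply: le_trans (lee_wpmul2l th0' h).
rewrite -mulrA EFinM; have := ms_ge0 s; case: (ms x s) => //= [r r0|_]; last first.
  by rewrite addeNy leNye.
move: r0; rewrite lee_fin => r0.
rewrite /= -?EFinB -?EFinM -?EFinB lee_fin mulrBr.
by rewrite lerD2l lerN2 ler_piMl.
Qed.

Lemma biconj_le t : (0 <= t)%R -> F t <= m x t.
Proof.
move=> t0; apply: ge_ereal_sup => _ [s /= s0 <-].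
have h : (s * t)%:E - m x t <= ms x s by apply: ereal_sup_ubound; exists t.
move: h (m_ge0 t0) (ms_ge0 s); rewrite mulrC.
case: (m x t) => //= [r|]; last by move=> *; rewrite leey.
case: (ms x s) => //= [r'|]; last by move=> *; rewrite leNye.
rewrite -!EFinB !lee_fin; lra.
Qed.

End biconjugate.

Local Close Scope ereal_scope.
Local Close Scope ereal_scope.

(** * Profiles: the conjugate in both variables *)

Section real_preliminaries.
Context {R : realType}.

Lemma cvg_powR (T : Type) (F : set_system T) {FF : ProperFilter F} (f : T -> R) (l r : R) :
  0 < r -> (forall s, 0 <= f s) -> f s @[s --> F] --> l ->
  (f s `^ r) @[s --> F] --> l `^ r.
Proof.
move=> r0 f0 fl.
have l0 : 0 <= l.
  rewrite leNgt; apply/negP => l0.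
  have /cvgrPdist_lt/(_ _ (_ : 0 < - l)) := fl; rewrite oppr_gt0 => /(_ l0) h.
  have [s] := filter_ex h; rewrite ltr_norml => /andP[h1 _].
  have := f0 s; lra.
move: l0; rewrite le_eqVlt => /predU1P[l0|l0]; last first.
  have cl : {for l, continuous (fun z : R => z `^ r)}.
    apply: differentiable_continuous; apply/derivable1_diffP.
    by have [] := is_derive1_powR r l0.
  exact: (cvg_comp f (fun z => z `^ r) fl cl).
(* The power need not be derivable at $0$, so the limit $0$ is treated through the threshold
   $e^{1/r}$. *)
rewrite -l0 powR0 ?gt_eqF//; apply/cvgr0Pnorm_lt => e e0.
have e1 : 0 < e `^ r^-1 by exact: powR_gt0.
have := fl; rewrite -l0 => /cvgr0Pnorm_lt/(_ _ e1); apply: filterS => s.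
rewrite !ger0_norm ?powR_ge0// => fs.
have := gt0_ltr_powR r0 (_ : f s \in Num.nneg) (_ : e `^ r^-1 \in Num.nneg) fs.
by rewrite -powRrM mulVf ?gt_eqF// powRr1 ?ltW//; apply; rewrite nnegrE// powR_ge0.
Qed.

(** The hypothesis compares values near [c] with the value at [c] only, not with each other. Go up
    to the supremum of the points where the claim holds, then step past it. *)
Lemma local_nondecreasing (f : R -> R) (a b : R) : a <= b ->
  (forall c, a <= c <= b -> exists d : R, 0 < d /\ forall s, a <= s <= b -> `|s - c| < d ->
     (s <= c -> f s <= f c) /\ (c <= s -> f c <= f s)) ->
  f a <= f b.
Proof.
move=> ab loc; pose A := [set s | a <= s <= b /\ f a <= f s].
have Aa : A a by split; rewrite ?lexx.
have hs : has_sup A by split; [exists a|exists b => s [/andP[]]].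
pose c := sup A.
have ac : a <= c by exact: (sup_upper_bound hs).
have cb : c <= b by apply: ge_sup; [exists a|move=> s [/andP[]]].
have [d [d0 hd]] := loc c (introT andP (conj ac cb)).
have [s [sab fs] sc] := sup_adherent d0 hs.
have sc' : s <= c by exact: (sup_upper_bound hs).
have fac : f a <= f c.
  apply: (le_trans fs); have [] := hd s sab; last by move=> h _; exact: h.
  by rewrite ler0_norm ?subr_le0// -/c in sc *; lra.
have [cb'|bc] := ltP c b; last by rewrite (_ : b = c)//; apply/eqP; rewrite eq_le cb bc.
pose m := Num.min b (c + d / 2).
have cm : c < m by rewrite lt_min cb'/= ltrDl divr_gt0.
have mb : m <= b by rewrite ge_min lexx.
have mb2 : m <= c + d / 2 by rewrite ge_min lexx orbT.
have am : a <= m <= b by rewrite mb (le_trans ac (ltW cm)).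
have [|_ h] := hd m am; first by rewrite ger0_norm ?subr_ge0 ?ltW//; lra.
have : m <= c by apply: (sup_upper_bound hs); split => //; exact: (le_trans fac (h (ltW cm))).
by rewrite leNgt cm.
Qed.

End real_preliminaries.

Section profile.
Context {R : realType} {N : nat}.
Local Notation V := 'rV[R]_N.
Local Notation BV := (BV R N).
Local Notation mu := (@bleb R N).

(** What the estimates use of the conjugate. Convexity is known where the $\phi_i$ are N-functions,
    that is off one null set, whereas the null set of the derivative bound depends on [t] and
    [i]. *)
Record sobolev_profile (Omega : set V) (q nu c0 : R) (G : V -> R -> R) : Prop := {
  sp_ge0 : forall x t, 0 <= G x t ;
  sp_gt0 : forall x t, Omega x -> 0 < t -> 0 < G x t ;
  sp_mono : forall x s t, Omega x -> s <= t -> G x s <= G x t ;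
  sp_lip : forall t, 0 <= t -> exists k, 0 <= k /\
    forall x y, Omega x -> Omega y -> `|G x t - G y t| <= k * `|x - y| ;
  sp_good : exists Z : set BV, [/\ measurable Z, mu Z = 0%E &
    forall x, Omega x -> ~ Z x -> G x 0 = 0 /\
      forall t0 t1 t2, 0 <= t0 -> t0 < t1 -> t1 < t2 ->
      (G x t1 `^ q - G x t0 `^ q) * (t2 - t1) <= (G x t2 `^ q - G x t1 `^ q) * (t1 - t0)] ;
  sp_der : forall (i : 'I_N) t, 0 < t -> exists Z : set BV, [/\ measurable Z, mu Z = 0%E &
    forall x, Omega x -> ~ Z x -> derivable (G^~ t) x (delta_mx ord0 i) ->
      `|partial i (G^~ t) x| <= c0 * (G x t + G x t `^ (1 + nu))] }.

Variables (Omega : set V) (q nu c0 : R) (G : V -> R -> R).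
Hypothesis oO : open Omega.
Hypothesis bO : bounded_set Omega.
Hypothesis q0 : 0 < q.
Hypothesis GP : sobolev_profile Omega q nu c0 G.

Lemma null_dense (Z : set BV) (U : set V) x : measurable Z -> mu Z = 0%E -> open U -> U x ->
  exists2 y, U y & ~ Z y.
Proof.
move=> mZ Z0 oU Ux; apply: contrapT => h.
have UZ : U `<=` Z by move=> y Uy; apply: contrapT => nZ; apply: h; exists y.
have := bleb_open_gt0 oU Ux.
rewrite ltNge => /negP; apply; rewrite -Z0; apply: le_measure; rewrite ?inE//.
exact: open_borel.
Qed.

(** Null sets have empty interior, so an inequality between continuous functions passes from almost
    every point of an open set to all of them. This removes the exceptional set of [sp_good]. *)
Lemma ext_ge0 (Z : set BV) (f : V -> R) (U : set V) : measurable Z -> mu Z = 0%E -> open U ->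
  (forall x, U x -> f y @[y --> x] --> f x) ->
  (forall x, U x -> ~ Z x -> 0 <= f x) -> forall x, U x -> 0 <= f x.
Proof.
move=> mZ Z0 oU cf fp x Ux; rewrite leNgt; apply/negP => fx.
have nb : nbhs x (fun y => U y /\ f y < 0).
  apply: filterI; first exact: open_nbhs_nbhs.
  have /cvgrPdist_lt/(_ _ (_ : 0 < - f x)) := cf x Ux; rewrite oppr_gt0 => /(_ fx).
  by apply: filterS => y; rewrite ltr_norml => /andP[h1 _]; lra.
have [y Uy nZ] := null_dense mZ Z0 (@open_interior _ _) nb.
have [Uy' fy] := interior_subset Uy.
by have := fp y Uy' nZ; rewrite leNgt fy.
Qed.

Lemma profile_cts t x : 0 <= t -> Omega x -> G y t @[y --> x] --> G x t.
Proof.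
move=> t0 Ox; have [k [k0 hk]] := sp_lip GP t0.
apply/(@cvgrPdist_lt _ _ _ (nbhs x) (nbhs_filter x)) => e e0.
have k1 : 0 < k + 1 by rewrite ltr_wpDl.
have nb : nbhs x Omega by exact: open_nbhs_nbhs.
have ek : 0 < e / (k + 1) by rewrite divr_gt0.
have nx : nbhs x (fun y => `|x - y| < e / (k + 1)).
  by apply/nbhs_ballP; exists (e / (k + 1)) => // y; rewrite -ball_normE.
apply: filterS2 nb nx => y Oy xy; apply: (le_lt_trans (hk _ _ Ox Oy)).
apply: (@le_lt_trans _ _ ((k + 1) * `|x - y|)); first by rewrite ler_wpM2r// lerDl.
by rewrite mulrC -ltr_pdivlMr.
Qed.

Lemma profile_G0 x : Omega x -> G x 0 = 0.
Proof.
move=> Ox; have [Z [mZ Z0 hZ]] := sp_good GP.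
apply/eqP; rewrite eq_le (sp_ge0 GP) andbT.
rewrite -oppr_ge0; move: x Ox; apply: (@ext_ge0 Z (fun x => - G x 0) Omega) => //.
  by move=> x Ox; have h := profile_cts (lexx 0) Ox; exact: (cvgN h).
by move=> x Ox nZ; have [-> _] := hZ x Ox nZ; rewrite oppr0.
Qed.

Definition profH x t : R := G x t `^ q.

Lemma profH_ge0 x t : 0 <= profH x t. Proof. exact: powR_ge0. Qed.

Lemma profH_cts t x : 0 <= t -> Omega x -> profH y t @[y --> x] --> profH x t.
Proof.
move=> t0 Ox; apply: (@cvg_powR R V (nbhs x) (nbhs_pfilter x)) => //.
  by move=> s; exact: (sp_ge0 GP).
exact: profile_cts.
Qed.

Lemma profH0 x : Omega x -> profH x 0 = 0.
Proof. by move=> Ox; rewrite /profH profile_G0// powR0// gt_eqF. Qed.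

Lemma profH_mono x s t : Omega x -> s <= t -> profH x s <= profH x t.
Proof.
move=> Ox st; apply: ge0_ler_powR; rewrite ?nnegrE ?(ltW q0) ?(sp_ge0 GP)//.
exact: (sp_mono GP).
Qed.

Lemma profH_convex x t0 t1 t2 : Omega x -> 0 <= t0 -> t0 < t1 -> t1 < t2 ->
  (profH x t1 - profH x t0) * (t2 - t1) <= (profH x t2 - profH x t1) * (t1 - t0).
Proof.
move=> Ox t00 t01 t12; have [Z [mZ Z0 hZ]] := sp_good GP.
rewrite -subr_ge0; move: x Ox.
pose f x := (profH x t2 - profH x t1) * (t1 - t0) - (profH x t1 - profH x t0) * (t2 - t1).
apply: (@ext_ge0 Z f Omega) => //.
  have t10 : 0 <= t1 by rewrite (le_trans t00)// ltW.
  have t20 : 0 <= t2 by rewrite (le_trans t10)// ltW.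
  move=> x Ox; have c0' := profH_cts t00 Ox; have c1 := profH_cts t10 Ox.
  have c2 := profH_cts t20 Ox.
  exact: (cvgB (cvgM (cvgB c2 c1) (cvg_cst (t1 - t0))) (cvgM (cvgB c1 c0') (cvg_cst (t2 - t1)))).
by move=> x Ox nZ; rewrite subr_ge0; have [_] := hZ x Ox nZ; exact.
Qed.

(** For a convex function the chord over $[s,t]$ is no steeper than a chord that starts at a later
    point [tau]. *)
Lemma profH_slope x s t tau d : Omega x -> 0 <= s -> s <= t -> t <= tau -> 0 < d ->
  profH x t - profH x s <= (t - s) * ((profH x (tau + d) - profH x tau) / d).
Proof.
move=> Ox s0; rewrite le_eqVlt => /predU1P[->|st]; first by rewrite !subrr mul0r.
move=> ttau d0; have t0 := le_lt_trans s0 st.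
set D := profH x (tau + d) - profH x tau.
have h1 : profH x t - profH x s <= (t - s) * ((profH x (tau + d) - profH x t) / (tau + d - t)).
  have p : 0 < tau + d - t by lra.
  rewrite mulrA ler_pdivlMr// [leRHS]mulrC; apply: profH_convex => //; lra.
apply: (le_trans h1); rewrite ler_pM2l ?subr_gt0//.
have p : 0 < tau + d - t by lra.
rewrite ler_pdivrMr// mulrAC ler_pdivlMr//.
move: ttau; rewrite le_eqVlt => /predU1P[tE|ttau].
  by rewrite /D -tE (_ : t + d - t = d)//; ring.
have := @profH_convex x t tau (tau + d) Ox (ltW t0) ttau (_ : tau < tau + d).
rewrite ltrDl => /(_ d0); rewrite -/D (_ : tau + d - tau = d); last by ring.
move=> h; rewrite (_ : profH x (tau + d) - profH x t = D + (profH x tau - profH x t)); last first.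
  by rewrite /D; ring.
nra.
Qed.

Lemma profile_bound t : 0 <= t -> exists B, 0 < B /\ forall x, Omega x -> G x t <= B.
Proof.
move=> t0; have [k [k0 hk]] := sp_lip GP t0.
have [r [r0 [Or _]]] := bounded_box bO.
have [[y Oy]|nO] := pselect (exists y, Omega y); last first.
  by exists 1; split => // x Ox; exfalso; apply: nO; exists x.
exists (G y t + k * (r + r) + 1); split.
  by rewrite ltr_wpDl// addr_ge0 ?(sp_ge0 GP)// mulr_ge0// addr_ge0// ltW.
move=> x Ox; have := hk x y Ox Oy; rewrite ler_norml => /andP[_ h].
have : k * `|x - y| <= k * (r + r).
  by rewrite ler_wpM2l// (le_trans (ler_normB _ _))// lerD// Or.
lra.
Qed.

Lemma profH_bound t : 0 <= t -> exists B, 0 < B /\ forall x, Omega x -> profH x t <= B.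
Proof.
move=> /profile_bound[B [B0 hB]]; exists (B `^ q); split; first exact: powR_gt0.
move=> x Ox; apply: ge0_ler_powR; rewrite ?nnegrE ?(ltW q0) ?(sp_ge0 GP) ?(ltW B0)//.
exact: hB.
Qed.

(** Joint continuity follows from continuity in [x]: by convexity $H(y,\cdot)$ is Lipschitz near [t]
    with constant $H(y,t+2)$, which stays bounded as [y] tends to [x]. *)
Lemma profH_cvg (T : Type) (F : set_system T) {FF : ProperFilter F} (y : T -> V) (w : T -> R) (x : V) (t : R) :
  Omega x -> (forall s, 0 <= w s) -> 0 <= t -> y @ F --> x -> w @ F --> t ->
  profH (y s) (w s) @[s --> F] --> profH x t.
Proof.
move=> Ox w0 t0 yx wt.
have cH b : 0 <= b -> profH (y s) b @[s --> F] --> profH x b.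
  by move=> b0; exact: (cvg_comp y (fun z => profH z b) yx (profH_cts b0 Ox)).
have t2 : 0 <= t + 1 + 1 by rewrite !addr_ge0.
have c1 : `|w s - t| * profH (y s) (t + 1 + 1) + `|profH (y s) t - profH x t| @[s --> F] --> (0 : R).
  rewrite -[X in _ --> X](addr0) -{1}(mul0r (profH x (t + 1 + 1))).
  have sub0 (f : T -> R) (l : R) : f s @[s --> F] --> l -> `|f s - l| @[s --> F] --> (0 : R).
    move=> fl; rewrite -(@normr0 _ R) -(subrr l); apply: cvg_norm; apply: cvgB => //.
    exact: cvg_cst.
  apply: cvgD; last by apply: sub0; exact: cH.
  by apply: cvgM; [exact: sub0|exact: cH].
apply/cvgrPdist_lt => e e0; have /cvgr0Pnorm_lt/(_ e e0) c2 := c1.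
have nO : \forall s \near F, Omega (y s) by apply: yx; exact: open_nbhs_nbhs.
have nw : \forall s \near F, `|t - w s| < 1.
  by have /cvgrPdist_lt/(_ _ (ltr01 : 0 < 1 :> R)) := wt.
apply: filterS3 nO nw c2 => s Os; rewrite ltr_norml => /andP[w1 w2].
rewrite ger0_norm; last by rewrite addr_ge0// mulr_ge0 ?profH_ge0.
rewrite [`|profH x t - _|]distrC; apply: le_lt_trans.
rewrite -[profH (y s) (w s) - _](subrKA (profH (y s) t)) (le_trans (ler_normD _ _))// lerD2r.
have S1 : (profH (y s) (t + 1 + 1) - profH (y s) (t + 1)) / 1 <= profH (y s) (t + 1 + 1).
  by rewrite divr1 lerBlDr lerDl profH_ge0.
have [wt'|tw] := leP (w s) t.
  have h := profH_slope Os (w0 s) wt' (_ : t <= t + 1) ltr01.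
  rewrite ler0_norm ?subr_le0 ?profH_mono// [`|w s - t|]ler0_norm ?subr_le0// !opprB.
  apply: (le_trans (h _)); first by rewrite lerDl.
  by rewrite ler_wpM2l ?subr_ge0.
have h := profH_slope Os t0 (ltW tw) (_ : w s <= t + 1) ltr01.
have tw' := ltW tw.
rewrite ger0_norm ?subr_ge0 ?profH_mono// [`|w s - t|]ger0_norm ?subr_ge0//.
apply: (le_trans (h _)); first lra.
by rewrite ler_wpM2l ?subr_ge0.
Qed.

(** The bound $c_0(G+G^{1+\nu})$ multiplied by $qG^{q-1}$, the derivative of the power, and
    expressed through $H=G^q$. *)
Definition profP x t : R := c0 * q * (profH x t + profH x t `^ (1 + nu / q)).

Hypothesis nu0 : 0 < nu.

Lemma profP_cvg (T : Type) (F : set_system T) {FF : ProperFilter F} (y : T -> V) (w : T -> R) (x : V) (t : R) :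
  Omega x -> (forall s, 0 <= w s) -> 0 <= t -> y @ F --> x -> w @ F --> t ->
  profP (y s) (w s) @[s --> F] --> profP x t.
Proof.
move=> Ox w0 t0 yx wt; apply: cvgMr; apply: cvgD; first exact: profH_cvg.
apply: cvg_powR; [by rewrite addr_gt0// divr_gt0|by move=> s; exact: profH_ge0|].
exact: profH_cvg.
Qed.

Hypothesis c00 : 0 < c0.

Lemma profP_ge0 x t : 0 <= profP x t.
Proof.
by rewrite mulr_ge0 ?mulr_ge0 ?(ltW c00) ?(ltW q0)// addr_ge0 ?profH_ge0 ?powR_ge0.
Qed.

Lemma profP_mono x s t : Omega x -> s <= t -> profP x s <= profP x t.
Proof.
move=> Ox st; rewrite ler_wpM2l ?mulr_ge0 ?(ltW c00) ?(ltW q0)// lerD ?profH_mono//.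
apply: ge0_ler_powR; rewrite ?nnegrE ?profH_ge0 ?profH_mono//.
by rewrite addr_ge0// divr_ge0 ?ltW.
Qed.

End profile.

(** * Local Lipschitz bounds in the space variable *)

Section coordinate_lines.
Context {R : realType} {N : nat}.
Local Notation V := 'rV[R]_N.
Local Notation BV := (BV R N).
Local Notation mu := (@bleb R N).
Variables (Omega : set V) (q nu c0 : R) (G : V -> R -> R).
Hypothesis oO : open Omega.
Hypothesis bO : bounded_set Omega.
Hypothesis q0 : 0 < q.
Hypothesis q1 : q <= 1.
Hypothesis nu0 : 0 < nu.
Hypothesis c00 : 0 < c0.
Hypothesis GP : sobolev_profile Omega q nu c0 G.
Local Notation H := (profH q G).
Local Notation P := (profP q nu c0 G).

(** Away from $0$ the power is Lipschitz; what matters about the constant is that it is finite. *)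
Lemma powR_lip (m B x y : R) : 0 < m -> m <= y -> y <= x -> x <= B ->
  x `^ q - y `^ q <= B `^ q / m * (x - y).
Proof.
move=> m0 my yx xB; have y0 := lt_le_trans m0 my; have x0 := lt_le_trans y0 yx.
have q0' := q0; have q1' := q1.
have xy : 1 <= x / y by rewrite ler_pdivlMr// mul1r.
have h : (x / y) `^ q <= x / y.
  by rewrite -[leRHS]powRr1 ?(le_trans ler01)//; apply: ler_powR.
have e : x `^ q = y `^ q * (x / y) `^ q.
  by rewrite -powRM ?divr_ge0 ?(ltW x0) ?(ltW y0)// mulrC divfK// gt_eqF.
have yB : y `^ q <= B `^ q.
  by apply: ge0_ler_powR; rewrite ?nnegrE; lra.
have xy1 : 1 <= (x / y) `^ q.
  by have := @ge0_ler_powR R q (ltW q0) 1 (x / y) _ _ xy; rewrite powR1 !nnegrE; apply; lra.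
rewrite e -{2}(mulr1 (y `^ q)) -mulrBr.
apply: (@le_trans _ _ (B `^ q * (x / y - 1))).
  by apply: ler_pM; rewrite ?powR_ge0 ?lerD2r ?subr_ge0.
rewrite -mulrA ler_wpM2l ?powR_ge0//.
have -> : x / y - 1 = y^-1 * (x - y) by rewrite mulrBr mulVf ?gt_eqF// mulrC.
by rewrite ler_wpM2r ?subr_ge0// lef_pV2 ?posrE.
Qed.

(** The assumption concerns $G$, and only where $G$ is derivable. Where $H$ has a derivative along
    the line, so has $G=H^{1/q}$, because $H$ is positive there. *)
Lemma profile_line_deriv (i : 'I_N) (z : V) (tau t : R) (Z : set BV) :
  (forall x, Omega x -> ~ Z x -> derivable (G^~ tau) x (delta_mx ord0 i) ->
      `|partial i (G^~ tau) x| <= c0 * (G x tau + G x tau `^ (1 + nu))) ->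
  Omega (z + t *: unitv i) -> ~ Z (z + t *: unitv i) -> 0 < tau ->
  derivable (fun s : R => H (z + s *: unitv i) tau) t 1 ->
  `|'D_1 (fun s : R => H (z + s *: unitv i) tau) t| <= P (z + t *: unitv i) tau.
Proof.
move=> hZ Oz nZ tau0 dp; set x := z + t *: unitv i.
pose p (s : R) := H (z + s *: unitv i) tau; pose p' : R := 'D_(1 : R) p t.
have q0' := q0.
have g0 : 0 < G x tau by exact: (sp_gt0 GP).
have Dp : is_derive t 1 p p' by split.
rewrite -/p -/p'.
have Dp1 : is_derive (0 : R) 1 (fun h : R => p (1 * h + t)) (1 * p').
  by apply: is_derive_aff; rewrite mulr0 add0r.
have pE (h : R) : p (1 * h + t) = H (x + h *: unitv i) tau.
  by rewrite /p /x mul1r scalerDl -addrA [_ *: _ + _]addrC.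
have p00 : 0 < p (1 * 0 + t) by rewrite pE scale0r addr0 powR_gt0.
have Dpsi := @is_derive1_comp R (fun y => y `^ q^-1) (fun h : R => p (1 * h + t)) 0 _ _
  (is_derive1_powR q^-1 p00) Dp1.
have psiE : (fun y => y `^ q^-1) \o (fun h : R => p (1 * h + t)) = (fun h : R => G (x + h *: unitv i) tau).
  apply/funext => h /=; rewrite pE /profH -powRrM mulfV ?gt_eqF// powRr1//.
  exact: (sp_ge0 GP).
rewrite psiE in Dpsi.
have [dG DG] := @is_derive_line R N (G^~ tau) x (unitv i) _ Dpsi.
have := hZ x Oz nZ dG; rewrite /partial DG pE scale0r addr0 mul1r.
rewrite !normrM [`|q^-1|]gtr0_norm ?invr_gt0// [`|_ `^ _|]ger0_norm ?powR_ge0//.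
rewrite /profH -powRrM (_ : q * (q^-1 - 1) = 1 - q); last by field; rewrite gt_eqF.
set g := G x tau in g0 *; move=> h.
have c : 0 < q * g `^ (q - 1) by rewrite mulr_gt0// powR_gt0.
move: h; rewrite -(ler_pM2l c).
have gg (s r : R) : g `^ s * g `^ r = g `^ (s + r).
  by rewrite -powRD//; apply/implyP => _; rewrite gt_eqF.
have -> : q * g `^ (q - 1) * (q^-1 * g `^ (1 - q) * `|p'|) = `|p'|.
  transitivity ((g `^ (q - 1) * g `^ (1 - q)) * `|p'|); first by field; rewrite gt_eqF.
  by rewrite gg (_ : q - 1 + (1 - q) = 0) ?powRr0 ?mul1r//; ring.
move=> /le_trans; apply; rewrite /profP /profH -/g -powRrM.
rewrite (_ : q * (1 + nu / q) = q + nu); last by field; rewrite gt_eqF.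
rewrite (_ : q * _ * (c0 * _) = c0 * q * (g `^ (q - 1) * g + g `^ (q - 1) * g `^ (1 + nu))); last by ring.
rewrite -{2}(powRr1 (ltW g0)) !gg (_ : q - 1 + 1 = q); last by ring.
by rewrite (_ : q - 1 + (1 + nu) = q + nu)//; ring.
Qed.

(** On almost every line the derivative bound holds almost everywhere, which is enough for a
    function known to be Lipschitz. Both sides being continuous in [z], the remaining lines follow
    by [ext_ge0]. *)
Lemma coord_lip (y0 : V) (rho tau M : R) i : 0 < tau ->
  (forall z, `|z - y0| < rho -> Omega z) ->
  (forall z, `|z - y0| < rho -> P z tau <= M) ->
  forall z d, 0 < d -> `|z - y0| < rho -> `|z + d *: unitv i - y0| < rho ->
  `|H (z + d *: unitv i) tau - H z tau| <= M * d.
Proof.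
move=> tau0 bOm bM z d d0.
have [Z [mZ Z0 hZ]] := sp_der GP i tau0.
have [Z' [mZ' Z'0 hZ']] := ae_line (unitv i) mZ Z0.
pose U := [set z | `|z - y0| < rho /\ `|z + d *: unitv i - y0| < rho].
have oU : open U.
  have ob (w : V) : open [set z : V | `|z + w| < rho].
    rewrite openE => x /= xr; apply/nbhs_ballP; exists (rho - `|x + w|); rewrite /= ?subr_gt0// => y.
    rewrite -ball_normE/= => xy; rewrite (_ : y + w = x + w - (x - y)); last first.
      by apply/rowP => k; rewrite !mxE; ring.
    by apply: (le_lt_trans (ler_normB _ _)); lra.
  rewrite (_ : U = [set z : V | `|z + (- y0)| < rho] `&` [set z : V | `|z + (d *: unitv i - y0)| < rho]).
    by apply: openI.
  by apply/seteqP; split => x [h1 h2]; split => //; move: h2; rewrite /= addrA.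
move=> z1 z2; rewrite -subr_ge0.
apply: (@ext_ge0 R N Z' (fun z => M * d - `|H (z + d *: unitv i) tau - H z tau|) U) => //.
  move=> x [x1 x2]; have t0 := ltW tau0.
  have h1 := profH_cts oO q0 GP t0 (bOm _ x1).
  have h2 := profH_cts oO q0 GP t0 (bOm _ x2).
  have sh : (fun y : V => y + d *: unitv i) @ x --> x + d *: unitv i.
    apply/(@cvgrPdist_lt _ _ _ (nbhs x) (nbhs_filter x)) => e e0.
    apply/nbhs_ballP; exists e => // y; rewrite -ball_normE/=.
    by rewrite opprD addrACA subrr addr0.
  have h3 : H (y + d *: unitv i) tau @[y --> x] --> H (x + d *: unitv i) tau.
    exact: (cvg_comp (fun y : V => y + d *: unitv i) (fun y => H y tau) sh h2).
  exact: (cvgB (cvg_cst _) (cvg_norm (cvgB h3 h1))).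
move=> x [x1 x2] nZ'; rewrite subr_ge0.
have seg t : 0 <= t <= d -> `|x + t *: unitv i - y0| < rho.
  move=> /andP[ta tb]; pose s := t / d.
  have s0 : 0 <= s by rewrite divr_ge0// ltW.
  have s1 : s <= 1 by rewrite ler_pdivrMr// mul1r.
  have -> : x + t *: unitv i - y0 = (1 - s) *: (x - y0) + s *: (x + d *: unitv i - y0).
    apply/rowP => k; rewrite !mxE.
    have -> : t = s * d by rewrite divfK// gt_eqF.
    by ring.
  have n1 : `|1 - s| = 1 - s by rewrite ger0_norm// subr_ge0.
  have n2 : `|s| = s by rewrite ger0_norm.
  apply: (le_lt_trans (ler_normD _ _)).
  have e1 : `|(1 - s) *: (x - y0)| = (1 - s) * `|x - y0| by rewrite normrZ n1.
  have e2 : `|s *: (x + d *: unitv i - y0)| = s * `|x + d *: unitv i - y0| by rewrite normrZ n2.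
  rewrite e1 e2.
  have aux (s' A B m : R) : 0 <= s' -> s' <= 1 -> A <= m -> B <= m -> m < rho ->
      (1 - s') * A + s' * B < rho.
    move=> h1 h2 h3 h4 h5; have : 0 <= (1 - s') * (m - A) by rewrite mulr_ge0 ?subr_ge0.
    have : 0 <= s' * (m - B) by rewrite mulr_ge0 ?subr_ge0.
    by rewrite !mulrBr !mulrBl !mul1r; lra.
  have m1 : `|x - y0| <= Num.max `|x - y0| `|x + d *: unitv i - y0| by rewrite le_max lexx.
  have m2 : `|x + d *: unitv i - y0| <= Num.max `|x - y0| `|x + d *: unitv i - y0|.
    by rewrite le_max lexx orbT.
  have m3 : Num.max `|x - y0| `|x + d *: unitv i - y0| < rho by rewrite gt_max x1 x2.
  exact: (aux _ _ _ _ s0 s1 m1 m2 m3).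
have Oseg t : 0 <= t <= d -> Omega (x + t *: unitv i) by move=> /seg; exact: bOm.
have null : lebesgue_measure [set t : R | Z (x + t *: unitv i)] = 0%E.
  by apply: contrapT => h; apply: nZ'; apply: hZ'.
have M0 : 0 <= M by apply: le_trans (bM _ x1); exact: profP_ge0.
pose p (t : R) := H (x + t *: unitv i) tau.
have [k [k0 hk]] := sp_lip GP (ltW tau0).
have [B [B0 hB]] := profile_bound bO GP (ltW tau0).
have un : `|unitv i : V| <= 1.
  apply/rV_norm_leP => // j; rewrite unitvE; by case: (j == i); rewrite ?normr1 ?normr0.
have Glip s t : 0 <= s <= d -> 0 <= t <= d -> `|G (x + s *: unitv i) tau - G (x + t *: unitv i) tau| <= k * `|s - t|.
  move=> sd td; apply: (le_trans (hk _ _ (Oseg _ sd) (Oseg _ td))); rewrite ler_wpM2l//.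
  rewrite (_ : x + s *: unitv i - (x + t *: unitv i) = (s - t) *: unitv i); last first.
    by rewrite opprD addrACA subrr add0r scalerBl.
  by rewrite normrZ ler_piMr.
(* The minimum of $G$ on the segment is positive, which makes $G^q$ Lipschitz there. *)
have [c cd hc] : exists2 c, c \in `[0, d] & forall t, t \in `[0, d] ->
    G (x + c *: unitv i) tau <= G (x + t *: unitv i) tau.
  apply: EVT_min; first exact: ltW.
  apply: continuous_in_subspaceT => t; rewrite inE/= in_itv/= => td.
  have lc : (fun t : R => x + t *: unitv i) @ t --> x + t *: unitv i.
    by apply: cvgD; [exact: cvg_cst|apply: cvgZr_tmp; exact: cvg_id].
  exact: (cvg_comp (fun t : R => x + t *: unitv i) (fun y => G y tau) lc
    (profile_cts oO GP (ltW tau0) (Oseg _ td))).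
pose m := G (x + c *: unitv i) tau.
have m0 : 0 < m by apply: (sp_gt0 GP) => //; apply: Oseg; move: cd; rewrite in_itv.
have K0 : 0 <= B `^ q / m by rewrite divr_ge0 ?powR_ge0// ltW.
have := @lipschitz_ae_derive_le R p 0 d (B `^ q / m * k) M d0 M0 _ _.
rewrite subr0 /p scale0r addr0; apply.
  move=> s t s0 st td.
  have sd : 0 <= s <= d by rewrite s0 (le_trans st).
  have td' : 0 <= t <= d by rewrite td (le_trans s0).
  have := Glip t s td' sd; rewrite [`|t - s|]ger0_norm ?subr_ge0// => hts.
  rewrite -mulrA; apply: (@le_trans _ _ (B `^ q / m * `|G (x + t *: unitv i) tau - G (x + s *: unitv i) tau|)); last by rewrite ler_wpM2l.
  have ms : m <= G (x + s *: unitv i) tau by apply: hc; rewrite in_itv.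
  have mt : m <= G (x + t *: unitv i) tau by apply: hc; rewrite in_itv.
  have Bs := hB _ (Oseg _ sd); have Bt := hB _ (Oseg _ td').
  rewrite /profH; have [gst|gts] := leP (G (x + s *: unitv i) tau) (G (x + t *: unitv i) tau).
    rewrite !ger0_norm ?subr_ge0//; first exact: powR_lip.
    by apply: ge0_ler_powR; rewrite ?nnegrE ?(ltW q0) ?(sp_ge0 GP).
  rewrite distrC [X in _ * X]distrC !ger0_norm ?subr_ge0 ?(ltW gts)//.
    by apply: powR_lip => //; exact: ltW.
  by apply: ge0_ler_powR; rewrite ?nnegrE ?(ltW q0) ?(sp_ge0 GP)// ltW.
have nullN : {ae lebesgue_measure, forall t : R, ~ Z (x + t *: unitv i)}.
  exists [set t : R | Z (x + t *: unitv i)]; split => //.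
    by have := measurable_line1 (unitv i) x measurableT mZ; rewrite setTI.
  by move=> t /= /contrapT.
have FL := ae_filter_ringOfSetsType (lebesgue_measure : {measure set (measurableTypeR R) -> \bar R}).
apply: filterS nullN => t nt /andP[t0 td] dp.
have td' : 0 <= t <= d by rewrite !ltW.
apply: (le_trans (profile_line_deriv hZ (Oseg _ td') nt tau0 dp)).
exact: bM (seg _ td').
Qed.

(** Coordinates are changed one at a time; balls of the sup norm are cubes, so the intermediate
    points stay inside. *)
Lemma profH_lip1 (y0 : V) (rho tau M : R) : 0 <= tau ->
  (forall z, `|z - y0| < rho -> Omega z) ->
  (forall z, `|z - y0| < rho -> P z tau <= M) ->
  forall z z', `|z - y0| < rho -> `|z' - y0| < rho ->
  `|H z' tau - H z tau| <= M * \sum_i `|z' ord0 i - z ord0 i|.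
Proof.
move=> tau0 bOm bM z z' hz hz'.
have M0 : 0 <= M by apply: le_trans (bM _ hz); exact: profP_ge0.
move: tau0; rewrite le_eqVlt => /predU1P[<-|tau0].
  rewrite !(profH0 oO q0 GP) ?subrr ?normr0; [|exact: bOm|exact: bOm].
  by rewrite mulr_ge0// sumr_ge0.
pose zk (k : nat) : V := \row_i (if (i < k)%N then z' ord0 i else z ord0 i).
pose r := Num.max `|z - y0| `|z' - y0|.
have rr : r < rho by rewrite gt_max hz hz'.
have r0 : 0 <= r by rewrite le_max normr_ge0.
have zkb k : `|zk k - y0| < rho.
  apply: le_lt_trans rr; apply/rV_norm_leP => // i; rewrite !mxE /r le_max.
  case: ifP => _; apply/orP; [right|left].
    by have := rV_coord_le (z' - y0) i; rewrite !mxE.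
  by have := rV_coord_le (z - y0) i; rewrite !mxE.
have zk0 : zk 0%N = z by apply/rowP => i; rewrite mxE.
have zkN : zk N = z' by apply/rowP => i; rewrite mxE ltn_ord.
have step (i : 'I_N) : `|H (zk i.+1) tau - H (zk i) tau| <= M * `|z' ord0 i - z ord0 i|.
  have e : zk i.+1 = zk i + (z' ord0 i - z ord0 i) *: unitv i.
    apply/rowP => k; rewrite !mxE eqxx /= ltnS leq_eqVlt -val_eqE /=.
    have [->|ki] := eqVneq k i; first by rewrite ltnn eqxx mulr1 addrC subrK.
    by rewrite (negbTE (_ : val k != val i))//= mulr0 addr0.
  have [d0|d0|d0] := ltgtP (z' ord0 i - z ord0 i) 0.
  - have e' : zk i = zk i.+1 + (z ord0 i - z' ord0 i) *: unitv i.
      by rewrite e -addrA -scalerDl (_ : _ - _ + _ = 0) ?scale0r ?addr0//; ring.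
    have d0' : 0 < z ord0 i - z' ord0 i by lra.
    have hz2 : `|zk i.+1 + (z ord0 i - z' ord0 i) *: unitv i - y0| < rho by rewrite -e' zkb.
    have := coord_lip tau0 bOm bM d0' (zkb i.+1) hz2; rewrite -e' => h.
    by rewrite distrC [`|z' ord0 i - _|]distrC [`|z ord0 i - _|]gtr0_norm.
  - have hz2 : `|zk i + (z' ord0 i - z ord0 i) *: unitv i - y0| < rho by rewrite -e zkb.
    have := coord_lip tau0 bOm bM d0 (zkb i) hz2; rewrite -e => h.
    by rewrite [`|z' ord0 i - _|]gtr0_norm.
  - by rewrite e d0 scale0r addr0 subrr !normr0 mulr0.
suff h k : (k <= N)%N -> `|H (zk k) tau - H (zk 0%N) tau| <= M * \sum_(i < N | (i < k)%N) `|z' ord0 i - z ord0 i|.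
  have := h N (leqnn N); rewrite zkN zk0; move=> /le_trans; apply.
  rewrite ler_wpM2l//; rewrite le_eqVlt; apply/orP; left; apply/eqP.
  by apply: eq_bigl => i; rewrite ltn_ord.
elim: k => [|k IH] kN; first by rewrite subrr normr0 mulr_ge0// sumr_ge0.
rewrite -[H (zk k.+1) tau - _](subrKA (H (zk k) tau)) (le_trans (ler_normD _ _))//.
rewrite (bigD1 (Ordinal kN))//= mulrDr; apply: lerD; first exact: (step (Ordinal kN)).
apply: (le_trans (IH (ltnW kN))); rewrite ler_wpM2l//.
rewrite le_eqVlt; apply/orP; left; apply/eqP; apply: eq_bigl => i.
by rewrite -val_eqE /= ltnS; case: ltngtP.
Qed.

End coordinate_lines.

Section line_inequality.
Context {R : realType} {N : nat}.
Local Notation V := 'rV[R]_N.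
Local Notation BV := (BV R N).
Local Notation mu := (@bleb R N).
Local Notation lam := (lebesgue_measure : {measure set (measurableTypeR R) -> \bar R}).
Variables (Omega : set V) (q nu c0 : R) (G : V -> R -> R).
Hypothesis oO : open Omega.
Hypothesis bO : bounded_set Omega.
Hypothesis q0 : 0 < q.
Hypothesis q1 : q <= 1.
Hypothesis nu0 : 0 < nu.
Hypothesis c00 : 0 < c0.
Hypothesis GP : sobolev_profile Omega q nu c0 G.
Local Notation H := (profH q G).
Local Notation P := (profP q nu c0 G).

Definition trunc (c kap : R) (s : R) : R := Num.min (c * `|s|) kap.

Variables (c kap d : R).
Hypothesis cc : 0 <= c.
Hypothesis kk : 0 <= kap.
Hypothesis d0 : 0 < d.

(** It stands for $\partial H/\partial t$: by convexity it dominates the slopes up to [t], and it is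
    continuous in both variables, which the derivative need not be. *)
Definition slopeH (x : V) (t : R) : R := (H x (t + d) - H x t) / d.

Lemma trunc_ge0 s : 0 <= trunc c kap s.
Proof. by rewrite le_min mulr_ge0. Qed.

Lemma trunc_lip s t : `|trunc c kap s - trunc c kap t| <= c * `|s - t|.
Proof.
have key (x y : R) : trunc c kap x - trunc c kap y <= c * `|x - y|.
  have h : c * `|x| <= c * `|y| + c * `|x - y|.
    by rewrite -mulrDr ler_wpM2l// -[X in `|X|](subrK y) addrC (le_trans (ler_normD _ _))// addrC.
  have m0 : 0 <= c * `|x - y| by rewrite mulr_ge0.
  rewrite /trunc; case: (leP (c * `|x|) kap) => h1; case: (leP (c * `|y|) kap) => h2; lra.
rewrite ler_norml; apply/andP; split; last exact: key.
by rewrite lerNl opprB distrC; exact: key.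
Qed.

Lemma slopeH_cvg (T : Type) (F : set_system T) {FF : ProperFilter F} (y : T -> V) (w : T -> R) (x : V) (t : R) :
  Omega x -> (forall s, 0 <= w s) -> 0 <= t -> y @ F --> x -> w @ F --> t ->
  slopeH (y s) (w s) @[s --> F] --> slopeH x t.
Proof.
move=> Ox w0 t0 yx wt; apply: cvgM; last exact: cvg_cst.
apply: cvgB; last exact: (profH_cvg oO q0 GP).
apply: (profH_cvg oO q0 GP) => //.
- by move=> s; rewrite addr_ge0// ltW.
- by rewrite addr_ge0// ltW.
- by apply: cvgD => //; exact: cvg_cst.
Qed.

Lemma slopeH_ge0 x t : Omega x -> 0 <= slopeH x t.
Proof.
move=> Ox; rewrite divr_ge0 ?(ltW d0)// subr_ge0 (profH_mono q0 GP)//.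
by rewrite lerDl ltW.
Qed.

Definition norm1 (a : V) : R := \sum_i `|a ord0 i|.

Lemma norm1_ge0 a : 0 <= norm1 a. Proof. exact: sumr_ge0. Qed.

(* Local estimate along a line: in the second variable by convexity, in the
   space variable by [profH_lip1]. *)
Lemma local_line (x a : V) (w : R -> R) (s0 e : R) : Omega (x + s0 *: a) ->
  (forall s, 0 <= w s) -> {for s0, continuous w} -> 0 < e ->
  \forall s \near s0,
    `|H (x + s *: a) (w s) - H (x + s0 *: a) (w s0)| <=
    `|w s - w s0| * (slopeH (x + s0 *: a) (w s0) + e) +
    `|s - s0| * norm1 a * (P (x + s0 *: a) (w s0) + e).
Proof.
move=> Ox w0 cw e0; set x0 := x + s0 *: a.
have ly : (fun s : R => x + s *: a) @ s0 --> x0.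
  by apply: cvgD; [exact: cvg_cst|apply: cvgZr_tmp; exact: cvg_id].
(* The larger of the two values: the quotient taken there controls the increment whichever way [w]
   moves. *)
pose W s := Num.max (w s) (w s0).
have W0 s : 0 <= W s by rewrite le_max w0.
have cW : W s @[s --> s0] --> w s0.
  have E s : W s = (w s + w s0 + `|w s - w s0|) / 2.
    by rewrite /W; case: (leP (w s) (w s0)) => h; [rewrite ler0_norm ?subr_le0//|rewrite gtr0_norm ?subr_gt0//]; lra.
  under eq_fun do rewrite E.
  have L : (w s + w s0 + `|w s - w s0|) / 2 @[s --> s0] --> (w s0 + w s0 + `|w s0 - w s0|) / 2.
    apply: cvgM; last exact: cvg_cst.
    apply: cvgD; first by apply: cvgD => //; exact: cvg_cst.
    by apply: cvg_norm; apply: cvgB => //; exact: cvg_cst.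
  rewrite subrr normr0 addr0 (_ : (w s0 + w s0) / 2 = w s0) in L; first exact: L.
  lra.
have n1 : \forall s \near s0, slopeH (x + s *: a) (W s) < slopeH x0 (w s0) + e.
  have c1 : slopeH (x + s *: a) (W s) @[s --> s0] --> slopeH x0 (w s0).
    exact: (@slopeH_cvg _ (nbhs s0) _ _ _ x0 (w s0) Ox W0 (w0 s0) ly cW).
  move: c1 => /cvgrPdist_lt/(_ e e0); apply: filterS => s; rewrite ltr_norml => /andP[h1 h2].
  lra.
have n2 : \forall y \near x0, P y (w s0) < P x0 (w s0) + e /\ Omega y.
  apply: filterI; last exact: open_nbhs_nbhs.
  have id0 : (fun y : V => y) @ x0 --> x0 by exact: cvg_id.
  have c2 : P y (w s0) @[y --> x0] --> P x0 (w s0).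
    apply: (@profP_cvg R N Omega q nu c0 G oO q0 GP nu0 _ (nbhs x0) (nbhs_pfilter x0) (fun y => y)
      (fun=> w s0) x0 (w s0) Ox) => //.
    by move=> A /nbhs_singleton Aw; apply: (@filterE _ (nbhs x0) (nbhs_filter x0)).
  have := (@cvgrPdist_lt _ _ _ (nbhs x0) (nbhs_filter x0) _ _).1 c2 e e0; apply: filterS => y.
  rewrite ltr_norml => /andP[]; move: (P x0 (w s0)) (P y (w s0)) => A B h1 h2.
  by rewrite -(ltrD2r (- B)) subrr; lra.
have [rho /= rho0 hrho] := (nbhs_ballP _ _).1 n2.
have hb z : `|z - x0| < rho -> P z (w s0) < P x0 (w s0) + e /\ Omega z.
  by move=> zr; apply: hrho; rewrite -ball_normE/= distrC.
have n3 : \forall s \near s0, `|x + s *: a - x0| < rho.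
  by have /cvgrPdist_lt/(_ rho rho0) := ly; apply: filterS => s; rewrite distrC.
apply: filterS2 n1 n3 => s hS hr.
have [Pz Oz] := hb _ hr.
rewrite -[H (x + s *: a) (w s) - _](subrKA (H (x + s *: a) (w s0))).
rewrite (le_trans (ler_normD _ _))// lerD//.
  apply: (@le_trans _ _ (`|w s - w s0| * slopeH (x + s *: a) (W s))); last first.
    by rewrite ler_wpM2l// ltW.
  have [h|h] := leP (w s0) (w s).
    rewrite !ger0_norm ?subr_ge0// ?(profH_mono q0 GP)//.
    apply: (profH_slope oO q0 GP) => //; by rewrite /W le_max lexx.
  rewrite !ler0_norm ?subr_le0 ?(profH_mono q0 GP)// ?(ltW h)// !opprB.
  by apply: (profH_slope oO q0 GP) => //; rewrite ?(ltW h)// /W le_max lexx orbT.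
have := @profH_lip1 R N Omega q nu c0 G oO bO q0 q1 c00 GP x0 rho (w s0) (P x0 (w s0) + e)
  (w0 s0) (fun z h => (hb z h).2) (fun z h => ltW (hb z h).1) x0 (x + s *: a).
rewrite subrr normr0 => /(_ rho0 hr) /le_trans; apply.
rewrite mulrC ler_wpM2r ?addr_ge0 ?profP_ge0 ?(ltW e0)//.
rewrite /norm1 mulr_sumr ler_sum// => i _.
rewrite /x0 !mxE -normrM (_ : x ord0 i + s * a ord0 i - (x ord0 i + s0 * a ord0 i) = (s - s0) * a ord0 i)//.
by ring.
Qed.

End line_inequality.

(** * Directions from the cone property *)

Section cone.
Context {R : realType} {N : nat}.
Local Notation V := 'rV[R]_N.
Implicit Types x y z v : V.

Lemma dotpDl x y z : dotp (x + y) z = dotp x z + dotp y z.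
Proof. by rewrite -big_split; apply: eq_bigr => i _; rewrite mxE mulrDl. Qed.
Lemma dotpC x y : dotp x y = dotp y x.
Proof. by apply: eq_bigr => i _; rewrite mulrC. Qed.
Lemma dotpZl (t : R) x y : dotp (t *: x) y = t * dotp x y.
Proof. by rewrite /dotp mulr_sumr; apply: eq_bigr => i _; rewrite mxE mulrA. Qed.
Lemma dotp_ge0 x : 0 <= dotp x x.
Proof. by apply: sumr_ge0 => i _; rewrite -expr2 sqr_ge0. Qed.
Lemma enorm_ge0 x : 0 <= enorm x. Proof. exact: sqrtr_ge0. Qed.
Lemma enorm_sq x : enorm x ^+ 2 = dotp x x.
Proof. by rewrite sqr_sqrtr// dotp_ge0. Qed.

Lemma enorm_gt0 x : x != 0 -> 0 < enorm x.
Proof.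
move=> x0; rewrite lt_neqAle enorm_ge0 andbT eq_sym; apply: contra_neq x0 => e0.
have : dotp x x = 0 by rewrite -enorm_sq e0 expr0n.
move=> /psumr_eq0P h; apply/rowP => i; rewrite mxE; apply/eqP.
rewrite -sqrf_eq0 expr2 h// => k _; by rewrite -expr2 sqr_ge0.
Qed.

Lemma dotp_enorm x y : dotp x y <= enorm x * enorm y.
Proof.
have [->|x0] := eqVneq x 0.
  by rewrite -(scale0r 0) dotpZl mul0r mulr_ge0 ?enorm_ge0.
have [->|y0] := eqVneq y 0.
  by rewrite dotpC -(scale0r 0) dotpZl mul0r mulr_ge0 ?enorm_ge0.
have a0 := enorm_gt0 x0; have b0 := enorm_gt0 y0.
have := dotp_ge0 (enorm y *: x + (- enorm x) *: y).
rewrite !(dotpDl, dotpZl) ![dotp _ (_ + _)]dotpC !(dotpDl, dotpZl) -!enorm_sq [dotp y x]dotpC.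
move: (enorm x) (enorm y) (dotp x y) a0 b0 => a b d a0 b0 h.
have ab : 0 < a * b by rewrite mulr_gt0.
by rewrite -(ler_pM2l ab); nra.
Qed.

Lemma enormD x y : enorm (x + y) <= enorm x + enorm y.
Proof.
have s0 : 0 <= enorm x + enorm y by rewrite addr_ge0 ?enorm_ge0.
rewrite -[leRHS]ger0_norm// -sqrtr_sqr; apply: ler_wsqrtr.
rewrite !dotpDl ![dotp _ (_ + _)]dotpC !dotpDl -!enorm_sq [dotp y x]dotpC.
have := dotp_enorm x y; nra.
Qed.

Lemma enormZ (t : R) x : 0 <= t -> enorm (t *: x) = t * enorm x.
Proof.
move=> t0; rewrite /enorm dotpZl dotpC dotpZl mulrA -expr2 sqrtrM ?sqr_ge0//.
by rewrite sqrtr_sqr ger0_norm.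
Qed.

Lemma enorm_coord x i : `|x ord0 i| <= enorm x.
Proof.
rewrite -sqrtr_sqr; apply: ler_wsqrtr; rewrite /dotp (bigD1 i)//= -expr2 lerDl.
by apply: sumr_ge0 => k _; rewrite -expr2 sqr_ge0.
Qed.

Lemma enorm_le x (eta : R) : 0 <= eta -> (forall i, `|x ord0 i| <= eta) ->
  enorm x <= N%:R * eta.
Proof.
move=> e0 h; have s0 : 0 <= N%:R * eta by rewrite mulr_ge0.
rewrite -[leRHS]ger0_norm// -sqrtr_sqr; apply: ler_wsqrtr.
apply: (@le_trans _ _ (\sum_(i < N) eta ^+ 2)).
  apply: ler_sum => i _; rewrite -expr2 -real_normK ?num_real// ler_sqr ?nnegrE//.
rewrite sumr_const card_ord -[eta ^+ 2 *+ N]mulr_natl exprMn ler_wpM2r ?sqr_ge0//.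
by rewrite -natrX ler_nat; case: (N) => // n; rewrite leq_pmulr.
Qed.

Lemma cone_scale (rho kappa t : R) v z : 0 <= t <= 1 ->
  finite_cone rho kappa v z -> finite_cone rho kappa v (t *: z).
Proof.
move=> /andP[t0 t1] [h1 h2]; rewrite /finite_cone /= enormZ// dotpZl; split.
  by apply: le_trans h1; rewrite ler_piMl ?enorm_ge0.
by rewrite -!mulrA ler_wpM2l// mulrA.
Qed.

Lemma cone_ball (rho kappa : R) : 0 < rho -> 0 < kappa -> kappa <= pi ->
  exists r : R, [/\ 0 < r, r <= rho / 4 & forall v, v != 0 ->
    exists z0, enorm z0 = rho / 2 /\
      forall y, enorm y <= r -> finite_cone rho kappa v (z0 + y)].
Proof.
move=> rho0 k0 kpi; set c := cos (kappa / 2).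
have pi0 := pi_gt0 R.
have c1 : c < 1.
  have h1 : 0 <= kappa / 2 <= pi by apply/andP; split; lra.
  have h2 : 0 <= (0 : R) <= pi by rewrite lexx pi_ge0.
  have m1 : kappa / 2 \in `[0, pi] by rewrite in_itv.
  have m2 : (0 : R) \in `[0, pi] by rewrite in_itv.
  by have := ltr_cos m2 m1; rewrite cos0 => ->; lra.
have c0 : 0 <= c.
  by apply: cos_ge0_pihalf; apply/andP; split; lra.
(* The centre is the midpoint of the axis. The radius solves $(\rho/2+r)c\le\rho/2-r$, by
   $1+c\le2$. *)
exists (rho / 4 * (1 - c)); split; [nra|nra|].
move=> v v0; have nv := enorm_gt0 v0.
exists ((rho / 2 / enorm v) *: v); split.
  by rewrite enormZ ?divr_ge0 ?(ltW nv)//; [rewrite divfK// gt_eqF|lra].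
move=> y yr; have e0 : enorm ((rho / 2 / enorm v) *: v) = rho / 2.
  by rewrite enormZ ?divr_ge0 ?(ltW nv)//; [rewrite divfK// gt_eqF|lra].
have t1 := enormD ((rho / 2 / enorm v) *: v) y; rewrite e0 in t1.
have ny := enorm_ge0 y.
split => //=; first nra.
have d1 : dotp ((rho / 2 / enorm v) *: v) v = rho / 2 * enorm v.
  by rewrite dotpZl -enorm_sq expr2 mulrA divfK// gt_eqF.
have d2 := dotp_enorm (- y) v.
have ny' : enorm (- y) = enorm y.
  rewrite /enorm -scaleN1r dotpZl dotpC dotpZl; congr Num.sqrt; ring.
have d3 : dotp (- y) v = - dotp y v by rewrite -scaleN1r dotpZl mulN1r.
rewrite dotpDl d1 -/c; rewrite ny' d3 in d2.
have : enorm ((rho / 2 / enorm v) *: v + y) * enorm v * c <= (rho / 2 + enorm y) * enorm v * c.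
  have nvc : 0 <= enorm v * c by rewrite mulr_ge0// ltW.
  by rewrite -[X in X <= _]mulrA -[X in _ <= X]mulrA; exact: ler_wpM2r.
move=> /le_trans; apply; rewrite (_ : _ * enorm v * c = (rho / 2 + enorm y) * c * enorm v); last by ring.
apply: (@le_trans _ _ ((rho / 2 - enorm y) * enorm v)); last by lra.
by rewrite ler_pM2r//; nra.
Qed.

(** Finitely many candidate axes: a finite set of direction systems, each with its own constants,
    then serves all points of [Omega]. *)
Definition gridp (M : nat) (d : R) (m : {ffun 'I_N -> 'I_(M.*2.+1)}) : V :=
  \row_i (d * ((m i)%:R - M%:R)).

Lemma grid_approx (M : nat) (d : R) z : 0 < d -> (forall i, `|z ord0 i| <= M%:R * d) ->
  exists m : {ffun 'I_N -> 'I_(M.*2.+1)}, forall i, `|gridp d m ord0 i - z ord0 i| <= d.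
Proof.
move=> d0 hz.
have ex i : exists k : 'I_(M.*2.+1), `|d * (k%:R - M%:R) - z ord0 i| <= d.
  have := hz i; rewrite ler_norml => /andP[z1 z2].
  pose s := z ord0 i / d + M%:R.
  have zs : z ord0 i = d * (s - M%:R) by rewrite /s addrK mulrC divfK// gt_eqF.
  have s0 : 0 <= s by rewrite -(pmulr_rge0 _ d0) -(lerD2r (- (d * M%:R))) -mulrBr -zs add0r; lra.
  have s1 : s <= (M.*2)%:R.
    by rewrite -(ler_pM2l d0) -(lerD2r (- (d * M%:R))) -mulrBr -zs -addnn natrD; lra.
  have := truncn_itv s0 => /andP[k1 k2].
  have kM : (Num.truncn s < M.*2.+1)%N.
    by rewrite ltnS -(ler_nat R) (le_trans k1).
  exists (Ordinal kM) => /=; rewrite zs -mulrBr normrM gtr0_norm// ler_piMr ?(ltW d0)//.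
  by move: k2; rewrite -natr1 => k2; rewrite ler_norml; apply/andP; split; lra.
have /choice[m hm] := ex; exists [ffun i => m i] => i.
by rewrite mxE ffunE.
Qed.

Lemma cone_grid (Omega : set V) : (0 < N)%N -> cone_property Omega ->
  exists (M : nat) (d : R), 0 < d /\ forall x, Omega x ->
    exists (m : {ffun 'I_N -> 'I_(M.*2.+1)}) j, gridp d m ord0 j != 0 /\
      forall i, segset Omega (skewv (gridp d m) j d i) x.
Proof.
move=> N0 [rho [kappa [rho0 k0 kpi hc]]].
have [r [r0 rrho hr]] := cone_ball rho0 k0 kpi.
have NR : 0 < N%:R :> R by rewrite ltr0n.
(* The directions differ from [z0] by at most $2d$ in each coordinate, hence by at most $2Nd=r/2$ in
   norm. *)
pose d := r / (4 * N%:R).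
have d0 : 0 < d by rewrite divr_gt0// mulr_gt0.
have dr : 4 * (N%:R * d) = r by rewrite /d; field; rewrite gt_eqF.
pose M := Num.bound (rho / d).
have Mr : rho < M%:R * d by rewrite -ltr_pdivrMr// archi_boundP// divr_ge0// ltW.
exists M, d; split => // x Ox; have [v [v0 hv]] := hc x Ox.
have [z0 [ez0 hz]] := hr v v0.
have [m hm] := grid_approx (M := M) d0 (z := z0) (fun i => le_trans (enorm_coord z0 i)
  (eq_ind_r (fun w => w <= M%:R * d) (ltac:(lra) : rho / 2 <= M%:R * d) ez0)).
(* A vanishing grid point would give $|z_0|\le Nd$, against $|z_0|=\rho/2$. *)
have [j pj] : exists j, gridp d m ord0 j != 0.
  apply: contrapT => hn.
  have p0 i : gridp d m ord0 i = 0.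
    by apply/eqP; apply: contrapT => /negP h; apply: hn; exists i.
  have : enorm z0 <= N%:R * d.
    by apply: enorm_le; [exact: ltW|move=> i; have := hm i; rewrite p0 sub0r normrN].
  rewrite ez0; lra.
exists m, j; split => // i t t01.
set w := skewv _ _ _ _; apply: hv; exists (t *: w) => //.
apply: cone_scale => //; have -> : w = z0 + (w - z0) by rewrite addrC subrK.
apply: hz; apply: (@le_trans _ _ (N%:R * (2 * d))); last lra.
apply: enorm_le; first lra.
move=> k; have := hm k; rewrite /w /skewv !mxE; case: (i == j); rewrite !mxE.
  by move=> h; apply: (le_trans h); lra.
rewrite eqxx /= => h; rewrite addrAC (le_trans (ler_normD _ _))//.
have : `|d * (k == i)%:R| <= d.
  by rewrite normrM gtr0_norm// ler_piMr ?(ltW d0)//; case: (k == i); rewrite ?normr1 ?normr0.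
by lra.
Qed.

End cone.

(** * The line inequality *)

Section composition_along_lines.
Context {R : realType} {N : nat}.
Local Notation V := 'rV[R]_N.
Local Notation BV := (BV R N).
Local Notation mu := (@bleb R N).
Local Notation lam := (lebesgue_measure : {measure set (measurableTypeR R) -> \bar R}).
Variables (Omega : set V) (q nu c0 : R) (G : V -> R -> R).
Hypothesis oO : open Omega.
Hypothesis bO : bounded_set Omega.
Hypothesis q0 : 0 < q.
Hypothesis q1 : q <= 1.
Hypothesis nu0 : 0 < nu.
Hypothesis c00 : 0 < c0.
Hypothesis GP : sobolev_profile Omega q nu c0 G.
Local Notation H := (profH q G).
Local Notation P := (profP q nu c0 G).
Variables (c kap d : R).
Hypothesis cc : 0 <= c.
Hypothesis kk : 0 <= kap.
Hypothesis d0 : 0 < d.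
Local Notation S := (slopeH q G d).
Local Notation tr := (trunc c kap).

Lemma integral_itv_diff (F : R -> \bar R) (s t : R) :
  (forall r, 0 <= F r)%E -> measurable_fun (setT : set (measurableTypeR R)) F ->
  (\int[lam]_(r in `]0%R, 1%R]) F r < +oo)%E -> 0 <= s -> s <= t -> t <= 1 ->
  fine (\int[lam]_(r in `]0%R, t]) F r)%E - fine (\int[lam]_(r in `]0%R, s]) F r)%E =
  fine (\int[lam]_(r in `]s, t]) F r)%E /\ (\int[lam]_(r in `]s, t]) F r < +oo)%E.
Proof.
move=> F0 mF fin s0 st t1.
have mFD D : measurable_fun (D : set (measurableTypeR R)) F by exact: measurable_funTS.
have fin1 := fin.
have le1 (I J : set R) : measurable (I : set (measurableTypeR R)) ->
    measurable (J : set (measurableTypeR R)) -> I `<=` J ->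
    (\int[lam]_(r in I) F r <= \int[lam]_(r in J) F r)%E.
  by move=> mI mJ IJ; exact: ge0_subset_integral.
have f1 : (\int[lam]_(r in `]0%R, s]) F r < +oo)%E.
  apply: le_lt_trans fin1; apply: le1 => //; apply: subset_itvl; rewrite bnd_simp.
  exact: le_trans t1.
have f2 : (\int[lam]_(r in `]s, t]) F r < +oo)%E.
  by apply: le_lt_trans fin1; apply: le1 => //; apply: subset_itv; rewrite bnd_simp.
split => //.
have e : (\int[lam]_(r in `]0%R, t]) F r =
   \int[lam]_(r in `]0%R, s]) F r + \int[lam]_(r in `]s, t]) F r)%E.
  rewrite -ge0_integral_setU//=.
    by rewrite -itv_bndbnd_setU// bnd_simp.
  rewrite disj_set2E; apply/eqP/seteqP; split => x //= -[].
  by rewrite !in_itv/= => /andP[_ h1] /andP[h2 _]; rewrite leNgt h2 in h1.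
rewrite e fineD ?ge0_fin_numE ?integral_ge0//.
by rewrite addrAC subrr add0r.
Qed.

(* Monotonicity of [H(x + s a, w s) + \int_0^s k] along the segment, for [w] a
   continuous path whose increments are controlled by [vv]. *)
Lemma line_mono (x a : V) (w vv : R -> R) (e : R) : segset Omega a x -> 0 < e ->
  (forall s, 0 <= w s) -> (forall s, 0 <= s <= 1 -> {for s, continuous w}) ->
  measurable_fun (setT : set (measurableTypeR R)) vv -> (forall r, 0 <= vv r) ->
  (\int[lam]_(r in `]0%R, 1%R]) (vv r)%:E < +oo)%E ->
  (forall s t : R, 0 <= s -> s <= t -> t <= 1 ->
     `|w t - w s| <= fine (\int[lam]_(r in `]s, t]) (vv r)%:E)%E) ->
  let k (r : R) := vv r * (S (x + r *: a) (w r) + (e + e)) + norm1 a * (P (x + r *: a) (w r) + (e + e)) in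
  (\int[lam]_(r in `]0%R, 1%R]) (k r)%:E < +oo)%E ->
  forall h : R, 0 <= h <= 1 -> H x (w 0) <= H (x + h *: a) (w h) + fine (\int[lam]_(r in `]0%R, 1%R]) (k r)%:E)%E.
Proof.
move=> sx e0 w0 cw mvv vv0 ivv wvv k ik h /andP[h0 h1].
have ly (s : R) : (fun r : R => x + r *: a) @ s --> x + s *: a.
  by apply: cvgD; [exact: cvg_cst|apply: cvgZr_tmp; exact: cvg_id].
have cS (s : R) : 0 <= s <= 1 -> S (x + r *: a) (w r) @[r --> s] --> S (x + s *: a) (w s).
  move=> s01; exact: (slopeH_cvg oO q0 GP d0 (sx _ s01) w0 (w0 s) (ly s) (cw s s01)).
have cP (s : R) : 0 <= s <= 1 -> P (x + r *: a) (w r) @[r --> s] --> P (x + s *: a) (w s).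
  move=> s01; exact: (profP_cvg oO q0 GP nu0 (sx _ s01) w0 (w0 s) (ly s) (cw s s01)).
have n10 : 0 <= norm1 a by exact: norm1_ge0.
have mD : measurable (`]0%R, 1%R]%classic : set (measurableTypeR R)) by [].
have mk : measurable_fun (`]0%R, 1%R]%classic : set (measurableTypeR R)) k.
  have mS : measurable_fun (`]0%R, 1%R]%classic : set (measurableTypeR R)) (fun r => S (x + r *: a) (w r)).
    apply: subspace_continuous_measurable_fun => //; apply: continuous_in_subspaceT.
    by move=> r; rewrite inE/= in_itv/= => /andP[r0 r1]; apply: cS; rewrite ltW.
  have mP : measurable_fun (`]0%R, 1%R]%classic : set (measurableTypeR R)) (fun r => P (x + r *: a) (w r)).
    apply: subspace_continuous_measurable_fun => //; apply: continuous_in_subspaceT.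
    by move=> r; rewrite inE/= in_itv/= => /andP[r0 r1]; apply: cP; rewrite ltW.
  apply: measurable_funD; apply: measurable_funM => //.
  - exact: measurable_funTS.
  - exact: measurable_funD.
  - exact: measurable_funD.
have k0 (r : R) : 0 <= r <= 1 -> 0 <= k r.
  move=> r01; have Or := sx _ r01.
  apply: addr_ge0; apply: mulr_ge0 => //; rewrite addr_ge0 ?addr_ge0 ?(ltW e0)//.
    exact: (slopeH_ge0 q0 GP d0).
  exact: profP_ge0.
(* Continuity of [w] and membership in [Omega] are known on $[0,1]$ only; beyond it the integrand is
   cut to zero. *)
pose F := (EFin \o k) \_ `]0%R, 1%R]%classic.
have F0 (r : R) : (0 <= F r)%E.
  rewrite /F patchE; case: ifPn => // /set_mem/=; rewrite in_itv/= => /andP[r0 r1].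
  by rewrite lee_fin k0// ltW.
have mF : measurable_fun (setT : set (measurableTypeR R)) F.
  by apply/(measurable_restrictT _ mD); exact/measurable_EFinP.
have iF : (\int[lam]_(r in `]0%R, 1%R]) F r < +oo)%E.
  by rewrite /F -integral_mkcondr setIid.
pose J (s : R) := fine (\int[lam]_(r in `]0%R, s]) F r)%E.
have Jd (s t : R) : 0 <= s -> s <= t -> t <= 1 -> J t - J s = fine (\int[lam]_(r in `]s, t]) F r)%E.
  by move=> s0 st t1; have [] := integral_itv_diff F0 mF iF s0 st t1.
have mvE : measurable_fun (setT : set (measurableTypeR R)) (EFin \o vv) by exact/measurable_EFinP.
have vv0' r : (0 <= (EFin \o vv) r)%E by rewrite lee_fin.
(* on a small interval where [S] and [P] vary by at most [e] *)
have seg (s t A B : R) : 0 <= s -> s <= t -> t <= 1 -> 0 <= A -> 0 <= B ->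
    (forall r, s < r <= t -> A <= S (x + r *: a) (w r) + e /\ B <= P (x + r *: a) (w r) + e) ->
    `|w t - w s| * (A + e) + (t - s) * norm1 a * (B + e) <= J t - J s.
  move=> s0 st t1 A0 B0 hr.
  have [_ fF] := integral_itv_diff F0 mF iF s0 st t1.
  have [_ fv] := integral_itv_diff vv0' mvE ivv s0 st t1.
  rewrite Jd//.
  apply: (@le_trans _ _ (fine (\int[lam]_(r in `]s, t]) (vv r)%:E)%E * (A + e) + (t - s) * norm1 a * (B + e))).
    by rewrite lerD2r ler_wpM2r ?wvv// addr_ge0// ltW.
  rewrite -lee_fin fineK; last by rewrite ge0_fin_numE ?integral_ge0.
  have Ae : 0 <= A + e by rewrite addr_ge0// ltW.
  have Be : 0 <= norm1 a * (B + e) by rewrite mulr_ge0// addr_ge0// ltW.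
  have fvE : (\int[lam]_(r in `]s, t]) (vv r)%:E)%E \is a fin_num.
    by rewrite ge0_fin_numE//; apply: integral_ge0 => r _; rewrite lee_fin.
  rewrite EFinD EFinM fineK//.
  have -> : ((t - s) * norm1 a * (B + e))%:E = (\int[lam]_(r in `]s, t]) (norm1 a * (B + e))%:E)%E.
    rewrite integral_cst//= lebesgue_measure_itv/= lte_fin -EFinB.
    case: ltP => [_|ts]; first by rewrite -EFinM; congr EFin; ring.
    by rewrite (_ : t - s = 0) ?mul0r ?mule0//; lra.
  have mvI : measurable_fun (`]s, t]%classic : set (measurableTypeR R)) (EFin \o vv).
    exact: measurable_funTS.
  have mvA : measurable_fun (`]s, t]%classic : set (measurableTypeR R)) (fun r => (A + e)%:E * (EFin \o vv) r)%E.
    exact: measurable_funeM.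
  have vA r : `]s, t]%classic r -> (0 <= (A + e)%:E * (EFin \o vv) r)%E.
    by move=> _; rewrite mule_ge0// lee_fin.
  have vI r : `]s, t]%classic r -> (0 <= (EFin \o vv) r)%E by [].
  rewrite muleC -ge0_integralZl_EFin// -ge0_integralD//.
  apply: ge0_le_integral => //.
  - by move=> r rst; rewrite adde_ge0 ?vA// lee_fin.
  - exact: emeasurable_funD.
  - exact: measurable_funTS.
  move=> r; rewrite /= in_itv/= => /andP[sr rt].
  have r0 : 0 < r := le_lt_trans s0 sr; have r1 : r <= 1 := le_trans rt t1.
  rewrite /F patchE mem_set/= ?in_itv/= ?r0 ?r1// -EFinM -EFinD lee_fin /k.
  have [hA hB] := hr r (introT andP (conj sr rt)).
  rewrite mulrC; apply: lerD; apply: ler_wpM2l => //.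
    by rewrite addrA lerD2r.
  by rewrite addrA lerD2r.
have loc (s : R) : 0 <= s <= h -> exists dl : R, 0 < dl /\ forall t : R, 0 <= t <= h -> `|t - s| < dl ->
    (t <= s -> H (x + t *: a) (w t) + J t <= H (x + s *: a) (w s) + J s) /\
    (s <= t -> H (x + s *: a) (w s) + J s <= H (x + t *: a) (w t) + J t).
  move=> /andP[s0 sh]; have s01 : 0 <= s <= 1 by rewrite s0 (le_trans sh).
  have Os := sx _ s01.
  (* One [e] of the integrand [k] pays for [local_line], the other for the variation of [S] and [P]
     near [s]. *)
  have n1 := local_line oO bO q0 q1 nu0 c00 GP d0 Os w0 (cw s s01) e0.
  have n2 : \forall r \near s, S (x + s *: a) (w s) <= S (x + r *: a) (w r) + e.
    have /cvgrPdist_lt/(_ e e0) := cS s s01; apply: filterS => r; rewrite ltr_norml => /andP[_ h2].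
    by rewrite -lerBlDl ltW.
  have n3 : \forall r \near s, P (x + s *: a) (w s) <= P (x + r *: a) (w r) + e.
    have /cvgrPdist_lt/(_ e e0) := cP s s01; apply: filterS => r; rewrite ltr_norml => /andP[_ h2].
    by rewrite -lerBlDl ltW.
  have [dl /= dl0 hdl] := (nbhs_ballP _ _).1 (filterI n1 (filterI n2 n3)).
  have hd r : `|r - s| < dl -> `|H (x + r *: a) (w r) - H (x + s *: a) (w s)| <=
      `|w r - w s| * (S (x + s *: a) (w s) + e) + `|r - s| * norm1 a * (P (x + s *: a) (w s) + e) /\
      (S (x + s *: a) (w s) <= S (x + r *: a) (w r) + e /\ P (x + s *: a) (w s) <= P (x + r *: a) (w r) + e).
    by move=> rs; apply: hdl; rewrite -ball_normE/= distrC.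
  have S0 := slopeH_ge0 q0 GP d0 (w s) Os.
  have P0 : 0 <= P (x + s *: a) (w s) by exact: profP_ge0.
  exists dl; split => // t /andP[t0 th] ts; have [h2 _] := hd t ts.
  split => st.
    have tst : forall r, t < r <= s -> S (x + s *: a) (w s) <= S (x + r *: a) (w r) + e /\
        P (x + s *: a) (w s) <= P (x + r *: a) (w r) + e.
      move=> r /andP[tr' rs]; apply: (proj2 (hd r _)).
      apply: le_lt_trans ts; rewrite !ler0_norm ?subr_le0//; lra.
    have s1 : s <= 1 by case/andP: s01.
    have := seg t s _ _ t0 st s1 S0 P0 tst.
    rewrite distrC [`|t - s|]distrC [`|s - t|]ger0_norm ?subr_ge0// in h2.
    rewrite distrC in h2; move: h2; rewrite [`|w t - w s|]distrC.
    have := ler_norm (H (x + t *: a) (w t) - H (x + s *: a) (w s)).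
    move: `|H _ _ - _| => z; lra.
  have tst : forall r, s < r <= t -> S (x + s *: a) (w s) <= S (x + r *: a) (w r) + e /\
      P (x + s *: a) (w s) <= P (x + r *: a) (w r) + e.
    move=> r /andP[sr rt]; apply: (proj2 (hd r _)).
    apply: le_lt_trans ts; rewrite !ger0_norm ?subr_ge0 ?(ltW sr)//; lra.
  have t1 : t <= 1 := le_trans th h1.
  have := seg s t _ _ s0 st t1 S0 P0 tst.
  rewrite [`|t - s|]ger0_norm ?subr_ge0// in h2; move: h2.
  have := ler_norm (- (H (x + t *: a) (w t) - H (x + s *: a) (w s))); rewrite normrN.
  move: `|H _ _ - _| => z; lra.
have := local_nondecreasing h0 loc.
rewrite scale0r addr0 {1}/J set_itv_ge ?bnd_simp// integral_set0 addr0 => /le_trans; apply.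
rewrite lerD2l /J; apply: fine_le.
- rewrite ge0_fin_numE ?integral_ge0//; apply: le_lt_trans iF.
  by apply: ge0_subset_integral => //; [exact: measurable_funTS|apply: subset_itvl; rewrite bnd_simp].
- rewrite ge0_fin_numE//; apply: integral_ge0 => r; rewrite /= in_itv/= => /andP[r0 r1].
  by rewrite lee_fin k0// ltW.
apply: (@le_trans _ _ (\int[lam]_(r in `]0%R, 1%R]) F r)%E).
  apply: ge0_subset_integral => //; first exact: measurable_funTS.
  by apply: subset_itvl; rewrite bnd_simp.
by rewrite /F -integral_mkcondr setIid.
Qed.

End composition_along_lines.

Section truncated_composition.
Context {R : realType} {N : nat}.
Local Notation V := 'rV[R]_N.
Local Notation BV := (BV R N).
Local Notation mu := (@bleb R N).
Local Notation lam := (lebesgue_measure : {measure set (measurableTypeR R) -> \bar R}).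
Variables (Omega : set V) (q nu c0 : R) (G : V -> R -> R).
Hypothesis oO : open Omega.
Hypothesis bO : bounded_set Omega.
Hypothesis q0 : 0 < q.
Hypothesis q1 : q <= 1.
Hypothesis nu0 : 0 < nu.
Hypothesis c00 : 0 < c0.
Hypothesis GP : sobolev_profile Omega q nu c0 G.
Local Notation H := (profH q G).
Local Notation P := (profP q nu c0 G).

(* For K nondecreasing and right-continuous in t, the set where
   [K x (w x) < c] is the union over rationals r of
   [{K x r < c}] intersected with [{w x < r}]. *)
Lemma measurable_monotone_comp (K : V -> R -> R) (w : V -> R) :
  (forall x s t, Omega x -> s <= t -> K x s <= K x t) ->
  (forall x t, Omega x -> 0 <= t -> K y t @[y --> x] --> K x t) ->
  (forall x t, Omega x -> 0 <= t -> K x (t + n.+1%:R^-1) @[n --> \oo] --> K x t) ->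
  (forall x, 0 <= w x) -> measurable_fun (setT : set BV) w ->
  measurable_fun (Omega : set BV) (fun x => K x (w x)).
Proof.
move=> Km Kc Kr w0 mw; have mO := open_borel oO.
apply: (measurability _ (RGenInftyO.measurableE R)) => //.
move=> _ [_ [c ->] <-].
rewrite (_ : Omega `&` _ = \bigcup_(r : rat) ((Omega `&` [set x | 0 <= (ratr r : R) /\ K x (ratr r) < c]) `&`
    [set x | w x < ratr r])).
  apply: bigcupT_measurable_rat => r; apply: measurableI; last first.
    rewrite (_ : mkset _ = w @^-1` `]-oo, ratr r[%classic); last first.
      by apply/seteqP; split => x /=; rewrite in_itv.
    by have := mw measurableT `]-oo, ratr r[%classic (measurable_itv _); rewrite setTI.
  have [r0|r0] := leP 0 (ratr r : R); last first.
    by rewrite (_ : Omega `&` _ = set0)//; apply/seteqP; split => // x [_ []].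
  apply: open_borel; rewrite openE => x [Ox [_ Kx]].
  have nb := open_nbhs_nbhs (conj oO Ox).
  have e0 : 0 < c - K x (ratr r) by rewrite subr_gt0.
  have := (@cvgrPdist_lt _ _ _ (nbhs x) (nbhs_filter x) _ _).1 (Kc x _ Ox r0) _ e0.
  apply: (@filterS2 _ _ (nbhs_filter x) _ _ _ _ nb) => y Oy; rewrite ltr_norml => /andP[h1 _].
  by split => //; split => //; lra.
apply/seteqP; split => x; last first.
  move=> [r _ [[Ox [_ Kx]] wr]]; split => //=; rewrite in_itv/=.
  by apply: le_lt_trans Kx; apply: Km => //; exact: ltW.
move=> [Ox]; rewrite /= in_itv/= => Kx.
have e0 : 0 < c - K x (w x) by rewrite subr_gt0.
have /cvgrPdist_lt/(_ _ e0) := Kr x (w x) Ox (w0 x).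
move=> [n _ /(_ n (leqnn n))]; rewrite /= ltr_norml => /andP[h1 _].
have wn : w x < w x + n.+1%:R^-1 by rewrite ltrDl invr_gt0.
have [r] := rat_in_itvoo wn; rewrite in_itv/= => /andP[r1 r2].
exists r => //; split => //; split => //; split; first by rewrite ltW// (le_lt_trans (w0 x)).
by apply: (@le_lt_trans _ _ (K x (w x + n.+1%:R^-1))); [apply: Km => //; exact: ltW|lra].
Qed.

Let rc (t : R) : (t + n.+1%:R^-1 : R) @[n --> \oo] --> t.
Proof.
rewrite -[X in _ --> X]addr0; apply: cvgD; first exact: cvg_cst.
exact: (@cvg_harmonic R).
Qed.

Lemma measurable_H_comp (w : V -> R) (d : R) : 0 <= d -> (forall x, 0 <= w x) ->
  measurable_fun (setT : set BV) w ->
  measurable_fun (Omega : set BV) (fun x => H x (w x + d)).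
Proof.
move=> d0 w0 mw; apply: measurable_monotone_comp.
- by move=> x s t Ox st; exact: (profH_mono q0 GP).
- by move=> x t Ox t0; exact: (profH_cts oO q0 GP).
- move=> x t Ox t0; apply: (profH_cvg oO q0 GP) => //.
  + by move=> n; rewrite addr_ge0// invr_ge0.
  + exact: cvg_cst.
- by move=> x; rewrite addr_ge0.
- exact: measurable_funD.
Qed.

Lemma measurable_P_comp (w : V -> R) : (forall x, 0 <= w x) ->
  measurable_fun (setT : set BV) w ->
  measurable_fun (Omega : set BV) (fun x => P x (w x)).
Proof.
move=> w0 mw; apply: measurable_monotone_comp => //.
- by move=> x s t Ox st; exact: (profP_mono q0 GP nu0 c00).
- move=> x t Ox t0.
  apply: (@profP_cvg R N Omega q nu c0 G oO q0 GP nu0 _ (nbhs x) (nbhs_pfilter x) (fun y => y)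
      (fun=> t) x t Ox) => //.
  by move=> A /nbhs_singleton At; apply: (@filterE _ (nbhs x) (nbhs_filter x)).
- move=> x t Ox t0; apply: (profP_cvg oO q0 GP nu0) => //.
  + by move=> n; rewrite addr_ge0// invr_ge0.
  + exact: cvg_cst.
Qed.

Lemma integral_continuous (f : R -> R) : measurable_fun (setT : set (measurableTypeR R)) f ->
  (forall r, 0 <= f r) -> (\int[lam]_(r in `]0%R, 1%R]) (f r)%:E < +oo)%E ->
  forall s, 0 <= s <= 1 ->
  {for s, continuous (fun s : R => fine (\int[lam]_(r in `]0%R, s]) (f r * \1_(`]0%R, 1%R]%classic) r)%:E)%E)}.
Proof.
move=> mf f0 fin s /andP[s0 s1].
pose g r := f r * \1_(`]0%R, 1%R]%classic) r.
have mg : measurable_fun (setT : set (measurableTypeR R)) g.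
  by apply: measurable_funM => //; exact: measurable_indic.
have g0 r : 0 <= g r by rewrite mulr_ge0.
have gE D : (\int[lam]_(r in D) (g r)%:E = \int[lam]_(r in D `&` `]0%R, 1%R]%classic) (f r)%:E)%E.
  rewrite integral_mkcondr; apply: eq_integral => r _; rewrite /g patchE indicE.
  by case: (r \in _); rewrite ?mulr1 ?mulr0.
(* A larger interval, so that $0$ and $1$ are interior points; the indicator in [g] leaves the
   integral unchanged. *)
have ig : lam.-integrable (`[(-1)%R, 2%R]%classic : set (measurableTypeR R)) (EFin \o g).
  apply/integrableP; split; first by apply/measurable_EFinP; exact: measurable_funTS.
  under eq_integral do rewrite gee0_abs ?lee_fin//.
  rewrite gE; apply: le_lt_trans fin; apply: ge0_subset_integral => //.
  - exact: measurableI.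
  - by apply/measurable_EFinP; exact: measurable_funTS.
  - by move=> r _; rewrite lee_fin.
have lt12 : (-1 : R) < 2 by lra.
have := parameterized_integral_continuous (ltW lt12) ig.
move=> /(continuous_within_itvP _ lt12)[h _ _].
have sI : s \in `]-1, 2[ by rewrite in_itv/=; apply/andP; split; lra.
pose K := fun x : R => (\int[lam]_(t in `[(-1)%R, x]) g t)%R.
have hs : {for s, continuous K} by exact: h.
have E : K = (fun s : R => fine (\int[lam]_(r in `]0%R, s]) (g r)%:E)%E).
  apply/funext => x; rewrite /K /Rintegral; congr fine; rewrite !gE; congr (integral _ _ _).
  apply/seteqP; split => r /= []; rewrite !in_itv/=.
    by move=> /andP[_ rx] /andP[r0 r1]; rewrite r0 rx r1.
  by move=> /andP[r0 rx] /andP[_ r1]; rewrite r0 rx r1 (le_trans _ (ltW r0))//; lra.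
by rewrite E in hs.
Qed.

End truncated_composition.

Section line_inequality.
Context {R : realType} {N : nat}.
Local Notation V := 'rV[R]_N.
Local Notation BV := (BV R N).
Local Notation mu := (@bleb R N).
Local Notation lam := (lebesgue_measure : {measure set (measurableTypeR R) -> \bar R}).
Variables (Omega : set V) (q nu c0 : R) (G : V -> R -> R).
Hypothesis oO : open Omega.
Hypothesis bO : bounded_set Omega.
Hypothesis q0 : 0 < q.
Hypothesis q1 : q <= 1.
Hypothesis nu0 : 0 < nu.
Hypothesis c00 : 0 < c0.
Hypothesis GP : sobolev_profile Omega q nu c0 G.
Local Notation H := (profH q G).
Local Notation P := (profP q nu c0 G).
Variables (c kap d : R).
Hypothesis cc : 0 <= c.
Hypothesis kk : 0 <= kap.
Hypothesis d0 : 0 < d.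
Local Notation S := (slopeH q G d).
Local Notation tr := (trunc c kap).
Variables (u v : V -> R).
Hypothesis mu_ : measurable_fun (setT : set BV) u.
Hypothesis mv_ : measurable_fun (setT : set BV) v.

Definition lineF (A : R) (z : R) (x : V) (s : R) : R :=
  H x s + (S x s * (c * `|z|) + A * P x s).

Lemma lineF_ge0 A z x s : Omega x -> 0 <= A -> 0 <= lineF A z x s.
Proof using q0 c00 GP cc d0.
move=> Ox A0; have s1 := slopeH_ge0 q0 GP d0 s Ox.
have p1 : 0 <= P x s by exact: profP_ge0.
apply: addr_ge0; first exact: profH_ge0.
by apply: addr_ge0; apply: mulr_ge0 => //; exact: mulr_ge0.
Qed.

Lemma tr_continuous s : {for s, continuous tr}.
Proof using cc.
apply/cvgrPdist_lt => e e0; have c1 : 0 < c + 1 by rewrite ltr_wpDl.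
have ec : 0 < e / (c + 1) by rewrite divr_gt0.
have nb : nbhs s (fun t => `|s - t| < e / (c + 1)).
  by apply/nbhs_ballP; exists (e / (c + 1)) => // t; rewrite -ball_normE.
apply: filterS nb => t st; apply: (le_lt_trans (trunc_lip kap cc _ _)).
apply: (@le_lt_trans _ _ ((c + 1) * `|s - t|)); first by rewrite ler_wpM2r// lerDl.
by rewrite mulrC -ltr_pdivlMr.
Qed.

Lemma measurable_tr : measurable_fun (setT : set BV) (fun x => tr (u x)).
Proof using cc mu_.
have mt : measurable_fun (setT : set (measurableTypeR R)) tr.
  by apply: continuous_measurable_fun => s; exact: tr_continuous.
exact: (measurableT_comp mt mu_).
Qed.

Lemma bmeas_lineF (A : R) : 0 <= A ->
  bmeas ((fun y => (lineF A (v y) y (tr (u y)))%:E) \_ Omega).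
Proof using oO q0 nu0 c00 GP cc kk d0 mu_ mv_.
move=> A0; have mO := open_borel oO; apply/(measurable_restrictT _ mO).
have t0 x : 0 <= tr (u x) by exact: trunc_ge0.
have mt := measurable_tr.
have mH := measurable_H_comp oO q0 GP (lexx 0) t0 mt.
have mHd := measurable_H_comp oO q0 GP (ltW d0) t0 mt.
have mP := measurable_P_comp oO q0 nu0 c00 GP t0 mt.
have mH' : measurable_fun (Omega : set BV) (fun x => H x (tr (u x))).
  by under eq_fun do rewrite -[tr _]addr0.
apply/measurable_EFinP; apply: measurable_funD => //; apply: measurable_funD.
  apply: measurable_funM.
    by apply: measurable_funM => //; exact: measurable_funB.
  apply: measurable_funM => //; apply: measurable_funTS.
  exact: measurableT_comp.
exact: measurable_funM.
Qed.

(** On the segment [u] is replaced by [ub], the integral of its derivative, which is continuous and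
    equal to [u] almost everywhere there. [line_mono] bounds $H(x,w(0))$ by the value at any [h]
    plus an integral; averaging over [h] in $]0,1]$ turns that value into the integral of $H$. *)
Lemma line_ineq (a x : V) : segset Omega a x ->
  (lineseg a 1 (EFin \o pospart v) x < +oo)%E ->
  (lineseg a 1 (EFin \o negpart v) x < +oo)%E ->
  {ae lam, forall h : R, 0 <= h <= 1 -> u (x + h *: a) = u x +
       (fine (lineseg a h (EFin \o pospart v) x) - fine (lineseg a h (EFin \o negpart v) x))} ->
  ((H x (tr (u x)))%:E <=
   lineint a ((fun y => (lineF (norm1 a) (v y) y (tr (u y)))%:E) \_ Omega) x)%E.
Proof using oO bO q0 q1 nu0 c00 GP cc kk d0 mu_ mv_.
move=> sx l1 l2 ac; set FF := _ \_ Omega.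
have A0 := norm1_ge0 a.
have FF0 y : (0 <= FF y)%E.
  rewrite /FF patchE; case: ifPn => // /set_mem Oy; rewrite lee_fin.
  exact: lineF_ge0.
have mFF : bmeas FF := bmeas_lineF A0.
have mI : measurable (`]0%R, 1%R]%classic : set (measurableTypeR R)) by [].
have mFl := bmeas_line1 a x mFF.
apply: (@le_trans _ _ (\int[lam]_(r in `]0%R, 1%R]) FF (x + r *: a)%R)%E); last first.
  by apply: ge0_subset_integral.
(* In the remaining case the right side is finite, and so will be its two parts [T1] and [T2]. *)
have := leey (\int[lam]_(r in `]0%R, 1%R]) FF (x + r *: a)%R)%E.
rewrite le_eqVlt => /predU1P[->|fin]; first exact: leey.
pose vp (r : R) := pospart v (x + r *: a); pose vn (r : R) := negpart v (x + r *: a).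
have mvl : measurable_fun (setT : set (measurableTypeR R)) (fun r : R => v (x + r *: a)).
  exact: (measurableT_comp mv_ (measurable_line1 a x)).
have mvp : measurable_fun (setT : set (measurableTypeR R)) vp.
  exact: (measurableT_comp (measurable_pospart mv_) (measurable_line1 a x)).
have mvn : measurable_fun (setT : set (measurableTypeR R)) vn.
  exact: (measurableT_comp (measurable_negpart mv_) (measurable_line1 a x)).
have vp0 r : 0 <= vp r by exact: pospart_ge0.
have vn0 r : 0 <= vn r by exact: negpart_ge0.
have vpE r : (0 <= (EFin \o vp) r)%E by rewrite lee_fin.
have vnE r : (0 <= (EFin \o vn) r)%E by rewrite lee_fin.
have mvpE : measurable_fun (setT : set (measurableTypeR R)) (EFin \o vp) by exact/measurable_EFinP.
have mvnE : measurable_fun (setT : set (measurableTypeR R)) (EFin \o vn) by exact/measurable_EFinP.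
pose Ph (f : R -> R) (s : R) := fine (\int[lam]_(r in `]0%R, s]) (f r * \1_(`]0%R, 1%R]%classic) r)%:E)%E.
have PhE (f : R -> R) s : s <= 1 -> Ph f s = fine (\int[lam]_(r in `]0%R, s]) (f r)%:E)%E.
  move=> s1; congr fine; apply: eq_integral => r; rewrite inE/= in_itv/= => /andP[r0 rs].
  by rewrite indicE mem_setE in_itv/= r0 (le_trans rs s1) mulr1.
pose ub s := u x + (Ph vp s - Ph vn s).
pose w s := tr (ub s).
have w0 s : 0 <= w s by exact: trunc_ge0.
have cw s : 0 <= s <= 1 -> {for s, continuous w}.
  move=> s01; have cp := integral_continuous mvp vp0 l1 s01.
  have cn := integral_continuous mvn vn0 l2 s01.
  have cu : {for s, continuous ub} by apply: cvgD; [exact: cvg_cst|exact: (cvgB cp cn)].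
  exact: (continuous_comp cu (@tr_continuous (ub s))).
pose vv r := c * (vp r + vn r).
have vvE r : vv r = c * `|v (x + r *: a)|.
  rewrite /vv /vp /vn /pospart /negpart; congr (_ * _).
  have [h|h] := leP (v (x + r *: a)) 0.
    by rewrite max_l ?oppr_ge0// add0r ler0_norm.
  by rewrite max_r ?oppr_le0 ?(ltW h)// addr0 gtr0_norm.
have vv0 r : 0 <= vv r by rewrite mulr_ge0// addr_ge0.
have mvv : measurable_fun (setT : set (measurableTypeR R)) vv.
  by apply: measurable_funM => //; exact: measurable_funD.
have ivD s t : 0 <= s -> s <= t -> t <= 1 ->
    (\int[lam]_(r in `]s, t]) (vv r)%:E =
     c%:E * (\int[lam]_(r in `]s, t]) (vp r)%:E + \int[lam]_(r in `]s, t]) (vn r)%:E))%E.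
  move=> s0 st t1; have mst : measurable (`]s, t]%classic : set (measurableTypeR R)) by [].
  have q1' (r : R) : `]s, t]%classic r -> (0 <= (vp r)%:E)%E by move=> _; rewrite lee_fin.
  have q2' (r : R) : `]s, t]%classic r -> (0 <= (vn r)%:E)%E by move=> _; rewrite lee_fin.
  have m1 : measurable_fun (`]s, t]%classic : set (measurableTypeR R)) (fun r => (vp r)%:E).
    by apply: measurable_funTS; exact: mvpE.
  have m2 : measurable_fun (`]s, t]%classic : set (measurableTypeR R)) (fun r => (vn r)%:E).
    by apply: measurable_funTS; exact: mvnE.
  have q3' (r : R) : `]s, t]%classic r -> (0 <= (vp r)%:E + (vn r)%:E)%E.
    by move=> _; rewrite -EFinD lee_fin addr_ge0.
  have cE : (0 <= c%:E)%E by rewrite lee_fin.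
  rewrite -(ge0_integralD lam mst q1' m1 q2' m2).
  by rewrite -(ge0_integralZl lam mst (emeasurable_funD m1 m2) q3' cE).
have ivv : (\int[lam]_(r in `]0%R, 1%R]) (vv r)%:E < +oo)%E.
  rewrite ivD// ?ler01//; apply: lte_mul_pinfty => //.
  exact: lte_add_pinfty.
have wvv s t : 0 <= s -> s <= t -> t <= 1 ->
    `|w t - w s| <= fine (\int[lam]_(r in `]s, t]) (vv r)%:E)%E.
  move=> s0 st t1; have s1 := le_trans st t1.
  have [e1 f1] := integral_itv_diff vpE mvpE l1 s0 st t1.
  have [e2 f2] := integral_itv_diff vnE mvnE l2 s0 st t1.
  apply: (le_trans (trunc_lip kap cc _ _)).
  have p1 : (\int[lam]_(r in `]s, t]) (vp r)%:E)%E \is a fin_num.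
    by rewrite fin_numElt f1 andbT (lt_le_trans (ltNy0 : (-oo < 0 :> \bar R)%E))//; apply: integral_ge0 => r _; rewrite lee_fin.
  have p2 : (\int[lam]_(r in `]s, t]) (vn r)%:E)%E \is a fin_num.
    by rewrite fin_numElt f2 andbT (lt_le_trans (ltNy0 : (-oo < 0 :> \bar R)%E))//; apply: integral_ge0 => r _; rewrite lee_fin.
  have -> : ub t - ub s = fine (\int[lam]_(r in `]s, t]) (vp r)%:E)%E - fine (\int[lam]_(r in `]s, t]) (vn r)%:E)%E.
    by rewrite -e1 -e2 /ub !PhE//; ring.
  rewrite (ivD s t s0 st t1); move: p1 p2.
  have g1 : (0 <= \int[lam]_(r in `]s, t]) (vp r)%:E)%E by apply: integral_ge0 => r _; rewrite lee_fin.
  have g2 : (0 <= \int[lam]_(r in `]s, t]) (vn r)%:E)%E by apply: integral_ge0 => r _; rewrite lee_fin.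
  move: g1 g2; case: (\int[lam]_(r in `]s, t]) (vp r)%:E)%E => //= y1; case: (\int[lam]_(r in `]s, t]) (vn r)%:E)%E => //= y2.
  rewrite !lee_fin => y10 y20 _ _; rewrite ler_wpM2l//.
  by rewrite (le_trans (ler_normB _ _))// !ger0_norm.
have ly (s : R) : (fun r : R => x + r *: a) @ s --> x + s *: a.
  by apply: cvgD; [exact: cvg_cst|apply: cvgZr_tmp; exact: cvg_id].
have Hc (s : R) : 0 <= s <= 1 -> H (x + r *: a) (w r) @[r --> s] --> H (x + s *: a) (w s).
  move=> s01; exact: (profH_cvg oO q0 GP (sx _ s01) w0 (w0 s) (ly s) (cw s s01)).
pose gk (e : R) (r : R) := vv r * (S (x + r *: a) (w r) + (e + e)) + norm1 a * (P (x + r *: a) (w r) + (e + e)).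
pose Hn (r : R) := H (x + r *: a) (w r).
have ae1 : {ae lam, forall r, `]0%R, 1%R]%classic r -> FF (x + r *: a)%R = (Hn r + gk 0 r)%:E}.
  have FL := ae_filter_ringOfSetsType lam.
  apply: filterS ac => r hr; rewrite /= in_itv/= => /andP[r0 r1].
  have r01 : 0 <= r <= 1 by rewrite ltW.
  have uE : u (x + r *: a) = ub r by rewrite hr// /ub !PhE.
  rewrite /FF patchE mem_set; last exact: sx.
  by rewrite /lineF uE /gk /Hn vvE !addr0 -/(w r) [S _ _ * _]mulrC.
have mS (s : R) : 0 <= s <= 1 -> S (x + r *: a) (w r) @[r --> s] --> S (x + s *: a) (w s).
  move=> s01; exact: (slopeH_cvg oO q0 GP d0 (sx _ s01) w0 (w0 s) (ly s) (cw s s01)).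
have mP (s : R) : 0 <= s <= 1 -> P (x + r *: a) (w r) @[r --> s] --> P (x + s *: a) (w s).
  move=> s01; exact: (profP_cvg oO q0 GP nu0 (sx _ s01) w0 (w0 s) (ly s) (cw s s01)).
have mI01 (K : R -> R) : (forall s, 0 <= s <= 1 -> {for s, continuous K}) ->
    measurable_fun (`]0%R, 1%R]%classic : set (measurableTypeR R)) K.
  move=> hK; apply: subspace_continuous_measurable_fun => //; apply: continuous_in_subspaceT.
  by move=> r; rewrite inE/= in_itv/= => /andP[r0 r1]; apply: hK; rewrite ltW.
have mHn : measurable_fun (`]0%R, 1%R]%classic : set (measurableTypeR R)) Hn by apply: mI01.
have mgk e : measurable_fun (`]0%R, 1%R]%classic : set (measurableTypeR R)) (gk e).
  apply: measurable_funD; apply: measurable_funM => //.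
  - exact: measurable_funTS.
  - by apply: measurable_funD => //; exact: mI01.
  - by apply: measurable_funD => //; exact: mI01.
have gk0 e r : 0 <= e -> `]0%R, 1%R]%classic r -> 0 <= gk e r.
  move=> e0; rewrite /= in_itv/= => /andP[r0 r1]; have r01 : 0 <= r <= 1 by rewrite ltW.
  rewrite /gk addr_ge0 ?mulr_ge0 ?addr_ge0//.
  - exact: (slopeH_ge0 q0 GP d0 _ (sx _ r01)).
  - exact: profP_ge0.
have Hn0 r : 0 <= Hn r by exact: profH_ge0.
have eqF : (\int[lam]_(r in `]0%R, 1%R]) FF (x + r *: a)%R =
    \int[lam]_(r in `]0%R, 1%R]) (Hn r)%:E + \int[lam]_(r in `]0%R, 1%R]) (gk 0 r)%:E)%E.
  transitivity (\int[lam]_(r in `]0%R, 1%R]) ((Hn r)%:E + (gk 0 r)%:E))%E.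
    apply: ae_eq_integral => //.
    - exact: measurable_funTS.
    - by apply: emeasurable_funD; exact/measurable_EFinP.
  rewrite ge0_integralD//.
  - by move=> r _; rewrite lee_fin.
  - exact/measurable_EFinP.
  - by move=> r rI; rewrite lee_fin gk0.
  - exact/measurable_EFinP.
pose T1 := (\int[lam]_(r in `]0%R, 1%R]) (Hn r)%:E)%E.
pose T2 := (\int[lam]_(r in `]0%R, 1%R]) (gk 0 r)%:E)%E.
pose C := (\int[lam]_(r in `]0%R, 1%R]) (vv r)%:E)%E.
have T10 : (0 <= T1)%E by apply: integral_ge0 => r _; rewrite lee_fin.
have T20 : (0 <= T2)%E by apply: integral_ge0 => r rI; rewrite lee_fin gk0.
have C0 : (0 <= C)%E by apply: integral_ge0 => r _; rewrite lee_fin.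
have Cf : C \is a fin_num by rewrite ge0_fin_numE.
have T1f : T1 \is a fin_num.
  by rewrite ge0_fin_numE//; apply: le_lt_trans fin; rewrite eqF leeDl.
have T2f : T2 \is a fin_num.
  by rewrite ge0_fin_numE//; apply: le_lt_trans fin; rewrite eqF leeDr.
have lam1 : (lam `]0%R, 1%R]%classic = 1)%E.
  by rewrite /= lebesgue_measure_itv/= lte_fin ltr01 -EFinB subr0.
have ic (z : R) : (\int[lam]_(r in `]0%R, 1%R]) z%:E = z%:E)%E.
  by have := @integral_cst _ _ _ lam _ mI z%:E => /= ->; rewrite lam1 mule1.
have gke e : 0 <= e -> (\int[lam]_(r in `]0%R, 1%R]) (gk e r)%:E =
    T2 + (e + e)%:E * (C + (norm1 a)%:E))%E.
  move=> e0; have ee : 0 <= e + e by rewrite addr_ge0.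
  transitivity (\int[lam]_(r in `]0%R, 1%R]) ((gk 0 r)%:E + (e + e)%:E * ((vv r)%:E + (norm1 a)%:E)))%E.
    apply: eq_integral => r _.
    transitivity ((gk 0 r + (e + e) * (vv r + norm1 a))%:E) => //.
    by congr EFin; rewrite /gk; ring.
  have m1 : measurable_fun (`]0%R, 1%R]%classic : set (measurableTypeR R)) (fun r => (vv r)%:E).
    by apply/measurable_EFinP; exact: measurable_funTS.
  have m2 : measurable_fun (`]0%R, 1%R]%classic : set (measurableTypeR R)) (fun r => ((vv r)%:E + (norm1 a)%:E)%E).
    exact: emeasurable_funD.
  have p1 (r : R) : `]0%R, 1%R]%classic r -> (0 <= (vv r)%:E + (norm1 a)%:E)%E.
    by move=> _; rewrite adde_ge0 ?lee_fin.
  have p2 (r : R) : `]0%R, 1%R]%classic r -> (0 <= (e + e)%:E * ((vv r)%:E + (norm1 a)%:E))%E.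
    by move=> rI; apply: mule_ge0; [by rewrite lee_fin|exact: p1 rI].
  have p3 (r : R) : `]0%R, 1%R]%classic r -> (0 <= (gk 0 r)%:E)%E.
    by move=> rI; rewrite lee_fin gk0.
  have p4 (r : R) : `]0%R, 1%R]%classic r -> (0 <= (vv r)%:E)%E by rewrite lee_fin.
  have m3 : measurable_fun (`]0%R, 1%R]%classic : set (measurableTypeR R)) (fun r => (gk 0 r)%:E).
    exact/measurable_EFinP.
  have m4 : measurable_fun (`]0%R, 1%R]%classic : set (measurableTypeR R))
      (fun r => ((e + e)%:E * ((vv r)%:E + (norm1 a)%:E))%E) by exact: measurable_funeM.
  have eeE : (0 <= (e + e)%:E)%E by rewrite lee_fin.
  rewrite (ge0_integralD _ mI p3 m3 p2 m4) (ge0_integralZl _ mI m2 p1 eeE).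
  have p5 (r : R) : `]0%R, 1%R]%classic r -> (0 <= (norm1 a)%:E)%E by rewrite lee_fin.
  have m5 : measurable_fun (`]0%R, 1%R]%classic : set (measurableTypeR R)) (fun=> (norm1 a)%:E).
    exact: measurable_cst.
  by rewrite (ge0_integralD lam mI p4 m1 p5 m5) ic.
rewrite eqF -/T1 -/T2.
apply/lee_addgt0Pr => eps eps0.
(* The tolerances contribute $2e(C+|a|_1)$ in all, at most [eps] when $e$ is [eps] over [B]; the
   summand $1$ keeps [B] positive. *)
pose B := 2 * (fine C + norm1 a) + 1.
have fC0 : 0 <= fine C by exact: fine_ge0.
have B0 : 0 < B by rewrite /B; lra.
pose e := eps / B; have e0 : 0 < e by rewrite divr_gt0.
have eB : (e + e) * (fine C + norm1 a) <= eps.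
  have : e * B = eps by rewrite /e divfK// gt_eqF.
  by rewrite /B; nra.
have ik : (\int[lam]_(r in `]0%R, 1%R]) (gk e r)%:E < +oo)%E.
  by rewrite gke ?(ltW e0)// -(fineK T2f) -(fineK Cf); exact: ltry.
have main h : 0 <= h <= 1 -> H x (w 0) <= Hn h + fine (\int[lam]_(r in `]0%R, 1%R]) (gk e r)%:E)%E.
  by move=> h01; exact: (line_mono oO bO q0 q1 nu0 c00 GP d0 sx e0 w0 cw mvv vv0 ivv wvv ik h01).
have w00 : w 0 = tr (u x).
  by rewrite /w /ub /Ph set_itv_ge ?bnd_simp// !integral_set0 subrr addr0.
rewrite w00 gke ?(ltW e0)// in main.
have E2 : fine (T2 + (e + e)%:E * (C + (norm1 a)%:E))%E = fine T2 + (e + e) * (fine C + norm1 a).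
  by rewrite -{1}(fineK T2f) -{1}(fineK Cf).
rewrite E2 in main.
set K := fine T2 + _ in main.
have K0 : 0 <= K by rewrite /K addr_ge0 ?fine_ge0// mulr_ge0 ?addr_ge0 ?(ltW e0).
apply: (@le_trans _ _ (T1 + K%:E)%E); last first.
  by rewrite -(fineK T1f) -(fineK T2f) -!EFinD lee_fin /K; lra.
(* The left side is constant, hence its own average over $]0,1]$; the bound at each [h] can now be
   integrated. *)
rewrite -[X in (X <= _)%E]ic.
have t1 (r : R) : `]0%R, 1%R]%classic r -> (0 <= (Hn r)%:E)%E by rewrite lee_fin.
have t2 : measurable_fun (`]0%R, 1%R]%classic : set (measurableTypeR R)) (fun r => (Hn r)%:E).
  exact/measurable_EFinP.
have t3 (r : R) : `]0%R, 1%R]%classic r -> (0 <= K%:E)%E by rewrite lee_fin.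
have t4 : measurable_fun (`]0%R, 1%R]%classic : set (measurableTypeR R)) (fun=> K%:E).
  exact: measurable_cst.
have -> : (T1 + K%:E = \int[lam]_(r in `]0%R, 1%R]) ((Hn r)%:E + K%:E))%E.
  by rewrite (ge0_integralD lam mI t1 t2 t3 t4) ic.
apply: ge0_le_integral => //.
- by move=> r _; rewrite lee_fin profH_ge0.
- exact: emeasurable_funD t2 t4.
- move=> r; rewrite /= in_itv/= => /andP[r0 r1]; rewrite -EFinD lee_fin; apply: main.
  by rewrite ltW.
Qed.

End line_inequality.

(** * The Loomis-Whitney inequality for skew directions *)

Section multi_hoelder.
Context d (T : measurableType d) {R : realType}.
Variable mu : {measure set T -> \bar R}.

Lemma powR_prod (I : Type) (s : seq I) (P : pred I) (z : I -> R) r :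
  (forall i, 0 <= z i) ->
  (\prod_(i <- s | P i) z i) `^ r = \prod_(i <- s | P i) z i `^ r.
Proof.
move=> z0; elim: s => [|i s IH]; first by rewrite !big_nil powR1.
rewrite !big_cons; case: ifP => // _; rewrite powRM ?IH//.
exact: prodr_ge0.
Qed.

Lemma amgm_prod (I : finType) (A : {set I}) (z : I -> R) : (0 < #|A|)%N ->
  (forall k, 0 <= z k) ->
  \prod_(k in A) z k `^ (#|A|%:R^-1) <= #|A|%:R^-1 * \sum_(k in A) z k.
Proof.
move=> A0 z0; have m0 : (0 < #|A|%:R :> R) by rewrite ltr0n.
have [h _] := @leif_AGM R I (mem A) z (fun i _ => z0 i).
rewrite -powR_prod// mulrC.
have s0 : 0 <= (\sum_(i in A) z i) / #|A|%:R by rewrite divr_ge0 ?sumr_ge0 ?ltW.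
rewrite -[leRHS]powRr1// -[X in _ <= _ `^ X](@mulfV _ #|A|%:R) ?gt_eqF// powRrM powR_mulrn//.
have p0 : 0 <= \prod_(i in A) z i by apply: prodr_ge0 => i _.
apply: ge0_ler_powR => //; rewrite ?nnegrE ?exprn_ge0 ?invr_ge0 ?(ltW m0)//.
Qed.

Local Open Scope ereal_scope.

Lemma eprod_ge0 (I : Type) (s : seq I) (P : pred I) (z : I -> \bar R) :
  (forall i, 0 <= z i) -> 0 <= \big[mule/1]_(i <- s | P i) z i.
Proof. by move=> z0; elim/big_ind: _ => // x y; exact: mule_ge0. Qed.

Lemma eprod_fin (I : Type) (s : seq I) (P : pred I) (z : I -> R) :
  \big[mule/1]_(i <- s | P i) (z i)%:E = (\prod_(i <- s | P i) z i)%R%:E.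
Proof. by elim/big_ind2 : _ => // x1 x2 y1 y2 -> ->. Qed.

Lemma eprod0 (I : finType) (P : pred I) (z : I -> \bar R) k : P k -> z k = 0 ->
  \big[mule/1]_(i | P i) z i = 0.
Proof. by move=> Pk zk; rewrite (bigD1 k)//= zk mul0e. Qed.

Lemma le_eprod (I : Type) (s : seq I) (P : pred I) (z w : I -> \bar R) :
  (forall i, 0 <= z i) -> (forall i, z i <= w i) ->
  \big[mule/1]_(i <- s | P i) z i <= \big[mule/1]_(i <- s | P i) w i.
Proof.
move=> z0 zw; elim: s => [|i s IH]; first by rewrite !big_nil.
rewrite !big_cons; case: ifP => // _; apply: lee_pmul => //.
exact: eprod_ge0.
Qed.

Lemma measurable_eprod (I : Type) (s : seq I) (P : pred I) (f : I -> T -> \bar R) :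
  (forall i, measurable_fun setT (f i)) ->
  measurable_fun setT (fun x => \big[mule/1]_(i <- s | P i) f i x).
Proof.
move=> mf; elim: s => [|i s IH].
  by under eq_fun do rewrite big_nil; exact: measurable_cst.
under eq_fun do rewrite big_cons; case: (P i) => //.
exact: emeasurable_funM.
Qed.

(** The arithmetic-geometric inequality for the $z_k/a_k$; the $a_k$ will be the integrals of the
    factors. *)
Lemma eamgm (I : finType) (A : {set I}) (z : I -> \bar R) (a : I -> R) :
  (0 < #|A|)%N -> (forall k, 0 <= z k) -> (forall k, k \in A -> (0 < a k)%R) ->
  \big[mule/1]_(k in A) z k `^ (#|A|%:R^-1) <=
  (\prod_(k in A) a k `^ (#|A|%:R^-1))%R%:E *
   \sum_(k in A) (#|A|%:R^-1 / a k)%R%:E * z k.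
Proof.
move=> A0 z0 a0; have m0 : (0 < #|A|%:R :> R)%R by rewrite ltr0n.
have c0 : (0 < \prod_(k in A) a k `^ (#|A|%:R^-1))%R.
  by apply: prodr_gt0 => k kA; rewrite powR_gt0// a0.
have t0 k : k \in A -> 0 <= (#|A|%:R^-1 / a k)%R%:E * z k.
  by move=> kA; rewrite mule_ge0// lee_fin divr_ge0 ?invr_ge0 ?ltW// a0.
have [[k [kA zk]]|fin] := pselect (exists k, k \in A /\ z k = +oo).
  rewrite [X in _ <= _ * X](bigD1 (P := mem A) k)//= zk gt0_muley; last first.
    by rewrite lte_fin divr_gt0 ?invr_gt0// a0.
  rewrite addye ?gt0_muley ?leey// ?lte_fin// gt_eqF//.
  by apply: (@lt_le_trans _ _ 0) => //; apply: sume_ge0 => i /andP[iA _]; exact: t0.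
pose y k := fine (z k).
have zy k : k \in A -> z k = (y k)%:E.
  move=> kA; rewrite fineK// ge0_fin_numE// ltey; apply/eqP => zk.
  by apply: fin; exists k.
have y0 k : (0 <= y k)%R by exact: fine_ge0.
rewrite (eq_bigr (fun k => (y k `^ (#|A|%:R^-1))%R%:E)); last first.
  by move=> k kA; rewrite zy.
rewrite eprod_fin (eq_bigr (fun k => (#|A|%:R^-1 / a k * y k)%R%:E)); last first.
  by move=> k kA; rewrite zy.
rewrite sumEFin -EFinM lee_fin.
have h := @amgm_prod I A (fun k => y k / `|a k|)%R A0
   (fun k => divr_ge0 (y0 k) (normr_ge0 _)).
have -> : (\prod_(k in A) y k `^ #|A|%:R^-1 = \prod_(k in A) a k `^ #|A|%:R^-1 *
   \prod_(k in A) (y k / `|a k|) `^ #|A|%:R^-1)%R.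
  rewrite -big_split/=; apply: eq_bigr => k kA.
  have ak := a0 _ kA; rewrite gtr0_norm// -powRM ?divr_ge0 ?(ltW ak)//.
  by rewrite mulrCA divff ?mulr1// gt_eqF.
apply: (ler_wpM2l (ltW c0)); apply: le_trans h _.
rewrite mulr_sumr ler_sum// => k kA; rewrite gtr0_norm ?a0//.
by rewrite mulrA mulrAC.
Qed.

(** Apply the arithmetic-geometric inequality pointwise to the functions divided by their integrals,
    then integrate. Vanishing and infinite integrals are separate cases. *)
Lemma multi_hoelder (I : finType) (A : {set I}) (f : I -> T -> \bar R) :
  (0 < #|A|)%N -> (forall k, measurable_fun setT (f k)) ->
  (forall k x, 0 <= f k x) ->
  \int[mu]_x \big[mule/1]_(k in A) f k x `^ (#|A|%:R^-1) <=
  \big[mule/1]_(k in A) (\int[mu]_x f k x) `^ (#|A|%:R^-1).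
Proof.
move=> A0 mf f0; have m0 : (0 < #|A|%:R :> R)%R by rewrite ltr0n.
have mi : (#|A|%:R^-1 != 0 :> R)%R by rewrite invr_eq0 gt_eqF.
have mp k : measurable_fun setT (fun x => f k x `^ (#|A|%:R^-1)).
  by apply: (measurableT_comp (measurable_poweR _)).
have mprod : measurable_fun setT (fun x => \big[mule/1]_(k in A) f k x `^ (#|A|%:R^-1)).
  exact: measurable_eprod.
have prod0 x : 0 <= \big[mule/1]_(k in A) f k x `^ (#|A|%:R^-1).
  by apply: eprod_ge0 => k; exact: poweR_ge0.
have if0 k : 0 <= \int[mu]_x f k x by exact: integral_ge0.
have [[k [kA fk0]]|n0] := pselect (exists k, k \in A /\ \int[mu]_x f k x = 0).
  rewrite [leLHS](_ : _ = 0); first by apply: eprod_ge0 => i; exact: poweR_ge0.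
  have : ae_eq mu setT (f k) (cst 0).
    apply/ae_eq_integral_abs => //; rewrite -[RHS]fk0; apply: eq_integral => x _.
    by rewrite gee0_abs.
  move=> fk; rewrite -[RHS](integral0 mu setT); apply: ge0_ae_eq_integral => //.
  apply: filterS fk => x /(_ Logic.I) /= fk _.
  by rewrite (@eprod0 _ _ _ k)// fk poweR0r.
have ip k : k \in A -> 0 < \int[mu]_x f k x.
  move=> kA; rewrite lt_neqAle if0 andbT eq_sym; apply/eqP => h.
  by apply: n0; exists k.
have [[k [kA fkoo]]|fin] := pselect (exists k, k \in A /\ \int[mu]_x f k x = +oo).
  rewrite [leRHS](bigD1 (P := mem A) k)//= fkoo poweRyr// gt0_mulye ?leey//.
  elim/big_ind : _ => // [x y x0 y0|i /andP[iA _]]; first exact: mule_gt0.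
  by rewrite poweR_gt0// ip.
pose a k := fine (\int[mu]_x f k x).
have ia k : k \in A -> \int[mu]_x f k x = (a k)%:E.
  move=> kA; rewrite fineK// ge0_fin_numE// ltey; apply/eqP => h.
  by apply: fin; exists k.
have a0 k : k \in A -> (0 < a k)%R.
  by move=> kA; rewrite -lte_fin -ia// ip.
have c0 : (0 <= \prod_(k in A) a k `^ (#|A|%:R^-1))%R.
  by apply: prodr_ge0 => k kA; rewrite powR_ge0.
have ms : measurable_fun setT (fun x => \sum_(k in A) (#|A|%:R^-1 / a k)%R%:E * f k x).
  by under eq_fun do rewrite big_mkcond/=; apply: emeasurable_sum => k; case: (k \in A) => //; apply: emeasurable_funM.
have t0 k x : k \in A -> 0 <= (#|A|%:R^-1 / a k)%R%:E * f k x.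
  by move=> kA; rewrite mule_ge0// lee_fin divr_ge0 ?invr_ge0 ?ltW// a0.
apply: (@le_trans _ _ (\int[mu]_x ((\prod_(k in A) a k `^ (#|A|%:R^-1))%R%:E *
   \sum_(k in A) (#|A|%:R^-1 / a k)%R%:E * f k x))).
  apply: ge0_le_integral => //.
    by apply: emeasurable_funM.
  by move=> x _; exact: eamgm.
rewrite ge0_integralZl_EFin//; last by move=> x _; apply: sume_ge0 => k kA; exact: t0.
under eq_integral do rewrite big_mkcond/=.
rewrite ge0_integral_sum//; last 2 first.
- by move=> k; case: (k \in A) => //; apply: emeasurable_funM.
- by move=> k x _; case: ifP => // kA; exact: t0.
rewrite (eq_bigr (fun k => if k \in A then (#|A|%:R^-1)%:E else 0)); last first.
  move=> k _; case: ifP => kA; last by rewrite integral0.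
  rewrite ge0_integralZl_EFin// ?divr_ge0 ?invr_ge0 ?ltW ?a0//.
  by rewrite ia// -EFinM divfK// gt_eqF// a0.
rewrite -big_mkcond/= sumEFin sumr_const -(mulr_natl (#|A|%:R^-1)%R) mulfV ?gt_eqF// mule1.
rewrite -eprod_fin; rewrite [leRHS](eq_bigr (fun k => (a k `^ (#|A|%:R^-1))%R%:E))//.
by move=> k kA; rewrite ia.
Qed.

End multi_hoelder.

Section loomis_whitney.
Context {R : realType} {N : nat}.
Local Notation V := 'rV[R]_N.
Local Notation BV := (BV R N).
Local Notation mu := (@bleb R N).
Variable a : 'I_N -> V.
Hypothesis N2 : (2 <= N)%N.
Local Open Scope ereal_scope.
Let r : R := (N.-1%:R^-1)%R.

Let card_setC1 l : #|[set~ l]%SET : {set 'I_N}| = N.-1.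
Proof. by rewrite cardsC1 card_ord. Qed.

Lemma bmeas_poweR (f : V -> \bar R) p : bmeas f -> bmeas (fun x => f x `^ p).
Proof. by move=> mf; exact: (measurableT_comp (measurable_poweR _) mf). Qed.

Lemma bmeas_eprod (f : 'I_N -> V -> \bar R) (P : pred 'I_N) : (forall k, bmeas (f k)) ->
  bmeas (fun x => \big[mule/1]_(k | P k) f k x).
Proof. by move=> mf; exact: measurable_eprod. Qed.

(** Induction on the directions integrated. Along [a l] the factor built from [F l] is constant and
    leaves the integral; Holder with $N-1$ equal exponents treats the others. *)
Lemma loomis_whitney_lines (F : 'I_N -> V -> \bar R) (s : seq 'I_N) x :
  (forall k, bmeas (F k)) -> (forall k x, 0 <= F k x) ->
  (forall k x t, F k (x + t *: a k)%R = F k x) -> uniq s ->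
  iterint (map a s) (fun x => \big[mule/1]_k F k x `^ r) x <=
  \big[mule/1]_k (iterint (map a (seq.filter (predC1 k) s)) (F k) x) `^ r.
Proof.
move=> mF F0 inv; elim: s x => [//|l s IH] x /= /andP[ls us].
pose Phi k := iterint (map a (seq.filter (predC1 k) s)) (F k).
have mPhi k : bmeas (Phi k) by exact: bmeas_iterint.
have Phi0 k y : 0 <= Phi k y by exact: iterint_ge0.
have mP : bmeas (fun x => \big[mule/1]_k F k x `^ r).
  by apply: bmeas_eprod => k; exact: bmeas_poweR.
have P0 y : 0 <= \big[mule/1]_k F k y `^ r.
  by apply: eprod_ge0 => k; exact: poweR_ge0.
apply: (@le_trans _ _ (lineint (a l) (fun y => \big[mule/1]_k Phi k y `^ r) x)).
  apply: le_lineint.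
  - exact: bmeas_iterint.
  - by apply: bmeas_eprod => k; exact: bmeas_poweR.
  - exact: iterint_ge0.
  - by move=> y; exact: IH.
have Phil t : Phi l (x + t *: a l)%R = Phi l x.
  rewrite /Phi -iterint_translate; congr (iterint _ _ x).
  by apply/funext => y; exact: inv.
rewrite /lineint.
rewrite (_ : (fun t : R => \big[mule/1]_k Phi k (x + t *: a l)%R `^ r) =
   (fun t : R => Phi l x `^ r *
     \big[mule/1]_(k in [set~ l]%SET) Phi k (x + t *: a l)%R `^ r)); last first.
  apply/funext => t; rewrite (bigD1 l)//= Phil; congr (_ * _).
  by apply: eq_bigl => k; rewrite !inE.
have mline k : measurable_fun setT (fun t : R => Phi k (x + t *: a l)%R).
  exact: bmeas_line1.
rewrite ge0_integralZl//; last 3 first.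
- by apply: measurable_eprod => k; exact: (measurableT_comp (measurable_poweR r) (mline k)).
- by move=> t _; apply: eprod_ge0 => k; exact: poweR_ge0.
- exact: poweR_ge0.
rewrite [leRHS](bigD1 l)//= eqxx /=; apply: lee_pmul.
- exact: poweR_ge0.
- by apply: integral_ge0 => t _; apply: eprod_ge0 => k; exact: poweR_ge0.
- by [].
have cA : (0 < #|[set~ l]%SET|)%N by rewrite card_setC1; case: (N) N2 => [|[]].
have := multi_hoelder lebesgue_measure cA mline (fun k t => Phi0 k _).
rewrite card_setC1 => h; apply: (le_trans h).
rewrite [leRHS](eq_bigl (fun k => k \in [set~ l]%SET)); last first.
  by move=> k; rewrite !inE.
rewrite [leRHS](eq_bigr (fun k => (\int[lebesgue_measure]_t Phi k (x + t *: a l)%R) `^ r))//.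
by move=> k; rewrite !inE => kl; rewrite eq_sym (negbTE kl).
Qed.

(** Take for [F k] the integral of [g] along [a k]: integrated over the other $N-1$ directions it
    gives back the full integral. [C] accounts for the determinant of the directions. *)
Lemma loomis_whitney (C : R) (g : V -> \bar R) : bmeas g -> (forall x, 0 <= g x) ->
  (0 < C)%R ->
  (forall f, bmeas f -> (forall x, 0 <= f x) ->
     forall x, iterint [seq a i | i <- enum 'I_N] f x = C%:E * \int[mu]_y f y) ->
  C%:E * \int[mu]_x \big[mule/1]_k (lineint (a k) g x) `^ r <=
  \big[mule/1]_(k < N) (C%:E * \int[mu]_x g x) `^ r.
Proof.
move=> mg g0 C0 hC.
have mF k : bmeas (lineint (a k) g) by exact: bmeas_lineint.
have F0 k x : 0 <= lineint (a k) g x by exact: lineint_ge0.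
rewrite -(hC _ _ _ 0%R); last 2 first.
- by apply: bmeas_eprod => k; exact: bmeas_poweR.
- by move=> x; apply: eprod_ge0 => k; exact: poweR_ge0.
apply: le_trans (loomis_whitney_lines 0%R mF F0 _ (enum_uniq _)) _.
  move=> k x t; rewrite /lineint -[LHS]mul1e -(normr1 R).
  rewrite (@integral_affine _ 1 t (fun s => g (x + s *: a k)%R))//; last first.
    exact: bmeas_line1.
  congr (_ * _); apply: eq_integral => s _; rewrite mul1r scalerDl addrAC -addrA.
  by rewrite [X in g (x + X)%R]addrC addrA.
apply: le_eprod => k; first exact: poweR_ge0.
rewrite -(hC _ mg g0 0%R) iterint_lineintC//.
rewrite -[lineint _ _]/(iterint (a k :: _) g).
rewrite (_ : a k :: _ = map a (k :: seq.filter (predC1 k) (enum 'I_N)))//.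
rewrite (iterint_perm mg g0 (perm_map a (_ : perm_eq _ (enum 'I_N))))//.
rewrite perm_sym -rem_filter ?enum_uniq//.
by apply: perm_to_rem; rewrite mem_enum.
Qed.

End loomis_whitney.

Local Close Scope ereal_scope.
Local Close Scope ereal_scope.

(** * The Gagliardo-Nirenberg step *)

Section gagliardo.
Context {R : realType} {N : nat}.
Local Notation V := 'rV[R]_N.
Local Notation BV := (BV R N).
Local Notation mu := (@bleb R N).
Local Notation lam := (lebesgue_measure : {measure set (measurableTypeR R) -> \bar R}).
Variables (Omega : set V) (nu c0 : R) (G : V -> R -> R).
Hypothesis N2 : (2 <= N)%N.
Local Notation q := (1 - N%:R^-1 : R).
Hypothesis oO : open Omega.
Hypothesis bO : bounded_set Omega.
Hypothesis coneO : cone_property Omega.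
Hypothesis nu0 : 0 < nu.
Hypothesis c00 : 0 < c0.
Hypothesis GP : sobolev_profile Omega q nu c0 G.
Local Notation H := (profH q G).
Local Notation P := (profP q nu c0 G).

Lemma q_itv : 0 < q /\ q <= 1.
Proof.
have N0 : 0 < N%:R :> R by rewrite ltr0n (leq_trans _ N2).
split; first by rewrite subr_gt0 invf_lt1// ltr1n.
by rewrite lerBlDr lerDl invr_ge0 ltW.
Qed.

Let q0 : 0 < q. Proof. by have [] := q_itv. Qed.
Let q1 : q <= 1. Proof. by have [] := q_itv. Qed.

Definition acl (a : V) (u v : V -> R) :=
  {ae mu, forall x, segset Omega a x ->
     [/\ (lineseg a 1 (EFin \o pospart v) x < +oo)%E,
      (lineseg a 1 (EFin \o negpart v) x < +oo)%E &
     {ae lam, forall h : R, 0 <= h <= 1 -> u (x + h *: a) = u x +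
       (fine (lineseg a h (EFin \o pospart v) x) - fine (lineseg a h (EFin \o negpart v) x))}]}.

Definition energy (c kap d : R) (u : V -> R) (v : 'I_N -> V -> R) (y : V) : R :=
  H y (trunc c kap (u y)) + P y (trunc c kap (u y)) +
  slopeH q G d y (trunc c kap (u y)) * (c * \sum_i `|v i y|).

Lemma energy_ge0 c kap d u v y : 0 <= c -> 0 < d -> Omega y -> 0 <= energy c kap d u v y.
Proof.
move=> cc d0 Oy; have s1 := slopeH_ge0 q0 GP d0 (trunc c kap (u y)) Oy.
have p1 : 0 <= P y (trunc c kap (u y)) by apply: profP_ge0 => //; exact: q0.
have h1 : 0 <= H y (trunc c kap (u y)) by exact: profH_ge0.
apply: addr_ge0; first exact: addr_ge0.
by apply: mulr_ge0 => //; apply: mulr_ge0 => //; exact: sumr_ge0.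
Qed.

Lemma measurable_energy c kap d u v : 0 <= c -> 0 <= kap -> 0 < d ->
  measurable_fun (setT : set BV) u -> (forall i, measurable_fun (setT : set BV) (v i)) ->
  measurable_fun (Omega : set BV) (energy c kap d u v).
Proof.
move=> cc kk d0 mu_ mv_; have t0 x : 0 <= trunc c kap (u x) by exact: trunc_ge0.
have mt := @measurable_tr R N c kap cc u mu_.
have mH := measurable_H_comp oO q0 GP (lexx 0) t0 mt.
have mHd := measurable_H_comp oO q0 GP (ltW d0) t0 mt.
have mP := measurable_P_comp oO q0 nu0 c00 GP t0 mt.
have mH' : measurable_fun (Omega : set BV) (fun x => H x (trunc c kap (u x))).
  by under eq_fun do rewrite -[trunc _ _ _]addr0.
apply: measurable_funD; first exact: measurable_funD.
apply: measurable_funM; first by apply: measurable_funM => //; exact: measurable_funB.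
apply: measurable_funM => //; apply: measurable_funTS.
apply: measurable_sum => i; exact: measurableT_comp.
Qed.

(** On the piece of [Omega] where the [N] segments of one direction system stay inside, the [N] line
    inequalities multiply to a bound of $H^{N/(N-1)}=G$. Finitely many pieces cover [Omega], and
    [C3] sums their constants. *)
Lemma gagliardo : exists C3, 0 < C3 /\
  forall (c kap d : R) (u : V -> R) (v : 'I_N -> V -> R) (I : R),
  0 <= c -> 0 <= kap -> 0 < d -> 0 <= I ->
  measurable_fun (setT : set BV) u -> (forall i, measurable_fun (setT : set BV) (v i)) ->
  (forall (a : V) j, a ord0 j != 0 -> acl a u (fun x => \sum_i a ord0 i * v i x)) ->
  (\int[mu]_(x in (Omega : set BV)) (energy c kap d u v x)%:E <= I%:E)%E ->
  (\int[mu]_(x in (Omega : set BV)) (G x (trunc c kap (u x)))%:E <= (C3 * I `^ q^-1)%:E)%E.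
Proof.
have N0 : (0 < N)%N by rewrite (leq_trans _ N2).
have [M [dl [dl0 grid]]] := cone_grid N0 coneO.
pose J := ({ffun 'I_N -> 'I_(M.*2.+1)} * 'I_N)%type.
pose dir (s : J) (k : 'I_N) : V := skewv (gridp dl s.1) s.2 dl k.
pose ok (s : J) := gridp dl s.1 ord0 s.2 != 0.
(* At least $1$ and at least the norm of each direction, so that [A s] times the energy dominates
   all [N] line integrands. *)
pose A (s : J) := 1 + \sum_k norm1 (dir s k).
pose C (s : J) := skew_const (gridp dl s.1) s.2 dl.
(* Read off from the Loomis-Whitney bound $C\int G\le(CAI)^{1/q}$. *)
pose D (s : J) := (C s)^-1 * (C s * A s) `^ q^-1.
have A1 s : 1 <= A s by rewrite lerDl sumr_ge0// => k _; exact: norm1_ge0.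
have Ak s k : norm1 (dir s k) <= A s.
  rewrite /A (bigD1 k)//= addrCA lerDl addr_ge0// sumr_ge0// => i _; exact: norm1_ge0.
have C0 s : ok s -> 0 < C s.
  move=> os; rewrite /C /skew_const mulr_gt0//.
    by rewrite exprn_gt0// invr_gt0 normr_gt0 gt_eqF.
  by rewrite invr_gt0 normr_gt0.
exists (1 + \sum_(s | ok s) D s); split.
  rewrite ltr_pwDl// sumr_ge0// => s os; rewrite /D mulr_ge0 ?powR_ge0// invr_ge0.
  exact: ltW (C0 s os).
move=> c kap d u v I cc kk d0 I0 mu_ mv_ ac EI.
have mO := open_borel oO.
pose w x := trunc c kap (u x).
have w0 x : 0 <= w x by exact: trunc_ge0.
have mw := @measurable_tr R N c kap cc u mu_.
have mH : measurable_fun (Omega : set BV) (fun x => H x (w x)).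
  by under eq_fun do rewrite -[w _]addr0; exact: (measurable_H_comp oO q0 GP (lexx 0) w0 mw).
have GE x : G x (w x) = H x (w x) `^ q^-1.
  by rewrite /profH -powRrM mulfV ?(gt_eqF q0)// powRr1// (sp_ge0 GP).
have mG : measurable_fun (Omega : set BV) (fun x => (G x (w x))%:E).
  apply/measurable_EFinP; under eq_fun do rewrite GE.
  exact: (measurableT_comp (measurable_powR q^-1) mH).
have G0 x : (0 <= (G x (w x))%:E)%E by rewrite lee_fin (sp_ge0 GP).
pose Om (s : J) := [set x | forall k, segset Omega (dir s k) x].
have mOm s : measurable (Om s : set BV).
  rewrite (_ : Om s = \bigcap_(k in [set: 'I_N]) segset Omega (dir s k)).
    apply: fin_bigcap_measurable => [|k _]; first exact: finite_finset.
    by apply: open_borel; exact: segset_open.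
  by apply/seteqP; split => x h k => [_|]; exact: h.
pose gW := (fun y => (energy c kap d u v y)%:E) \_ Omega.
have mW := measurable_energy cc kk d0 mu_ mv_ (d := d).
have mgW : bmeas gW by apply/(measurable_restrictT _ mO); exact/measurable_EFinP.
have gW0 y : (0 <= gW y)%E.
  rewrite /gW patchE; case: ifPn => // /set_mem Oy; rewrite lee_fin.
  exact: energy_ge0.
have igW : (\int[mu]_y gW y <= I%:E)%E by rewrite /gW -integral_mkcond.
have N1 : 0 < N.-1%:R :> R by rewrite ltr0n -subn1 subn_gt0.
pose r : R := N.-1%:R^-1.
have r0 : 0 < r by rewrite invr_gt0.
have qr : q^-1 = r * N%:R.
  have NN : N%:R = N.-1%:R + 1 :> R by rewrite natr1 prednK.
  have NNp : N%:R - 1 = N.-1%:R :> R by rewrite NN addrK.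
  have NNn : N%:R != 0 :> R by rewrite pnatr_eq0 -lt0n.
  have h : 1 - N%:R^-1 = N.-1%:R / N%:R :> R by rewrite -NNp mulrBl mulfV// mul1r.
  by rewrite h invf_div mulrC.
have one s : ok s -> (\int[mu]_(x in (Om s : set BV)) (G x (w x))%:E <= (D s * I `^ q^-1)%:E)%E.
  move=> os; have Cs := C0 s os; have As := lt_le_trans ltr01 (A1 s).
  pose g y := ((A s)%:E * gW y)%E.
  have mg : bmeas g by exact: measurable_funeM.
  have g0 y : (0 <= g y)%E by rewrite mule_ge0// lee_fin ltW.
  have dj : dir s s.2 ord0 s.2 != 0 by rewrite /dir /skewv eqxx.
  have LW := @loomis_whitney R N (dir s) N2 (C s) g mg g0 Cs
    (fun f mf f0 x => iterint_skew x os (lt0r_neq0 dl0) mf f0).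
  have key : {ae mu, forall x, Om s x -> ((G x (w x))%:E <= \big[mule/1%E]_k (lineint (dir s k) g x) `^ r)%E}.
    have aek k : {ae mu, forall x, Om s x -> ((H x (w x))%:E <= lineint (dir s k) g x)%E}.
      set a := dir s k; pose va x := \sum_i a ord0 i * v i x.
      have [j aj] : exists j, a ord0 j != 0.
        have [kj|kj] := eqVneq k s.2; first by exists s.2; rewrite /a kj.
        have [z0|z0] := eqVneq (a ord0 s.2) 0; last by exists s.2.
        exists s.2; move: os; rewrite /ok; move: z0.
        rewrite /a /dir /skewv (negbTE kj) !mxE eqxx (_ : s.2 == k = false) ?mulr0 ?addr0 1?eq_sym ?(negbTE kj)//.
      have mva : measurable_fun (setT : set BV) va.
        by apply: measurable_sum => i; exact: measurable_funM.
      have FF := ae_filter_ringOfSetsType mu.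
      apply: filterS (ac a j aj) => x hx Ox; have [l1 l2 l3] := hx (Ox k).
      apply: (le_trans (line_ineq oO bO q0 q1 nu0 c00 GP cc kk d0 mu_ mva (Ox k) l1 l2 l3)).
      have n10 := norm1_ge0 a.
      apply: le_lineint => //.
      - exact: (bmeas_lineF oO q0 nu0 c00 GP cc kk d0 mu_ mva).
      - move=> y; rewrite patchE; case: ifPn => // /set_mem Oy; rewrite lee_fin.
        exact: (lineF_ge0 q0 c00 GP cc d0).
      - move=> y; rewrite /g /gW !patchE; case: ifPn => [/set_mem Oy|]; last by rewrite mule0.
        rewrite -EFinM lee_fin /lineF /energy -/(w y).
        have s1 := slopeH_ge0 q0 GP d0 (w y) Oy.
        have p1 : 0 <= P y (w y) by apply: profP_ge0 => //; exact: q0.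
        have h1 : 0 <= H y (w y) by exact: profH_ge0.
        have va1 : `|va y| <= A s * \sum_i `|v i y|.
          apply: (le_trans (ler_norm_sum _ _ _)); rewrite mulr_sumr ler_sum// => i _.
          rewrite normrM ler_wpM2r// (le_trans _ (Ak s k))// /norm1 (bigD1 i)//= lerDl.
          exact: sumr_ge0.
        have t1 : slopeH q G d y (w y) * (c * `|va y|) <= A s * (slopeH q G d y (w y) * (c * \sum_i `|v i y|)).
          rewrite [leRHS]mulrCA; apply: ler_wpM2l => //; rewrite [leRHS]mulrCA.
          exact: ler_wpM2l.
        have t2 : norm1 a * P y (w y) <= A s * P y (w y) by rewrite ler_wpM2r// Ak.
        have t3 : H y (w y) <= A s * H y (w y) by rewrite ler_peMl.
        by rewrite !mulrDr; lra.
    have FF := ae_filter_ringOfSetsType mu.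
    have : {ae mu, forall x k, Om s x -> ((H x (w x))%:E <= lineint (dir s k) g x)%E}.
      exact: filter_forall.
    apply: filterS => x hx Ox; rewrite GE qr powRrM powR_mulrn ?powR_ge0//.
    have -> : (((H x (w x)) `^ r) ^+ N)%:E = \big[mule/1%E]_(k < N) ((H x (w x))%:E `^ r)%E.
      rewrite (eq_bigr (fun=> ((H x (w x)) `^ r)%:E)) => [|k _]; last by rewrite poweR_EFin.
      by rewrite -(@big_morph _ _ EFin 1%E mule 1 *%R EFinM (erefl _)) prodr_const card_ord.
    apply: le_eprod => k; first exact: poweR_ge0.
    apply: gt0_ler_poweR; [exact: ltW| | |exact: hx]; rewrite in_itv/= leey andbT.
      by rewrite lee_fin profH_ge0.
    exact: lineint_ge0.
  have bl k : bmeas (fun x => (lineint (dir s k) g x `^ r)%E).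
    by apply: bmeas_poweR; apply: bmeas_lineint.
  have bp : bmeas (fun x => \big[mule/1%E]_k (lineint (dir s k) g x `^ r)%E) by exact: bmeas_eprod.
  have bp0 x : (0 <= \big[mule/1%E]_k (lineint (dir s k) g x `^ r))%E.
    by elim/big_ind: _ => [|y z|k _]; [exact: lee01|exact: mule_ge0|exact: poweR_ge0].
  have OmO : Om s `<=` Omega.
    have [k] : exists k : 'I_N, True by exists (Ordinal N0).
    by move=> _ x /(_ k); exact: segset_sub.
  have mGs : measurable_fun (Om s : set BV) (fun x => (G x (w x))%:E) by exact: measurable_funS mG.
  have bps : measurable_fun (Om s : set BV) (fun x => \big[mule/1%E]_k (lineint (dir s k) g x `^ r)%E).
    exact: measurable_funTS.
  have st1 := ae_ge0_le_integral (mOm s) (fun x _ => G0 x) mGs (fun x _ => bp0 x) bps key.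
  have st2 : (\int[mu]_(x in (Om s : set BV)) \big[mule/1%E]_k (lineint (dir s k) g x `^ r) <=
     \int[mu]_x \big[mule/1%E]_k (lineint (dir s k) g x `^ r))%E.
    exact: ge0_subset_integral.
  have ig : ((C s)%:E * \int[mu]_x g x <= (C s * A s * I)%:E)%E.
    rewrite /g ge0_integralZl//; last by rewrite lee_fin ltW.
    rewrite muleA -EFinM [leRHS]EFinM; apply: lee_wpmul2l => //.
    by rewrite lee_fin mulr_ge0 ?ltW.
  have CAI0 : 0 <= C s * A s * I by rewrite !mulr_ge0 ?(ltW Cs) ?(ltW As).
  have st3 : (\big[mule/1%E]_(k < N) ((C s)%:E * \int[mu]_x g x) `^ r <= ((C s * A s * I) `^ q^-1)%:E)%E.
    rewrite qr powRrM powR_mulrn ?powR_ge0//.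
    have -> : (((C s * A s * I) `^ r) ^+ N)%:E = \big[mule/1%E]_(k < N) ((C s * A s * I)%:E `^ r)%E.
      rewrite (eq_bigr (fun=> ((C s * A s * I) `^ r)%:E)) => [|k _]; last by rewrite poweR_EFin.
      by rewrite -(@big_morph _ _ EFin 1%E mule 1 *%R EFinM (erefl _)) prodr_const card_ord.
    have ig0 : (0 <= (C s)%:E * \int[mu]_x g x)%E.
      by rewrite mule_ge0 ?lee_fin ?(ltW Cs)//; exact: integral_ge0.
    apply: le_eprod => k; first exact: poweR_ge0.
    by apply: gt0_ler_poweR; [exact: ltW| | |exact: ig]; rewrite in_itv/= leey andbT ?lee_fin.
  have st4 := le_trans LW st3.
  have Ci : (0 <= ((C s)^-1)%:E)%E by rewrite lee_fin invr_ge0 ltW.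
  have st5 := lee_wpmul2l Ci (le_trans (lee_wpmul2l (ltW Cs : (0 <= (C s)%:E)%E) (le_trans st1 st2)) st4).
  rewrite muleA -EFinM mulVf ?gt_eqF// mul1e -EFinM in st5.
  by rewrite /D -mulrA -powRM// mulr_ge0 ?(ltW Cs) ?(ltW As).
have covO x : Omega x -> exists2 s : J, ok s & Om s x.
  by move=> Ox; have [m [j [h1 h2]]] := grid x Ox; exists (m, j).
pose ind (s : J) (x : V) : \bar R := ((fun y => (G y (w y))%:E) \_ (Om s)) x.
have OmOs s : Om s `<=` Omega.
  have [k] : exists k : 'I_N, True by exists (Ordinal N0).
  by move=> _ x /(_ k); exact: segset_sub.
have ind0 s x : (0 <= ind s x)%E by rewrite /ind patchE; case: ifP.
have mind s : measurable_fun (Omega : set BV) (ind s).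
  apply: measurable_funTS; apply/(measurable_restrictT _ (mOm s)).
  exact: measurable_funS mG.
have indI s : (\int[mu]_(x in (Omega : set BV)) ind s x = \int[mu]_(x in (Om s : set BV)) (G x (w x))%:E)%E.
  by rewrite /ind -integral_mkcondr setIidr.
pose js := [seq s <- index_enum J | ok s].
have ujs : uniq js by rewrite filter_uniq// index_enum_uniq.
have mall : measurable_fun (Omega : set BV) (fun x => (\sum_(s <- js) ind s x)%E).
  by apply: emeasurable_sum => s; exact: mind.
rewrite -[X in (X <= _)%E]/(\int[mu]_(x in (Omega : set BV)) (G x (w x))%:E)%E.
apply: (@le_trans _ _ (\int[mu]_(x in (Omega : set BV)) (\sum_(s <- js) ind s x))%E).
  apply: ge0_le_integral => //.
  move=> x Ox; have [s os Osx] := covO x Ox.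
  rewrite (bigD1_seq s)//=; last by rewrite mem_filter os mem_index_enum.
  rewrite [X in (_ <= X + _)%E](_ : _ = (G x (w x))%:E); last first.
    by rewrite /ind patchE mem_set.
  by rewrite leeDl//; apply: sume_ge0.
rewrite ge0_integral_sum//.
rewrite big_filter.
apply: (@le_trans _ _ (\sum_(s | ok s) (D s * I `^ q^-1)%:E)%E).
  by apply: lee_sum => s os; rewrite indI one.
rewrite sumEFin lee_fin mulrDl mul1r -mulr_suml lerDr powR_ge0//.
Qed.

End gagliardo.

(** * The continuation argument *)

Lemma powR_interp {R : realType} (e s p : R) : 0 < e -> s < p -> 0 < s ->
  exists C, 0 <= C /\ forall z, 0 <= z -> z `^ s <= e * z `^ p + C.
Proof.
(* The threshold [K] solves $eK^{p-s}=1$: beyond it $z^s\le ez^p$, below it $z^s\le K^s$. *)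
move=> e0 sp s0; pose K := e `^ (- (p - s)^-1); exists (K `^ s); split; first exact: powR_ge0.
have K0 : 0 < K by exact: powR_gt0.
have ps0 : 0 < p - s by rewrite subr_gt0.
move=> z z0; have [zK|Kz] := leP z K.
  apply: (@le_trans _ _ (K `^ s)); last by rewrite lerDr mulr_ge0 ?powR_ge0 ?(ltW e0).
  by apply: ge0_ler_powR; rewrite ?nnegrE ?(ltW s0) ?(ltW K0).
have z1 := lt_trans K0 Kz.
have h : e^-1 <= z `^ (p - s).
  have -> : e^-1 = K `^ (p - s).
    by rewrite /K -powRrM mulNr mulVf ?gt_eqF// powR_inv1 ?(ltW e0).
  by apply: ge0_ler_powR; rewrite ?nnegrE ?(ltW ps0) ?(ltW K0) ?(ltW z1) ?(ltW Kz).
have -> : z `^ p = z `^ s * z `^ (p - s).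
  by rewrite -powRD; [rewrite addrC subrK|apply/implyP => _; rewrite gt_eqF].
have h1 : 1 <= e * z `^ (p - s) by rewrite -(mulfV (lt0r_neq0 e0)) ler_pM2l.
have zs0 := powR_ge0 z s; have Ks := powR_ge0 K s.
rewrite mulrCA (le_trans _ (_ : z `^ s * (e * z `^ (p - s)) <= _)) ?lerDl//.
by rewrite ler_peMr.
Qed.

Section bootstrap.
Context {R : realType} {N : nat}.
Local Notation V := 'rV[R]_N.
Local Notation BV := (BV R N).
Local Notation mu := (@bleb R N).
Variables (Omega : set V) (nu c0 : R) (G : V -> R -> R).
Hypothesis N2 : (2 <= N)%N.
Local Notation q := (1 - N%:R^-1 : R).
Hypothesis oO : open Omega.
Hypothesis bO : bounded_set Omega.
Hypothesis coneO : cone_property Omega.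
Hypothesis nu0 : 0 < nu.
Hypothesis nuN : nu < N%:R^-1.
Hypothesis c00 : 0 < c0.
Hypothesis GP : sobolev_profile Omega q nu c0 G.
Local Notation H := (profH q G).
Local Notation P := (profP q nu c0 G).

Let q0 : 0 < q. Proof. by have [] := @q_itv R N N2. Qed.
Let q1 : q <= 1. Proof. by have [] := @q_itv R N N2. Qed.
Let q1' : q < 1. Proof. by rewrite ltrBlDr ltrDl invr_gt0 ltr0n (leq_trans _ N2). Qed.
Let p1 : 1 < q^-1. Proof. by rewrite -[X in X < _]invr1 ltf_pV2 ?posrE ?q0 ?q1'. Qed.
Let mO : measurable (Omega : set BV). Proof. exact: open_borel. Qed.

Lemma prof_powK x t : G x t = H x t `^ q^-1.
Proof. by rewrite /profH -powRrM mulfV ?(gt_eqF q0)// powRr1// (sp_ge0 GP). Qed.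

Lemma measurable_G_comp (d : R) (w : V -> R) : 0 <= d -> (forall x, 0 <= w x) ->
  measurable_fun (setT : set BV) w -> measurable_fun (Omega : set BV) (fun x => G x (w x + d)).
Proof.
move=> d0 w0 mw.
have -> : (fun x => G x (w x + d)) = (fun x => H x (w x + d) `^ q^-1).
  by apply/funext => x; rewrite prof_powK.
exact: (measurableT_comp (measurable_powR q^-1) (measurable_H_comp oO q0 GP d0 w0 mw)).
Qed.

(* [G x] is convex, being a power of the convex function [H x] *)
Lemma G_step x t d T B : Omega x -> 0 <= t -> 0 <= d -> d <= 1 -> t + 1 <= T ->
  (forall x, Omega x -> G x T <= B) -> G x (t + d) <= G x t + d * B.
Proof.
move=> Ox t0 d0 d1 tT hB.
have GB : G x (t + 1) <= B by apply: le_trans (hB x Ox); exact: (sp_mono GP).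
have [->|dn] := eqVneq d 0; first by rewrite addr0 mul0r addr0.
have [->|dn1] := eqVneq d 1; first by rewrite mul1r (le_trans GB)// lerDr (sp_ge0 GP).
have dp : 0 < d by rewrite lt_def dn.
have dl : d < 1 by rewrite lt_neqAle dn1.
have t1 : t < t + d by rewrite ltrDl.
have t2 : t + d < t + 1 by rewrite ltrD2l.
have ineq : H x (t + d) <= d * H x (t + 1) + (1 - d) * H x t.
  have := profH_convex oO q0 GP Ox t0 t1 t2.
  have -> : t + 1 - (t + d) = 1 - d by ring.
  have -> : t + d - t = d by ring.
  by move: (H x (t + d)) (H x (t + 1)) (H x t) => h1 h2 h0; nra.
have h00 : 0 <= H x t by exact: profH_ge0.
have h20 : 0 <= H x (t + 1) by exact: profH_ge0.
have h10 : 0 <= H x (t + d) by exact: profH_ge0.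
have step : G x (t + d) <= d * G x (t + 1) + (1 - d) * G x t.
  rewrite !prof_powK; apply: (@le_trans _ _ ((d * H x (t + 1) + (1 - d) * H x t) `^ q^-1)).
    have z0 : 0 <= d * H x (t + 1) + (1 - d) * H x t by exact: le_trans ineq.
    by apply: ge0_ler_powR; rewrite ?nnegrE ?invr_ge0 ?(ltW q0).
  have := @convex_powR R q^-1 (ltW p1) (Itv01 d0 d1) (H x (t + 1)) (H x t).
  rewrite !inE/= !in_itv/= !andbT => /(_ h20 h00).
  by rewrite !convRE.
have g0 := sp_ge0 GP x t.
have : d * G x (t + 1) <= d * B by rewrite ler_wpM2l.
by have := mulr_ge0 d0 g0; lra.
Qed.

(** The remainder is $Ct$ and not a constant, so that it becomes small with the factor $\theta$ of
    [w]. For $t>1$ it comes from interpolation of powers, for $t\le1$ from $H(x,t)\le tH(x,1)$. *)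
Lemma lower_order_bound e : 0 < e -> exists C, 0 <= C /\
  forall x t, Omega x -> 0 <= t -> H x t + P x t <= e * G x t + C * t.
Proof.
move=> e0; have [B [B0 hB]] := profH_bound bO q0 GP (@ler01 R).
have q0' := q0; have c0' := c00.
pose k := c0 * q; have k0 : 0 < k by exact: mulr_gt0.
pose r := 1 + nu / q.
have nq : 0 < nu / q by rewrite divr_gt0.
(* This is $q+\nu<1$, that is $\nu<1/N$. *)
have rp : r < q^-1.
  rewrite /r -[X in X + _](mulfV (lt0r_neq0 q0)) -mulrDl -[ltRHS]mul1r ltr_pM2r ?invr_gt0//.
  by have := nuN; lra.
have [C1 [C10 h1]] := @powR_interp R (e / (2 * (1 + k))) 1 q^-1 (divr_gt0 e0 (mulr_gt0 (ltr0n R 2) (ltr_wpDr (ltW k0) ltr01))) p1 ltr01.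
have r0 : 0 < r by rewrite /r addr_gt0.
have [C2 [C20 h2]] := @powR_interp R (e / (2 * k)) r q^-1 (divr_gt0 e0 (mulr_gt0 (ltr0n R 2) k0)) rp r0.
pose D1 := (1 + k) * C1 + k * C2.
pose D2 := B + k * (B + B * B `^ (nu / q)).
have kz := ltW k0; have Bz := ltW B0; have k1 : 0 <= 1 + k by exact: addr_ge0.
have D10 : 0 <= D1 by apply: addr_ge0; exact: mulr_ge0.
have D20 : 0 <= D2.
  apply: addr_ge0 => //; apply: mulr_ge0 => //; apply: addr_ge0 => //; apply: mulr_ge0 => //.
  exact: powR_ge0.
exists (D1 + D2); split; first exact: addr_ge0.
move=> x t Ox t0; have h0 : 0 <= H x t by exact: profH_ge0.
have g0 := sp_ge0 GP x t.
have PE : P x t = k * (H x t + H x t `^ r) by [].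
have [t1|t1] := leP t 1; last first.
  have := h1 _ h0; have := h2 _ h0; rewrite -prof_powK powRr1// => i2 i1.
  have j1 : (1 + k) * H x t <= e / 2 * G x t + (1 + k) * C1.
    have := ler_wpM2l (ltW (ltr_wpDr (ltW k0) ltr01) : 0 <= 1 + k) i1.
    have -> : (1 + k) * (e / (2 * (1 + k)) * G x t + C1) = e / 2 * G x t + (1 + k) * C1.
      by field; rewrite gt_eqF// ltr_wpDr ?(ltW k0).
    by [].
  have j2 : k * H x t `^ r <= e / 2 * G x t + k * C2.
    have := ler_wpM2l (ltW k0) i2.
    have -> : k * (e / (2 * k) * G x t + C2) = e / 2 * G x t + k * C2.
      by field; rewrite gt_eqF.
    by [].
  have j3 : D1 <= (D1 + D2) * t.
    have := ler_wpM2l (addr_ge0 D10 D20) (ltW t1); rewrite mulr1 => /(le_trans _); apply.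
    by rewrite lerDl.
  rewrite PE; move: j1 j2 j3; rewrite /D1.
  by move: (H x t `^ r) (H x t) (G x t) (D2) => y z g d; lra.
have Hb : H x t <= t * B.
  have [->|tn] := eqVneq t 0; first by rewrite (profH0 oO q0 GP Ox) mul0r.
  have [->|tn1] := eqVneq t 1; first by rewrite mul1r hB.
  have tp : 0 < t by rewrite lt_def tn.
  have tl : t < 1 by rewrite lt_neqAle tn1.
  have := profH_convex oO q0 GP Ox (lexx 0) tp tl.
  rewrite (profH0 oO q0 GP Ox) !subr0 => i1; have i2 := hB x Ox.
  have : t * H x 1 <= t * B by rewrite ler_wpM2l.
  by move: i1; move: (H x t) (H x 1) => y z; nra.
have HB : H x t <= B by rewrite (le_trans Hb)// ler_piMl// ltW.
have Hr : H x t `^ r <= t * B * B `^ (nu / q).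
  have [->|hn] := eqVneq (H x t) 0.
    by rewrite powR0 ?gt_eqF// mulr_ge0 ?powR_ge0// mulr_ge0 ?(ltW B0).
  rewrite /r powRD; last by rewrite hn implybT.
  rewrite powRr1// ler_pM ?powR_ge0//.
  by apply: ge0_ler_powR; rewrite ?nnegrE ?(ltW nq) ?(ltW B0).
have Pb : P x t <= k * (t * B + t * B * B `^ (nu / q)) by rewrite PE ler_wpM2l ?(ltW k0)// lerD.
have d1 := mulr_ge0 D10 t0; have e1 := mulr_ge0 (ltW e0) g0.
have -> : (D1 + D2) * t = D1 * t + (t * B + k * (t * B + t * B * B `^ (nu / q))).
  by rewrite /D2; ring.
by lra.
Qed.

Definition int_bound (f : V -> R) (a : R) := [/\ measurable_fun (Omega : set BV) f,
  (forall x, Omega x -> 0 <= f x) & (\int[mu]_(x in (Omega : set BV)) (f x)%:E <= a%:E)%E].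

Lemma int_bound_le (f g : V -> R) (a : R) : measurable_fun (Omega : set BV) f -> (forall x, Omega x -> 0 <= f x) ->
  (forall x, Omega x -> f x <= g x) -> int_bound g a -> int_bound f a.
Proof.
move=> mf f0 fg [mg g0 ga]; split => //; apply: le_trans ga.
have m1 : measurable_fun (Omega : set BV) (EFin \o f) by exact/measurable_EFinP.
have m2 : measurable_fun (Omega : set BV) (EFin \o g) by exact/measurable_EFinP.
by apply: (@ge0_le_integral _ _ _ mu _ mO).
Qed.

Lemma int_boundD (f g : V -> R) (a b : R) : int_bound f a -> int_bound g b -> int_bound (fun x => f x + g x) (a + b).
Proof.
move=> [mf f0 fa] [mg g0 gb]; split; first exact: measurable_funD.
  by move=> x Ox; rewrite addr_ge0 ?f0 ?g0.
have m1 : measurable_fun (Omega : set BV) (EFin \o f) by exact/measurable_EFinP.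
have m2 : measurable_fun (Omega : set BV) (EFin \o g) by exact/measurable_EFinP.
have f0' x : Omega x -> (0 <= (EFin \o f) x)%E by move=> Ox; rewrite lee_fin f0.
have g0' x : Omega x -> (0 <= (EFin \o g) x)%E by move=> Ox; rewrite lee_fin g0.
by have := ge0_integralD mu mO f0' m1 g0' m2 => /= ->; rewrite EFinD leeD.
Qed.

Lemma int_boundM (c : R) (f : V -> R) (a : R) : 0 <= c -> int_bound f a -> int_bound (fun x => c * f x) (c * a).
Proof.
move=> cc [mf f0 fa]; split; first exact: measurable_funM.
  by move=> x Ox; rewrite mulr_ge0 ?f0.
have m1 : measurable_fun (Omega : set BV) (EFin \o f) by exact/measurable_EFinP.
have f0' x : Omega x -> (0 <= (EFin \o f) x)%E by move=> Ox; rewrite lee_fin f0.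
have c0' : (0 <= c%:E)%E by rewrite lee_fin.
have := ge0_integralZl mu mO m1 f0' c0' => /= ->.
by rewrite EFinM; exact: lee_wpmul2l.
Qed.

Lemma int_bound0 : int_bound (fun=> 0) 0.
Proof. by split => //; rewrite integral0_eq. Qed.

Lemma int_bound_sum (I : Type) (s : seq I) (f : I -> V -> R) (a : I -> R) :
  (forall i, int_bound (f i) (a i)) ->
  int_bound (fun x => \sum_(i <- s) f i x) (\sum_(i <- s) a i).
Proof.
move=> fa; elim: s => [|i s IH].
  by rewrite big_nil (_ : (fun x => _) = (fun=> 0)); [exact: int_bound0|apply/funext => x; rewrite big_nil].
rewrite big_cons (_ : (fun x => _) = (fun x => f i x + \sum_(j <- s) f j x)).
  exact: int_boundD.
by apply/funext => x; rewrite big_cons.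
Qed.

Lemma int_bound_cst (c : R) : 0 <= c -> int_bound (fun=> c) (c * fine (mu (Omega : set BV))).
Proof.
move=> cc; split => //; have := @integral_cst _ _ _ mu _ mO c%:E => /= ->.
by rewrite EFinM fineK// ge0_fin_numE//; exact: bleb_bounded.
Qed.

(** Young's inequality enters as a bound on the integral of a positive part that involves Borel
    functions only; the composition of $\phi_i$ with the derivative of [u], whose measurability is
    not at hand, is kept out. *)
Lemma bootstrap (M M0 : R) : 0 <= M -> 0 <= M0 -> exists th0 : R, 0 < th0 /\
  forall (u : V -> R) (v : 'I_N -> V -> R) (l : R), 0 < l ->
  measurable_fun (setT : set BV) u -> (forall i, measurable_fun (setT : set BV) (v i)) ->
  (forall (a : V) j, a ord0 j != 0 -> acl Omega a u (fun x => \sum_i a ord0 i * v i x)) ->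
  (\int[mu]_(x in (Omega : set BV)) (`|u x| / l)%:E <= M0%:E)%E ->
  (forall (i : 'I_N) (d : R) (w : V -> R), 0 < d -> measurable_fun (setT : set BV) w -> (forall x, 0 <= w x) ->
    (\int[mu]_(x in (Omega : set BV))
       (Num.max 0 (slopeH q G d x (w x) * (`|v i x| / l) - q * G x (w x + d)))%:E <= (q * M)%:E)%E) ->
  (\int[mu]_(x in (Omega : set BV)) (G x (th0 * (`|u x| / l)))%:E <= 1)%E.
Proof.
move=> M_0 M00; have q0' := q0.
have [C3 [C30 gag]] := gagliardo N2 oO bO coneO nu0 c00 GP.
(* Solves $C_3(2\varepsilon)^{1/q}=1/2$: an energy of at most $2\varepsilon$ yields $X\le1/2$. *)
pose eps := (2 * C3)^-1 `^ q / 2.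
have eps0 : 0 < eps by rewrite divr_gt0// powR_gt0// invr_gt0 mulr_gt0.
have epsE : C3 * (2 * eps) `^ q^-1 = 2^-1.
  have -> : 2 * eps = (2 * C3)^-1 `^ q by rewrite /eps mulrC divfK.
  rewrite -powRrM mulfV ?(gt_eqF q0)// powRr1 ?invr_ge0 ?mulr_ge0 ?(ltW C30)//.
  by rewrite invfM mulrCA mulfV ?mulr1// gt_eqF.
have [Ce [Ce0 fP]] := lower_order_bound eps0.
(* Each of the [N] Young terms costs $qM$ for its positive part and $2q$ for $\int G(x,w+d)\le2$;
   [th0] is then chosen so that $\theta D\le\varepsilon$. *)
pose D := Ce * M0 + \sum_(i < N) (q * M + q * 2).
have D0 : 0 <= D.
  by rewrite addr_ge0 ?mulr_ge0// sumr_ge0// => i _; rewrite addr_ge0 ?mulr_ge0 ?(ltW q0).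
pose th0 := eps / (D + 1).
have D1 : 0 < D + 1 by rewrite ltr_wpDl.
have th00 : 0 < th0 by rewrite divr_gt0.
exists th0; split => // u v l l0 mu_ mv_ ac hU hY.
pose A := fine (mu (Omega : set BV)).
have A0 : 0 <= A by exact: fine_ge0.
have trunc_bound (k : nat) : int_bound (fun x => G x (trunc (th0 / l) (th0 * k%:R) (u x))) 2^-1.
  have k0 : 0 <= k%:R :> R by [].
  have [B [B0 hB]] : exists B, 0 < B /\ forall x, Omega x -> G x (th0 * k%:R + 1) <= B.
    by apply: (profile_bound bO GP); rewrite addr_ge0// mulr_ge0// ltW.
  pose tau x := Num.min (`|u x| / l) k%:R.
  have tau0 x : 0 <= tau x by rewrite le_min k0 divr_ge0// ltW.
  have tauk x : tau x <= k%:R by rewrite ge_min lexx orbT.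
  have wE (th : R) x : 0 <= th -> trunc (th / l) (th * k%:R) (u x) = th * tau x.
    by move=> t0; rewrite /trunc /tau minr_pMr// mulrAC mulrA.
  pose w (th : R) x := trunc (th / l) (th * k%:R) (u x).
  have w0 (th : R) : 0 <= th -> forall x, 0 <= w th x.
    by move=> t0 x; rewrite /w wE// mulr_ge0.
  have mw (th : R) : 0 <= th -> measurable_fun (setT : set BV) (w th).
    by move=> t0; apply: measurable_tr => //; rewrite divr_ge0// ltW.
  have mG (th : R) : 0 <= th -> measurable_fun (Omega : set BV) (fun x => G x (w th x)).
    move=> t0; rewrite (_ : (fun x => _) = (fun x => G x (w th x + 0))).
      exact: measurable_G_comp (lexx 0) (w0 th t0) (mw th t0).
    by apply/funext => x; rewrite addr0.
  have wT (th : R) x : 0 <= th -> th <= th0 -> w th x + 1 <= th0 * k%:R + 1.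
    by move=> t0 t1; rewrite /w wE// lerD2r ler_pM.
  have apriori (th : R) : 0 <= th -> th <= th0 ->
      int_bound (fun x => G x (w th x)) 1 -> int_bound (fun x => G x (w th x)) 2^-1.
    move=> t0 t1 X1; split; [exact: mG|by move=> x _; exact: (sp_ge0 GP)|].
    (* The step of the quotient is so small that $X\le1$ still gives $\int G(x,w+d)\le2$. It may
       depend on [k], as the resulting bound does not involve it. *)
    pose d := (B * A + 1)^-1.
    have BA : 0 < B * A + 1 by rewrite ltr_wpDl// mulr_ge0// ltW.
    have d0 : 0 < d by rewrite invr_gt0.
    have d1 : d <= 1 by rewrite invf_le1// lerDr mulr_ge0// ltW.
    have dBA : d * B * A <= 1.
      by rewrite -mulrA /d mulrC ler_pdivrMr// mul1r lerDl.
    have Gd : int_bound (fun x => G x (w th x + d)) 2.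
      have -> : 2 = 1 + 1 :> R by [].
      apply: (@int_bound_le _ (fun x => G x (w th x) + d * B)).
      - exact: measurable_G_comp (ltW d0) (w0 th t0) (mw th t0).
      - by move=> x _; exact: (sp_ge0 GP).
      - by move=> x Ox; apply: (G_step Ox _ (ltW d0) d1 (wT th x t0 t1) hB); exact: w0.
      apply: int_boundD => //; have dB0 : 0 <= d * B by rewrite mulr_ge0 ?(ltW d0) ?(ltW B0).
      have [c1 c2 c3] := int_bound_cst dB0; split => //.
      by apply: (le_trans c3); rewrite lee_fin.
    pose Y i x := Num.max 0 (slopeH q G d x (w th x) * (`|v i x| / l) - q * G x (w th x + d)).
    have mGd : measurable_fun (Omega : set BV) (fun x => G x (w th x + d)).
      by have [] := Gd.
    have mHw : measurable_fun (Omega : set BV) (fun x => H x (w th x)).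
      rewrite (_ : (fun x => _) = (fun x => H x (w th x + 0))).
        exact: (measurable_H_comp oO q0 GP (lexx 0) (w0 th t0) (mw th t0)).
      by apply/funext => x; rewrite addr0.
    have mHd := measurable_H_comp oO q0 GP (ltW d0) (w0 th t0) (mw th t0).
    have Yb i : int_bound (Y i) (q * M).
      split; last exact: (hY i d _ d0 (mw th t0) (w0 th t0)).
        apply: measurable_maxr => //; apply: measurable_funB; last exact: measurable_funM.
        apply: measurable_funM; first by apply: measurable_funM => //; exact: measurable_funB.
        apply: measurable_funM => //; apply: measurable_funTS; exact: measurableT_comp.
      by move=> x _; rewrite /Y le_max lexx.
    have ub : int_bound (fun x => `|u x| / l) M0.
      split => //; last by move=> x _; rewrite divr_ge0// ltW.
      apply: measurable_funM => //; apply: measurable_funTS; exact: measurableT_comp.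
    have cl : 0 <= th / l by rewrite divr_ge0// ltW.
    have kk : 0 <= th * k%:R by rewrite mulr_ge0.
    have tb : th * D <= eps.
      apply: (@le_trans _ _ (th0 * D)); first by rewrite ler_wpM2r.
      by rewrite /th0 mulrAC ler_pdivrMr// ler_wpM2l ?(ltW eps0)// lerDl.
    have ew : int_bound (energy nu c0 G (th / l) (th * k%:R) d u v) (2 * eps).
      have bnd : int_bound (fun x => eps * G x (w th x) + (th * (Ce * (`|u x| / l)) +
          th * \sum_(i <- index_enum 'I_N) (Y i x + q * G x (w th x + d)))) (eps * 1 + (th * (Ce * M0) +
          th * \sum_(i <- index_enum 'I_N) (q * M + q * 2))).
        apply: int_boundD; first exact: int_boundM (ltW eps0) X1.
        apply: int_boundD; first by apply: int_boundM => //; exact: int_boundM.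
        apply: int_boundM => //; apply: int_bound_sum => i; apply: int_boundD => //.
        by apply: int_boundM => //; exact: ltW.
      have [b1 b2 b3] : int_bound (energy nu c0 G (th / l) (th * k%:R) d u v)
         (eps * 1 + (th * (Ce * M0) + th * \sum_(i <- index_enum 'I_N) (q * M + q * 2))).
        apply: int_bound_le bnd; first exact: (measurable_energy N2 oO nu0 c00 GP cl kk d0 mu_ mv_).
          by move=> x Ox; exact: (energy_ge0 N2 c00 GP).
        move=> x Ox; rewrite /energy -/(w th x) addrA lerD//.
          apply: (le_trans (fP x _ Ox (w0 th t0 x))); rewrite lerD2l mulrCA ler_wpM2l//.
          by rewrite /w wE// ler_wpM2l// ge_min lexx.
        have -> : slopeH q G d x (w th x) * (th / l * \sum_i `|v i x|) =
            th * \sum_i (slopeH q G d x (w th x) * (`|v i x| / l)).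
          by rewrite -mulr_sumr -mulr_suml; ring.
        rewrite ler_wpM2l// ler_sum// => i _.
        by rewrite /Y -lerBlDr le_max lexx orbT.
      split => //; apply: (le_trans b3); rewrite lee_fin mulr1 -mulrDr.
      by move: tb; rewrite /D; lra.
    have [e1 e2 e3] := ew.
    have e20 : 0 <= 2 * eps by rewrite mulr_ge0// ltW.
    have := gag _ _ d u v _ cl kk d0 e20 mu_ mv_ ac e3.
    by rewrite epsE.
  (* The number [n] of steps from $0$ to [th0] is such that one step moves [w] by at most $1$ and
     $X$ by at most $1/2$: from $X\le1/2$ one reaches $X\le1$, and [apriori] brings it back to
     $1/2$. *)
  pose z := th0 * k%:R * (1 + 2 * (B * A)).
  have z0 : 0 <= z.
    apply: mulr_ge0; first by apply: mulr_ge0 => //; exact: ltW.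
    by apply: addr_ge0 => //; apply: mulr_ge0 => //; apply: mulr_ge0 => //; exact: ltW.
  pose n := (Num.truncn z).+1.
  have zn : z < n%:R by exact: truncnS_gt.
  have n0 : 0 < n%:R :> R by rewrite ltr0n.
  pose h := th0 / n%:R.
  have h0 : 0 <= h by rewrite divr_ge0// ltW.
  have tk0 : 0 <= th0 * k%:R by rewrite mulr_ge0// ltW.
  have BA0 : 0 <= B * A by rewrite mulr_ge0// ltW.
  have hk1 : h * k%:R <= 1.
    rewrite /h mulrAC ler_pdivrMr// mul1r (le_trans _ (ltW zn))// /z ler_peMr// lerDl mulr_ge0//.
  have hkB : h * k%:R * B * A <= 2^-1.
    have hn : h * n%:R = th0 by rewrite /h divfK// gt_eqF.
    have zz : th0 * k%:R * (2 * (B * A)) <= n%:R.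
      by rewrite (le_trans _ (ltW zn))// /z ler_wpM2l// lerDr.
    rewrite -(ler_pM2r n0).
    have -> : h * k%:R * B * A * n%:R = th0 * k%:R * (2 * (B * A)) / 2 by rewrite -hn; field.
    by move: zz; move: (th0 * k%:R * (2 * (B * A))) => Q; lra.
  have ind (j : nat) : (j <= n)%N -> int_bound (fun x => G x (w (j%:R * h) x)) 2^-1.
    elim: j => [_|j IH jn].
      apply: (@int_bound_le _ (fun=> 0)).
      - by apply: mG; rewrite mul0r.
      - by move=> x _; exact: (sp_ge0 GP).
      - move=> x Ox; rewrite /w mul0r wE// mul0r; have /eqP := profH0 oO q0 GP Ox.
        by rewrite prof_powK => /eqP ->; rewrite powR0// invr_neq0// gt_eqF.
      have [c1 c2 c3] := int_bound0; split => //; apply: (le_trans c3).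
      by rewrite lee_fin invr_ge0.
    have jh0 : 0 <= j%:R * h by rewrite mulr_ge0.
    have jh1 : j.+1%:R * h <= th0.
      by rewrite /h mulrA ler_pdivrMr// mulrC ler_wpM2l ?(ltW th00)// ler_nat.
    have jh2 : j%:R * h <= th0 by apply: le_trans jh1; rewrite ler_wpM2r// ler_nat.
    have sE : j.+1%:R * h = j%:R * h + h by rewrite -natr1 mulrDl mul1r.
    have jh3 : 0 <= j.+1%:R * h by rewrite mulr_ge0.
    apply: apriori => //.
    have hh : 1 = 2^-1 + 2^-1 :> R by rewrite -[LHS](@mulfV _ 2)//; ring.
    suff X : int_bound (fun x => G x (w (j.+1%:R * h) x)) (2^-1 + 2^-1) by move: X; rewrite -hh.
    apply: (@int_bound_le _ (fun x => G x (w (j%:R * h) x) + h * k%:R * B)).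
    - exact: mG.
    - by move=> x _; exact: (sp_ge0 GP).
    - move=> x Ox; rewrite {1}/w wE// sE mulrDl -wE// -/(w _ x).
      have hk : h * tau x <= h * k%:R by rewrite ler_wpM2l.
      have ht : 0 <= h * tau x by rewrite mulr_ge0.
      apply: (le_trans (G_step Ox (w0 _ jh0 x) ht (le_trans hk hk1) (wT _ x jh0 jh2) hB)).
      by rewrite lerD2l ler_wpM2r// ltW.
    apply: int_boundD; first by apply: IH; exact: ltnW.
    have hkB0 : 0 <= h * k%:R * B by apply: mulr_ge0; [exact: mulr_ge0|exact: ltW].
    have [c1 c2 c3] := int_bound_cst hkB0; split => //.
    by apply: (le_trans c3); rewrite lee_fin.
  have := ind n (leqnn n).
  by rewrite (_ : n%:R * h = th0)// /h mulrC divfK// gt_eqF.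
pose g (k : nat) x := (G x (trunc (th0 / l) (th0 * k%:R) (u x)))%:E.
have g0 k x : Omega x -> (0 <= g k x)%E by move=> _; rewrite lee_fin (sp_ge0 GP).
have mg k : measurable_fun (Omega : set BV) (g k).
  by have [h1 _ _] := trunc_bound k; exact/measurable_EFinP.
have gm x : Omega x -> {homo g^~ x : n m / (n <= m)%N >-> (n <= m)%E}.
  move=> Ox n m nm; rewrite lee_fin; apply: (sp_mono GP) => //.
  by rewrite /trunc le_min ge_min lexx/= ge_min ler_wpM2l ?(ltW th00) ?ler_nat ?orbT.
have gb k : (\int[mu]_(x in (Omega : set BV)) g k x <= 1)%E.
  have [_ _ h] := trunc_bound k; apply: (le_trans h); rewrite lee_fin.
  by rewrite invf_le1// ler1n.
have MC := monotone_convergence mu mO mg g0 gm.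
have lim1 : (\int[mu]_(x in (Omega : set BV)) limn (g^~ x) <= 1)%E.
  rewrite MC; apply: lime_le; last by apply: nearW => k; exact: gb.
  apply: ereal_nondecreasing_is_cvgn => n m nm.
  by apply: (@ge0_le_integral _ _ _ mu _ mO) => // x Ox; first [exact: g0|exact: (gm x Ox n m nm)].
rewrite (_ : (\int[mu]_(x in _) _ = \int[mu]_(x in (Omega : set BV)) limn (g^~ x))%E)//.
apply: eq_integral => x _; apply/esym; apply: lim_near_cst => //.
(* At each point the sequence is stationary once [k] exceeds $|u(x)|/l$. *)
exists (Num.bound (`|u x| / l)) => // k /= nk; rewrite /g; congr (G x _)%:E.
have ul0 : 0 <= `|u x| / l by rewrite divr_ge0// ltW.
have uk : `|u x| / l <= k%:R.
  by apply: (le_trans (ltW (archi_boundP ul0))); rewrite ler_nat.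
rewrite /trunc (_ : th0 / l * `|u x| = th0 * (`|u x| / l)); last by rewrite mulrAC mulrA.
by rewrite min_l// ler_wpM2l// ltW.
Qed.

End bootstrap.

(** * The embedding *)

Section leb_comparison.
Import HBNNSimple.
Context {R : realType} {N : nat}.
Local Notation V := 'rV[R]_N.
Local Notation BV := (BV R N).
Local Notation LV := (lebesgue_rV R N).
Local Notation mu := (@bleb R N).
Variable Omega : set V.
Hypothesis oO : open Omega.

Lemma ae_borel_set (Q : V -> Prop) : {ae @leb R N, forall x, Q x} ->
  exists Z : set BV, [/\ measurable Z, mu Z = 0%E & forall x, ~ Z x -> Q x].
Proof.
move=> h; have [Z [mZ Z0 hZ]] := leb_negligible_borel h; exists Z; split => // x nZ.
by apply: contrapT => nP; apply: nZ; exact: hZ.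
Qed.

(* Neither comparison needs [h] to be measurable: the integral of a nonnegative
   function is a supremum over simple functions. *)
Lemma bleb_le_leb (g : V -> R) (h : V -> \bar R) : measurable_fun (Omega : set BV) g ->
  (forall x, Omega x -> 0 <= g x) -> (forall x, Omega x -> (0 <= h x)%E) ->
  {ae @leb R N, forall x, Omega x -> ((g x)%:E <= h x)%E} ->
  (\int[mu]_(x in (Omega : set BV)) (g x)%:E <= \int[@leb R N]_(x in (Omega : set LV)) h x)%E.
Proof.
move=> mg g0 h0 /ae_borel_set[Z [mZ Z0 hZ]]; have mO := open_borel oO.
have mgE : measurable_fun (Omega : set BV) (EFin \o g) by exact/measurable_EFinP.
have g0' x : Omega x -> (0 <= (EFin \o g) x)%E by move=> Ox; rewrite lee_fin g0.
have := ge0_negligible_integral mZ mO mgE g0' Z0 => /= ->.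
have mOZ : measurable (Omega `\` Z : set BV) by exact: measurableD.
have mgz : measurable_fun (Omega `\` Z : set BV) (fun x => (g x)%:E).
  by apply: measurable_funS mgE => //; exact: subDsetl.
have gz0 x : (Omega `\` Z) x -> (0 <= (g x)%:E)%E by case=> Ox _; rewrite lee_fin g0.
(* Off [Z] the inequality is pointwise, so every simple function below [g] there is also below
   [h]. *)
rewrite -(leb_integralE mOZ mgz gz0) [X in (X <= _)%E]ge0_integralE//.
rewrite [X in (_ <= X)%E]ge0_integralE//.
apply: ge_ereal_sup => _ [k hk <-]; apply: ereal_sup_ubound; exists k => // x.
apply: (le_trans (hk x)); rewrite !patchE.
case: ifPn => [/set_mem[Ox nZ]|_]; last by case: ifPn => // /set_mem; exact: h0.
by rewrite mem_set//; exact: hZ.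
Qed.

Lemma leb_le_bleb (h : V -> \bar R) (g : V -> R) : measurable_fun (Omega : set BV) g ->
  (forall x, Omega x -> 0 <= g x) -> (forall x, Omega x -> (0 <= h x)%E) ->
  {ae @leb R N, forall x, Omega x -> (h x <= (g x)%:E)%E} ->
  (\int[@leb R N]_(x in (Omega : set LV)) h x <= \int[mu]_(x in (Omega : set BV)) (g x)%:E)%E.
Proof.
move=> mg g0 h0 hg; have mO := open_borel oO.
have mgE : measurable_fun (Omega : set BV) (fun x => (g x)%:E) by exact/measurable_EFinP.
have g0' x : Omega x -> (0 <= (g x)%:E)%E by move=> Ox; rewrite lee_fin g0.
rewrite -(leb_integralE mO mgE g0') [X in (X <= _)%E]ge0_integralE//.
apply: ge_ereal_sup => _ [k hk <-]; rewrite -integralT_nnsfun [leRHS]integral_mkcond.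
have k0 x : [set: LV] x -> (0 <= (k x)%:E)%E by move=> _; rewrite lee_fin.
have mk : measurable_fun [set: LV] (fun x => (k x)%:E) by apply/measurable_EFinP; exact: measurable_funPT.
have gO0 x : [set: LV] x -> (0 <= ((fun x => (g x)%:E) \_ Omega) x)%E.
  by move=> _; rewrite patchE; case: ifPn => // /set_mem; exact: g0'.
have mgO : measurable_fun [set: LV] ((fun x => (g x)%:E) \_ Omega).
  by apply: (@borel_leb_fun _ _ setT) => //; apply/(measurable_restrictT _ mO).
apply: (ae_ge0_le_integral measurableT k0 mk gO0 mgO).
have FF := ae_filter_ringOfSetsType (@leb R N).
apply: filterS hg => x hx _; apply: (le_trans (hk x)); rewrite !patchE.
by case: ifPn => // /set_mem; exact: hx.
Qed.

End leb_comparison.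

Section embedding.
Context {R : realType} {N : nat}.
Local Notation V := 'rV[R]_N.
Local Notation BV := (BV R N).
Local Notation LV := (lebesgue_rV R N).
Local Notation mu := (@bleb R N).
Local Notation q := (1 - N%:R^-1 : R).
Variables (Omega : set V) (phi : 'I_N -> V -> R -> R) (nu c0 : R).
Hypothesis N2 : (2 <= N)%N.
Hypothesis oO : open Omega.
Hypothesis bO : bounded_set Omega.
Hypothesis coneO : cone_property Omega.
Hypothesis phi_mo : forall i, musielak_orlicz Omega (phi i).
Hypothesis H1_0 : forall x, closure Omega x ->
  (\int[lebesgue_measure]_(t in `]0%R, 1%R])
     sobolev_integrand N (phi_min_ss phi x) t < +oo)%E.
Hypothesis H1_oo : forall x, closure Omega x ->
  (\int[lebesgue_measure]_(t in `[1%R, +oo[)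
     sobolev_integrand N (phi_min_ss phi x) t = +oo)%E.
Hypothesis nu0 : 0 < nu.
Hypothesis nuN : nu < N%:R^-1.
Hypothesis c00 : 0 < c0.
Hypothesis H2 : forall (i : 'I_N) (t : R),
  let psi := fun x => fine (sobolev_conjugate (phi_min_ss phi) x `|t|) in
  {ae @leb R N, forall x, Omega x ->
    derivable psi (x : 'rV[R]_N) (delta_mx ord0 i) ->
    `|partial i psi x| <= c0 * (psi x + psi x `^ (1 + nu))}.
Hypothesis H3 : forall t : R,
  [lipschitz (fine (sobolev_conjugate (phi_min_ss phi) x `|t|) : R)
    | x in closure Omega].

Let G x t : R := fine (sobolev_conjugate (phi_min_ss phi) x t).
Local Notation good x := (forall i, n_function (phi i x)).

Let N0 : (0 < N)%N. Proof. exact: leq_trans N2. Qed.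
Let i0 : 'I_N := Ordinal N0.
Let cO x : Omega x -> closure Omega x. Proof. exact: subset_closure. Qed.
Let q0 : 0 < q. Proof. by have [] := @q_itv R N N2. Qed.

Lemma ae_good : {ae @leb R N, forall x, Omega x -> good x}.
Proof.
have FF := ae_filter_ringOfSetsType (@leb R N).
have : {ae @leb R N, forall x i, Omega x -> n_function (phi i x)}.
  by apply: filter_forall => i; exact: musielak_orlicz_n_function (phi_mo i).
by apply: filterS => x hx Ox i; exact: hx.
Qed.

Lemma phi_ge0 i x t : Omega x -> 0 <= t -> 0 <= phi i x t.
Proof. by move=> Ox t0; apply: (musielak_orlicz_ge0 (phi_mo i)) => //; exact: cO. Qed.

Lemma phi_min_le i x t : (phi_min phi x t <= (phi i x t)%:E)%E.
Proof. exact: bigmin_le. Qed.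

Lemma phi_min_ge0 x t : Omega x -> 0 <= t -> (0 <= phi_min phi x t)%E.
Proof.
move=> Ox t0; rewrite /phi_min; elim/big_ind: _ => [|y z y0 z0|i _].
- exact: leey.
- by rewrite le_min y0.
- by rewrite lee_fin phi_ge0.
Qed.

Lemma phi_max_ge i x t : ((phi i x t)%:E <= phi_max phi x t)%E.
Proof. exact: le_bigmax. Qed.

Lemma phi_max_ge0 x t : Omega x -> 0 <= t -> (0 <= phi_max phi x t)%E.
Proof. by move=> Ox t0; apply: le_trans (phi_max_ge i0 x t); rewrite lee_fin phi_ge0. Qed.

Lemma phi_min0 x : Omega x -> good x -> phi_min phi x 0 = 0%E.
Proof.
move=> Ox gx; apply/eqP; rewrite eq_le phi_min_ge0// andbT.
apply: (le_trans (phi_min_le i0 x 0)).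
by have [_ ->] := n_function_eq0 (gx i0) (lexx 0).
Qed.

Let F x := phi_min_ss phi x.

Lemma phi_min_ss_le i x t : Omega x -> good x -> 0 <= t -> (F x t <= (phi i x t)%:E)%E.
Proof.
move=> Ox gx t0; apply: le_trans (phi_min_le i x t).
apply: (@biconj_le R V (phi_min phi) x) => //; first by move=> s; exact: phi_min_ge0.
exact: phi_min0.
Qed.

Lemma phi_min_ss_props x : Omega x -> good x ->
  [/\ forall (th t : R), 0 <= th -> th <= 1 -> 0 <= t -> (F x (th * t)%R <= th%:E * F x t)%E,
   forall t, 0 <= t -> (0 <= F x t)%E & forall t, 0 <= t -> (F x t < +oo)%E].
Proof.
move=> Ox gx; have m0 := phi_min0 Ox gx.
have mp t (t0 : 0 <= t) := phi_min_ge0 Ox t0; split.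
- by move=> th t th0 th1 t0; apply: biconj_star.
- by move=> t t0; apply: biconj_ge0.
- by move=> t t0; apply: le_lt_trans (phi_min_ss_le i0 Ox gx t0) (ltry _).
Qed.

(** The biconjugate lies below $\phi_{min}$ and so below every $\phi_i$: one conjugate serves all
    components of the gradient. *)
Lemma conjugate_young x i (b t1 t2 : R) : Omega x -> good x -> 0 <= b -> 0 <= t1 -> t1 <= t2 ->
  0 < t2 -> b * (G x t2 `^ q - G x t1 `^ q) <= q * (t2 - t1) * (G x t2 + phi i x b).
Proof.
move=> Ox gx b0 t10 t12 t20; have [F1 F2 F3] := phi_min_ss_props Ox gx.
apply: (le_trans (sobG_young N2 (H1_0 (cO Ox)) (H1_oo (cO Ox)) F1 F2 F3 b0 t10 t12 t20)).
apply: ler_wpM2l; first by apply: mulr_ge0; [exact: (ltW q0)|rewrite subr_ge0].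
apply: lerD; first exact: lexx.
rewrite -lee_fin fineK; first exact: phi_min_ss_le.
by rewrite ge0_fin_numE ?F2// F3.
Qed.

Lemma conjugate_profile : sobolev_profile Omega q nu c0 G.
Proof.
split.
- by move=> x t; rewrite /G fine_ge0// rinv_ge0.
- by move=> x t Ox t0; exact: (sobG_gt0 (H1_0 (cO Ox)) (H1_oo (cO Ox)) t0).
- by move=> x s t Ox st; exact: (sobG_mono (H1_oo (cO Ox)) st).
- move=> t t0; have [k [kr hk]] := H3 t.
  exists (Num.max k 0 + 1); split; first by rewrite addr_ge0// le_max lexx orbT.
  move=> x y Ox Oy.
  have km : k < Num.max k 0 + 1 by rewrite (@le_lt_trans _ _ (Num.max k 0)) ?le_max ?lexx// ltrDl.
  have := hk _ km (x, y); rewrite /= (ger0_norm t0); apply.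
  by split; exact: cO.
- have [Z [mZ Z0 hZ]] := ae_borel_set ae_good; exists Z; split => // x Ox nZ.
  have gx := hZ x nZ Ox; have [F1 F2 F3] := phi_min_ss_props Ox gx; split.
    exact: (sobG0 N2 (H1_0 (cO Ox)) (H1_oo (cO Ox)) F1).
  move=> t0 t1 t2 t00 t01 t12.
  exact: (sobG_convex N2 (H1_0 (cO Ox)) (H1_oo (cO Ox)) F1 t00 t01 t12).
- move=> i t t0; have := H2 i t; rewrite /= (ger0_norm (ltW t0)) => /ae_borel_set[Z [mZ Z0 hZ]].
  by exists Z; split => // x Ox nZ; exact: hZ.
Qed.

Let GP := conjugate_profile.

(** By convexity and $\phi(x,0)=0$ the quotient $\phi(x,t)/t$ is nondecreasing, and its infimum over
    [Omega] at $t=1$ is positive. This turns a bound on the modular of [u] into one on its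
    integral. *)
Lemma phi_superlinear : exists2 c : R, 0 < c & forall x t, Omega x -> good x -> 1 <= t -> c * t <= phi i0 x t.
Proof.
have [c c1 hc] : exists2 c : R, 0 < c & forall x, Omega x -> c <= phi i0 x 1.
  have := musielak_orlicz_inf1 (phi_mo i0); set e := ereal_inf _ => e0.
  have he x : Omega x -> (e <= (phi i0 x 1)%:E)%E.
    by move=> Ox; apply: ereal_inf_lbound; exists x.
  move: e0 he; case: e => [r|_|//].
    by rewrite lte_fin => r0 he; exists r => // x Ox; rewrite -lee_fin; exact: he.
  (* The infimum of finite values is infinite only if [Omega] is empty. *)
  by move=> he; exists 1 => // x Ox; have := he x Ox; rewrite leye_eq.
exists c => // x t Ox gx t1; have t0 : 0 < t by exact: lt_le_trans t1.
have p0 : 0 <= t^-1 by rewrite invr_ge0 ltW.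
have p1 : t^-1 <= 1 by rewrite invf_le1.
have tI : (t : R^o) \in ([set s | 0 <= s] : set R^o) by rewrite inE/=; exact: ltW.
have zI : (0 : R^o) \in ([set s | 0 <= s] : set R^o) by rewrite inE/=.
have [_ z] := n_function_eq0 (gx i0) (lexx 0).
have : phi i0 x (t^-1 * t + (1 - t^-1) * 0) <= t^-1 * phi i0 x t + (1 - t^-1) * phi i0 x 0.
  by have := n_function_convex (gx i0) (Itv01 p0 p1) tI zI; rewrite !convRE.
rewrite z// !mulr0 !addr0 mulVf ?gt_eqF//.
rewrite mulrC ler_pdivlMr// => h; apply: le_trans h; rewrite ler_wpM2r ?(ltW t0)//.
exact: hc.
Qed.

Lemma acl_weak (u' : V -> R) (v' : 'I_N -> V -> R) :
  measurable_fun (setT : set BV) u' -> (forall i, measurable_fun (setT : set BV) (v' i)) ->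
  (forall K : set V, compact K -> K `<=` Omega ->
        mu.-integrable (K : set BV) (EFin \o u') /\
        forall i, mu.-integrable (K : set BV) (EFin \o v' i)) ->
  (forall (a : V) (j : 'I_N) (q : 'I_N -> R -> R) (q' : R -> R) (al be : 'I_N -> R),
       a ord0 j != 0 -> (forall i, sm (q i)) -> (forall s : R, is_derive s 1 (q j) (q' s)) ->
       (forall i s, q i s != 0 -> al i <= s <= be i) -> skbox a j al be `<=` Omega ->
       (\int[mu]_(x in (skbox a j al be : set BV))
          (u' x * (q' (skc a j j x) * \prod_(i | i != j) q i (skc a j i x))) =
        - \int[mu]_(x in (skbox a j al be : set BV))
          ((\sum_i a ord0 i * v' i x) * \prod_i q i (skc a j i x)))%R) ->
  forall (a : V) j, a ord0 j != 0 -> acl Omega a u' (fun x => \sum_i a ord0 i * v' i x).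
Proof.
move=> mu' mv' iuv star a j aj; apply: (ac_lines oO aj mu' (v := fun x => \sum_i a ord0 i * v' i x)).
- by apply: measurable_sum => i; exact: measurable_funM.
- by move=> K cK KO; have [] := iuv K cK KO.
- move=> K cK KO; have [_ iv] := iuv K cK KO; have mK : measurable (K : set BV) by exact: compact_borel.
  rewrite (_ : EFin \o _ = (fun x => \sum_i ((a ord0 i)%:E * (EFin \o v' i) x))%E).
    by apply: integrable_sum => // i _; exact: integrableZl.
  by apply/funext => x /=; rewrite -sumEFin.
- by move=> Q Q' al be; exact: star.
Qed.

(** As [th0] depends on [M] and not on [u], both conclusions follow: $M=1$ gives the norm
    inequality, and the sum of the modulars of a given [u] gives the inclusion. *)
Lemma embedding_modular (M : R) : 0 <= M -> exists2 th0 : R, 0 < th0 &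
  forall (u : V -> R) (l0 L : R) (l : 'I_N -> R),
  (forall i, is_weak_partial Omega i u (weak_partial Omega i u)) ->
  0 < l0 -> l0 <= L -> (forall i, 0 < l i) -> (forall i, l i <= L) ->
  (modular Omega (phi_max phi) l0 u <= M%:E)%E ->
  (forall i, (modular Omega (fun x t => (phi i x t)%:E) (l i) (weak_partial Omega i u) <= M%:E)%E) ->
  (modular Omega (sobolev_conjugate (phi_min_ss phi)) (L / th0) u <= 1)%E.
Proof.
move=> M_0; have [c cp hc] := phi_superlinear.
have mO := open_borel oO; have q0' := q0.
have FF := ae_filter_ringOfSetsType (@leb R N).
(* From $|u|/L\le1+(|u|/L-1)^+$, where [c] times the positive part is at most
   $\phi_{max}(x,|u|/l_0)$. *)
pose M0 := 1 * fine (mu (Omega : set BV)) + c^-1 * M.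
have M00 : 0 <= M0.
  by rewrite addr_ge0 ?mul1r ?fine_ge0// mulr_ge0// invr_ge0 ltW.
have [th0 [th00 boot]] := bootstrap N2 oO bO coneO nu0 nuN c00 GP M_0 M00.
exists th0 => // u l0 L l wu l00 lL lp li modu modv.
have L0 : 0 < L by exact: lt_le_trans lL.
have [u' [v' [[mu' u0] nu' mv' nv' [iuv star]]]] := skprod_weak oO bO i0 wu.
have aeu : {ae @leb R N, forall x, Omega x -> u' x = u x}.
  have [Z [mZ Z0 hZ]] := nu'; exists Z; split => // x nx; apply: hZ => /=.
  by apply: contrapT => h; apply: nx => /= Ox; apply: contrapT => h'; exact: h.
have aev i : {ae @leb R N, forall x, Omega x -> v' i x = weak_partial Omega i u x}.
  have [Z [mZ Z0 hZ]] := nv' i; exists Z; split => // x nx; apply: hZ => /=.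
  by apply: contrapT => h; apply: nx => /= Ox; apply: contrapT => h'; exact: h.
have mv'1 i : measurable_fun (setT : set BV) (v' i) by have [] := mv' i.
have mun : measurable_fun (Omega : set BV) (fun x => `|u' x| / L).
  by apply: measurable_funM => //; apply: measurable_funTS; exact: measurableT_comp.
have nE (y r : R) : 0 < r -> `|y / r| = `|y| / r.
  by move=> r0; rewrite normrM normfV (gtr0_norm r0).
have bU : int_bound Omega (fun x => `|u' x| / L) M0.
  pose g x := c * Num.max 0 (`|u' x| / L - 1).
  have g0 x : Omega x -> 0 <= g x by move=> _; rewrite mulr_ge0 ?(ltW cp)// le_max lexx.
  have mg : measurable_fun (Omega : set BV) g.
    by apply: measurable_funM => //; apply: measurable_maxr => //; exact: measurable_funB.
  have bg : int_bound Omega g M.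
    split => //; apply: le_trans modu; apply: bleb_le_leb => //.
      by move=> x Ox; exact: phi_max_ge0.
    apply: filterS2 aeu ae_good => x ux gx Ox; apply: le_trans (phi_max_ge i0 _ _).
    rewrite lee_fin nE// /g (ux Ox).
    have [h|h] := leP (`|u x| / L - 1) 0; first by rewrite mulr0 phi_ge0// divr_ge0// ltW.
    have uL : `|u x| / L <= `|u x| / l0 by rewrite ler_wpM2l// lef_pV2.
    have u1 : 1 <= `|u x| / l0 by move: h; lra.
    apply: le_trans (hc x _ Ox (gx Ox) u1); apply: ler_wpM2l; [exact: ltW|by move: uL; lra].
  apply: (int_bound_le oO (g := fun x => 1 + c^-1 * g x)) => //.
  - by move=> x _; rewrite divr_ge0// ltW.
  - move=> x _; rewrite /g mulKf ?gt_eqF// -lerBlDl le_max lexx orbT//.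
  apply: (int_boundD oO); first exact: (int_bound_cst oO bO).
  by apply: (int_boundM oO) => //; rewrite invr_ge0 ltW.
have [_ _ hU] := bU.
have main := boot u' v' L L0 mu' mv'1 (acl_weak mu' mv'1 iuv star) hU.
pose gG x := G x (th0 * (`|u' x| / L)).
have wp x : 0 <= th0 * (`|u' x| / L) by rewrite mulr_ge0 ?divr_ge0 ?(ltW th00)// ltW.
have mw : measurable_fun (setT : set BV) (fun x => th0 * (`|u' x| / L)).
  by apply: measurable_funM => //; apply: measurable_funM => //; exact: measurableT_comp.
have mgG : measurable_fun (Omega : set BV) gG.
  rewrite (_ : gG = (fun x => G x (th0 * (`|u' x| / L) + 0))).
    exact: (measurable_G_comp N2 oO GP (lexx 0) wp mw).
  by apply/funext => x; rewrite addr0.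
apply: (@le_trans _ _ (\int[mu]_(x in (Omega : set BV)) (gG x)%:E)%E).
  apply: leb_le_bleb => //.
  - by move=> x _; exact: (sp_ge0 GP).
  - by move=> x _; exact: rinv_ge0.
  apply: filterS aeu => x ux Ox; rewrite /gG (ux Ox) nE ?divr_gt0// invf_div.
  rewrite (_ : `|u x| * (th0 / L) = th0 * (`|u x| / L)); last by rewrite mulrCA.
  by rewrite /G fineK//; exact: (sobG_fin (H1_oo (cO Ox))).
apply: main => i d w d0 mw' w0.
(* By [conjugate_young] this is at most $\phi_i(x,|\partial_iu|/l_i)$ almost everywhere, hence its
   integral is at most [M]. *)
pose Y x := q^-1 * Num.max 0 (slopeH q G d x (w x) * (`|v' i x| / L) - q * G x (w x + d)).
have mGd := measurable_G_comp N2 oO GP (ltW d0) w0 mw'.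
have mHd := measurable_H_comp oO q0 GP (ltW d0) w0 mw'.
have mHw : measurable_fun (Omega : set BV) (fun x => profH q G x (w x)).
  rewrite (_ : (fun x => _) = (fun x => profH q G x (w x + 0))).
    exact: (measurable_H_comp oO q0 GP (lexx 0) w0 mw').
  by apply/funext => x; rewrite addr0.
have mY : measurable_fun (Omega : set BV) Y.
  apply: measurable_funM => //; apply: measurable_maxr => //.
  apply: measurable_funB; last exact: measurable_funM.
  apply: measurable_funM; first by apply: measurable_funM => //; exact: measurable_funB.
  by apply: measurable_funM => //; apply: measurable_funTS; exact: measurableT_comp.
have Y0 x : Omega x -> 0 <= Y x by move=> _; rewrite mulr_ge0 ?invr_ge0 ?(ltW q0)// le_max lexx.
have bY : int_bound Omega Y M.
  split => //; apply: le_trans (modv i); apply: bleb_le_leb => //.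
    by move=> x Ox; rewrite lee_fin phi_ge0.
  apply: filterS2 (aev i) ae_good => x vx gx Ox; rewrite lee_fin nE// /Y (vx Ox).
  set b := `|weak_partial Omega i u x|.
  have b0 : 0 <= b / l i by apply: divr_ge0; [exact: normr_ge0|exact: ltW].
  have bb : b / L <= b / l i by apply: ler_wpM2l; [exact: normr_ge0|rewrite lef_pV2 ?posrE].
  have ph0 : 0 <= phi i x (b / l i) by exact: phi_ge0.
  have s0 := slopeH_ge0 q0 GP d0 (w x) Ox.
  have y := conjugate_young i Ox (gx Ox) b0 (w0 x) (ler_wpDr (ltW d0) (lexx _)) (ltr_wpDl (w0 x) d0).
  have sl : slopeH q G d x (w x) * (b / l i) <= q * (G x (w x + d) + phi i x (b / l i)).
    rewrite /slopeH mulrAC ler_pdivrMr// mulrC; apply: (le_trans y).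
    by rewrite addrAC subrr add0r mulrAC.
  have sb : slopeH q G d x (w x) * (b / L) <= slopeH q G d x (w x) * (b / l i) by rewrite ler_wpM2l.
  rewrite mulrC ler_pdivrMr// mulrC.
  rewrite ge_max mulr_ge0 ?(ltW q0)//=.
  by move: sl sb; rewrite mulrDr; lra.
have [_ _] := int_boundM oO (ltW q0) bY.
by under eq_integral do rewrite /Y mulVKf ?gt_eqF//.
Qed.

Lemma modular_ge0 (psi : V -> R -> \bar R) (l : R) u :
  (forall x t, Omega x -> 0 <= t -> (0 <= psi x t)%E) -> (0 <= modular Omega psi l u)%E.
Proof. by move=> h; apply: integral_ge0 => x Ox; exact: h. Qed.

Lemma luxemburg_ge0 (psi : V -> R -> \bar R) u : (0 <= luxemburg_norm Omega psi u)%E.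
Proof. by apply: le_ereal_inf_tmp => _ [l [l0 _] <-]; rewrite lee_fin ltW. Qed.

Lemma conjugate_L_space u : W1_space Omega phi u ->
  L_space Omega (sobolev_conjugate (phi_min_ss phi)) u.
Proof.
move=> [[mu_ [l0 [l00 f0]]] hv]; split => //.
have /choice[l hl] : forall i, exists l : R, 0 < l /\
    (modular Omega (fun x t => (phi i x t)%:E) l (weak_partial Omega i u) < +oo)%E.
  by move=> i; have [_ [_ h]] := hv i.
have lp i : 0 < l i by have [] := hl i.
pose m0 := modular Omega (phi_max phi) l0 u.
pose m i := modular Omega (fun x t => (phi i x t)%:E) (l i) (weak_partial Omega i u).
have m00 : (0 <= m0)%E by apply: modular_ge0 => x t; exact: phi_max_ge0.
have m_0 i : (0 <= m i)%E by apply: modular_ge0 => x t Ox t0; rewrite lee_fin phi_ge0.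
have m0f : m0 \is a fin_num by rewrite ge0_fin_numE.
have mf i : m i \is a fin_num by rewrite ge0_fin_numE//; have [] := hl i.
pose M := fine m0 + \sum_i fine (m i).
(* One scale above all the individual ones, as [embedding_modular] requires. *)
pose L := l0 + \sum_i l i.
have sM : 0 <= \sum_i fine (m i) by apply: sumr_ge0 => i _; exact: fine_ge0.
have M0 : 0 <= M by rewrite addr_ge0// fine_ge0.
have [th0 th00 emb] := embedding_modular M0.
exists (L / th0); split.
  by rewrite divr_gt0// ltr_pwDl// sumr_ge0// => i _; exact: ltW.
apply: (@le_lt_trans _ _ 1%E); last exact: ltry.
apply: (emb u l0 L l) => //.
- by move=> i; have [] := hv i.
- by rewrite lerDl sumr_ge0// => i _; exact: ltW.
- move=> i; rewrite /L (bigD1 i)//= addrCA lerDl addr_ge0 ?(ltW l00)// sumr_ge0// => k _; exact: ltW.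
- by rewrite -/m0 -(fineK m0f) lee_fin lerDl.
- move=> i; rewrite -/(m i) -(fineK (mf i)) lee_fin /M (bigD1 i)//= addrCA lerDl addr_ge0 ?fine_ge0//.
  by apply: sumr_ge0 => k _; exact: fine_ge0.
Qed.

Lemma conjugate_norm_le : exists C : R, 0 < C /\ forall u, W1_space Omega phi u ->
  (luxemburg_norm Omega (sobolev_conjugate (phi_min_ss phi)) u <= C%:E * W1_norm Omega phi u)%E.
Proof.
have [th0 th00 emb] := embedding_modular (@ler01 R).
exists th0^-1; split; first by rewrite invr_gt0.
move=> u [_ hv].
pose n0 := luxemburg_norm Omega (phi_max phi) u.
pose n i := luxemburg_norm Omega (fun x t => (phi i x t)%:E) (weak_partial Omega i u).
have n00 : (0 <= n0)%E by exact: luxemburg_ge0.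
have n_0 i : (0 <= n i)%E by exact: luxemburg_ge0.
rewrite /W1_norm -/n0 -/(n _); set W := (n0 + _)%E.
have sn : (0 <= \sum_(i < N) n i)%E by apply: sume_ge0.
have W0 : (0 <= W)%E by exact: adde_ge0.
have n0W : (n0 <= W)%E by rewrite leeDl.
have nW i : (n i <= W)%E.
  apply: (@le_trans _ _ (\sum_(k < N) n k)%E); last by rewrite leeDr.
  by rewrite (bigD1 i)//= leeDl// sume_ge0.
have := leey W; rewrite le_eqVlt => /predU1P[->|Wy].
  by rewrite gt0_muley ?leey// lte_fin invr_gt0.
have Wf : W \is a fin_num by rewrite ge0_fin_numE.
apply/lee_addgt0Pr => e e0.
(* The norms are infima that need not be attained, hence the margin; divided by [th0] it becomes
   [e]. *)
pose L := fine W + e * th0.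
have et : 0 < e * th0 by rewrite mulr_gt0.
have WL : (W < L%:E)%E by rewrite -(fineK Wf) lte_fin ltrDl.
have L0 : 0 < L by rewrite -lte_fin; exact: le_lt_trans WL.
have [_ [l0 [l00 h0] <-] l0L] := ereal_inf_lt (le_lt_trans n0W WL).
have /choice[l hl] : forall i, exists l : R, [/\ 0 < l, l < L &
    (modular Omega (fun x t => (phi i x t)%:E) l (weak_partial Omega i u) <= 1)%E].
  move=> i; have [_ [l [lp hl] <-] lL] := ereal_inf_lt (le_lt_trans (nW i) WL).
  by exists l; split.
have fin : (modular Omega (sobolev_conjugate (phi_min_ss phi)) (L / th0) u <= 1)%E.
  apply: (emb u l0 L l) => //.
  - by move=> i; have [] := hv i.
  - exact: ltW.
  - by move=> i; have [] := hl i.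
  - by move=> i; have [_ /ltW] := hl i.
  - by move=> i; have [] := hl i.
apply: (@le_trans _ _ (L / th0)%:E).
  by apply: ereal_inf_lbound; exists (L / th0) => //; split => //; rewrite divr_gt0.
rewrite -(fineK Wf) -EFinM -EFinD lee_fin /L mulrDl mulfK ?gt_eqF// mulrC.
exact: lexx.
Qed.

End embedding.

Theorem theorem3p1 (R : realType) (N : nat) (Omega : set 'rV[R]_N)
    (phi : 'I_N -> 'rV[R]_N -> R -> R) (nu c0 : R)
    (N_ge2 : (2 <= N)%N)
    (Omega_open : open Omega) (Omega_bounded : bounded_set Omega)
    (Omega_cone : cone_property Omega)
    (phi_mo : forall i, musielak_orlicz Omega (phi i))
    (H1_0 : forall x, closure Omega x ->
      (\int[lebesgue_measure]_(t in `]0%R, 1%R])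
         sobolev_integrand N (phi_min_ss phi x) t < +oo)%E)
    (H1_oo : forall x, closure Omega x ->
      (\int[lebesgue_measure]_(t in `[1%R, +oo[)
         sobolev_integrand N (phi_min_ss phi x) t = +oo)%E)
    (nu_gt0 : 0 < nu) (nu_lt : nu < N%:R^-1) (c0_gt0 : 0 < c0)
    (H2 : forall (i : 'I_N) (t : R),
      let psi := fun x => fine (sobolev_conjugate (phi_min_ss phi) x `|t|) in
      {ae @leb R N, forall x, Omega x ->
        derivable psi (x : 'rV[R]_N) (delta_mx ord0 i) ->
        `|partial i psi x| <= c0 * (psi x + psi x `^ (1 + nu))})
    (H3 : forall t : R,
      [lipschitz (fine (sobolev_conjugate (phi_min_ss phi) x `|t|) : R)
        | x in closure Omega])
    (H4 : locally_integrable_phi Omega (phi_max phi)) :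
  continuous_embedding (W1_space Omega phi)
    (L_space Omega (sobolev_conjugate (phi_min_ss phi)))
    (W1_norm Omega phi)
    (luxemburg_norm Omega (sobolev_conjugate (phi_min_ss phi))).
Proof.
split.
  by move=> u; exact: (conjugate_L_space N_ge2 Omega_open Omega_bounded Omega_cone phi_mo
    H1_0 H1_oo nu_gt0 nu_lt c0_gt0 H2 H3).
exact: (conjugate_norm_le N_ge2 Omega_open Omega_bounded Omega_cone phi_mo
  H1_0 H1_oo nu_gt0 nu_lt c0_gt0 H2 H3).
Qed.
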